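(* Let $\mathcal V:BV(\Omega,\{0,1\})\to(-\infty,+\infty]$ satisfy, for some $r>0$ and $K>1$: (a) $\mathcal V$ is bounded from below in $BV(\Omega,\{0,1\})$ and $\mathcal V(C_r^K)<+\infty$; (b) $\mathcal V(E)\ge\mathcal V(E\cap C_\rho^l)$ for any $E\in BV(\Omega,\{0,1\})$, $\rho\in(r,+\infty]$ and $l\in(K-1,K+1)$; (c) $\mathcal V(E)\ge\mathcal V(E\setminus(C_{\rho_1}^K\setminus\overline{C_{\rho_2}^K}))$ for any $E\in BV(\Omega,\{0,1\})$ and $r<\rho_2<\rho_1<+\infty$; (d) $\mathcal V$ is $L^1(\Omega)$-lower semicontinuous in $BV(\Omega,\{0,1\})$. Suppose also that $\beta\in L^\infty(\partial\Omega)$ and there exists $\kappa\in(0,\frac12]$ such that $-1\le\beta\le1-2\kappa$ $\mathcal H^n$-a.e. on $\partial\Omega$. Set $\mathcal G_\beta(E)=\mathcal C_\beta(E,\Omega)+\mathcal V(E)$. Then the minimum problem $$\inf_{E\in BV(\Omega,\{0,1\})}\mathcal G_\beta(E)$$ has a solution. Moreover, any minimizer is contained in $C_{\mathcal R_0}^K$, where $$\mathcal R_0=r+1+\max\Big\{8^{n^2+n+1}\,\mathfrak a^{\frac{n+1}n},\,4\mu(\kappa,n)\Big\},\qquad\mu(\kappa,n)=\Big(\frac1\kappa+2\Big)^{\frac{n+1}n},$$ $$\mathfrak a=\kappa^{-1}\Big(\sup_{R>r}\ \inf_{E\in BV(C_R^K,\{0,1\})}\mathcal G_\beta(E)-\inf_{BV(\Omega,\{0,1\})}\mathcal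 V\Big).$$
   Context: Let $n\ge1$, $\Omega=\mathbb R^n\times(0,+\infty)\subset\mathbb R^{n+1}$, and identify $\partial\Omega$ with $\mathbb R^n$. $BV(\Omega,\{0,1\})$ is the collection of measurable $E\subseteq\Omega$ with $\chi_E\in BV(\Omega)$, and $P(E,\Omega)=\int_\Omega|D\chi_E|$. Each set is identified with its set of points of Lebesgue density one. On $\partial\Omega$, $\chi_E$ denotes the trace of $E$. $\mathcal C_\beta(E,\Omega)=P(E,\Omega)-\int_{\partial\Omega}\beta\chi_E\,d\mathcal H^n$. $\hat B_\rho\subset\mathbb R^n$ is the open ball of radius $\rho$ centered at the origin, and $C_\rho^l=\hat B_\rho\times(0,l)$ for $\rho,l>0$, with $C_{+\infty}^l=\mathbb R^n\times(0,l)$. $BV(C_R^K,\{0,1\})$ denotes the sets of finite perimeter contained in $C_R^K$ (regarded as elements of $BV(\Omega,\{0,1\})$). *)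

(* Defs.v *)
From HB Require Import structures.
From mathcomp Require Import all_boot all_order all_algebra.
From mathcomp Require Import all_classical all_reals all_analysis.

Set Implicit Arguments.
Unset Strict Implicit.
Unset Printing Implicit Defensive.

Import Order.TTheory GRing.Theory Num.Theory.
Import numFieldNormedType.Exports.

Local Open Scope classical_set_scope.
Local Open Scope ring_scope.

Definition rV_display : measure_display -> measure_display.
Proof. exact. Qed.

(* The Borel sigma-algebra of R^n, generated by the coordinates (as the library
   does for tuples). *)
Section measurable_rV.
Variables (R : realType) (n : nat).

Let coord (i : 'I_n) (x : 'rV[R]_n) : measurableTypeR R := x ord0 i.

Let rV_set0 : g_sigma_preimage coord set0.
Proof. exact: sigma_algebra0. Qed.

Let rV_setC A : g_sigma_preimage coord A -> g_sigma_preimage coord (~` A).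
Proof. exact: sigma_algebraC. Qed.

Let rV_bigcup (F : _^nat) : (forall i, g_sigma_preimage coord (F i)) ->
  g_sigma_preimage coord (\bigcup_i (F i)).
Proof. exact: sigma_algebra_bigcup. Qed.

HB.instance Definition _ := @isMeasurable.Build
  (rV_display default_measure_display)
  'rV[R]_n (g_sigma_preimage coord) rV_set0 rV_setC rV_bigcup.

End measurable_rV.

Definition rV_cons (R : realType) (n : nat) (p : 'rV[R]_n * measurableTypeR R)
  : 'rV[R]_n.+1 := row_mx (\row_(_ < 1) p.2) p.1.

Lemma measurable_rV_coord (R : realType) (n : nat) (i : 'I_n) :
  measurable_fun [set: 'rV[R]_n] (fun x : 'rV[R]_n => x ord0 i : measurableTypeR R).
Proof.
move=> _ A mA; apply: sub_sigma_algebra.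
case: n i => [[] []//|n i].
rewrite -bigcup_mkord_ord; exists i; first exact: ltn_ord.
by exists A => //; rewrite inord_val.
Qed.

Lemma measurable_rV_cons (R : realType) (n : nat) :
  measurable_fun setT (@rV_cons R n).
Proof.
have mc (j : 'I_(1 + n)) : measurable_fun setT
    (fun p : 'rV[R]_n * measurableTypeR R =>
       (rV_cons p : 'rV[R]_(1 + n)) ord0 j : measurableTypeR R).
  case: (split_ordP j) => k ->.
  - have -> : (fun p : 'rV[R]_n * measurableTypeR R =>
        (rV_cons p : 'rV[R]_(1 + n)) ord0 (lshift n k) : measurableTypeR R) = snd.
      by apply/funext => p; rewrite /rV_cons row_mxEl mxE.
    exact: measurable_snd.
  - have -> : (fun p : 'rV[R]_n * measurableTypeR R =>
        (rV_cons p : 'rV[R]_(1 + n)) ord0 (rshift 1 k) : measurableTypeR R) =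
        (fun x : 'rV[R]_n => x ord0 k : measurableTypeR R) \o fst.
      by apply/funext => p; rewrite /rV_cons row_mxEr.
    apply: measurableT_comp; last exact: measurable_fst.
    exact: measurable_rV_coord.
move=> _ A mA; rewrite setTI.
suff: g_sigma_preimage
    (fun (j : 'I_n.+1) (x : 'rV[R]_n.+1) => x ord0 j : measurableTypeR R)
    `<=` [set B | measurable (@rV_cons R n @^-1` B)] by apply.
apply: smallest_sub; first split => /=.
- by rewrite preimage_set0.
- by move=> B mB; rewrite setTD preimage_setC; exact: measurableC.
- by move=> F mF; rewrite preimage_bigcup; exact: bigcupT_measurable.
rewrite -bigcup_mkord_ord; apply: bigcup_sub => i _ B [C mC <-] /=.
rewrite setTI -[X in measurable X]setTI.
exact: (mc (inord i) measurableT C mC).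
Qed.

Definition leb_step (R : realType) (n : nat)
    (m : {measure set 'rV[R]_n -> \bar R}) : set 'rV[R]_n.+1 -> \bar R :=
  pushforward (m \x (@lebesgue_measure R))%E (@rV_cons R n).

Section leb_step_measure.
Variables (R : realType) (n : nat) (m : {measure set 'rV[R]_n -> \bar R}).

Let mpre A : measurable A -> measurable (@rV_cons R n @^-1` A).
Proof. by move=> mA; rewrite -[X in measurable X]setTI; exact: measurable_rV_cons. Qed.

Let leb_step0 : leb_step m set0 = 0%E.
Proof. by rewrite /leb_step /pushforward preimage_set0 measure0. Qed.

Let leb_step_ge0 A : (0 <= leb_step m A)%E.
Proof. by rewrite /leb_step /pushforward. Qed.

Let leb_step_sigma_additive : semi_sigma_additive (leb_step m).
Proof.
move=> F mF tF mUF; rewrite /leb_step /pushforward preimage_bigcup.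
apply: measure_semi_sigma_additive.
- by move=> k; exact: mpre.
- apply/trivIsetP => /= i j _ _ ij; rewrite -preimage_setI.
  by move/trivIsetP : tF => /(_ _ _ _ _ ij) ->//; rewrite preimage_set0.
- by rewrite -preimage_bigcup; exact: mpre.
Qed.

HB.instance Definition _ := isMeasure.Build _ _ _ (leb_step m)
  leb_step0 leb_step_ge0 leb_step_sigma_additive.

End leb_step_measure.

(* Lebesgue measure on R^n, by iterated products with the line. *)
Fixpoint leb (R : realType) (n : nat) : {measure set 'rV[R]_n -> \bar R} :=
  match n return {measure set 'rV[R]_n -> \bar R} with
  | 0 => \d_ (0 : 'rV[R]_0)
  | m.+1 => leb_step (leb R m)
  end.

(* R^(n+1) = R^n x R, with Omega the points of positive second coordinate. The
   norm of the library on this product is a maximum, hence the Euclidean norms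
   below; the topology and the derivatives are the usual ones. *)
Notation Rn1 R n := ('rV[R]_n * measurableTypeR R)%type.

Section capillarity.
Variables (R : realType) (n : nat).
Implicit Types (p v : Rn1 R n) (phi : Rn1 R n -> Rn1 R n).
Implicit Types (f : Rn1 R n -> R) (U E : set (Rn1 R n)).

Definition vol : {measure set (Rn1 R n) -> \bar R} :=
  (leb R n \x (@lebesgue_measure R))%E.

Definition enorm_rV (x : 'rV[R]_n) : R := Num.sqrt (\sum_(i < n) x ord0 i ^+ 2).

Definition enorm p : R := Num.sqrt (enorm_rV p.1 ^+ 2 + (p.2 : R) ^+ 2).

Definition eball p (rho : R) : set (Rn1 R n) := [set q | enorm (q - p) < rho].

Definition Omega : set (Rn1 R n) := [set p | (0 : R) < p.2].

(* C_rho^l; rho = +oo gives R^n x (0, l). *)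
Definition cyl (rho : \bar R) (l : R) : set (Rn1 R n) :=
  [set p | ((enorm_rV p.1)%:E < rho)%E /\ (0 : R) < p.2 < l].

Definition divergence phi p : R :=
  \sum_(i < n) ('D_((delta_mx ord0 i, 0) : Rn1 R n) phi p).1 ord0 i
  + ('D_((0, 1) : Rn1 R n) phi p).2.

Definition C1c U phi : Prop :=
  [/\ forall p, differentiable phi p,
      forall v, continuous (fun p => 'D_v phi p),
      compact (closure [set p | phi p != 0]) &
      closure [set p | phi p != 0] `<=` U].

(* The total variation of Df on an open set U, by duality. *)
Definition tot_var U f : \bar R :=
  ereal_sup [set (\int[vol]_(p in U) (f p * divergence phi p)%:E)%E | phi in
    [set phi | C1c U phi /\ forall p, enorm (phi p) <= 1]].

Definition BVfun U f : Prop :=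
  vol.-integrable U (EFin \o f) /\ (tot_var U f < +oo)%E.

Definition perimeter E U : \bar R := tot_var U \1_E.

(* BV(Omega, {0,1}), a class modulo null sets being given by any of its Borel
   members. A functional satisfying L1_lsc below takes the same value on all
   members of a class, as the constant sequences show. *)
Definition BVset E : Prop := [/\ measurable E, E `<=` Omega & BVfun Omega \1_E].

(* The points of density one of E, the canonical member of its class. *)
Definition dens1 E : set (Rn1 R n) :=
  [set p | (fine (vol (E `&` eball p rho)) / fine (vol (eball p rho)))
             @[rho --> 0^'+] --> (1 : R)].

(* Trace of f on the boundary: its Lebesgue value from inside Omega, which
   exists at almost every boundary point when f is in BV(Omega). *)
Definition bd_trace f (x : 'rV[R]_n) : R :=
  get [set a : R |
    ((rho ^- n.+1)%:E *
       \int[vol]_(p in eball (x, 0%R) rho `&` Omega) `|f p - a|%:E)%E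
      @[rho --> 0^'+] --> 0%E].

(* The boundary is identified with R^n, so that H^n is Lebesgue measure there. *)
Definition capillary (beta : 'rV[R]_n -> R) E : \bar R :=
  (perimeter E Omega - \int[leb R n]_x (beta x * bd_trace \1_E x)%:E)%E.

Definition L1_lsc (V : set (Rn1 R n) -> \bar R) : Prop :=
  forall (F : (set (Rn1 R n))^nat) E,
    (forall k, BVset (F k)) -> BVset E ->
    (\int[vol]_(p in Omega) `|\1_(F k) p - \1_E p|%:E)%E @[k --> \oo] --> 0%E ->
    (V E <= limn_einf (V \o F))%E.

Definition minimizer (G : set (Rn1 R n) -> \bar R) E : Prop :=
  BVset E /\ forall F, BVset F -> (G E <= G F)%E.

Definition frak_a (r K kappa : R) (V G : set (Rn1 R n) -> \bar R) : \bar R :=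
  ((kappa^-1)%:E *
   (ereal_sup [set ereal_inf [set G E | E in
                  [set E | BVset E /\ E `<=` cyl rho%:E K]]
              | rho in [set rho : R | (r < rho)%R]]
    - ereal_inf [set V E | E in BVset]))%E.

Definition mu_const (kappa : R) : R :=
  (kappa^-1 + 2) `^ (n.+1%:R / n%:R).

Definition calR0 (r kappa : R) (a : \bar R) : \bar R :=
  ((r + 1)%:E + maxe ((8 ^+ (n ^ 2 + n + 1)%N)%:E * a `^ (n.+1%:R / n%:R)%R)
                     (4 * mu_const kappa)%:E)%E.

End capillarity.

(* Main.v *)
Require Import Defs.
From HB Require Import structures.
From mathcomp Require Import all_boot all_order all_algebra.
From mathcomp Require Import all_classical all_reals all_analysis.
From mathcomp Require Import measurable_realfun ring lra zify.

Set Implicit Arguments.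
Unset Strict Implicit.
Unset Printing Implicit Defensive.

Import Order.TTheory GRing.Theory Num.Theory.
Import numFieldNormedType.Exports.

Local Open Scope classical_set_scope.
Local Open Scope ring_scope.

(** Everything is deduced from test fields, without the structure theory of BV.
    Along a coordinate direction, the lines on which a set E is not constant on
    disjoint given intervals, counted with the number of these intervals, have
    total measure at most the perimeter.  This gives the trace of E (the set of
    boundary points above which E is full near the boundary), and, by averaging
    over a grid of cubes, an isoperimetric inequality and compactness in L^1.
    Cut-off fields give the change of perimeter when E is cut by a horizontal
    plane or by a cylinder.

    Since beta <= 1 - 2 kappa, the capillary energy controls 2 kappa P(E), and it
    is lower semicontinuous among the sets contained in a given cylinder: the
    direct method applies in C_R^K.  Let E be a set whose energy is not lowered by
    removing parts of it, let w(s) be the volume of E in r + s < |x| < R_0 - s, and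
    phi = w^(1/(n+1)).  Removing this ring costs at most twice the limit of
    (2/h) (w(s) - w(s + h)), and the isoperimetric inequality in the ring turns
    this into phi' <= - kappa / (4 (n+1)^2) as long as phi > 0.  The value of R_0
    forces phi to vanish before the middle of the ring; the part of E beyond the
    empty ring can then be dropped, and has zero perimeter.  Hence the minimizers
    in C_R^K all live in C_{R_0}^K, and a minimizer in C_{R_0}^K is a global one,
    for any competitor may be cut at height K and at a large radius where the
    cutting cost is small.  Finally, a point outside the convex set C_{R_0}^K is
    not of density one, by reflection through it. *)


(** * Lebesgue measure on coordinate products *)

Section measure_basics.
Variable R : realType.
Local Notation mR := (measurableTypeR R).
Local Notation lam := (@lebesgue_measure R).

(** The coarea formula is replaced by volumes of thin shells: the cost of a cut at radius b is
    always a bound of 2 / h times the volume of E in a shell of width h, along some sequence h -> 0.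
    So the differential inequality for phi only says that at each s some arbitrarily small h gives a
    drop of slope q; as phi is monotone, this is enough ([dini_decrease]). The constant q comes out
    as follows. If all small drops were below q h, the part of E in the ring would have perimeter at
    most c / kappa with c = 2 (n+1) q phi^n, whereas phi^n is at most n+1 times this perimeter; with
    q = kappa / (4 (n+1)^2) this reads phi^n <= phi^n / 2. Two points of strictness shape the rest.
    Cutting at height K does not raise the energy, but to place every minimizer below K the cut has
    to lower it strictly; this is why the vertical field of the cut is tilted in a horizontal
    direction. And V is controlled only for radii larger than r, so that the ring starts at r + 1/2,
    within the margin r + 1 of R_0. *)

Lemma rV_cons0 n (p : 'rV[R]_n * mR) : rV_cons p ord0 ord0 = p.2.
Proof.
have -> : (ord0 : 'I_n.+1) = lshift n (ord0 : 'I_1) by exact/val_inj.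
by rewrite /rV_cons [LHS]row_mxEl mxE.
Qed.

Lemma rV_consS n (p : 'rV[R]_n * mR) (j : 'I_n) : rV_cons p ord0 (lift ord0 j) = p.1 ord0 j.
Proof.
have -> : (lift ord0 j : 'I_n.+1) = rshift 1 j by exact/val_inj.
by rewrite /rV_cons [LHS]row_mxEr.
Qed.

Definition box n (B : 'I_n -> set R) : set 'rV[R]_n := [set x | forall i, B i (x ord0 i)].

Lemma boxE n (B : 'I_n -> set R) :
  box B = \bigcap_(i in setT) ((fun x : 'rV[R]_n => x ord0 i : mR) @^-1` B i).
Proof. by apply/seteqP; split => x /= xB; [move=> i _; exact: xB|move=> i; exact: xB]. Qed.

Lemma measurable_coord_preimage n (i : 'I_n) (B : set mR) : measurable B ->
  measurable ((fun x : 'rV[R]_n => x ord0 i : mR) @^-1` B).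
Proof.
by move=> mB; rewrite -[X in measurable X]setTI; exact: measurable_rV_coord.
Qed.

Lemma measurable_box n (B : 'I_n -> set mR) : (forall i, measurable (B i)) ->
  measurable (box B).
Proof.
move=> mB; rewrite boxE; apply: fin_bigcap_measurable => //.
by move=> i _; exact: measurable_coord_preimage.
Qed.

Lemma leb_box n (B : 'I_n -> set mR) : (forall i, measurable (B i)) ->
  leb R n (box B) = \big[mule/1%E]_(i < n) lam (B i).
Proof.
elim: n B => [|n IH] B mB.
  by rewrite big_ord0 /= diracE mem_set// => -[].
rewrite big_ord_recl -IH//= /leb_step /pushforward.
rewrite muleC -product_measure1E//; last exact: measurable_box.
congr (_ _); apply/seteqP; split => [p pB|p [pB pB0]] /=.
  split; last by rewrite -rV_cons0; exact: pB.
  by move=> i; rewrite -rV_consS; exact: pB.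
by move=> i; case: (unliftP ord0 i) => [j|] ->; rewrite ?rV_consS ?rV_cons0.
Qed.

Lemma prode_fin n (f : 'I_n -> R) :
  (\big[mule/1%E]_(i < n) (f i)%:E = (\prod_(i < n) f i)%:E)%E.
Proof.
elim: n f => [|n IH] f; first by rewrite !big_ord0.
by rewrite !big_ord_recl IH EFinM.
Qed.

Lemma leb_itv n (a b : 'I_n -> R) (u v : bool) : (forall i, a i <= b i) ->
  leb R n (box (fun i => [set` Interval (BSide u (a i)) (BSide v (b i))])) =
  (\prod_(i < n) (b i - a i))%:E.
Proof.
move=> ab; rewrite leb_box; last by move=> i; exact: measurable_itv.
rewrite -prode_fin; apply: eq_bigr => i _.
rewrite lebesgue_measure_itv /=; have := ab i; rewrite lte_fin le_eqVlt => /predU1P[->|->//].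
by rewrite ltxx subrr.
Qed.

Lemma leb_sigma_finite n : sigma_finite [set: 'rV[R]_n] (leb R n).
Proof.
exists (fun k => box (fun=> [set` `]- k%:R, k%:R[])).
  apply/esym; rewrite -subTset => x _ /=.
  exists (\sum_(i < n) (Num.truncn `|x ord0 i|).+1)%N => // i /=.
  rewrite in_itv/= -ltr_norml; apply: lt_le_trans (@truncnS_gt _ _) _.
  by rewrite ler_nat (bigD1 i)//= leq_addr.
move=> k; split; first by apply: measurable_box => i; exact: measurable_itv.
rewrite leb_itv ?ltry// => i; apply: (@le_trans _ _ 0).
  by rewrite oppr_le0. by [].
Qed.

(** The measure [leb R n] under a new name, to which the sigma-finite structure asked by the Fubini
    and Tonelli theorems is attached. [volm] does the same for [vol]. *)
Definition lebm n : set 'rV[R]_n -> \bar R := leb R n.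

HB.instance Definition _ n := isMeasure.Build _ _ _ (@lebm n)
  (measure0 (leb R n)) (measure_ge0 (leb R n)) (@measure_semi_sigma_additive _ _ _ (leb R n)).

HB.instance Definition _ n := Measure_isSigmaFinite.Build _ _ _ (@lebm n) (@leb_sigma_finite n).

Lemma volX n (A : set 'rV[R]_n) (B : set mR) : measurable A -> measurable B ->
  vol R n (A `*` B) = (leb R n A * lam B)%E.
Proof. exact: product_measure1E. Qed.

Lemma measurable_rV_map d (T : measurableType d) n (f : T -> 'rV[R]_n) :
  (forall i, measurable_fun setT (fun x => f x ord0 i : mR)) -> measurable_fun setT f.
Proof.
move=> mf _ A mA; rewrite setTI.
suff: g_sigma_preimage
    (fun (j : 'I_n) (x : 'rV[R]_n) => x ord0 j : mR)
    `<=` [set B | measurable (f @^-1` B)] by apply.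
apply: smallest_sub; first split => /=.
- by rewrite preimage_set0.
- by move=> B mB; rewrite setTD preimage_setC; exact: measurableC.
- by move=> F mF; rewrite preimage_bigcup; exact: bigcupT_measurable.
case: n f mf A mA => [|n] f mf A mA.
  by rewrite big_ord0; exact: sub0set.
rewrite -bigcup_mkord_ord; apply: bigcup_sub => i _ B [C mC <-] /=.
rewrite setTI -[X in measurable X]setTI.
exact: (mf (inord i) measurableT C mC).
Qed.

Definition vbox n (B : 'I_n -> set mR) (C : set mR) : set (Rn1 R n) := box B `*` C.

Definition vboxes n : set (set (Rn1 R n)) :=
  [set A | exists B C, [/\ forall i, measurable (B i), measurable C & A = @vbox n B C]].

Lemma vboxes_gen n : (measurable : set (set (Rn1 R n))) = <<s @vboxes n >>.
Proof.
apply/seteqP; split; last first.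
  apply: smallest_sub; first exact: sigma_algebra_measurable.
  move=> _ [B [C [mB mC ->]]]; apply: measurableX => //; exact: measurable_box.
rewrite {1}/measurable/= ; apply: smallest_sub; first exact: smallest_sigma_algebra.
rewrite subUset; split => A [B mB <-]; rewrite setTI.
- have : g_sigma_preimage (fun (j : 'I_n) (x : 'rV[R]_n) => x ord0 j : mR) B by exact: mB.
  suff: g_sigma_preimage (fun (j : 'I_n) (x : 'rV[R]_n) => x ord0 j : mR)
    `<=` [set B | <<s @vboxes n >> (fst @^-1` B)] by apply.
  apply: smallest_sub; first split => /=.
  + by rewrite preimage_set0; exact: sigma_algebra0.
  + by move=> D mD; rewrite setTD preimage_setC; exact: sigma_algebraC.
  + by move=> F mF; rewrite preimage_bigcup; exact: sigma_algebra_bigcup.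
  case: n B A mB => [|n] B A mB; first by rewrite big_ord0; exact: sub0set.
  rewrite -bigcup_mkord_ord; apply: bigcup_sub => i _ D [C mC <-] /=.
  apply: sub_sigma_algebra.
  exists (fun j => if j == inord i then C else setT), setT; split => //.
    by move=> j; case: ifP.
  rewrite /vbox setTI; apply/seteqP; split => [p /= pC|p [/= pC _]].
    by split => // j; case: eqP => [->|].
  by have /= := pC (inord i); rewrite eqxx.
- apply: sub_sigma_algebra; exists (fun=> setT), B; split => //.
  by apply/seteqP; split => // p [].
Qed.

Lemma vboxes_setI n : setI_closed (@vboxes n).
Proof.
move=> _ _ [B [C [mB mC ->]]] [B' [C' [mB' mC' ->]]].
exists (fun i => B i `&` B' i), (C `&` C'); split.
- by move=> i; exact: measurableI.
- exact: measurableI.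
- apply/seteqP; split => [p [[pB pC] [pB' pC']]|p [pB [pC pC']]].
    by split; [move=> i; split; [exact: pB|exact: pB']|split].
  by split; split => // i; have [] := pB i.
Qed.

Lemma vol_vbox n (B : 'I_n -> set mR) C : (forall i, measurable (B i)) -> measurable C ->
  vol R n (vbox B C) = (\big[mule/1%E]_(i < n) lam (B i) * lam C)%E.
Proof.
by move=> mB mC; rewrite volX ?leb_box//; exact: measurable_box.
Qed.

Lemma measurable_vbox n (B : 'I_n -> set mR) C : (forall i, measurable (B i)) -> measurable C ->
  measurable (vbox B C).
Proof. by move=> mB mC; apply: measurableX => //; exact: measurable_box. Qed.

Definition vcube n (k : nat) : set (Rn1 R n) :=
  vbox (fun=> [set` `]- k%:R, k%:R[]) [set` `]- k%:R, k%:R[].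

Lemma measurable_vcube n k : measurable (@vcube n k).
Proof. by apply: measurable_vbox => [i|]; exact: measurable_itv. Qed.

Lemma vcube_cover n : \bigcup_k @vcube n k = setT.
Proof.
rewrite -subTset => -[x t] _ /=.
exists ((Num.trunc `|t|).+1 + \sum_(i < n) (Num.trunc `|x ord0 i|).+1)%N => //=.
split => [i /=|] /=; rewrite in_itv/= -ltr_norml; apply: lt_le_trans (@truncnS_gt _ _) _.
  by rewrite ler_nat (bigD1 i)//= addnCA leq_addr.
by rewrite ler_nat leq_addr.
Qed.

Lemma vol_vcube n k : (vol R n (@vcube n k) < +oo)%E.
Proof.
have k0 : - k%:R <= k%:R :> R by apply: (@le_trans _ _ 0); rewrite ?oppr_le0.
rewrite volX; [|by apply: measurable_box => i; exact: measurable_itv|exact: measurable_itv].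
rewrite leb_itv// lebesgue_measure_itv/=.
by case: ifPn => _; rewrite ?mule0// -EFinM ltry.
Qed.

Lemma vol_sigma_finite n : sigma_finite [set: Rn1 R n] (vol R n).
Proof.
exists (@vcube n); first by rewrite vcube_cover.
by move=> k; split; [exact: measurable_vcube|exact: vol_vcube].
Qed.

Definition volm n (A : set (Rn1 R n)) : \bar R := vol R n A.

HB.instance Definition _ n := isMeasure.Build _ _ _ (@volm n)
  (measure0 (vol R n)) (measure_ge0 (vol R n)) (@measure_semi_sigma_additive _ _ _ (vol R n)).

HB.instance Definition _ n := Measure_isSigmaFinite.Build _ _ _ (@volm n) (@vol_sigma_finite n).

Lemma vol_tonelli n (f : Rn1 R n -> \bar R) : measurable_fun [set: Rn1 R n] f ->
  (forall p, 0 <= f p)%E ->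
  (\int[vol R n]_p f p = \int[leb R n]_x \int[lam]_t f (x, t))%E.
Proof. exact: (@fubini_tonelli1 _ _ _ _ _ (@lebm n) lam). Qed.

(** Boxes generate the sigma-algebra and are stable under intersection, and the cubes exhaust the
    space with finite volume. The invariance of the volume under [swap] and [reflect] is read off on
    boxes in this way. *)
Lemma vol_unique n (m : {measure set (Rn1 R n) -> \bar R}) :
  (forall B C, (forall i, measurable (B i)) -> measurable C -> m (@vbox n B C) = vol R n (vbox B C)) ->
  forall A, measurable A -> m A = vol R n A.
Proof.
move=> mE; apply: (measure_unique (@vboxes n) (@vcube n)).
- exact: vboxes_gen.
- exact: vboxes_setI.
- by move=> k; exists (fun=> [set` `]- k%:R, k%:R[]), [set` `]- k%:R, k%:R[]; split.
- exact: vcube_cover.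
- by move=> _ [B [C [mB mC ->]]]; exact: mE.
- move=> k; rewrite mE; [exact: vol_vcube|by move=> i; exact: measurable_itv|exact: measurable_itv].
Qed.

(* The exchange of a horizontal coordinate with the vertical one, which is how statements about
   vertical lines are carried over to the other coordinate directions. *)
Definition swap n (i : option 'I_n) (p : Rn1 R n) : Rn1 R n :=
  if i is Some i then
    (\row_j (if j == i then p.2 : R else p.1 ord0 j), p.1 ord0 i : mR)
  else p.

Lemma swapK n i : involutive (@swap n i).
Proof.
case: i => [i|//] [x t]; rewrite /swap/=; congr pair; last by rewrite mxE eqxx.
by apply/rowP => j; rewrite !mxE; case: eqP => // ->.
Qed.

Lemma measurable_swap n i : measurable_fun setT (@swap n i).
Proof.
case: i => [i|]; last exact: measurable_id.
apply/measurable_fun_pair => /=; last first.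
  exact: (measurableT_comp (measurable_rV_coord i)).
apply: measurable_rV_map => j.
have [->|ji] := eqVneq j i.
  rewrite [X in measurable_fun _ X](_ : _ = snd); last by apply/funext => p; rewrite mxE eqxx.
  exact: measurable_snd.
rewrite [X in measurable_fun _ X](_ : _ = fun p : Rn1 R n => p.1 ord0 j); last first.
  by apply/funext => p; rewrite mxE (negbTE ji).
exact: (measurableT_comp (measurable_rV_coord j)).
Qed.

Lemma measurable_swap_preimage n i (A : set (Rn1 R n)) : measurable A ->
  measurable (swap i @^-1` A).
Proof. by move=> mA; rewrite -[X in measurable X]setTI; exact: measurable_swap. Qed.

Lemma vol_swap n i (A : set (Rn1 R n)) : measurable A ->
  vol R n (swap i @^-1` A) = vol R n A.
Proof.
move=> mA; have ms := @measurable_swap n i.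
have /= := @vol_unique n (pushforward (vol R n) (swap i)).
apply => // B C mB mC; rewrite /pushforward.
case: i ms => [i|//] _.
rewrite (_ : _ @^-1` _ = vbox (fun j => if j == i then C else B j) (B i)); last first.
  apply/seteqP; split => [[x t] [/= xB xi]|[x t] [/= xB xi]].
    split => /= [j|]; last by have := xB i; rewrite mxE eqxx.
    by have := xB j; rewrite mxE; case: eqP => // ->.
  split => /= [j|]; last by have := xB i; rewrite eqxx.
  by have := xB j; rewrite mxE; case: eqP => // ->.
rewrite !vol_vbox//; last by move=> j; case: ifP.
rewrite (bigD1 i)//= eqxx [in RHS](bigD1 i)//=.
rewrite muleAC [in RHS]muleC muleA; congr (_ * _ * _)%E.
by apply: eq_bigr => j /negbTE ->.
Qed.

Definition reflect n (c p : Rn1 R n) : Rn1 R n := (c.1 *+ 2 - p.1, c.2 *+ 2 - p.2).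

Let refl_pre (c : R) (A : set mR) : measurable A -> measurable ((fun x : mR => c - x : mR) @^-1` A).
Proof.
move=> mA; rewrite -[X in measurable X]setTI.
by apply: (measurable_funB (measurable_cst _) (@measurable_id _ _ _)).
Qed.

Lemma lebesgue_measure_reflect (c : R) (A : set mR) : measurable A ->
  lam ((fun x : mR => c - x : mR) @^-1` A) = lam A.
Proof.
have mr : measurable_fun setT (fun x : mR => c - x : mR).
  by apply: (measurable_funB (measurable_cst _) (@measurable_id _ _ _)).
move=> mA; apply/esym; apply: (@lebesgue_measure_unique _ (pushforward lam (fun x : mR => c - x : mR))) => //.
move=> X; rewrite /ocitv /= => -[[a b]] /= _ <-.
rewrite /pushforward (_ : _ @^-1` _ = [set` `[c - b, c - a[]); last first.
  apply/seteqP; split => x /=; rewrite !in_itv/= lerBlDr ltrBrDr => /andP[h1 h2];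
   by apply/andP; split; lra.
rewrite !lebesgue_measure_itv/= !lte_fin.
by rewrite ltrD2l ltrN2 -!EFinD; case: ifP => // _; congr (_%:E); lra.
Qed.

Lemma measurable_reflect n c : measurable_fun setT (@reflect n c).
Proof.
apply/measurable_fun_pair => /=; last first.
  by apply: (measurable_funB (measurable_cst _) measurable_snd).
apply: measurable_rV_map => j.
rewrite [X in measurable_fun _ X](_ : _ = fun p : Rn1 R n => (c.1 *+ 2) ord0 j - p.1 ord0 j); last first.
  by apply/funext => p; rewrite !mxE.
apply: measurable_funB => //.
exact: (measurableT_comp (measurable_rV_coord j)).
Qed.

Lemma vol_reflect n c (A : set (Rn1 R n)) : measurable A ->
  vol R n (reflect c @^-1` A) = vol R n A.
Proof.
move=> mA; have ms := @measurable_reflect n c.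
have /= := @vol_unique n (pushforward (vol R n) (reflect c)).
apply => // B C mB mC; rewrite /pushforward.
rewrite (_ : _ @^-1` _ = vbox (fun j => (fun x : mR => (c.1 *+ 2) ord0 j - x : mR) @^-1` B j) 
   ((fun x : mR => c.2 *+ 2 - x : mR) @^-1` C)); last first.
  apply/seteqP; split => [[x t] [/= xB xi]|[x t] [/= xB xi]].
    by split => //= j; have := xB j; rewrite !mxE.
  by split => //= j; have := xB j; rewrite /= !mxE.
rewrite !vol_vbox//; last first.
- exact: refl_pre.
- by move=> j; exact: refl_pre.
rewrite lebesgue_measure_reflect//; congr (_ * _)%E.
by apply: eq_bigr => j _; rewrite lebesgue_measure_reflect.
Qed.

End measure_basics.

(** * C1 functions, cut-offs and test fields *)

Section topology_measurability.
Variable R : realType.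
Local Notation mR := (measurableTypeR R).

(** The sigma-algebra is generated by the coordinates, not by the open sets; U is the union of the
    countably many boxes with rational centre and half-side 1 / (k+1) that it contains. *)
Lemma open_measurable_Rn1 n (U : set (Rn1 R n)) : open U -> measurable U.
Proof.
move=> oU.
pose q2b (q : 'rV[rat]_n * rat * nat) : set (Rn1 R n) :=
  vbox (fun i => [set` `]ratr (q.1.1 ord0 i) - q.2.+1%:R^-1, ratr (q.1.1 ord0 i) + q.2.+1%:R^-1[])
       [set` `]ratr q.1.2 - q.2.+1%:R^-1, ratr q.1.2 + q.2.+1%:R^-1[].
rewrite (_ : U = \bigcup_(q in [set q | q2b q `<=` U]) q2b q); last first.
  apply/seteqP; split => [[x t] Up|p [q] /=]; last exact.
  have /nbhs_ballP[e /= e0 eU] : nbhs (x, t) U by exact: open_nbhs_nbhs.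
  (* The point is within 1 / (k+1) of the rational centre, which is within 1 / (k+1) of every point
     of the box. *)
  have [k ke] : exists k : nat, 2 * k.+1%:R^-1 < e.
    exists (Num.trunc (2 / e)); rewrite ltr_pdivrMr// mulrC -ltr_pdivrMr//.
    exact: truncnS_gt.
  have k0 : 0 < k.+1%:R^-1 :> R by rewrite invr_gt0.
  have near (s : R) : {q : rat | `|s - ratr q| < k.+1%:R^-1}.
    apply: cid.
    have /rat_in_itvoo[q] : s - k.+1%:R^-1 < s + k.+1%:R^-1 by rewrite ltrD2l gtrN.
    by rewrite in_itv/= => h; exists q; rewrite distrC ltr_distl.
  exists (\row_i sval (near (x ord0 i)), sval (near t), k).
    move=> /= [y s] [yq] sq; apply: eU; rewrite /= in_itv/= in sq.
    split => /=.
      split => // i j; rewrite (ord1 i).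
      have := yq j; rewrite /= in_itv/= mxE; case: (near _) => q /= qx.
      rewrite -ltr_distl -ball_normE/= => yq'.
      apply: le_lt_trans ke; rewrite (le_trans (ler_distD (ratr q) _ _))// mulr2n mulrDl mul1r.
      by rewrite lerD// ltW// distrC.
    move: sq; case: (near t) => q /= qx; rewrite -ltr_distl => sq.
    rewrite -ball_normE/=.
    apply: le_lt_trans ke; rewrite (le_trans (ler_distD (ratr q) _ _))// mulr2n mulrDl mul1r.
    by rewrite lerD// ltW// distrC.
  split => /= [i|]; rewrite /= in_itv/= ?mxE -ltr_distl; case: (near _) => q /=; by [].
rewrite bigcup_mkcond; apply: countable_bigcupT_measurable => [|q].
  exact: countableP.
case: ifPn => _; last exact: measurable0.
by apply: measurable_vbox => [i|]; exact: measurable_itv.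
Qed.

Lemma continuous_measurable_Rn1 n (f : Rn1 R n -> R) : continuous f ->
  measurable_fun [set: Rn1 R n] f.
Proof.
move=> /continuousP cf; apply: (measurability _ (RGenOpens.measurableE R)).
by move=> _ [_ [a [b ->] <-]]; rewrite setTI; apply: open_measurable_Rn1; exact/cf/interval_open.
Qed.

Lemma continuous_fst1 n (i : 'I_n) : continuous (fun p : Rn1 R n => p.1 ord0 i : R).
Proof.
move=> p; apply: (@continuous_comp _ _ _ fst (fun x : 'rV[R]_n => x ord0 i)); first exact: cvg_fst.
exact: coord_continuous.
Qed.

Lemma continuous_snd1 n : continuous (fun p : Rn1 R n => p.2 : R).
Proof. by move=> p; exact: cvg_snd. Qed.

End topology_measurability.

Section calculus.
Variables (R : realType).

(** The regularity asked in [C1c], for maps between any normed spaces, so that coordinates, cut-offs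
    and whole fields share the same closure rules. *)
Definition C1 (V W : normedModType R) (f : V -> W) :=
  (forall p, differentiable f p) /\ forall v, continuous (fun p => 'D_v f p).

Section generic.
Variables (V W : normedModType R).
Implicit Types (f g : V -> W).

Lemma C1_continuous f : C1 f -> continuous f.
Proof. by move=> [df _] p; exact/differentiable_continuous. Qed.

Lemma C1_derivable f p v : C1 f -> derivable f p v.
Proof. by move=> [df _]; exact/diff_derivable. Qed.

Lemma C1_cst (a : W) : C1 (fun _ : V => a).
Proof.
split=> [p|v]; first exact: differentiable_cst.
rewrite [X in continuous X](_ : _ = cst 0); first by move=> p; exact: cvg_cst.
by apply/funext => p; rewrite derive_cst.
Qed.

Lemma deriveD' f g p v : C1 f -> C1 g ->
  'D_v (fun p => f p + g p) p = 'D_v f p + 'D_v g p.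
Proof.
move=> cf cg. exact: (deriveD (C1_derivable cf) (C1_derivable cg)).
Qed.

Lemma C1D f g : C1 f -> C1 g -> C1 (fun p => f p + g p).
Proof.
move=> cf cg; split=> [p|v]; first exact: (differentiableD (cf.1 p) (cg.1 p)).
rewrite [X in continuous X](_ : _ = (fun p => 'D_v f p + 'D_v g p)); last first.
  by apply/funext => p; rewrite deriveD'.
by move=> p; apply: cvgD; [exact: cf.2|exact: cg.2].
Qed.

Lemma deriveN' f p v : C1 f -> 'D_v (fun p => - f p) p = - 'D_v f p.
Proof. by move=> cf; exact: (deriveN (C1_derivable cf)). Qed.

Lemma C1N f : C1 f -> C1 (fun p => - f p).
Proof.
move=> cf; split=> [p|v]; first exact: (differentiableN (cf.1 p)).
rewrite [X in continuous X](_ : _ = (fun p => - 'D_v f p)); last first.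
  by apply/funext => p; rewrite deriveN'.
by move=> p; apply: cvgN; exact: cf.2.
Qed.

Lemma C1B f g : C1 f -> C1 g -> C1 (fun p => f p - g p).
Proof. by move=> cf cg; apply: C1D => //; exact: C1N. Qed.

Lemma deriveB' f g p v : C1 f -> C1 g ->
  'D_v (fun p => f p - g p) p = 'D_v f p - 'D_v g p.
Proof.
by move=> cf cg; exact: (deriveB (C1_derivable cf) (C1_derivable cg)).
Qed.

Lemma C1_sum (I : Type) (r : seq I) (P : pred I) (F : I -> V -> W) :
  (forall i, P i -> C1 (F i)) -> C1 (fun p => \sum_(i <- r | P i) F i p).
Proof.
move=> cF; elim: r => [|a r IH].
  rewrite (_ : (fun p => _) = (fun=> 0)); first exact: C1_cst.
  by apply/funext => p; rewrite big_nil.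
have [Pa|Pa] := boolP (P a); last first.
  rewrite (_ : (fun p => _) = (fun p => \sum_(i <- r | P i) F i p))//.
  by apply/funext => p; rewrite big_cons (negbTE Pa).
rewrite (_ : (fun p => _) = (fun p => F a p + \sum_(i <- r | P i) F i p)); last first.
  by apply/funext => p; rewrite big_cons Pa.
by apply: C1D => //; exact: cF.
Qed.

Lemma derive_sum' (I : Type) (r : seq I) (P : pred I) (F : I -> V -> W) p v :
  (forall i, P i -> C1 (F i)) ->
  'D_v (fun p => \sum_(i <- r | P i) F i p) p = \sum_(i <- r | P i) 'D_v (F i) p.
Proof.
move=> cF; elim: r => [|a r IH].
  rewrite big_nil (_ : (fun p => _) = cst 0); first exact: derive_cst.
  by apply/funext => q; rewrite big_nil.
rewrite big_cons -IH; have [Pa|Pa] := boolP (P a); last first.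
  congr ('D_v _ p); apply/funext => q; by rewrite big_cons (negbTE Pa).
rewrite -deriveD'; [|exact: cF|exact: C1_sum].
by congr ('D_v _ p); apply/funext => q; rewrite big_cons Pa.
Qed.

Lemma C1_lin (f : {linear V -> W}) : continuous f -> C1 f.
Proof.
move=> cf; split=> [p|v]; first exact: linear_differentiable.
rewrite [X in continuous X](_ : _ = cst (f v)); first by move=> p; exact: cvg_cst.
by apply/funext => q; rewrite deriveE ?diff_lin//; exact: linear_differentiable.
Qed.

Lemma derive_lin (f : {linear V -> W}) p v : continuous f -> 'D_v f p = f v.
Proof. by move=> cf; rewrite deriveE ?diff_lin//; exact: linear_differentiable. Qed.

End generic.

Lemma deriveM' (V : normedModType R) (h k : V -> R) p v : C1 h -> C1 k ->
  'D_v (fun p => h p * k p) p = h p * 'D_v k p + k p * 'D_v h p.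
Proof.
by move=> ch ck; exact: (deriveM (C1_derivable ch) (C1_derivable ck)).
Qed.

Lemma C1M (V : normedModType R) (h k : V -> R) : C1 h -> C1 k -> C1 (fun p => h p * k p).
Proof.
move=> cf cg; split=> [p|v]; first exact: (differentiableM (cf.1 p) (cg.1 p)).
rewrite [X in continuous X](_ : _ = (fun p => h p * 'D_v k p + k p * 'D_v h p)); last first.
  by apply/funext => p; rewrite deriveM'.
by move=> p; apply: cvgD; apply: cvgM;
  [exact: (C1_continuous cf)|exact: cg.2|exact: (C1_continuous cg)|exact: cf.2].
Qed.

Lemma derive_comp_lin (U V W : normedModType R) (L : {linear U -> V}) (f : V -> W) p v :
  continuous L -> C1 f -> 'D_v (f \o L) p = 'D_(L v) f (L p).
Proof.
move=> cL cf.
have dL : differentiable L p by exact: linear_differentiable.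
rewrite !deriveE; [|exact: cf.1|apply: differentiable_comp => //; exact: cf.1].
by rewrite diff_comp//; [rewrite /= diff_lin|exact: cf.1].
Qed.

Lemma C1_comp_lin (U V W : normedModType R) (L : {linear U -> V}) (f : V -> W) :
  continuous L -> C1 f -> C1 (f \o L).
Proof.
move=> cL cf; split=> [p|v].
  by apply: differentiable_comp; [exact: linear_differentiable|exact: cf.1].
rewrite [X in continuous X](_ : _ = (fun p => 'D_(L v) f (L p))); last first.
  by apply/funext => p; rewrite derive_comp_lin.
by move=> p; apply: (@continuous_comp _ _ _ L (fun q => 'D_(L v) f q)); [exact: cL|exact: cf.2].
Qed.

Lemma derive_lin_comp (U V W : normedModType R) (f : U -> V) (L : {linear V -> W}) p v :
  continuous L -> C1 f -> 'D_v (L \o f) p = L ('D_v f p).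
Proof.
move=> cL cf.
have dL : differentiable L (f p) by exact: linear_differentiable.
rewrite !deriveE; [|exact: cf.1|apply: differentiable_comp => //; exact: cf.1].
by rewrite diff_comp//; [rewrite /= diff_lin|exact: cf.1].
Qed.

Lemma C1_lin_comp (U V W : normedModType R) (f : U -> V) (L : {linear V -> W}) :
  continuous L -> C1 f -> C1 (L \o f).
Proof.
move=> cL cf; split=> [p|v].
  by apply: differentiable_comp; [exact: cf.1|exact: linear_differentiable].
rewrite [X in continuous X](_ : _ = (fun p => L ('D_v f p))); last first.
  by apply/funext => p; rewrite derive_lin_comp.
by move=> p; apply: (@continuous_comp _ _ _ (fun p => 'D_v f p) L); [exact: cf.2|exact: cL].
Qed.

Lemma derive_comp1 (V : normedModType R) (f : V -> R) (g : R -> R) p v :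
  C1 g -> C1 f -> 'D_v (g \o f) p = derive1 g (f p) * 'D_v f p.
Proof.
move=> cg cf.
rewrite deriveE; last by apply: differentiable_comp; [exact: cf.1|exact: cg.1].
rewrite diff_comp; [|exact: cf.1|exact: cg.1].
have dg : derivable g (f p) 1 by exact: C1_derivable.
by rewrite [LHS]/= (deriv1E dg) -(deriveE _ (cf.1 p)) mulrC.
Qed.

Lemma C1_comp1 (V : normedModType R) (f : V -> R) (g : R -> R) :
  C1 g -> C1 f -> C1 (g \o f).
Proof.
move=> cg cf; split=> [p|v].
  by apply: differentiable_comp; [exact: cf.1|exact: cg.1].
rewrite [X in continuous X](_ : _ = (fun p => derive1 g (f p) * 'D_v f p)); last first.
  by apply/funext => p; rewrite derive_comp1.
move=> p; apply: cvgM; last exact: cf.2.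
apply: (@continuous_comp _ _ _ f (derive1 g)); first exact: (C1_continuous cf).
by rewrite (_ : derive1 g = (fun p => 'D_1 g p)); [exact: cg.2|apply/funext => q; rewrite derive1E].
Qed.

Lemma C1_pair (U V W : normedModType R) (f : U -> V) (g : U -> W) :
  C1 f -> C1 g -> C1 (fun p => (f p, g p)).
Proof.
move=> cf cg.
have E v p : 'D_v (fun p => (f p, g p)) p = ('D_v f p, 'D_v g p).
  rewrite !deriveE; [|exact: cg.1|exact: cf.1|by apply: differentiable_pair; [exact: cf.1|exact: cg.1]].
  by rewrite diff_pair//; [exact: cf.1|exact: cg.1].
split=> [p|]; first by apply: differentiable_pair; [exact: cf.1|exact: cg.1].
move=> v; rewrite [X in continuous X](_ : _ = (fun p => ('D_v f p, 'D_v g p))); last by apply/funext => p.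
by move=> p; apply: cvg_pair; [exact: cf.2|exact: cg.2].
Qed.

Lemma C1_scalel (V W : normedModType R) (h : V -> R) (w : W) : C1 h -> C1 (fun p => h p *: w).
Proof.
move=> ch.
have E v p : 'D_v (fun p => h p *: w) p = 'D_v h p *: w.
  rewrite !deriveE; [|exact: ch.1|by apply: differentiableZl; exact: ch.1].
  by rewrite diffZl//; exact: ch.1.
split=> [p|v]; first by apply: differentiableZl; exact: ch.1.
rewrite [X in continuous X](_ : _ = (fun p => 'D_v h p *: w)); last by apply/funext => p.
by move=> p; apply: cvgZr_tmp; exact: ch.2.
Qed.

Lemma row_sum_delta n (V : Type) (f : 'I_n -> V -> R) :
  (fun p => \row_i f i p) = (fun p => \sum_(i < n) f i p *: (delta_mx ord0 i : 'rV[R]_n)).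
Proof.
apply/funext => p; apply/rowP => j; rewrite mxE summxE (bigD1 j)//= big1 ?addr0.
  by rewrite !mxE !eqxx mulr1.
by move=> i ij; rewrite !mxE eqxx/= eq_sym (negbTE ij) mulr0.
Qed.

Lemma C1_row n (V : normedModType R) (f : 'I_n -> V -> R) :
  (forall i, C1 (f i)) -> C1 (fun p => \row_i f i p).
Proof.
by move=> cf; rewrite row_sum_delta; apply: C1_sum => i _; exact: C1_scalel.
Qed.

End calculus.

(** * A C1 step function *)

Section step.
Variable R : realType.
Implicit Types t : R.

(** A quadratic spline with a knot at 0; [step] is a combination of four translates of it. *)
Definition pos2 t : R := Num.max t 0 ^+ 2.

Lemma pos2_approx t h : `|pos2 (t + h) - pos2 t - 2 * Num.max t 0 * h| <= h ^+ 2.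
Proof.
rewrite /pos2 ler_norml.
case: (leP t 0) => t0; case: (leP (t + h) 0) => th; apply/andP; split; nra.
Qed.

Lemma is_derive_pos2 t : is_derive t 1 pos2 (2 * Num.max t 0).
Proof.
have H : h^-1 *: (pos2 (h *: 1 + t) - pos2 t) @[h --> 0^'] --> 2 * Num.max t 0.
  apply/cvgrPdist_lt => e e0; near=> h.
  have h0 : h != 0 by near: h; exact: nbhs_dnbhs_neq.
  have he : `|h| < e by near: h; apply: dnbhs0_lt.
  apply: le_lt_trans he; rewrite distrC [_%:A]mulr1 (addrC h).
  rewrite (_ : _ - _ = h^-1 * (pos2 (t + h) - pos2 t - 2 * Num.max t 0 * h)); last first.
    by rewrite [RHS]mulrBr (mulrC _ h) mulKf.
  rewrite normrM normfV ler_pdivrMl ?normr_gt0// -expr2 -normrX (ger0_norm (sqr_ge0 h)).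
  exact: pos2_approx.
split; first by apply: cvgP; exact: H.
exact: cvg_lim H.
Unshelve. all: by end_near.
Qed.

Lemma C1_from_derive (f df : R -> R) : (forall t, is_derive t 1 f (df t)) -> continuous df ->
  C1 f.
Proof.
move=> fdf cdf; split=> [p|v].
  by apply/derivable1_diffP; have [] := fdf p.
rewrite [X in continuous X](_ : _ = (fun p => v * df p)).
  by move=> p; apply: cvgM; [exact: cvg_cst|exact: cdf].
apply/funext => p; have [dp <-] := fdf p.
rewrite deriveE; last exact/derivable1_diffP.
by rewrite deriv1E// derive1E.
Qed.

(** A trapezoid of area one with the plateau 3/2 on [1/3, 2/3]. A triangle would reach 2; the lower
    maximum 3/2 leaves in [ramp_slope] the room needed for a gradient of at most 2 / (b - a). *)
Definition tent t : R := 9 / 2 * (Num.max t 0 - Num.max (t - 3^-1) 0 - Num.max (t - 2 / 3) 0 + Num.max (t - 1) 0).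

(* A C1 step from 0 to 1 on [0, 1]; its derivative [tent] is a piecewise affine bump. *)
Definition step t : R := 9 / 4 * (pos2 t - pos2 (t - 3^-1) - pos2 (t - 2 / 3) + pos2 (t - 1)).

Lemma is_derive_step t : is_derive t 1 step (tent t).
Proof.
have sh a : is_derive t 1 (fun t => pos2 (t - a)) (2 * Num.max (t - a) 0).
  have := @is_derive1_comp R pos2 (fun t => t - a) t (2 * Num.max (t - a) 0) 1.
  rewrite mulr1; apply; first exact: is_derive_pos2.
  by rewrite -[X in is_derive _ _ _ X](subr0 1); exact: is_deriveB.
have H : is_derive t 1 (9 / 4 *: ((pos2 - (fun t => pos2 (t - 3^-1))) - (fun t => pos2 (t - 2 / 3)) + (fun t => pos2 (t - 1))))
  (9 / 4 *: (2 * Num.max t 0 - 2 * Num.max (t - 3^-1) 0 - 2 * Num.max (t - 2/3) 0 + 2 * Num.max (t - 1) 0)).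
  apply: is_deriveZ; apply: is_deriveD; apply: is_deriveB; apply: is_deriveB; exact: is_derive_pos2.
rewrite (_ : tent t = 9 / 4 *: (2 * Num.max t 0 - 2 * Num.max (t - 3^-1) 0 - 2 * Num.max (t - 2/3) 0 + 2 * Num.max (t - 1) 0)) //.
rewrite /tent /GRing.scale/=; lra.
Qed.

Lemma continuous_tent : continuous tent.
Proof.
have H a : continuous (fun t : R => Num.max (t - a) 0).
  move=> t; apply: (@continuous_max _ _ (fun t => t - a) (cst 0)); last exact: cvg_cst.
  by apply: cvgB; [exact: cvg_id|exact: cvg_cst].
have H0 : continuous (fun t : R => Num.max t 0).
  move=> t; apply: (@continuous_max _ _ id (cst 0)); last exact: cvg_cst.
  exact: cvg_id.
move=> t; apply: cvgM; first exact: cvg_cst.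
by apply: cvgD; [apply: cvgB; [apply: cvgB|]|]; [exact: H0|exact: H|exact: H|exact: H].
Qed.

Lemma C1_step : C1 step.
Proof. exact: (C1_from_derive is_derive_step continuous_tent). Qed.

Lemma derive1_step t : derive1 step t = tent t.
Proof. by rewrite derive1E; have [] := is_derive_step t. Qed.

Lemma step_le0 t : t <= 0 -> step t = 0.
Proof. move=> t0; rewrite /step /pos2 !max_r ?expr0n/=; lra. Qed.

Lemma step_ge1 t : 1 <= t -> step t = 1.
Proof. move=> t0; rewrite /step /pos2 !max_l ?expr0n/=; lra. Qed.

Lemma tent_ge0 t : 0 <= tent t <= 3 / 2.
Proof.
rewrite /tent; case: (leP t 0) => h1; case: (leP (t - 3^-1) 0) => h2;
 case: (leP (t - 2/3) 0) => h3; case: (leP (t - 1) 0) => h4; apply/andP; split; lra.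
Qed.

Lemma tent_le0 t : t <= 0 -> tent t = 0.
Proof. move=> t0; rewrite /tent !max_r; lra. Qed.

Lemma tent_ge1 t : 1 <= t -> tent t = 0.
Proof. move=> t0; rewrite /tent !max_l; lra. Qed.

Lemma step_ge0 t : 0 <= step t <= 1.
Proof.
rewrite /step /pos2; case: (leP t 0) => h1; case: (leP (t - 3^-1) 0) => h2;
 case: (leP (t - 2/3) 0) => h3; case: (leP (t - 1) 0) => h4; apply/andP; split; nra.
Qed.

End step.

(** * Vector fields in coordinates *)

Section fields.
Variables (R : realType) (n : nat).
Local Notation V := (Rn1 R n).
Local Notation mR := (measurableTypeR R).
Implicit Types (p v : V) (i : option 'I_n).

(* Directions are indexed by [option 'I_n], [None] being the vertical one. *)
Definition comp i p : R := if i is Some i then p.1 ord0 i else p.2.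
Definition dirv i : V := if i is Some i then (delta_mx ord0 i, 0) else (0, 1).
Definition del i (f : V -> R) p : R := 'D_(dirv i) f p.

Lemma comp_is_linear i : linear (comp i).
Proof. by case: i => [i|] a [x s] [y t]; rewrite /comp//= !mxE. Qed.

HB.instance Definition _ i := GRing.isLinear.Build R V R _ (comp i) (comp_is_linear i).

Lemma continuous_comp_coord i : continuous (comp i).
Proof. by case: i => [i|]; [exact: continuous_fst1|exact: continuous_snd1]. Qed.

Lemma C1_coord i : C1 (comp i).
Proof. by apply: C1_lin; exact: continuous_comp_coord. Qed.

Lemma derive_coord i p v : 'D_v (comp i) p = comp i v.
Proof. by apply: derive_lin; exact: continuous_comp_coord. Qed.

Lemma comp_dirv i j : comp i (dirv j) = (i == j)%:R.
Proof. by case: i => [i|]; case: j => [j|] //=; rewrite !mxE ?eqxx//= eq_sym. Qed.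

Lemma del_coord i j p : del i (comp j) p = (i == j)%:R.
Proof. by rewrite /del derive_coord comp_dirv eq_sym. Qed.

Definition mkf (f : option 'I_n -> V -> R) p : V := (\row_i f (Some i) p, f None p).

Lemma comp_mkf f i p : comp i (mkf f p) = f i p.
Proof. by case: i => [i|]//; rewrite /comp mxE. Qed.

Lemma C1_mkf f : (forall i, C1 (f i)) -> C1 (mkf f).
Proof. by move=> cf; apply: C1_pair => //; exact: C1_row. Qed.

Lemma big_option (W : nmodType) (F : option 'I_n -> W) :
  \sum_i F i = \sum_(i < n) F (Some i) + F None.
Proof.
rewrite (bigID (fun i : option 'I_n => i != None))/= addrC [X in X + _](_ : _ = F None); last first.
  by rewrite (eq_bigl (pred1 None)) ?big_pred1_eq// => i; rewrite negbK.
rewrite addrC; congr (_ + _).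
rewrite (reindex_omap Some id) => [|[i|]//]/=.
by apply: eq_bigl => i; rewrite eqxx.
Qed.

Lemma divergenceE phi p : C1 phi ->
  divergence phi p = \sum_i del i (fun q => comp i (phi q)) p.
Proof.
move=> cphi; rewrite big_option /divergence /del; congr (_ + _); last first.
  exact: (esym (derive_lin_comp _ _ (@continuous_comp_coord None) cphi)).
apply: eq_bigr => i _.
exact: (esym (derive_lin_comp _ _ (@continuous_comp_coord (Some i)) cphi)).
Qed.

Lemma enormE p : enorm p = Num.sqrt (\sum_i comp i p ^+ 2).
Proof.
rewrite big_option /enorm /enorm_rV sqr_sqrtr//.
by apply: sumr_ge0 => i _; exact: sqr_ge0.
Qed.

Lemma enorm_le1 p : (enorm p <= 1) = (\sum_i comp i p ^+ 2 <= 1).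
Proof.
by rewrite enormE -[X in _ <= X]sqrtr1 ler_sqrt ?ler01.
Qed.

(** The competitors of [tot_var], by components. Some compact set stands for the closed support, so
    that sums and products of fields do not require supports to be computed. *)
Definition testf (U : set V) (f : option 'I_n -> V -> R) :=
  [/\ forall i, C1 (f i), forall p, \sum_i f i p ^+ 2 <= 1 &
   exists K, [/\ compact K, K `<=` U & forall p, ~ K p -> forall i, f i p = 0]].

Definition dive (f : option 'I_n -> V -> R) p : R := \sum_i del i (f i) p.

Lemma closed_Rn1_compact (K : set V) : compact K -> closed K.
Proof. by apply: compact_closed; exact: norm_hausdorff. Qed.

Lemma testf_C1c U f : testf U f -> C1c U (mkf f) /\ forall p, enorm (mkf f p) <= 1.
Proof.
move=> [cf nf [K [cK KU K0]]]; split; last first.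
  by move=> p; rewrite enorm_le1; under eq_bigr do rewrite comp_mkf.
have sK : closure [set p | mkf f p != 0] `<=` K.
  have /closure_id KE := closed_Rn1_compact cK.
  rewrite [X in _ `<=` X]KE.
  apply: closure_subset => p /=; apply: contraNP => Kp.
  apply/eqP; congr pair; last exact: K0.
  by apply/rowP => j; rewrite !mxE K0.
have [c1 c2] := C1_mkf cf.
split => //; last exact: (subset_trans sK).
by apply: subclosed_compact sK => //; exact: closed_closure.
Qed.

Lemma C1c_testf U phi : C1c U phi -> (forall p, enorm (phi p) <= 1) ->
  testf U (fun i p => comp i (phi p)) /\ forall p, divergence phi p = dive (fun i p => comp i (phi p)) p.
Proof.
move=> [c1 c2 c3 c4] n1; have cphi : C1 phi by split.
split; last by move=> p; exact: divergenceE.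
split.
- by move=> i; apply: (@C1_lin_comp _ _ _ _ phi (comp i)) => //; exact: continuous_comp_coord.
- by move=> p; rewrite -enorm_le1.
- exists (closure [set p | phi p != 0]); split => // p np i.
  have -> : phi p = 0; last by rewrite linear0.
  apply: contra_notP np => /eqP np; exact: subset_closure.
Qed.

Lemma dive_mkf f p : (forall i, C1 (f i)) -> divergence (mkf f) p = dive f p.
Proof.
move=> cf; rewrite divergenceE; last exact: C1_mkf.
by apply: eq_bigr => i _; congr del; apply/funext => q; rewrite comp_mkf.
Qed.

End fields.

(** * Integrals of test fields and the perimeter *)

Section cauchy_schwarz.
Variables (R : realType) (I : finType).
Implicit Types a b : I -> R.

Lemma cauchy_schwarz a b :
  (\sum_i a i * b i) ^+ 2 <= (\sum_i a i ^+ 2) * (\sum_i b i ^+ 2).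
Proof.
set A := \sum_i a i ^+ 2; set B := \sum_i b i ^+ 2; set C := \sum_i a i * b i.
have B0 : 0 <= B by apply: sumr_ge0 => i _; exact: sqr_ge0.
have H t : 0 <= A - 2 * t * C + t ^+ 2 * B.
  rewrite (_ : _ + _ = \sum_i (a i - t * b i) ^+ 2); first by apply: sumr_ge0 => i _; exact: sqr_ge0.
  rewrite /A /B /C !mulr_sumr -sumrB -big_split/=; apply: eq_bigr => i _; ring.
have [B_eq0|Bn0] := eqVneq B 0.
  have : C = 0.
    rewrite /C big1// => i _.
    have : b i ^+ 2 = 0.
      apply/eqP; rewrite eq_le sqr_ge0 andbT -B_eq0 /B (bigD1 i)//= lerDl.
      by apply: sumr_ge0 => j _; exact: sqr_ge0.
    by move/eqP; rewrite sqrf_eq0 => /eqP ->; rewrite mulr0.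
  by move=> ->; rewrite B_eq0 mulr0 expr0n.
have Bp : 0 < B by rewrite lt_neqAle eq_sym Bn0.
have := H (C / B).
have -> : A - 2 * (C / B) * C + (C / B) ^+ 2 * B = (A * B - C ^+ 2) / B by field.
by rewrite pmulr_lge0 ?invr_gt0// subr_ge0.
Qed.

Lemma cauchy_schwarz_le1 a b c : 0 <= c -> \sum_i a i ^+ 2 <= c ^+ 2 -> \sum_i b i ^+ 2 <= 1 ->
  `|\sum_i a i * b i| <= c.
Proof.
move=> c0 ac b1.
rewrite -(ler_pXn2r (_ : 0 < 2)%N) ?nnegrE// real_normK ?num_real//.
apply: le_trans (cauchy_schwarz a b) _; rewrite -[leRHS]mulr1; apply: ler_pM => //.
- by apply: sumr_ge0 => i _; exact: sqr_ge0.
- by apply: sumr_ge0 => i _; exact: sqr_ge0.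
Qed.

Lemma sqsum_convex a b (t : R) : 0 <= t <= 1 -> \sum_i a i ^+ 2 <= 1 -> \sum_i b i ^+ 2 <= 1 ->
  \sum_i (t * a i + (1 - t) * b i) ^+ 2 <= 1.
Proof.
move=> /andP[t0 t1] a1 b1.
apply: (@le_trans _ _ (\sum_i (t * a i ^+ 2 + (1 - t) * b i ^+ 2))).
  apply: ler_sum => i _; rewrite -subr_ge0.
  have -> : t * a i ^+ 2 + (1 - t) * b i ^+ 2 - (t * a i + (1 - t) * b i) ^+ 2 =
    t * (1 - t) * (a i - b i) ^+ 2 by ring.
  by rewrite mulr_ge0 ?sqr_ge0// mulr_ge0// subr_ge0.
rewrite big_split/= -!mulr_sumr.
have : t * (\sum_i a i ^+ 2) <= t by rewrite ler_piMr.
have : (1 - t) * (\sum_i b i ^+ 2) <= 1 - t by rewrite ler_piMr// subr_ge0.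
lra.
Qed.

End cauchy_schwarz.

Section integrals.
Variables (R : realType) (n : nat).
Local Notation V := (Rn1 R n).
Local Notation mR := (measurableTypeR R).
Local Notation vol := (vol R n).
Implicit Types (p v : V) (E : set V) (g : V -> R) (f : option 'I_n -> V -> R).

Definition cc g := continuous g /\ exists K : set V, compact K /\ forall p, ~ K p -> g p = 0.

Lemma compact_vcube (K : set V) : compact K -> exists k, K `<=` @vcube R n k.
Proof.
move=> cK.
have [M [_ MK]] := compact_bounded cK.
exists (Num.trunc (M + 1)).+1 => -[x t] Kp.
have pM : `|(x, t)| <= M + 1 by apply: (MK (M + 1)) => //; rewrite ltrDl.
have MT : M + 1 < (Num.trunc (M + 1)).+1%:R by exact: truncnS_gt.
have [xM tM] : `|x| <= M + 1 /\ `|t : R| <= M + 1.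
  have : Num.max `|x| `|t : R| <= M + 1 := pM.
  by rewrite ge_max => /andP.
split => /= [i|]; rewrite /= in_itv/= -ltr_norml; apply: le_lt_trans MT => //.
apply: le_trans xM.
rewrite [leRHS]/Num.norm /= mx_normrE; by apply/bigmax_geP; right => /=; exists (ord0, i).
Qed.

Lemma cc_bounded g : cc g -> exists2 M, 0 <= M & forall p, `|g p| <= M.
Proof.
move=> [cg [K [cK K0]]].
have [M [_ HM]] : bounded_set (g @` K).
  by apply: compact_bounded; apply: continuous_compact => //; exact: continuous_subspaceT.
exists (Num.max M 0 + 1); first by rewrite addr_ge0// le_max lexx orbT.
move=> p; have [Kp|Kp] := pselect (K p); last first.
  by rewrite K0// normr0 addr_ge0// le_max lexx orbT.
apply: (HM (Num.max M 0 + 1)); last by exists p.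
by rewrite (@le_lt_trans _ _ (Num.max M 0))// ?le_max ?lexx// ltrDl.
Qed.

Lemma cc_measurable g : cc g -> measurable_fun setT g.
Proof. by move=> [cg _]; exact: continuous_measurable_Rn1. Qed.

Lemma vcube_integrable_cst k (M : R) : vol.-integrable setT (EFin \o (fun p => M * \1_(@vcube R n k) p)).
Proof.
have mQ := @measurable_vcube R n k.
have -> : EFin \o (fun p => M * \1_(@vcube R n k) p) = (fun p => M%:E * (EFin \o \1_(@vcube R n k)) p)%E.
  by apply/funext => p /=; rewrite EFinM.
apply: integrableZl => //.
apply/integrableP; split; first exact/measurable_EFinP.
under eq_integral do rewrite /= ger0_norm//.
by rewrite integral_indic// setIT vol_vcube.
Qed.

Lemma cc_dominated g : cc g -> exists k M, 0 <= M /\ forall p, `|g p| <= M * \1_(@vcube R n k) p.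
Proof.
move=> cg; have [M M0 HM] := cc_bounded cg.
case: (cg) => _ [K [cK K0]]; have [k Kk] := compact_vcube cK.
exists k, M; split => // p; rewrite indicE.
have [pk|pk] := boolP (p \in @vcube R n k); first by rewrite mulr1.
rewrite mulr0 K0 ?normr0// => Kp; move: pk; rewrite notin_setE; apply; exact: Kk.
Qed.

Lemma cc_integrable E g : measurable E -> cc g -> vol.-integrable E (EFin \o g).
Proof.
move=> mE cg; apply: (@integrableS _ _ _ _ setT) => //.
have [k [M [M0 HM]]] := cc_dominated cg.
apply: le_integrable (vcube_integrable_cst k M) => //.
  by apply/measurable_EFinP; exact: cc_measurable.
by move=> p _ /=; rewrite lee_fin (le_trans (HM p))// ler_norm.
Qed.

Definition Int E g : R := \int[vol]_(p in E) g p.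

Lemma ccM (h : V -> R) g : continuous h -> cc g -> cc (fun p => h p * g p).
Proof.
move=> ch [cg [K [cK K0]]]; split; first by move=> p; apply: cvgM; [exact: ch|exact: cg].
by exists K; split => // p Kp; rewrite K0 ?mulr0.
Qed.

Lemma ccD g h : cc g -> cc h -> cc (fun p => g p + h p).
Proof.
move=> [cg [K [cK K0]]] [ch [L [cL L0]]]; split.
  by move=> p; apply: cvgD; [exact: cg|exact: ch].
exists (K `|` L); split; first exact: compactU.
by move=> p /not_orP[Kp Lp]; rewrite K0// L0// addr0.
Qed.

Lemma cc0 : cc (fun=> 0).
Proof. by split; [move=> p; exact: cvg_cst|exists set0; split => //; exact: compact0]. Qed.

Lemma cc_sum (I : Type) (r : seq I) (P : pred I) (F : I -> V -> R) :
  (forall i, cc (F i)) -> cc (fun p => \sum_(i <- r | P i) F i p).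
Proof.
move=> cF; elim: r => [|a r IH].
  by rewrite (_ : (fun p => _) = (fun=> 0)); [exact: cc0|apply/funext => p; rewrite big_nil].
have [Pa|Pa] := boolP (P a); last first.
  rewrite (_ : (fun p => _) = (fun p => \sum_(i <- r | P i) F i p))//.
  by apply/funext => p; rewrite big_cons (negbTE Pa).
rewrite (_ : (fun p => _) = (fun p => F a p + \sum_(i <- r | P i) F i p)).
  exact: ccD.
by apply/funext => p; rewrite big_cons Pa.
Qed.

Lemma ccZ (c : R) g : cc g -> cc (fun p => c * g p).
Proof. by apply: ccM => p; exact: cvg_cst. Qed.

Lemma ccN g : cc g -> cc (fun p => - g p).
Proof. by move=> /(ccZ (-1)); under eq_fun do rewrite mulN1r. Qed.

Lemma ccB g h : cc g -> cc h -> cc (fun p => g p - h p).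
Proof. by move=> cg ch; apply: ccD => //; exact: ccN. Qed.

Lemma cc_abs g : cc g -> cc (fun p => `|g p|).
Proof.
move=> [cg [K [cK K0]]]; split.
  by move=> p; apply: (@continuous_comp _ _ _ g (@Num.norm R R)); [exact: cg|exact: norm_continuous].
by exists K; split => // p Kp; rewrite K0// normr0.
Qed.

Lemma del_outside (K : set V) (h : V -> R) i p : compact K -> (forall p, ~ K p -> h p = 0) ->
  ~ K p -> del i h p = 0.
Proof.
move=> cK K0 Kp; rewrite /del.
have -> : 'D_(dirv R i) h p = 'D_(dirv R i) (cst 0) p.
  have [->|v0] := eqVneq (dirv R i) 0; first by rewrite !derive0.
  apply: near_eq_derive => //.
  have oK : open (~` K) by by apply: closed_openC; exact: closed_Rn1_compact.
  near=> q; apply: K0; near: q; exact: open_nbhs_nbhs.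
by rewrite derive_cst.
Unshelve. all: by end_near. Qed.

Lemma cc_del (h : V -> R) i : C1 h -> (exists K : set V, compact K /\ forall p, ~ K p -> h p = 0) ->
  cc (del i h).
Proof.
move=> ch [K [cK K0]]; split; first exact: ch.2.
by exists K; split => // p; exact: del_outside.
Qed.

Lemma cc_dive U f : testf U f -> cc (dive f).
Proof.
move=> [cf _ [K [cK _ K0]]]; apply: cc_sum => i; apply: cc_del => //.
by exists K; split => // p Kp; exact: K0.
Qed.

Lemma IntD E g h : measurable E -> cc g -> cc h -> Int E (fun p => g p + h p) = Int E g + Int E h.
Proof. by move=> mE cg ch; rewrite /Int RintegralD//; exact: cc_integrable. Qed.

Lemma IntB E g h : measurable E -> cc g -> cc h -> Int E (fun p => g p - h p) = Int E g - Int E h.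
Proof. by move=> mE cg ch; rewrite /Int RintegralB//; exact: cc_integrable. Qed.

Lemma IntZ E c g : measurable E -> cc g -> Int E (fun p => c * g p) = c * Int E g.
Proof. by move=> mE cg; rewrite /Int RintegralZl//; exact: cc_integrable. Qed.

Lemma IntN E g : measurable E -> cc g -> Int E (fun p => - g p) = - Int E g.
Proof.
by move=> mE cg; rewrite -mulN1r -IntZ//; congr Int; apply/funext => p; rewrite mulN1r.
Qed.

Lemma Int_sum E (I : Type) (r : seq I) (F : I -> V -> R) : measurable E ->
  (forall i, cc (F i)) -> Int E (fun p => \sum_(i <- r) F i p) = \sum_(i <- r) Int E (F i).
Proof.
move=> mE cF; elim: r => [|a r IH].
  rewrite big_nil (_ : (fun p => _) = cst 0); first by rewrite /Int Rintegral_cst// mul0r.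
  by apply/funext => p; rewrite big_nil.
rewrite big_cons -IH -IntD//; last exact: cc_sum.
by congr Int; apply/funext => p; rewrite big_cons.
Qed.

Lemma le_Int E g h : measurable E -> cc g -> cc h -> (forall p, E p -> g p <= h p) ->
  Int E g <= Int E h.
Proof. by move=> mE cg ch gh; apply: le_Rintegral => //; exact: cc_integrable. Qed.

Lemma Int_setU E F g : measurable E -> measurable F -> E `&` F = set0 -> cc g ->
  Int (E `|` F) g = Int E g + Int F g.
Proof.
move=> mE mF EF cg; apply: Rintegral_setU => //; last by rewrite disj_set2E EF.
by apply: cc_integrable => //; exact: measurableU.
Qed.

Lemma Int_norm E g : measurable E -> cc g -> `|Int E g| <= Int E (fun p => `|g p|).
Proof. by move=> mE cg; apply: le_normr_Rintegral => //; exact: cc_integrable. Qed.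

Lemma Int_bound E g M : measurable E -> cc g -> (vol E < +oo)%E ->
  (forall p, E p -> `|g p| <= M) -> `|Int E g| <= M * fine (vol E).
Proof.
move=> mE cg Eoo gM; apply: le_trans (Int_norm mE cg) _.
rewrite -(Rintegral_cst vol mE); apply: le_Rintegral => //.
  by apply: cc_integrable => //; exact: cc_abs.
apply/integrableP; split; first exact: measurable_cst.
rewrite integral_cst//.
case: (eqVneq (vol E) 0%E) => [->|E0]; first by rewrite mule0.
by rewrite lte_mul_pinfty// ge0_fin_numE//.
Qed.

Lemma Int_null E g : measurable E -> cc g -> vol E = 0%E -> Int E g = 0.
Proof.
move=> mE cg E0; apply/eqP; rewrite -normr_le0.
have [M M0 HM] := cc_bounded cg.
by have := @Int_bound E g M mE cg; rewrite E0 mulr0; apply.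
Qed.

Lemma Int_indic E D g : measurable D -> Int (D `&` E) g = Int D (fun p => \1_E p * g p).
Proof.
move=> mD; rewrite /Int Rintegral_mkcondr; apply: eq_Rintegral => p _.
by rewrite patchE indicE; case: ifPn => _; rewrite ?mul1r ?mul0r.
Qed.

Lemma Int_cvg E (g_ : nat -> V -> R) g (h : V -> R) : measurable E -> (forall k, cc (g_ k)) -> measurable_fun setT g -> cc h ->
  (forall k p, E p -> `|g_ k p| <= `|h p|) -> (forall p, E p -> g_ ^~ p @ \oo --> g p) ->
  (fun k => Int E (g_ k)) @ \oo --> Int E g.
Proof.
move=> mE cg mg ch gh gg.
have ih : vol.-integrable E (fun p => `|h p|%:E).
  by apply: (@cc_integrable E (fun p => `|h p|)) => //; exact: cc_abs.
have [] := @dominated_convergence _ _ _ vol E mE (fun k p => (g_ k p)%:E) (EFin \o g)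
  (fun p => `|h p|%:E).
- move=> k; apply: measurable_funTS; apply/measurable_EFinP; exact: cc_measurable.
- by apply: measurable_funTS; apply/measurable_EFinP.
- apply: aeW => p Ep; apply: cvg_EFin; [by near=> k|exact: gg].
- exact: ih.
- by apply: aeW => p k Ep; rewrite /= lee_fin; exact: gh.
move=> i1 _ i3.
apply: fine_cvg; rewrite fineK; first exact: i3.
exact: integrable_fin_num.
Unshelve. all: by end_near. Qed.

End integrals.

Lemma le_limD (R : realType) (u v : nat -> R) (a b c : R) :
  u @ \oo --> a -> v @ \oo --> b -> (forall k, u k + v k <= c) -> a + b <= c.
Proof.
move=> ua vb uv; have w : (fun k => u k + v k) @ \oo --> a + b by exact: cvgD.
rewrite -(cvg_lim (@Rhausdorff R) w); apply: limr_le; last by near=> k.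
by apply/cvg_ex; eexists; exact: w.
Unshelve. all: by end_near. Qed.

Lemma norm_shift (R : realType) (a c d P : R) : `|c| <= d -> a + c <= P -> a <= P + d.
Proof. by rewrite ler_norml => /andP[? ?]; lra. Qed.

(** * The perimeter by duality, and its change under a cut *)

Section perimeter.
Variables (R : realType) (n : nat).
Local Notation V := (Rn1 R n).
Local Notation mR := (measurableTypeR R).
Local Notation vol := (vol R n).
Local Notation Om := (@Omega R n).
Implicit Types (p v : V) (E A : set V) (g : V -> R) (f : option 'I_n -> V -> R).

Lemma open_Omega : open Om.
Proof.
rewrite (_ : Om = (fun p : V => p.2 : R) @^-1` [set t : R | 0 < t])//.
by apply: open_comp => //= p _; exact: continuous_snd1.
Qed.

Lemma measurable_Omega : measurable Om.
Proof. by apply: open_measurable_Rn1; exact: open_Omega. Qed.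

Lemma cc_div phi : C1c Om phi -> cc (divergence phi).
Proof.
move=> [c1 c2 c3 c4].
have cphi : C1 phi by split.
rewrite (_ : divergence phi = dive (fun i p => comp i (phi p))); last first.
  by apply/funext => p; exact: divergenceE.
apply: cc_sum => i; apply: cc_del.
  by apply: (@C1_lin_comp _ _ _ _ phi (comp i)) => //; exact: continuous_comp_coord.
exists (closure [set p | phi p != 0]); split => // p np.
have -> : phi p = 0; last by rewrite linear0.
apply: contra_notP np => /eqP np; exact: subset_closure.
Qed.

Lemma integral_Omega_indic E g : measurable E -> E `<=` Om -> cc g ->
  (\int[vol]_(p in Om) (\1_E p * g p)%:E = (Int E g)%:E)%E.
Proof.
move=> mE EO cg; rewrite -(setIidr EO) /Int /Rintegral fineK; last first.
  apply: integrable_fin_num; last exact: (cc_integrable (measurableI _ _ measurable_Omega mE) cg).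
  exact: measurableI measurable_Omega mE.
rewrite [RHS]integral_mkcondr; apply: eq_integral => p _.
rewrite patchE indicE; case: (boolP (p \in E)) => pE.
  by rewrite in_setI pE mem_set ?mul1r//; apply: EO; rewrite inE in pE.
by rewrite in_setI (negbTE pE) andbF mul0r.
Qed.

Lemma perimeter_ub E (c : R) : measurable E -> E `<=` Om ->
  (forall f, testf Om f -> Int E (dive f) <= c) -> (perimeter E Om <= c%:E)%E.
Proof.
move=> mE EO Hc; apply: ge_ereal_sup => _ [phi [cphi nphi] <-].
rewrite (integral_Omega_indic mE EO (cc_div cphi)).
have [tf dE] := C1c_testf cphi nphi.
by rewrite (_ : divergence phi = dive (fun i p => comp i (phi p)))?lee_fin; [exact: Hc|apply/funext].
Qed.

Lemma perimeter_lb E f : measurable E -> E `<=` Om -> testf Om f ->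
  ((Int E (dive f))%:E <= perimeter E Om)%E.
Proof.
move=> mE EO tf; have [cm nm] := testf_C1c tf.
apply: ereal_sup_ubound; exists (mkf f) => //.
rewrite (integral_Omega_indic mE EO (cc_div cm)); congr ((Int E _)%:E).
by apply/funext => p; rewrite dive_mkf//; case: tf.
Qed.

Definition Per E : R := fine (perimeter E Om).

Lemma testf0 (U : set V) : testf U (fun=> fun=> 0).
Proof.
split=> [i|p|]; first exact: C1_cst.
  by rewrite big1 ?ler01// => i _; rewrite expr0n.
by exists set0; split => //; exact: compact0.
Qed.

Lemma dive0 : dive (fun (_ : option 'I_n) (_ : V) => 0) = (fun=> 0) :> (V -> R).
Proof. by apply/funext => p; rewrite /dive big1// => i _; rewrite /del derive_cst. Qed.

Lemma Int0 E : measurable E -> Int E (fun=> 0) = 0.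
Proof. by move=> mE; rewrite /Int Rintegral_cst// mul0r. Qed.

Lemma perimeter_ge0 E : measurable E -> E `<=` Om -> (0 <= perimeter E Om)%E.
Proof.
by move=> mE EO; have := perimeter_lb mE EO (testf0 Om); rewrite dive0 Int0.
Qed.

Lemma BVset_vol E : BVset E -> (vol E < +oo)%E.
Proof.
move=> [mE EO [/integrableP[_ +] _]].
under eq_integral do rewrite /= ger0_norm//.
rewrite integral_indic//; last exact: measurable_Omega.
by rewrite setIidl.
Qed.

Lemma BVset_measurable E : BVset E -> measurable E. Proof. by case. Qed.

Lemma BVset_sub E : BVset E -> E `<=` Om. Proof. by case. Qed.

Lemma BVset_per E : BVset E -> perimeter E Om = (Per E)%:E.
Proof.
move=> [mE EO [_ Poo]]; rewrite /Per fineK// ge0_fin_numE//.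
exact: perimeter_ge0.
Qed.

Lemma Per_ge0 E : 0 <= Per E.
Proof.
have [cm nm] := testf_C1c (testf0 Om).
apply: fine_ge0; apply: ereal_sup_ubound; exists (mkf (fun=> fun=> 0)); first by split.
apply: integral0_eq => p _; rewrite dive_mkf ?dive0 ?mulr0// => i.
exact: C1_cst.
Qed.

Lemma Per_lb E f : BVset E -> testf Om f -> Int E (dive f) <= Per E.
Proof.
move=> bE tf; rewrite -lee_fin -BVset_per//; apply: perimeter_lb => //.
  exact: BVset_measurable.
exact: BVset_sub.
Qed.

Lemma BVset_intro E (c : R) : measurable E -> E `<=` Om -> (vol E < +oo)%E ->
  (forall f, testf Om f -> Int E (dive f) <= c) -> BVset E /\ Per E <= c.
Proof.
move=> mE EO Eoo Hc; have Pc := perimeter_ub mE EO Hc.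
have bE : BVset E.
  split => //; split; last exact: le_lt_trans Pc (ltry _).
  apply/integrableP; split.
    by apply/measurable_EFinP; exact: measurable_indic.
  under eq_integral do rewrite /= ger0_norm//.
  by rewrite integral_indic//; [rewrite setIidl|exact: measurable_Omega].
by split => //; rewrite -lee_fin -BVset_per.
Qed.

Lemma Per_approx E (e : R) : BVset E -> 0 < e -> exists2 f, testf Om f & Per E - e < Int E (dive f).
Proof.
move=> bE e0; apply: contrapT => /forall2NP H.
have [] := @BVset_intro E (Per E - e).
- exact: BVset_measurable.
- exact: BVset_sub.
- exact: BVset_vol.
- by move=> f tf; have [|/negP] := H f; [|rewrite -leNgt].
- by move=> _; rewrite lerBrDr gerDl leNgt e0.
Qed.

(** The unit ball is convex, so two fields glued by a cut-off are again an admissible field: one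
    test of E then serves for two pieces of E. *)
Lemma testf_convex (U : set V) (h : V -> R) f1 f2 : C1 h -> (forall p, 0 <= h p <= 1) ->
  testf U f1 -> testf U f2 ->
  testf U (fun i p => h p * f1 i p + (1 - h p) * f2 i p).
Proof.
move=> ch h01 [c1 n1 [K1 [cK1 K1U K10]]] [c2 n2 [K2 [cK2 K2U K20]]].
have c1h : C1 (fun p => 1 - h p) by apply: C1B; [exact: C1_cst|exact: ch].
split.
- move=> i; apply: C1D; apply: C1M; [exact: ch|exact: c1|exact: c1h|exact: c2].
- by move=> p; apply: sqsum_convex.
- exists (K1 `|` K2); split; [exact: compactU|by move=> p [/K1U|/K2U]|].
  by move=> p /not_orP[p1 p2] i; rewrite K10// K20// !mulr0 addr0.
Qed.

Lemma dive_convex (h : V -> R) f1 f2 p : C1 h -> (forall i, C1 (f1 i)) -> (forall i, C1 (f2 i)) ->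
  dive (fun i p => h p * f1 i p + (1 - h p) * f2 i p) p =
  h p * dive f1 p + (1 - h p) * dive f2 p + \sum_i del i h p * (f1 i p - f2 i p).
Proof.
move=> ch c1 c2; rewrite /dive !mulr_sumr -!big_split/=; apply: eq_bigr => i _.
have c1h : C1 (fun p => 1 - h p) by apply: C1B; [exact: C1_cst|exact: ch].
rewrite /del (deriveD' _ _ (C1M ch (c1 i)) (C1M c1h (c2 i))).
rewrite (deriveM' _ _ ch (c1 i)) (deriveM' _ _ c1h (c2 i)) (deriveB' _ _ (C1_cst _ _) ch).
rewrite derive_cst; ring.
Qed.

Lemma Int_subset_bound E S g (M : R) : measurable E -> measurable S -> cc g ->
  (vol E < +oo)%E -> (forall p, E p -> `|g p| <= M * \1_S p) -> `|Int E g| <= M * fine (vol (E `&` S)).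
Proof.
move=> mE mS cg Eoo gM.
have -> : Int E g = Int (E `&` S) g.
  rewrite Int_indic//; apply: eq_Rintegral => p; rewrite inE => Ep.
  rewrite indicE; case: (boolP (p \in S)) => pS; first by rewrite mul1r.
  by rewrite mul0r; apply/eqP; rewrite -normr_le0; have := gM p Ep; rewrite indicE (negbTE pS) mulr0.
apply: Int_bound => //; first exact: measurableI.
  by apply: le_lt_trans Eoo; apply: le_measure; rewrite ?inE//; exact: measurableI.
by move=> p [Ep Sp]; have := gM p Ep; rewrite indicE mem_set// mulr1.
Qed.

Lemma Int_weight_cvg E A (eta : nat -> V -> R) g : measurable E -> measurable A -> cc g ->
  (forall k, C1 (eta k)) -> (forall k p, 0 <= eta k p <= 1) ->
  (forall p, E p -> eta ^~ p @ \oo --> (\1_A p : R)) ->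
  (fun k => Int E (fun p => eta k p * g p)) @ \oo --> Int (E `&` A) g.
Proof.
move=> mE mA cg ce e01 eA; rewrite Int_indic//; apply: (@Int_cvg _ _ _ _ _ g) => //.
- by move=> k; apply: ccM => //; exact: (C1_continuous (ce k)).
- apply: measurable_funM; first exact: measurable_indic.
  exact: cc_measurable.
- move=> k p _; rewrite normrM ler_piMl//.
  by have /andP[? ?] := e01 k p; rewrite ger0_norm.
- by move=> p Ep; apply: cvgM; [exact: eA|exact: cvg_cst].
Qed.

(** E is tested with [f1] and [f2] glued by [eta k]. In the limit each field sees its own piece of
    E; the gluing leaves the term grad eta . (f1 - f2), at most 2 |grad eta|, hence at most 2 b on S
    and zero elsewhere. *)
Lemma cut_test E A (eta : nat -> V -> R) (b : nat -> R) (S : nat -> set V) (c : R) f1 f2 :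
  BVset E -> measurable A ->
  (forall k, C1 (eta k)) -> (forall k p, 0 <= eta k p <= 1) ->
  (forall p, E p -> eta ^~ p @ \oo --> (\1_A p : R)) ->
  (forall k, measurable (S k)) -> (forall k, 0 <= b k) ->
  (forall k p, E p -> \sum_i del i (eta k) p ^+ 2 <= (b k * \1_(S k) p) ^+ 2) ->
  (forall k, b k * fine (vol (E `&` S k)) <= c) ->
  testf Om f1 -> testf Om f2 ->
  Int (E `&` A) (dive f1) + Int (E `\` A) (dive f2) <= Per E + 2 * c.
Proof.
move=> bE mA ce e01 eA mS b0 eS bc t1 t2.
have mE := BVset_measurable bE.
have mA' : measurable (~` A) by exact: measurableC.
have cd1 := cc_dive t1; have cd2 := cc_dive t2.
have c1e k : C1 (fun p => 1 - eta k p) by apply: C1B; [exact: C1_cst|exact: ce].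
have w1 := Int_weight_cvg mE mA cd1 ce e01 eA.
have w2 : (fun k => Int E (fun p => (1 - eta k p) * dive f2 p)) @ \oo --> Int (E `\` A) (dive f2).
  apply: (Int_weight_cvg mE mA' cd2 c1e).
  - by move=> k p; have := e01 k p; rewrite subr_ge0 gerBl andbC.
  - move=> p Ep; rewrite (_ : \1_(~` A) p = 1 - \1_A p); last first.
      by rewrite !indicE in_setC; case: (p \in A); rewrite ?subrr ?subr0.
    apply: cvgB; [exact: cvg_cst|exact: eA].
apply: (le_limD w1 w2) => k.
have := Per_lb bE (testf_convex (ce k) (e01 k) t1 t2).
have -> : dive (fun i p => eta k p * f1 i p + (1 - eta k p) * f2 i p) = (fun p =>
    eta k p * dive f1 p + (1 - eta k p) * dive f2 p + \sum_i del i (eta k) p * (f1 i p - f2 i p)).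
  by apply/funext => p; apply: dive_convex => //; [case: t1|case: t2].
have ca : cc (fun p => eta k p * dive f1 p) by apply: ccM => //; exact: (C1_continuous (ce k)).
have cb : cc (fun p => (1 - eta k p) * dive f2 p) by apply: ccM => //; exact: (C1_continuous (c1e k)).
have cr : cc (fun p => \sum_i del i (eta k) p * (f1 i p - f2 i p)).
  apply: cc_sum => i; apply: ccM; first exact: (ce k).2.
  case: t1 => c1 _ [K1 [? _ K10]]; case: t2 => c2 _ [K2 [? _ K20]].
  apply: ccB; split; [exact: (C1_continuous (c1 i))|by exists K1; split => // p Kp; exact: K10|
    exact: (C1_continuous (c2 i))|by exists K2; split => // p Kp; exact: K20].
rewrite IntD//; last exact: ccD.
rewrite IntD//.
suff : `|Int E (fun p => \sum_i del i (eta k) p * (f1 i p - f2 i p))| <= 2 * c.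
  exact: norm_shift.
apply: (@le_trans _ _ (2 * b k * fine (vol (E `&` S k)))); last first.
  by rewrite -mulrA ler_wpM2l.
apply: Int_subset_bound => //; first exact: BVset_vol.
move=> p Ep; rewrite -mulrA mulr2n mulrDl mul1r.
under eq_bigr do rewrite mulrBr.
have bS0 : 0 <= b k * \1_(S k) p by rewrite mulr_ge0.
rewrite sumrB (le_trans (ler_normB _ _))// lerD//; apply: cauchy_schwarz_le1 => //.
- exact: eS.
- by case: t1.
- exact: eS.
- by case: t2.
Qed.

(** The two fields of [cut_test] are independent, so the suprema over them may be taken separately.
    This is the additivity of perimeter up to twice the area of the cut, the area being replaced by
    [c]. *)
Lemma cut_BV E A (eta : nat -> V -> R) (b : nat -> R) (S : nat -> set V) (c : R) :
  BVset E -> measurable A ->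
  (forall k, C1 (eta k)) -> (forall k p, 0 <= eta k p <= 1) ->
  (forall p, E p -> eta ^~ p @ \oo --> (\1_A p : R)) ->
  (forall k, measurable (S k)) -> (forall k, 0 <= b k) ->
  (forall k p, E p -> \sum_i del i (eta k) p ^+ 2 <= (b k * \1_(S k) p) ^+ 2) ->
  (forall k, b k * fine (vol (E `&` S k)) <= c) ->
  [/\ BVset (E `&` A), BVset (E `\` A) & Per (E `&` A) + Per (E `\` A) <= Per E + 2 * c].
Proof.
move=> bE mA ce e01 eA mS b0 eS bc.
have mE := BVset_measurable bE.
have H f1 f2 := @cut_test E A eta b S c f1 f2 bE mA ce e01 eA mS b0 eS bc.
have fin B : measurable B -> B `<=` E -> (vol B < +oo)%E.
  by move=> mB BE; apply: le_lt_trans (BVset_vol bE); apply: le_measure; rewrite ?inE.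
have mI : measurable (E `&` A) by exact: measurableI.
have mD : measurable (E `\` A) by exact: measurableD.
have [b1 _] : BVset (E `&` A) /\ Per (E `&` A) <= Per E + 2 * c.
  apply: BVset_intro => //; first by move=> p [/(BVset_sub bE)].
    by apply: fin => // p [].
  by move=> f tf; have := H f _ tf (testf0 _); rewrite dive0 Int0// addr0.
have [b2 _] : BVset (E `\` A) /\ Per (E `\` A) <= Per E + 2 * c.
  apply: BVset_intro => //; first by move=> p [/(BVset_sub bE)].
    by apply: fin => // p [].
  by move=> f tf; have := H _ f (testf0 _) tf; rewrite dive0 Int0// add0r.
split => //; apply/ler_addgt0Pr => e e0.
have e20 : 0 < e / 2 by rewrite divr_gt0.
have [f1 t1 h1] := Per_approx b1 e20; have [f2 t2 h2] := Per_approx b2 e20.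
move: (H f1 f2 t1 t2) h1 h2.
move: (Per _) (Per _) (Per _) (Int _ _) (Int _ _) => x1 x2 x3 x4 x5; clear; lra.
Qed.

(** The L^1 distance of the indicators, see [L1_symd]. *)
Definition symd E F : R := fine (vol (E `\` F)) + fine (vol (F `\` E)).

Lemma Int_symd E F g (M : R) : measurable E -> measurable F -> (vol E < +oo)%E -> (vol F < +oo)%E ->
  cc g -> (forall p, `|g p| <= M) -> `|Int E g - Int F g| <= M * symd E F.
Proof.
move=> mE mF Eoo Foo cg gM.
have mEF := measurableD mE mF; have mFE := measurableD mF mE.
have mI := measurableI _ _ mE mF.
have dis A B : (A `&` B) `&` (A `\` B) = set0.
  by rewrite -subset0 => p [[_ ?] [_ ?]].
have iE : Int E g = Int (E `&` F) g + Int (E `\` F) g.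
  by rewrite -Int_setU// setUIDK.
have iF : Int F g = Int (E `&` F) g + Int (F `\` E) g.
  by rewrite setIC -Int_setU ?setUIDK//; exact: measurableI.
rewrite iE iF opprD addrACA subrr add0r /symd mulrDr (le_trans (ler_normB _ _))// lerD//.
  apply: (Int_bound mEF cg) => [|p _]; last exact: gM.
  by apply: le_lt_trans Eoo; apply: le_measure; rewrite ?inE// => p [].
apply: (Int_bound mFE cg) => [|p _]; last exact: gM.
by apply: le_lt_trans Foo; apply: le_measure; rewrite ?inE// => p [].
Qed.

Lemma symd_ge0 E F : 0 <= symd E F. Proof. by rewrite addr_ge0. Qed.

Lemma Int_symd_cvg (F : nat -> set V) E g : (forall k, measurable (F k)) -> measurable E ->
  (forall k, vol (F k) < +oo)%E -> (vol E < +oo)%E -> cc g ->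
  (fun k => symd (F k) E) @ \oo --> (0 : R) -> (fun k => Int (F k) g) @ \oo --> Int E g.
Proof.
move=> mF mE Foo Eoo cg FE; have [M M0 HM] := cc_bounded cg.
apply/cvgrPdist_le => e e0.
have M1 : 0 < M + 1 by rewrite ltr_wpDl.
near=> k.
rewrite distrC; apply: le_trans (Int_symd (mF k) mE (Foo k) Eoo cg HM) _.
apply: (@le_trans _ _ ((M + 1) * symd (F k) E)).
  by rewrite ler_wpM2r ?symd_ge0// lerDl.
rewrite mulrC -ler_pdivlMr//.
have : `|0 - symd (F k) E| <= e / (M + 1).
  by near: k; move/cvgrPdist_le : FE; apply; rewrite divr_gt0.
by rewrite sub0r normrN ger0_norm// symd_ge0.
Unshelve. all: by end_near. Qed.

End perimeter.

(** * Approximation by C1 functions *)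

Lemma cvge0_lt (R : realType) (u : nat -> \bar R) (e : R) : u @ \oo --> 0%E -> 0 < e ->
  exists N, (u N < e%:E)%E.
Proof.
move=> cu e0.
have [N _ HN] : \forall N \near \oo, (u N < e%:E)%E.
  apply: (cu [set y | y < e%:E]%E).
  by apply: open_nbhs_nbhs; split; [exact: open_ereal_lt_ereal|rewrite /= lte_fin].
by exists N; apply: HN => /=.
Qed.

Section approximation.
Variables (R : realType) (n : nat).
Local Notation mR := (measurableTypeR R).
Local Notation X := 'rV[R]_n.
Local Notation leb := (leb R n).
Variables (D : set X) (mD : measurable D) (Doo : (leb D < +oo)%E).
Implicit Types (P : set X) (f : X -> R).

Lemma continuous_measurable_rV f : continuous f -> measurable_fun setT f.
Proof.
move=> cf.
have m1 : measurable_fun setT (fun p : Rn1 R n => f p.1).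
  apply: continuous_measurable_Rn1 => p.
  by apply: (@continuous_comp _ _ _ fst f); [exact: cvg_fst|exact: cf].
have m2 : measurable_fun setT (fun x : X => (x, 0 : mR)).
  by apply/measurable_fun_pair => /=; [exact: measurable_id|exact: measurable_cst].
exact: (measurableT_comp m1 m2).
Qed.

Definition L1d f (P : set X) := (\int[leb]_(x in D) `|f x - \1_P x|%:E)%E.

(** Density of C1 functions in L^1 of [D], for indicators. The approximable sets form a
    sigma-algebra that contains the coordinate half-spaces, hence all measurable sets. The values
    are kept in [0, 1] so that sums of such functions can serve as weights. *)
Definition approximable P := measurable P /\ forall e : R, 0 < e ->
  exists f, [/\ C1 f, forall x, 0 <= f x <= 1 & (L1d f P <= e%:E)%E].

Lemma measurable_L1d f P : C1 f -> measurable P -> measurable_fun D (fun x => `|f x - \1_P x|%:E).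
Proof.
move=> cf mP; apply: measurable_funTS; apply/measurable_EFinP.
apply: measurableT_comp => //; apply: measurable_funB.
  by apply: continuous_measurable_rV; exact: (C1_continuous cf).
exact: measurable_indic.
Qed.

Lemma approximable0 : approximable set0.
Proof.
split; first exact: measurable0.
move=> e e0; exists (fun=> 0); split; first exact: C1_cst.
  by move=> x; rewrite lexx ler01.
rewrite /L1d integral0_eq ?lee_fin ?ltW// => x _.
by rewrite indicE in_set0 subrr normr0.
Qed.

Lemma approximableC P : approximable P -> approximable (~` P).
Proof.
move=> [mP aP]; split; first exact: measurableC.
move=> e /aP[f [cf f01 fe]]; exists (fun x => 1 - f x); split.
- by apply: C1B; [exact: C1_cst|exact: cf].
- by move=> x; have := f01 x; rewrite subr_ge0 gerBl andbC.
- apply: le_trans fe; rewrite /L1d le_eqVlt; apply/orP; left; apply/eqP.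
  apply: eq_integral => x _; congr EFin.
  rewrite distrC !indicE in_setC; case: (x \in P) => /=; last by rewrite opprB addrCA subrr addr0 subr0.
  by rewrite sub0r normrN distrC.
Qed.

Lemma approximableU P Q : approximable P -> approximable Q -> approximable (P `|` Q).
Proof.
move=> [mP aP] [mQ aQ]; split; first exact: measurableU.
move=> e e0; have e20 : 0 < e / 2 by rewrite divr_gt0.
have [f [cf f01 fe]] := aP _ e20; have [g [cg g01 ge]] := aQ _ e20.
(* This is 1 - (1 - f)(1 - g): it stays in [0, 1], and its distance to the indicator of the union is
   at most the sum of the two distances. *)
exists (fun x => f x + g x - f x * g x); split.
- by apply: C1B; [apply: C1D|apply: C1M].
- by move=> x; move: (f01 x) (g01 x); move: (f x) (g x) => a b; nra.
- apply: (@le_trans _ _ (L1d f P + L1d g Q)%E); last first.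
    by rewrite (splitr e) EFinD leeD.
  rewrite /L1d -ge0_integralD//; [|exact: measurable_L1d|exact: measurable_L1d].
  apply: ge0_le_integral => //.
  + apply: measurable_L1d; last exact: measurableU.
    by apply: C1B; [apply: C1D|apply: C1M].
  + by apply: emeasurable_funD; exact: measurable_L1d.
  move=> x _; rewrite -EFinD lee_fin !indicE in_setU.
  move: (f01 x) (g01 x); move: (f x) (g x) => a b.
  case: (x \in P); case: (x \in Q) => /= /andP[a0 a1] /andP[b0 b1];
   rewrite ?subr0.
  + by rewrite (ler0_norm (_ : a + b - a * b - 1 <= 0)) ?(ler0_norm (_ : a - 1 <= 0)) ?(ler0_norm (_ : b - 1 <= 0)); nra.
  + by rewrite (ger0_norm b0) (ler0_norm (_ : a + b - a * b - 1 <= 0)) ?(ler0_norm (_ : a - 1 <= 0)); nra.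
  + by rewrite (ger0_norm a0) (ler0_norm (_ : a + b - a * b - 1 <= 0)) ?(ler0_norm (_ : b - 1 <= 0)); nra.
  + by rewrite (ger0_norm a0) (ger0_norm b0) ger0_norm; nra.
Qed.

Lemma approximable_close P : measurable P ->
  (forall e : R, 0 < e -> exists2 Q, approximable Q & Q `<=` P /\ (leb (D `&` (P `\` Q)) <= e%:E)%E) ->
  approximable P.
Proof.
move=> mP H; split => // e e0; have e20 : 0 < e / 2 by rewrite divr_gt0.
have [Q [mQ aQ] [QP Qe]] := H _ e20; have [f [cf f01 fe]] := aQ _ e20.
exists f; split => //.
apply: (@le_trans _ _ (L1d f Q + \int[leb]_(x in D) (\1_(P `\` Q) x)%:E)%E); last first.
  rewrite (splitr e) EFinD leeD// integral_indic//; last exact: measurableD.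
  by rewrite setIC.
have mPQ : measurable_fun D (EFin \o (\1_(P `\` Q) : X -> R)).
  by apply: measurable_funTS; apply/measurable_EFinP; apply: measurable_indic; exact: measurableD.
rewrite /L1d -ge0_integralD//; last exact: measurable_L1d.
apply: ge0_le_integral => //.
- exact: measurable_L1d.
- by apply: emeasurable_funD => //; exact: measurable_L1d.
move=> x _; rewrite -EFinD lee_fin; apply: le_trans (ler_distD (\1_Q x) _ _) _.
rewrite lerD2l !indicE in_setD.
case: (boolP (x \in Q)) => xQ.
  have -> : x \in P by rewrite inE; apply: QP; rewrite inE in xQ.
  by rewrite subrr normr0.
by case: (x \in P); rewrite ?sub0r ?subrr ?normrN ?normr1 ?normr0.
Qed.

(** A finite union is close to the whole one: what is left over, cut to the set [D] of finite
    measure, decreases to the empty set. *)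
Lemma approximable_bigcup (F : (set X)^nat) : (forall k, approximable (F k)) ->
  approximable (\bigcup_k F k).
Proof.
move=> aF; have mF k : measurable (F k) by case: (aF k).
apply: approximable_close; first exact: bigcupT_measurable.
move=> e e0.
have aN N : approximable (\big[setU/set0]_(k < N) F k).
  elim: N => [|N IH]; first by rewrite big_ord0; exact: approximable0.
  by rewrite big_ord_recr; exact: approximableU.
pose G N := D `&` (\bigcup_k F k `\` \big[setU/set0]_(k < N) F k).
have cvg : leb (G N) @[N --> \oo] --> leb (\bigcap_N G N).
  apply: nonincreasing_cvg_mu.
  - apply: le_lt_trans Doo; apply: le_measure; rewrite ?inE//; last by move=> x [].
    apply: measurableI => //; apply: measurableD; first exact: bigcupT_measurable.
    by case: (aN 0%N).
  - move=> N; apply: measurableI => //; apply: measurableD; first exact: bigcupT_measurable.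
    by case: (aN N).
  - apply: bigcapT_measurable => N; apply: measurableI => //; apply: measurableD; first exact: bigcupT_measurable.
    by case: (aN N).
  - move=> N M NM; apply/subsetPset => x [Dx [Fx nx]]; split => //; split => // Nx; apply: nx.
    by move: Nx; rewrite -!bigcup_mkord => -[k /= kN Fk]; exists k => //=; exact: leq_trans NM.
have G0 : \bigcap_N G N = set0.
  rewrite -subset0 => x Gx; have [_ [[k _ Fk] _]] := Gx 0%N I.
  have [_ [_]] := Gx k.+1 I; apply; rewrite -bigcup_mkord; exists k => //=.
move: cvg; rewrite G0 measure0 => cvg.
have [N HN] : exists N, (leb (G N) < e%:E)%E.
  exact: cvge0_lt cvg e0.
exists (\big[setU/set0]_(k < N) F k) => //; split.
  by rewrite -bigcup_mkord => x [k _ Fk]; exists k.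
exact/ltW/HN.
Qed.

Lemma approximable_ray (i : 'I_n) (a : R) :
  approximable ((fun x : X => x ord0 i : mR) @^-1` [set` `]a, +oo[]).
Proof.
set P := _ @^-1` _.
have mP : measurable P by apply: measurable_coord_preimage; exact: measurable_itv.
have ccoord : C1 (fun x : X => x ord0 i).
  pose L : X -> R := fun x => x ord0 i.
  have lL : linear L by move=> c x y; rewrite /L !mxE.
  pose h := GRing.isLinear.Build R X R _ L lL.
  pose L' : {linear X -> R} := HB.pack L h.
  by apply: (@C1_lin _ _ _ L'); exact: coord_continuous.
pose f (k : nat) (x : X) := step (k%:R * (x ord0 i - a)).
have cf k : C1 (f k).
  apply: (@C1_comp1 _ _ (fun x : X => k%:R * (x ord0 i - a)) (@step R)); first exact: C1_step.
  by apply: C1M; [exact: C1_cst|apply: C1B; [exact: ccoord|exact: C1_cst]].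
split => // e e0.
have [] := @dominated_convergence _ _ _ leb D mD (fun k x => `|f k x - \1_P x|%:E) (cst 0%E) (cst 1%E).
- by move=> k; exact: measurable_L1d.
- exact: measurable_cst.
- apply: aeW => x Dx.
  apply: cvg_near_cst; have [xP|xP] := leP (x ord0 i) a.
    near=> k; rewrite /f step_le0 ?indicE ?memNset ?subrr ?normr0//.
      by rewrite /P /= in_itv/= andbT; apply/negP; rewrite -leNgt.
    by rewrite mulr_ge0_le0// subr_le0.
  near=> k; rewrite /f step_ge1 ?indicE ?mem_set ?subrr ?normr0//.
    by rewrite /P /= in_itv/= andbT.
  rewrite -ler_pdivrMr ?subr_gt0// mul1r; near: k.
  exact: nbhs_infty_ger.
- apply/integrableP; split; first exact: measurable_cst.
  by rewrite integral_cst// normr1 mul1e.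
- apply: aeW => x k Dx; rewrite /= lee_fin normr_id.
  have /andP[] : 0 <= f k x <= 1 by exact: step_ge0.
  rewrite indicE ler_norml; case: (x \in P) => /=; move: (f k x) => y; lra.
move=> _ _; rewrite integral0 => cvg.
have [N HN] : exists N, (\int[leb]_(x in D) `|f N x - \1_P x|%:E < e%:E)%E.
  exact: cvge0_lt cvg e0.
exists (f N); split; [exact: cf|by move=> x; exact: step_ge0|].
exact/ltW/HN.
Unshelve. all: by end_near. Qed.

Lemma approximable_measurable P : measurable P -> approximable P.
Proof.
move=> mP.
suff: g_sigma_preimage (fun (j : 'I_n) (x : X) => x ord0 j : mR) `<=` approximable by apply.
apply: smallest_sub; first split => /=.
- exact: approximable0.
- by move=> A; rewrite setTD; exact: approximableC.
- by move=> F; exact: approximable_bigcup.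
apply: (big_ind (fun B => B `<=` approximable)) => [|A B aA aB|i _].
- exact: sub0set.
- by rewrite subUset.
move=> B [C mC <-]; rewrite setTI.
suff: <<s (@RGenOInfty.G R) >> `<=` [set C : set mR | approximable ((fun x : X => x ord0 i : mR) @^-1` C)].
  by apply; have : (@RGenOInfty.G R).-sigma.-measurable C by rewrite -RGenOInfty.measurableE; exact: mC.
apply: smallest_sub; first split => /=.
- by rewrite preimage_set0; exact: approximable0.
- by move=> A; rewrite setTD preimage_setC; exact: approximableC.
- by move=> F aF; rewrite preimage_bigcup; exact: approximable_bigcup.
by move=> _ [a ->]; exact: approximable_ray.
Qed.

End approximation.

Lemma integrable_cst_fin d (T : measurableType d) (R : realType) (mu : {measure set T -> \bar R})
  (A : set T) (c : R) : measurable A -> (mu A < +oo)%E -> mu.-integrable A (EFin \o (fun=> c)).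
Proof.
move=> mA Aoo; apply/integrableP; split; first exact: measurable_cst.
rewrite (_ : (fun x => _) = cst `|c|%:E)// integral_cst//.
have fin : mu A \is a fin_num by rewrite ge0_fin_numE.
by rewrite -[mu A]fineK// -EFinM ltry.
Qed.

(** * Detecting a change along a line *)

Section onedim.
Variable R : realType.
Local Notation mR := (measurableTypeR R).
Local Notation lam := (@lebesgue_measure R).

(** Almost every point of A is a density point and P is not null. P is the part of A in a given
    interval, so that the density point found lies in that interval. *)
Lemma density_pt (A P : set mR) : measurable A -> measurable P -> P `<=` A -> (0 < lam P)%E ->
  exists2 x : R, P x & forall e : R, 0 < e -> exists2 d : R, 0 < d & forall r, 0 < r < d ->
    (lam (ball x r `\` A) <= (e * r)%:E)%E.
Proof.
move=> mA mP PA P0.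
have [N [mN N0 sN]] := lebesgue_density mA.
have [x Px Nx] : exists2 x, P x & ~ N x.
  apply: contrapT => /forall2NP H.
  have : (lam P <= lam N)%E.
    by apply: le_measure; rewrite ?inE// => x Px; have [|/contrapT] := H x.
  by rewrite N0 leNgt P0.
exists x => // e e0.
have : (lam (A `&` ball x r) * (lam (ball x r))^-1)%E @[r --> 0^'+] --> (1 : R)%:E.
  have /contrapT := (contra_not (@sN x) Nx).
  by rewrite /= indicE mem_set//; exact: PA.
move=> cvg.
have : \forall r \near 0^'+, ((1 - e / 2)%:E < lam (A `&` ball x r) * (lam (ball x r))^-1)%E.
  apply: (cvg [set y | ((1 - e / 2)%:E < y)%E]).
  apply: open_nbhs_nbhs; split; first exact: open_ereal_gt_ereal.
  by rewrite /= lte_fin gtrBl divr_gt0.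
move=> [d /= d0 dH].
exists d => // r /andP[r0 rd].
have := dH r; rewrite /= sub0r normrN gtr0_norm// => /(_ rd r0).
have mB : measurable (ball x r : set mR) by exact: measurable_ball.
have lB : lam (ball x r) = (r *+ 2)%:E by rewrite lebesgue_measure_ball// ltW.
rewrite lB inver mulrn_eq0/= gt_eqF//.
have fin : lam (A `&` ball x r) \is a fin_num.
  rewrite ge0_fin_numE//; apply: (@le_lt_trans _ _ (lam (ball x r))).
    by apply: le_measure; rewrite ?inE//; exact: measurableI.
  by rewrite lB ltry.
have lBoo : (lam (ball x r) < +oo)%E by rewrite lB ltry.
have DE : lam (ball x r `\` A) = (lam (ball x r) - lam (ball x r `&` A))%E := measureD mB mA lBoo.
rewrite DE.
rewrite setIC in fin; rewrite lB (setIC A) -(fineK fin) -EFinM lte_fin -EFinB lee_fin.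
rewrite ltr_pdivlMr ?mulrn_wgt0//; nra.
Qed.

(** A continuous probability density carried by [t, t + d]; its primitive is a translated and
    rescaled [step]. *)
Definition kern (t d u : R) : R := d^-1 * tent (d^-1 * (u - t)).

(** A primitive of [kern t d - kern s d] with compact support and values in [-1, 1], whichever of s
    and t is the smaller. *)
Definition bump (s t d u : R) : R := step (d^-1 * (u - t)) - step (d^-1 * (u - s)).

Lemma C1_affine (t d : R) : C1 (fun u : R => d^-1 * (u - t)).
Proof.
apply: C1M; first exact: C1_cst.
by apply: C1B; [apply: (@C1_lin _ _ _ idfun) => x; exact: cvg_id|exact: C1_cst].
Qed.

Lemma C1_stepd (t d : R) : C1 (fun u : R => step (d^-1 * (u - t))).
Proof. exact: (C1_comp1 (@C1_step R) (C1_affine t d)). Qed.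

Lemma derive_stepd (t d u : R) : 'D_1 (fun u : R => step (d^-1 * (u - t))) u = kern t d u.
Proof.
rewrite (derive_comp1 _ _ (@C1_step R) (C1_affine t d)) derive1_step mulrC; congr (_ * _).
rewrite (deriveM' _ _ (C1_cst _ _) _); last first.
  by apply: C1B; [apply: (@C1_lin _ _ _ idfun) => x; exact: cvg_id|exact: C1_cst].
rewrite derive_cst mulr0 addr0 deriveB'; [|apply: (@C1_lin _ _ _ idfun) => x; exact: cvg_id|exact: C1_cst].
by rewrite derive_cst subr0 derive_id mulr1.
Qed.

Lemma C1_bump s t d : C1 (bump s t d).
Proof. by apply: C1B; exact: C1_stepd. Qed.

Lemma derive_bump s t d u : 'D_1 (bump s t d) u = kern t d u - kern s d u.
Proof. by rewrite -!derive_stepd; exact: (deriveB' _ _ (C1_stepd t d) (C1_stepd s d)). Qed.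

Lemma kern_ge0 (t d u : R) : 0 < d -> 0 <= kern t d u <= 3 / 2 / d.
Proof.
move=> d0; have /andP[h1 h2] := tent_ge0 (d^-1 * (u - t)).
have d1 : 0 <= d^-1 by rewrite invr_ge0 ltW.
by rewrite /kern mulr_ge0//= mulrC ler_wpM2r.
Qed.

Lemma kern_out (t d u : R) : 0 < d -> ~ (t < u < t + d) -> kern t d u = 0.
Proof.
move=> d0 /negP; rewrite negb_and -!leNgt /kern => /orP[h|h].
  by rewrite tent_le0 ?mulr0// mulr_ge0_le0 ?invr_ge0 ?subr_le0// ltW.
by rewrite tent_ge1 ?mulr0// mulrC ler_pdivlMr// mul1r lerBrDl.
Qed.

Lemma continuous_kern t d : continuous (kern t d).
Proof.
move=> u; apply: cvgM; first exact: cvg_cst.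
apply: (@continuous_comp _ _ _ (fun u : R => d^-1 * (u - t)) (@tent R)); last exact: continuous_tent.
exact: (C1_continuous (C1_affine t d)).
Qed.

Lemma kern_integrable (t d : R) (S : set mR) : 0 < d -> measurable S -> lam.-integrable S (EFin \o kern t d).
Proof.
move=> d0 mS; apply: (@integrableS _ _ _ _ setT) => //.
have -> : EFin \o kern t d = EFin \o (kern t d \_ `[t, t + d]).
  apply/funext => u /=; rewrite patchE; case: ifPn => // /negP h.
  rewrite kern_out// => /andP[h1 h2]; apply: h; rewrite inE/= in_itv/= !ltW//.
have := @integrable_mkcond _ _ R lam `[t, t + d]%classic (EFin \o kern t d) (measurable_itv _).
rewrite restrict_EFin => /iffLR; apply.
apply: continuous_compact_integrable; first exact: segment_compact.
by apply: continuous_subspaceT; exact: continuous_kern.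
Qed.

Lemma kern_total (t d : R) : 0 < d -> \int[lam]_u kern t d u = 1.
Proof.
move=> d0; rewrite /Rintegral.
have tt : t < t + d by rewrite ltrDl.
have -> : (\int[lam]_u (kern t d u)%:E = \int[lam]_(u in `[t, (t + d)%R]) (kern t d u)%:E)%E.
  rewrite [RHS]integral_mkcond; apply: eq_integral => u _.
  rewrite patchE; case: ifPn => // /negP h.
  by rewrite kern_out// => /andP[h1 h2]; apply: h; rewrite inE/= in_itv/= !ltW.
have C := C1_stepd t d.
rewrite (@continuous_FTC2 _ (kern t d) (fun u : R => step (d^-1 * (u - t))))//.
- by rewrite subrr mulr0 addrAC subrr add0r mulVf ?gt_eqF// step_ge1// step_le0// -EFinB subr0.
- by apply: continuous_subspaceT; exact: continuous_kern.
- split.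
  + by move=> u _; exact: C1_derivable.
  + by apply: cvg_at_right_filter; exact: (C1_continuous C).
  + by apply: cvg_at_left_filter; exact: (C1_continuous C).
- by move=> u _; rewrite derive1E derive_stepd.
Qed.

Lemma kern_small (t d : R) (S : set mR) (c : R) : 0 < d -> measurable S -> 0 <= c ->
  (lam (S `&` `]t, (t + d)%R[) <= (c * d)%:E)%E ->
  0 <= \int[lam]_(u in S) kern t d u <= 3 / 2 * c.
Proof.
move=> d0 mS c0 H; apply/andP; split.
  by apply: Rintegral_ge0 => u _; have /andP[] := kern_ge0 t u d0.
have mI : measurable (S `&` `]t, (t + d)%R[ : set mR) by apply: measurableI => //; exact: measurable_itv.
have fin : lam (S `&` `]t, (t + d)%R[) \is a fin_num.
  by rewrite ge0_fin_numE//; apply: le_lt_trans H _; rewrite ltry.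
have -> : \int[lam]_(u in S) kern t d u = \int[lam]_(u in S `&` `]t, (t + d)%R[) kern t d u.
  rewrite Rintegral_mkcondr; apply: eq_Rintegral => u _.
  rewrite patchE; case: ifPn => // /negP h.
  by rewrite kern_out// => h'; apply: h; rewrite inE/= in_itv.
apply: (@le_trans _ _ (\int[lam]_(u in S `&` `]t, (t + d)%R[) (3 / 2 / d))).
  apply: le_Rintegral => //.
  - exact: kern_integrable.
  - by apply: integrable_cst_fin => //; rewrite -ge0_fin_numE.
  - by move=> u _; have /andP[] := kern_ge0 t u d0.
rewrite Rintegral_cst//.
have -> : 3 / 2 * c = 3 / 2 / d * (c * d) by field; rewrite gt_eqF.
by apply: ler_wpM2l; [rewrite divr_ge0// ltW|rewrite -lee_fin fineK].
Qed.

(** Take a density point x of S and a density point y of its complement, both in the interval. A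
    kernel placed just after x has almost all its mass in S, one placed just after y almost none;
    their difference is the derivative of a [bump]. Rational positions and scales 1 / (k+1) suffice,
    so the family of bumps is countable. *)
Lemma nc_bump (S : set mR) (a b e : R) : measurable S ->
  (0 < lam (S `&` `]a, b[))%E -> (0 < lam (`]a, b[ `\` S))%E -> 0 < e ->
  exists (s t : rat) (k : nat), [/\ a < ratr s, ratr s + k.+1%:R^-1 < b,
     a < ratr t, ratr t + k.+1%:R^-1 < b &
     1 - e <= \int[lam]_(u in S) (kern (ratr t) k.+1%:R^-1 u - kern (ratr s) k.+1%:R^-1 u)].
Proof.
move=> mS h1 h2 e0.
have mI : measurable (`]a, b[ : set mR) by exact: measurable_itv.
have [x [Sx Ix] Hx] := @density_pt S (S `&` `]a, b[) mS (measurableI _ _ mS mI) (@subIsetl _ _ _) h1.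
have [y [Iy Sy] Hy] := @density_pt (~` S) (`]a, b[ `\` S) (measurableC mS) (measurableD mI mS)
  (fun z h => h.2) h2.
(* The carrier of a kernel of width d lies in a ball of radius 2 d; the wrong part of it then has
   length at most (e / 6)(2 d), and a density of at most 3 / (2 d) gives it the mass e / 2. There
   are two kernels. *)
have e6 : 0 < e / 6 by rewrite divr_gt0.
have [dx dx0 {}Hx] := Hx _ e6; have [dy dy0 {}Hy] := Hy _ e6.
move: Ix Iy; rewrite /= !in_itv/= => /andP[ax xb] /andP[ay yb].
pose m := Num.min (Num.min dx dy) (Num.min (b - x) (b - y)).
have m0 : 0 < m by rewrite !lt_min dx0 dy0 !subr_gt0 xb yb.
have [k km] : exists k : nat, 2 * k.+1%:R^-1 < m.
  exists (Num.trunc (2 / m)); rewrite ltr_pdivrMr// mulrC -ltr_pdivrMr//.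
  exact: truncnS_gt.
set d := k.+1%:R^-1 in km *.
have d0 : 0 < d by rewrite /d invr_gt0.
move: km; rewrite !lt_min => /andP[/andP[kdx kdy] /andP[kx ky]].
have near (z : R) : exists q : rat, z < ratr q < z + d.
  have /rat_in_itvoo[q] : z < z + d by rewrite ltrDl.
  by rewrite in_itv/= => h; exists q.
have [t /andP[xt td]] := near x; have [s /andP[ys sd]] := near y.
exists s, t, k; rewrite -/d; split; [lra|lra|lra|lra|].
have sub (z q : R) : z < q -> q < z + d -> `]q, (q + d)%R[%classic `<=` ball z (2 * d).
  move=> zq qz u; rewrite /= in_itv/= -ball_normE/= => /andP[h3 h4].
  by rewrite ltr_distl; apply/andP; split; lra.
have m2 : 0 < 2 * d < dx by rewrite kdx mulr_gt0.
have m2' : 0 < 2 * d < dy by rewrite kdy mulr_gt0.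
have mit q : measurable (`]q, (q + d)%R[ : set mR) by exact: measurable_itv.
have mbl z : measurable (ball z (2 * d) : set mR) by exact: measurable_ball.
have e3 : 0 <= e / 3 by rewrite divr_ge0// ltW.
have Ks := @kern_small (ratr s) d S (e / 3) d0 mS e3.
have Kt := @kern_small (ratr t) d (~` S) (e / 3) d0 (measurableC mS) e3.
have {Ks} /andP[_ Ks] : 0 <= \int[lam]_(u in S) kern (ratr s) d u <= 3 / 2 * (e / 3).
  apply: Ks; apply: le_trans (_ : (e / 6 * (2 * d))%:E <= _)%E; last by rewrite lee_fin; lra.
  apply: le_trans (Hy _ m2'); apply: le_measure; rewrite ?inE.
  - exact: measurableI.
  - by apply: measurableD => //; exact: measurableC.
  - by move=> u [Su /(sub _ _ ys sd) Bu]; split => // nS; exact: nS.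
have {Kt} /andP[_ Kt] : 0 <= \int[lam]_(u in ~` S) kern (ratr t) d u <= 3 / 2 * (e / 3).
  apply: Kt; apply: le_trans (_ : (e / 6 * (2 * d))%:E <= _)%E; last by rewrite lee_fin; lra.
  apply: le_trans (Hx _ m2); apply: le_measure; rewrite ?inE.
  - by apply: measurableI => //; exact: measurableC.
  - by apply: measurableD.
  - by move=> u [Su /(sub _ _ xt td) Bu]; split.
have tot : \int[lam]_(u in S) kern (ratr t) d u + \int[lam]_(u in ~` S) kern (ratr t) d u = 1.
  rewrite -Rintegral_setU ?setUv ?kern_total//.
  - exact: measurableC.
  - exact: kern_integrable.
  - by rewrite disj_set2E setICr.
rewrite RintegralB//; [|exact: kern_integrable|exact: kern_integrable].
move: Ks Kt tot; move: (\int[lam]_(u in S) kern (ratr t) d u) (\int[lam]_(u in S) kern (ratr s) d u) (\int[lam]_(u in ~` S) kern (ratr t) d u) => z1 z2 z3.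
lra.
Qed.

End onedim.

(** * Smoothing a measurable partition *)

Section partition.
Variables (R : realType) (n : nat).
Local Notation X := 'rV[R]_n.
Local Notation leb := (leb R n).
Variables (D : set X) (mD : measurable D) (Doo : (leb D < +oo)%E).

(** By induction, the last weight is an approximation [f] of its indicator multiplied by what the
    previous weights leave, 1 - s. On P M the previous indicators vanish, so s there is at most the
    sum of the previous errors. *)
Lemma approx_partition (P : nat -> set X) : (forall m, measurable (P m)) -> trivIset setT P ->
  forall (M : nat) (e : R), 0 < e -> exists b : nat -> X -> R,
  [/\ forall m, C1 (b m), forall m x, 0 <= b m x, forall x, \sum_(m < M) b m x <= 1 &
      forall m, (m < M)%N -> (L1d D (b m) (P m) <= e%:E)%E].
Proof.
move=> mP tP; elim => [|M IH] e e0.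
  exists (fun=> fun=> 0); split => //; first by move=> m; exact: C1_cst.
  by move=> x; rewrite big_ord0.
have M0 : 0 < M.+1%:R :> R by [].
(* The error of the last weight is that of [f] plus those of the M previous weights. *)
have e'0 : 0 < e / M.+1%:R by rewrite divr_gt0.
have [b [cb b0 b1 be]] := IH _ e'0.
have [_ aP] := approximable_measurable mD Doo (mP M).
have [f [cf f01 fe]] := aP _ e'0.
pose s x := \sum_(m < M) b m x.
have cs : C1 s by apply: C1_sum => m _; exact: cb.
exists (fun m => if m == M then (fun x => f x * (1 - s x)) else b m); split.
- move=> m; case: eqP => [_|_]; last exact: cb.
  apply: C1M; first exact: cf.
  by apply: C1B; [exact: C1_cst|exact: cs].
- move=> m x; case: eqP => [_|_]; last exact: b0.
  by rewrite mulr_ge0 ?subr_ge0//; [have /andP[] := f01 x|exact: b1].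
- move=> x; rewrite big_ord_recr/= eqxx.
  rewrite (_ : \sum_(i < M) _ = s x); last first.
    by apply: eq_bigr => i _; rewrite ltn_eqF.
  have : s x <= 1 by exact: b1.
  by move: (f01 x) => /andP[]; move: (f x) (s x) => u v; nra.
move=> m; rewrite ltnS leq_eqVlt => /predU1P[->|mM]; last first.
  rewrite ltn_eqF//; apply: le_trans (be m mM) _.
  rewrite lee_fin ler_pdivrMr//; apply: ler_peMr; first exact: ltW.
  by rewrite ler1n.
rewrite eqxx.
have mL m' : measurable_fun D (fun x => `|b m' x - \1_(P m') x|%:E) := measurable_L1d (cb m') (mP m').
have mf : measurable_fun D (fun x => `|f x - \1_(P M) x|%:E) := measurable_L1d cf (mP M).
apply: (@le_trans _ _ (L1d D f (P M) + \sum_(m' < M) L1d D (b m') (P m'))%E); last first.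
  apply: (@le_trans _ _ ((e / M.+1%:R)%:E + \sum_(m' < M) (e / M.+1%:R)%:E)%E).
    by apply: leeD => //; apply: lee_sum => i _; exact: be.
  rewrite sumEFin sumr_const card_ord -EFinD lee_fin -mulrS -[leLHS]mulr_natr.
  by rewrite divfK// gt_eqF.
rewrite /L1d -ge0_integral_sum//.
have mS : measurable_fun D (fun x => (\sum_(k < M) `|b k x - \1_(P k) x|%:E)%R).
  by apply: emeasurable_sum => i; exact: mL.
have S0 x : D x -> (0 <= (\sum_(k < M) `|b k x - \1_(P k) x|%:E)%R)%E by move=> _; apply: sume_ge0.
rewrite -ge0_integralD//.
apply: ge0_le_integral => //.
- apply: (measurable_L1d _ (mP M)).
  by apply: C1M; [exact: cf|apply: C1B; [exact: C1_cst|exact: cs]].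
- exact: emeasurable_funD.
move=> x _; rewrite sumEFin -EFinD lee_fin.
have s0 : 0 <= s x by apply: sumr_ge0.
have s1 : s x <= 1 by exact: b1.
have /andP[f0 f1] := f01 x.
have [xP|xP] := boolP (x \in P M).
  have sE : s x = \sum_(m' < M) `|b m' x - \1_(P m') x|.
    apply: eq_bigr => i _; rewrite indicE memNset ?subr0 ?ger0_norm// => Pi.
    have /trivIsetP := tP => /(_ i M I I); rewrite ltn_eqF// => /(_ isT).
    by rewrite -subset0 => /(_ x); apply; split => //; rewrite inE in xP.
  rewrite -sE indicE xP /= !ler0_norm ?subr_le0//; first by nra.
  by nra.
rewrite indicE (negbTE xP) /= !subr0 !ger0_norm ?mulr_ge0 ?subr_ge0//.
apply: (@le_trans _ _ (f x)); first by rewrite ler_piMr// gerBl.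
by rewrite lerDl; apply: sumr_ge0.
Qed.

Variables (h : nat -> X -> R) (c : nat -> R).
Hypothesis mh : forall m, measurable_fun D (h m).
Hypothesis hc : forall m x, `|h m x| <= c m.
Variables (chi : X -> R).
Hypothesis mchi : measurable_fun D chi.
Hypothesis chi01 : forall x, 0 <= chi x <= 1.
Variables (C : R).

Lemma integrable_bounded (f : X -> R) M : measurable_fun D f -> (forall x, `|f x| <= M) ->
  leb.-integrable D (EFin \o f).
Proof.
move=> mf fM; apply: le_integrable (integrable_cst_fin M mD Doo) => //.
  exact/measurable_EFinP.
by move=> x _ /=; rewrite lee_fin (le_trans (fM x))// ler_norm.
Qed.

Hypothesis H : forall M (b : nat -> X -> R), (forall m, C1 (b m)) -> (forall m x, 0 <= b m x) ->
  (forall x, \sum_(m < M) b m x <= 1) ->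
  \int[leb]_(y in D) (chi y * \sum_(m < M) b m y * h m y) <= C.

Lemma partition_bound M (P : nat -> set X) : (forall m, measurable (P m)) -> trivIset setT P ->
  \int[leb]_(y in D) (chi y * \sum_(m < M) \1_(P m) y * h m y) <= C.
Proof.
move=> mP tP; apply/ler_addgt0Pr => e e0.
(* Weights within e / B of the indicators change the integral by at most e times the sum of the c m,
   divided by B; the 1 keeps B positive. *)
pose B := 1 + \sum_(m < M) c m.
have c0 m : 0 <= c m by exact: le_trans (hc m 0).
have B0 : 0 < B by rewrite ltr_pwDl// sumr_ge0.
have [b [cb b0 b1 be]] := approx_partition mP tP M (divr_gt0 e0 B0).
apply: le_trans (_ : \int[leb]_(y in D) (chi y * \sum_(m < M) b m y * h m y) + e <= _); last first.
  by rewrite lerD2r; exact: H.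
have mb m : measurable_fun D (b m).
  by apply: measurable_funTS; apply: continuous_measurable_rV; exact: (C1_continuous (cb m)).
have m1 m : measurable_fun D (\1_(P m) : X -> R).
  by apply: measurable_funTS; exact: measurable_indic.
have ms (u : nat -> X -> R) : (forall m, measurable_fun D (u m)) ->
    measurable_fun D (fun y => chi y * \sum_(m < M) u m y * h m y).
  move=> mu; apply: measurable_funM => //; apply: measurable_sum => m.
  by apply: measurable_funM; [exact: mu|exact: mh].
have mle (u : nat -> X -> R) : (forall m y, (m < M)%N -> `|u m y| <= 1) ->
    forall y, `|chi y * \sum_(m < M) u m y * h m y| <= \sum_(m < M) c m.
  move=> u1 y; rewrite normrM; apply: (@le_trans _ _ `|\sum_(m < M) u m y * h m y|).
    by rewrite ler_piMl//; have /andP[? ?] := chi01 y; rewrite ger0_norm.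
  apply: le_trans (ler_norm_sum _ _ _) _; apply: ler_sum => m _.
  by rewrite normrM -[leRHS]mul1r ler_pM ?u1.
have i1 := integrable_bounded (ms _ m1) (mle _ _).
have i2 := integrable_bounded (ms _ mb) (mle _ _).
rewrite -lerBlDl -RintegralB//; last 2 first.
- by apply: i1 => m y _; rewrite indicE; case: (y \in _); rewrite ?normr1 ?normr0.
- apply: i2 => m y mM; rewrite ger0_norm//; apply: le_trans (b1 y).
  by rewrite (bigD1 (Ordinal mM))//= lerDl sumr_ge0.
have -> : (fun x => chi x * (\sum_(m < M) \1_(P m) x * h m x) - chi x * (\sum_(m < M) b m x * h m x)) =
   (fun x => chi x * \sum_(m < M) (\1_(P m) x - b m x) * h m x).
  apply/funext => x; rewrite -mulrBr -sumrB; congr (_ * _); apply: eq_bigr => i _; ring.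
have mL m' : measurable_fun D (fun x => `|b m' x - \1_(P m') x|%:E) by exact: measurable_L1d.
rewrite -lee_fin; apply: le_trans (_ : \int[leb]_(y in D) `|(chi y * \sum_(m < M) (\1_(P m) y - b m y) * h m y)%:E| <= _)%E.
  rewrite /Rintegral fineK.
    apply: le_trans (lee_abs _) _; apply: le_abse_integral => //.
    by apply/measurable_EFinP; apply: (ms (fun m y => \1_(P m) y - b m y)) => m; exact: measurable_funB.
  apply: integrable_fin_num => //.
  apply: (@integrable_bounded _ (\sum_(m < M) c m)).
    by apply: (ms (fun m y => \1_(P m) y - b m y)) => m; exact: measurable_funB.
  apply: (mle (fun m y => \1_(P m) y - b m y)) => m y mM.
  have bm1 : b m y <= 1.
    by apply: le_trans (b1 y); rewrite (bigD1 (Ordinal mM))//= lerDl sumr_ge0.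
  have := b0 m y; rewrite indicE ler_norml; case: (_ \in _) => /=; move: (b m y) bm1 => z; lra.
apply: (@le_trans _ _ (\int[leb]_(y in D) \sum_(m < M) (c m)%:E * `|b m y - \1_(P m) y|%:E)%E).
  apply: ge0_le_integral => //.
  - apply: measurableT_comp => //; apply/measurable_EFinP.
    by apply: (ms (fun m y => \1_(P m) y - b m y)) => m; exact: measurable_funB.
  - by apply: emeasurable_sum => m _; apply: emeasurable_funM.
  move=> y _; rewrite sumEFin lee_fin normrM.
  apply: (@le_trans _ _ `|\sum_(m < M) (\1_(P m) y - b m y) * h m y|).
    by rewrite ler_piMl//; have /andP[? ?] := chi01 y; rewrite ger0_norm.
  apply: le_trans (ler_norm_sum _ _ _) _; apply: ler_sum => m _.
  by rewrite normrM mulrC distrC ler_pM.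
rewrite ge0_integral_sum//; last 2 first.
- by move=> m; apply: emeasurable_funM.
- by move=> m y _; rewrite -EFinM lee_fin mulr_ge0.
apply: (@le_trans _ _ (\sum_(m < M) (c m)%:E * (e / B)%:E)%E).
  apply: lee_sum => m _; rewrite ge0_integralZl//; last by rewrite lee_fin.
  by rewrite lee_wpmul2l ?lee_fin//; exact: be.
rewrite (eq_bigr (fun m : 'I_M => (c m * (e / B))%:E)) => [|i _]; last by rewrite EFinM.
rewrite sumEFin lee_fin -mulr_suml mulrCA ger_pMr// ler_pdivrMr// mul1r.
by rewrite /B lerDr.
Qed.

End partition.

(** * Slices along coordinate lines *)

Lemma Rintegral_sum d (T : measurableType d) (R : realType) (mu : {measure set T -> \bar R})
  (D : set T) (I : Type) (r : seq I) (f : I -> T -> R) : measurable D ->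
  (forall i, mu.-integrable D (EFin \o f i)) ->
  \int[mu]_(x in D) (\sum_(i <- r) f i x) = \sum_(i <- r) \int[mu]_(x in D) f i x.
Proof.
move=> mD fi; elim: r => [|j r IH].
  rewrite big_nil (_ : (fun t => _) = (fun=> 0)); first by rewrite Rintegral_cst// mul0r.
  by apply/funext => t; rewrite big_nil.
rewrite big_cons -IH -RintegralD//; last first.
  have -> : EFin \o (fun x => \sum_(j <- r) f j x) = (fun u => \sum_(j <- r) (EFin \o f j) u)%E.
    by apply/funext => u /=; rewrite sumEFin.
  by apply: integrable_sum => // i _.
by apply: eq_Rintegral => t _; rewrite big_cons.
Qed.

Section lines.
Variables (R : realType) (n : nat).
Local Notation mR := (measurableTypeR R).
Local Notation lam := (@lebesgue_measure R).
Local Notation X := 'rV[R]_n.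
Local Notation V := (Rn1 R n).
Local Notation leb := (leb R n).
Local Notation vol := (vol R n).

Definition line (E : set V) (y : X) : set mR := [set t | E (y, t)].

Lemma lineE E y : line E y = xsection E y.
Proof. by apply/seteqP; split => t; rewrite /line /xsection/= inE. Qed.

Lemma measurable_line E y : measurable E -> measurable (line E y).
Proof. by move=> mE; rewrite lineE; exact: measurable_xsection. Qed.

Lemma measurable_line_meas E : measurable E -> measurable_fun setT (fun y => lam (line E y)).
Proof.
move=> mE; under eq_fun do rewrite lineE.
exact: measurable_fun_xsection.
Qed.

Definition strip (a b : R) : set V := [set p : V | p.2 \in `]a, b[].

Lemma measurable_strip a b : measurable (strip a b).
Proof.
rewrite (_ : strip a b = setT `*` [set` `]a, b[]).
  by apply: measurableX => //; exact: measurable_itv.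
by apply/seteqP; split => p //= [].
Qed.

(* The lines on which [E] is not constant, up to a null set, between heights [a] and [b]. *)
Definition NC (E : set V) (a b : R) : set X :=
  [set y | (0 < lam (line E y `&` `]a, b[))%E /\ (0 < lam (`]a, b[ `\` line E y))%E].

Lemma measurable_pos_line E : measurable E -> measurable [set y | (0 < lam (line E y))%E].
Proof.
move=> mE; rewrite -[X in measurable X]setTI.
exact: (emeasurable_fun_o_infty _ (measurable_line_meas mE)).
Qed.

Lemma measurable_NC E a b : measurable E -> measurable (NC E a b).
Proof.
move=> mE; rewrite (_ : NC E a b = [set y | (0 < lam (line (E `&` strip a b) y))%E] `&`
   [set y | (0 < lam (line (strip a b `\` E) y))%E]).
  by apply: measurableI; apply: measurable_pos_line; [apply: measurableI|apply: measurableD] => //;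
     exact: measurable_strip.
by apply/seteqP; split.
Qed.

Lemma Int_prod (E : set V) (b : X -> R) (g : R -> R) : measurable E ->
  cc (fun p : V => b p.1 * g p.2) -> lam.-integrable setT (EFin \o g) ->
  Int E (fun p : V => b p.1 * g p.2) = \int[leb]_y (b y * \int[lam]_(t in line E y) g t).
Proof.
move=> mE cbg ig; rewrite /Int {1}/Rintegral integral_mkcond.
pose F (p : V) := ((EFin \o (fun p : V => b p.1 * g p.2)) \_ E) p.
have iF : (vol.-integrable setT F) by apply/(integrable_mkcond _ mE); exact: cc_integrable.
have := @integral12_prod_meas1 _ _ _ _ _ (@lebm R n) lam F iF.
move=> <-; rewrite /Rintegral; congr fine; apply: eq_integral => y _.
rewrite /fubini_F.
have -> : (fun t => ((EFin \o (fun p : V => b p.1 * g p.2)) \_ E) (y, t)) =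
   (fun t => (b y)%:E * (((EFin \o g) \_ (line E y)) t))%E.
  apply/funext => t; rewrite !patchE /= (_ : ((y, t) \in E) = (t \in line E y)).
    by case: ifP => _; rewrite ?mule0// EFinM.
  by apply/idP/idP; rewrite !inE.
have il : lam.-integrable (line E y) (EFin \o g).
  by apply: integrableS ig => //; exact: measurable_line.
rewrite integralZl//; last by apply/(integrable_mkcond _ (measurable_line y mE)).
rewrite -integral_mkcond EFinM fineK//.
by apply: integrable_fin_num => //; exact: measurable_line.
Qed.

Variables (J : nat) (a b : 'I_J -> R).
Hypothesis disj : forall i j u, a i < u < b i -> a j < u < b j -> i = j.

(** The support of the bump with these parameters lies in the interval j. [None] is the zero
    function, used on the lines along which E is constant in that interval. *)
Definition valid (j : 'I_J) (o : option (rat * rat * nat)) : bool :=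
  if o is Some (s, t, k) then
    [&& a j < ratr s, ratr s + k.+1%:R^-1 < b j, a j < ratr t & ratr t + k.+1%:R^-1 < b j]
  else false.

Definition obump (o : option (rat * rat * nat)) : R -> R :=
  if o is Some (s, t, k) then bump (ratr s) (ratr t) k.+1%:R^-1 else (fun=> 0).

Definition okern (o : option (rat * rat * nat)) : R -> R :=
  if o is Some (s, t, k) then
    (fun u => kern (ratr t) k.+1%:R^-1 u - kern (ratr s) k.+1%:R^-1 u) else (fun=> 0).

Definition vb (j : 'I_J) o : R -> R := if valid j o then obump o else (fun=> 0).
Definition vk (j : 'I_J) o : R -> R := if valid j o then okern o else (fun=> 0).

(** A numbering of all the choices, for each interval, of one bump or none; numbers that encode
    nothing give the choice of no bump. *)
Definition fam (m : nat) : {ffun 'I_J -> option (rat * rat * nat)} :=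
  odflt [ffun=> None] (unpickle m).

Definition gm m (u : R) : R := \sum_j vb j (fam m j) u.
Definition km m (u : R) : R := \sum_j vk j (fam m j) u.

Let k0 (k : nat) : 0 < k.+1%:R^-1 :> R. Proof. by rewrite invr_gt0. Qed.

Lemma C1_vb j o : C1 (vb j o).
Proof.
rewrite /vb; case: ifP => // _; last exact: C1_cst.
by case: o => [[[s t] k]|] /=; [exact: C1_bump|exact: C1_cst].
Qed.

Lemma derive_vb j o u : 'D_1 (vb j o) u = vk j o u.
Proof.
rewrite /vb /vk; case: ifP => // _; last exact: derive_cst.
by case: o => [[[s t] k]|] /=; [exact: derive_bump|exact: derive_cst].
Qed.

Lemma C1_gm m : C1 (gm m).
Proof. by apply: C1_sum => j _; exact: C1_vb. Qed.

Lemma derive_gm m u : 'D_1 (gm m) u = km m u.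
Proof.
rewrite derive_sum'; last by move=> j _; exact: C1_vb.
by apply: eq_bigr => j _; rewrite derive_vb.
Qed.

Lemma vb_le1 j o u : `|vb j o u| <= 1.
Proof.
rewrite /vb; case: ifP => _; last by rewrite normr0.
case: o => [[[s t] k]|] /=; last by rewrite normr0.
rewrite /bump ler_norml.
have := step_ge0 (k.+1%:R^-1^-1 * (u - ratr t)); have := step_ge0 (k.+1%:R^-1^-1 * (u - ratr s)).
by move: (step _) (step _) => x y /andP[? ?] /andP[? ?]; apply/andP; split; lra.
Qed.

Definition osupp (o : option (rat * rat * nat)) : set R :=
  if o is Some (s, t, k) then
    [set` `[Num.min (ratr s) (ratr t), Num.max (ratr s) (ratr t) + k.+1%:R^-1]]
  else set0.

Lemma vb_out j o u : ~ osupp o u -> vb j o u = 0.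
Proof.
rewrite /vb; case: ifP => // _.
case: o => [[[s t] k]|] //= /negP; rewrite in_itv/= negb_and -!ltNge /bump => /orP[].
  have P (z : R) : u < z -> step (k.+1%:R^-1^-1 * (u - z)) = 0.
    by move=> uz; apply: step_le0; apply: mulr_ge0_le0; rewrite ?invr_ge0// subr_le0 ltW.
  by rewrite lt_min => /andP[h1 h2]; rewrite !P// subrr.
have P (z : R) : z + k.+1%:R^-1 < u -> step (k.+1%:R^-1^-1 * (u - z)) = 1.
  by move=> uz; apply: step_ge1; rewrite mulrC ler_pdivlMr// mul1r lerBrDl ltW.
by rewrite -ltrBrDr gt_max !ltrBrDr => /andP[h1 h2]; rewrite !P// subrr.
Qed.

Lemma osupp_sub j o : valid j o -> osupp o `<=` [set` `]a j, b j[].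
Proof.
case: o => [[[s t] k]|] // /and4P[h1 h2 h3 h4] u /=; rewrite !in_itv/= => /andP[u1 u2].
apply/andP; split; first by apply: lt_le_trans u1; rewrite lt_min h1 h3.
by apply: le_lt_trans u2 _; rewrite -ltrBrDr gt_max !ltrBrDr h2 h4.
Qed.

Lemma vb_neq0 j o u : vb j o u != 0 -> a j < u < b j.
Proof.
move=> h; have v : valid j o by move: h; rewrite /vb; case: ifP; rewrite ?eqxx.
have : osupp o u by apply: contrapT => /(vb_out j) E; rewrite E eqxx in h.
by move=> /(osupp_sub v); rewrite /= in_itv.
Qed.

(** The intervals being disjoint, at most one bump is nonzero at each height. This is why a line may
    be counted once for every interval in which E changes, at the price of a single unit field. *)
Lemma gm_le1 m u : `|gm m u| <= 1.
Proof.
have [[j hj]|nj] := pselect (exists j, vb j (fam m j) u != 0); last first.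
  rewrite /gm big1 ?normr0// => j _; apply/eqP/negP => /negP h; apply: nj; by exists j.
rewrite /gm (bigD1 j)//= big1 ?addr0; first exact: vb_le1.
move=> i ij; apply/eqP; apply: contraT => hi.
by have := disj (vb_neq0 hi) (vb_neq0 hj) => E; rewrite E eqxx in ij.
Qed.

Definition gsupp m : set R := \big[setU/set0]_(j | valid j (fam m j)) osupp (fam m j).

Lemma compact_gsupp m : compact (gsupp m).
Proof.
rewrite /gsupp; apply: (big_ind compact) => [|A B|j _].
- exact: compact0.
- exact: compactU.
- case: (fam m j) => [[[s t] k]|] /=; [exact: segment_compact|exact: compact0].
Qed.

Lemma gsupp_sub m : gsupp m `<=` [set u | exists j, a j < u < b j].
Proof.
rewrite /gsupp; apply: (big_ind (fun A => A `<=` [set u | exists j, a j < u < b j])).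
- exact: sub0set.
- by move=> A B; rewrite subUset.
- by move=> j v u /(osupp_sub v); rewrite /= in_itv/= => h; exists j.
Qed.

Lemma gm_out m u : ~ gsupp m u -> gm m u = 0.
Proof.
move=> h; rewrite /gm big1// => j _.
have [v|v] := boolP (valid j (fam m j)); last by rewrite /vb (negbTE v).
by apply: vb_out => o; apply: h; rewrite /gsupp (bigD1 j)//; left.
Qed.

Lemma okern_integrable o (S : set mR) : measurable S -> lam.-integrable S (EFin \o okern o).
Proof.
move=> mS; case: o => [[[s t] k]|] /=; last exact: integrable0.
have -> : EFin \o (fun u : R => kern (ratr t) k.+1%:R^-1 u - kern (ratr s) k.+1%:R^-1 u) =
  ((EFin \o kern (ratr t) k.+1%:R^-1) \- (EFin \o kern (ratr s) k.+1%:R^-1))%E by [].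
by apply: integrableB => //; exact: kern_integrable.
Qed.

Lemma vk_integrable j o (S : set mR) : measurable S -> lam.-integrable S (EFin \o vk j o).
Proof.
move=> mS; rewrite /vk; case: ifP => _; last exact: integrable0.
exact: okern_integrable.
Qed.

Lemma km_integrable m (S : set mR) : measurable S -> lam.-integrable S (EFin \o km m).
Proof.
move=> mS.
have -> : EFin \o km m = (fun u => \sum_(j <- index_enum 'I_J) (EFin \o vk j (fam m j)) u)%E.
  by apply/funext => u /=; rewrite /km sumEFin.
by apply: integrable_sum => // j _; exact: vk_integrable.
Qed.

Definition hm (E : set V) m (y : X) : R := \int[lam]_(t in line E y) km m t.

Lemma hm_sum E m y : measurable E -> hm E m y = \sum_j \int[lam]_(t in line E y) vk j (fam m j) t.
Proof.
move=> mE; have mL := measurable_line y mE.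
by apply: Rintegral_sum => // j; exact: vk_integrable.
Qed.

Lemma hm_bound E m y : measurable E -> `|hm E m y| <= \int[lam]_t `|km m t|.
Proof.
move=> mE; have mL := measurable_line y mE.
apply: le_trans (le_normr_Rintegral mL (km_integrable m mL)) _.
rewrite [leLHS]Rintegral_mkcond; apply: le_Rintegral => //.
- have := integrable_norm (km_integrable m mL).
  by rewrite (integrable_mkcond _ mL) -restrict_EFin.
- exact: (integrable_norm (km_integrable m measurableT)).
- by move=> t _; rewrite patchE; case: ifP => // _; exact: normr_ge0.
Qed.

Lemma measurable_hm E m : measurable E -> measurable_fun setT (hm E m).
Proof.
move=> mE.
pose F (p : V) := ((EFin \o (fun p : V => km m p.2)) \_ E) p.
have mk : measurable_fun [set: mR] (km m).
  by have /integrableP[/measurable_EFinP] := km_integrable m measurableT.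
have mF : measurable_fun [set: V] F.
  apply/(measurable_restrictT _ mE); apply: measurable_funTS; apply/measurable_EFinP.
  exact: (measurableT_comp mk measurable_snd).
have mp : measurable_fun setT (fun y => \int[lam]_t (F^\+ (y, t)))%E.
  apply: measurable_fun_fubini_tonelli_F => //; exact: measurable_funepos.
have mn : measurable_fun setT (fun y => \int[lam]_t (F^\- (y, t)))%E.
  apply: measurable_fun_fubini_tonelli_F => //; exact: measurable_funeneg.
rewrite (_ : hm E m = fun y => fine ((\int[lam]_t (F^\+ (y, t))) - (\int[lam]_t (F^\- (y, t))))%E).
  by apply: measurableT_comp; [exact: fine_measurable|exact: emeasurable_funB].
apply/funext => y; rewrite /hm /Rintegral integral_mkcond integralE; congr (fine (_ - _))%E;
  apply: eq_integral => t _; rewrite ?funeposE ?funenegE /F !patchE;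
  by rewrite (_ : ((y, t) \in E) = (t \in line E y))//; apply/idP/idP; rewrite !inE.
Qed.

Definition cnt (E : set V) (y : X) : R := \sum_j \1_(NC E (a j) (b j)) y.

Lemma measurable_cnt E : measurable E -> measurable_fun setT (cnt E).
Proof.
by move=> mE; apply: measurable_sum => j; apply: measurable_indic; exact: measurable_NC.
Qed.

(** In each interval where E is not constant on the line a bump from [nc_bump] is taken, in the
    others none; the number of this choice is the index. *)
Lemma hm_cnt E y (e : R) : measurable E -> 0 < e -> exists m, (1 - e) * cnt E y <= hm E m y.
Proof.
move=> mE e0; have mL := measurable_line y mE.
have H j : exists o, (1 - e) * \1_(NC E (a j) (b j)) y <= \int[lam]_(t in line E y) vk j o t.
  have [[h1 h2]|h] := pselect (NC E (a j) (b j) y); last first.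
    exists None; rewrite indicE memNset// mulr0 /vk/=.
    by rewrite Rintegral_cst// mul0r.
  have [s [t [k [h3 h4 h5 h6 h7]]]] := nc_bump mL h1 h2 e0.
  exists (Some (s, t, k)); rewrite indicE mem_set// mulr1.
  by rewrite /vk /valid h3 h4 h5 h6.
pose o j := sval (cid (H j)).
exists (pickle [ffun j => o j]); rewrite hm_sum// /cnt mulr_sumr; apply: ler_sum => j _.
by rewrite /fam pickleK /= ffunE /o; case: cid.
Qed.

Variables (alpha beta : 'I_n -> R).
Hypothesis ab : forall i, alpha i <= beta i.
Definition cbox : set X := box (fun i => [set` `[alpha i, beta i]]).

Lemma compact_cbox : compact cbox.
Proof. by apply: (rV_compact (A := fun i => [set` `[alpha i, beta i]])) => i; exact: segment_compact. Qed.

Lemma measurable_cbox : measurable cbox.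
Proof. by apply: measurable_box => i; exact: measurable_itv. Qed.

Lemma leb_cbox : (leb cbox < +oo)%E.
Proof. by rewrite leb_itv// ltry. Qed.

Variables (E : set V) (chi : X -> R) (C : R).
Hypothesis mE : measurable E.
Hypothesis cchi : C1 chi.
Hypothesis chi01 : forall y, 0 <= chi y <= 1.
Hypothesis chi0 : forall y, ~ cbox y -> chi y = 0.
Hypothesis HC : forall xi : V -> R, C1 xi -> (forall p, `|xi p| <= 1) ->
  (exists K : set V, [/\ compact K, (forall p, K p -> cbox p.1 /\ exists j, a j < p.2 < b j) &
     forall p, ~ K p -> xi p = 0]) -> Int E (del None xi) <= C.

Lemma C1_prodfun (u : X -> R) (g : R -> R) : C1 u -> C1 g ->
  C1 (fun p : V => u p.1 * g p.2).
Proof.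
move=> cu cg.
have c1 : C1 (fun p : V => u p.1).
  apply: (@C1_comp_lin R V X R fst u); last exact: cu.
  by move=> p; exact: cvg_fst.
have c2 : C1 (fun p : V => g p.2).
  apply: (@C1_comp_lin R V R R (@comp R n None) g); last exact: cg.
  exact: continuous_comp_coord.
exact: (C1M c1 c2).
Qed.

Lemma del_prodfun (u : X -> R) (g : R -> R) (p : V) : C1 u -> C1 g ->
  del None (fun p : V => u p.1 * g p.2) p = u p.1 * 'D_1 g p.2.
Proof.
move=> cu cg.
have cf : continuous (fst : V -> X) by move=> q; exact: cvg_fst.
have c1 : C1 (fun p : V => u p.1) by exact: (@C1_comp_lin R V X R fst u).
have cs := @continuous_comp_coord R n None.
have c2 : C1 (fun p : V => g p.2) by exact: (@C1_comp_lin R V R R (@comp R n None) g).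
rewrite /del (deriveM' _ _ c1 c2).
rewrite [X in _ * X + _](@derive_comp_lin R V R R (@comp R n None) g p _ cs cg).
rewrite [X in _ + _ * X](@derive_comp_lin R V X R fst u p _ cf cu).
by rewrite derive0 mulr0 addr0.
Qed.

(** With smooth weights in place of the indicators, the integral is that of the vertical derivative
    of the sum of the products of [chi], a weight and a [gm]. Since the weights add up to at most 1,
    this sum is an admissible test function. *)
Lemma lines_partition M (P : nat -> set X) : (forall m, measurable (P m)) -> trivIset setT P ->
  \int[leb]_(y in cbox) (chi y * \sum_(m < M) \1_(P m) y * hm E m y) <= C.
Proof.
move=> mP tP.
have mchi : measurable_fun cbox chi.
  by apply: measurable_funTS; apply: continuous_measurable_rV; exact: (C1_continuous cchi).
apply: (@partition_bound R n cbox measurable_cbox leb_cbox (hm E) (fun m => \int[lam]_t `|km m t|)) => //.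
- by move=> m; apply: measurable_funTS; exact: measurable_hm.
- by move=> m x; exact: hm_bound.
move=> {M P mP tP} M bb cb b0 b1.
pose xi (p : V) := \sum_(m < M) (chi p.1 * bb m p.1) * gm m p.2.
have cu m : C1 (fun y => chi y * bb m y) by apply: C1M; [exact: cchi|exact: cb].
have cxi m : C1 (fun p : V => (chi p.1 * bb m p.1) * gm m p.2).
  exact: (C1_prodfun (cu m) (C1_gm m)).
have Dxi p : del None xi p = \sum_(m < M) (chi p.1 * bb m p.1) * km m p.2.
  rewrite /del /xi derive_sum'; last by move=> m _; exact: cxi.
  apply: eq_bigr => m _.
  by rewrite -derive_gm; exact: (@del_prodfun (fun y => chi y * bb m y) (gm m) p (cu m) (C1_gm m)).
have ck m : continuous (km m).
  rewrite (_ : km m = (fun u => 'D_1 (gm m) u)); first exact: (C1_gm m).2.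
  by apply/funext => u; rewrite derive_gm.
have km0 m u : ~ gsupp m u -> km m u = 0.
  move=> h; rewrite -derive_gm.
  suff -> : 'D_1 (gm m) u = 'D_1 (cst 0) u by exact: derive_cst.
  apply: near_eq_derive.
  have oK : open (~` gsupp m) by apply: closed_openC; apply: compact_closed; [exact: Rhausdorff|exact: compact_gsupp].
  near=> q; apply: gm_out; near: q; exact: open_nbhs_nbhs.
have ccp m : cc (fun p : V => (chi p.1 * bb m p.1) * km m p.2).
  split.
    move=> p; apply: cvgM.
      apply: (@continuous_comp _ _ _ fst (fun y => chi y * bb m y)); first exact: cvg_fst.
      exact: (C1_continuous (cu m)).
    apply: (@continuous_comp _ _ _ (fun p : V => p.2 : R) (km m)); first exact: continuous_snd1.
    exact: ck.
  exists (cbox `*` (gsupp m)); split; first by apply: compact_setX; [exact: compact_cbox|exact: compact_gsupp].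
  move=> p h; have [h1|h1] := pselect (cbox p.1); last by rewrite chi0// !mul0r.
  by rewrite km0 ?mulr0// => h2; apply: h; split.
have H := HC (_ : C1 xi) _ _.
have {H} : Int E (del None xi) <= C.
  apply: H.
  - by apply: C1_sum => m _; exact: cxi.
  - move=> p; rewrite /xi; apply: le_trans (ler_norm_sum _ _ _) _.
    apply: (@le_trans _ _ (\sum_(m < M) bb m p.1)); last exact: b1.
    apply: ler_sum => m _; rewrite !normrM (ger0_norm (b0 _ _)).
    have /andP[c0 c1] := chi01 p.1; rewrite (ger0_norm c0).
    have g1 := gm_le1 m p.2; have g0 := normr_ge0 (gm m p.2); have bb0 := b0 m p.1.
    move: (chi p.1) c0 c1 (`|gm m p.2|) g1 g0 (bb m p.1) bb0 => x x0 x1 y y1 y0 z z0.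
    by rewrite mulrAC ler_piMl// -[leRHS](mulr1 1) ler_pM.
  - exists (cbox `*` \big[setU/set0]_(m < M) gsupp m); split.
    + apply: compact_setX; first exact: compact_cbox.
      apply: (big_ind compact) => [|A B|j _]; [exact: compact0|exact: compactU|exact: compact_gsupp].
    + move=> p [h1 h2]; split => //; move: h2; rewrite -bigcup_mkord => -[m /= _].
      exact: gsupp_sub.
    + move=> p h; rewrite /xi big1// => m _.
      have [h1|h1] := pselect (cbox p.1); last by rewrite chi0// !mul0r.
      rewrite gm_out ?mulr0// => h2; apply: h; split => //.
      by rewrite -bigcup_mkord; exists m => //=.
rewrite (_ : del None xi = fun p => \sum_(m < M) (chi p.1 * bb m p.1) * km m p.2); last exact/funext.
rewrite Int_sum//; apply: le_trans.
have mI (m : 'I_M) : Int E (fun p : V => (chi p.1 * bb m p.1) * km m p.2) = \int[leb]_(y in cbox) (chi y * (bb m y * hm E m y)).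
  rewrite (@Int_prod E (fun y => chi y * bb m y) (km m) mE (ccp m)); last exact: km_integrable.
  rewrite [RHS]Rintegral_mkcond; apply: eq_Rintegral => y _.
  rewrite patchE; case: ifPn => [|/negP h]; first by rewrite mulrA.
  by rewrite chi0 ?mul0r// => h'; apply: h; rewrite inE.
rewrite (eq_bigr _ (fun m _ => mI m)).
have int (m : 'I_M) : leb.-integrable cbox (EFin \o (fun y => chi y * (bb m y * hm E m y))).
  apply: (@integrable_bounded R n cbox measurable_cbox leb_cbox _ (\int[lam]_t `|km m t|)).
    apply: measurable_funM => //; apply: measurable_funM.
      by apply: measurable_funTS; apply: continuous_measurable_rV; exact: (C1_continuous (cb m)).
    by apply: measurable_funTS; exact: measurable_hm.
  move=> y; rewrite !normrM.
  have /andP[c0 c1] := chi01 y; rewrite (ger0_norm c0) (ger0_norm (b0 _ _)).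
  have bm1 : bb m y <= 1.
    by apply: le_trans (b1 y); rewrite (bigD1 m)//= lerDl sumr_ge0.
  have hb := hm_bound m y mE.
  apply: le_trans hb; rewrite mulrA ler_piMl// -[leRHS](mulr1 1) ler_pM//.
rewrite -Rintegral_sum//; last exact: measurable_cbox.
by rewrite le_eqVlt; apply/orP; left; apply/eqP; apply: eq_Rintegral => y _; rewrite mulr_sumr.
Unshelve. all: by end_near. Qed.

(* The one-dimensional test function which detects a change on a given line is taken in a
   countable family; the first index that works is a measurable function of the line, and
   [partition_bound] smooths this choice into a genuine test field. *)
Lemma lines_bound : \int[leb]_(y in cbox) (chi y * cnt E y) <= C.
Proof.
have mchi : measurable_fun cbox chi.
  by apply: measurable_funTS; apply: continuous_measurable_rV; exact: (C1_continuous cchi).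
have mcnt := measurable_cnt mE.
have cnt0 y : 0 <= cnt E y by apply: sumr_ge0 => j _.
have cntJ y : cnt E y <= J%:R.
  rewrite -[leRHS]mulr1 mulr_natl -[X in _ *+ X](card_ord J) -sumr_const; apply: ler_sum => j _.
  by rewrite indicE; case: (_ \in _).
suff H e : 0 < e -> (1 - e) * \int[leb]_(y in cbox) (chi y * cnt E y) <= C.
  set I0 := \int[leb]_(y in cbox) (chi y * cnt E y) in H *.
  have I00 : 0 <= I0 by apply: Rintegral_ge0 => y _; rewrite mulr_ge0//; have /andP[] := chi01 y.
  apply/ler_addgt0Pr => d d0.
  have I1 : 0 < I0 + 1 by rewrite ltr_wpDl.
  have := H (d / (I0 + 1)) (divr_gt0 d0 I1).
  rewrite mulrBl mul1r lerBlDr => /le_trans; apply.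
  by rewrite lerD2l mulrAC ler_pdivrMr// ler_wpM2l ?(ltW d0)// lerDl.
move=> e0.
pose B m := [set y | (1 - e) * cnt E y <= hm E m y].
have mB m : measurable (B m).
  rewrite (_ : B m = setT `&` (fun y => hm E m y - (1 - e) * cnt E y) @^-1` [set` `[0, +oo[]).
    have mh : measurable_fun setT (fun y => hm E m y - (1 - e) * cnt E y).
      by apply: measurable_funB; [exact: measurable_hm|exact: measurable_funM].
    by apply: mh => //; exact: measurable_itv.
  by rewrite setTI; apply/seteqP; split => y; rewrite /B /= in_itv/= andbT subr_ge0.
pose P := seqDU B.
have mP m : measurable (P m) by rewrite /P /seqDU; apply: measurableD => //; apply: bigsetU_measurable => i _; exact: mB.
have tP : trivIset setT P by exact: trivIset_seqDU.
have UP : \bigcup_m P m = setT.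
  rewrite /P -seqDU_bigcup_eq -subTset => y _.
  by have [m hm] := hm_cnt y mE e0; exists m.
pose f (M : nat) (y : X) := chi y * \sum_(m < M) \1_(P m) y * ((1 - e) * cnt E y).
have m1 m : measurable_fun cbox (\1_(P m) : X -> R).
  by apply: measurable_funTS; exact: measurable_indic.
have mf M : measurable_fun cbox (f M).
  apply: measurable_funM => //; apply: measurable_sum => m; apply: measurable_funM => //.
  by apply: measurable_funM => //; exact: measurable_funTS.
have S1 M y : 0 <= \sum_(m < M) (\1_(P m) y : R) <= 1.
  rewrite sumr_ge0//=.
  have [[m Pm]|nP] := pselect (exists m : 'I_M, P m y); last first.
    rewrite big1 ?ler01// => m _; rewrite indicE memNset// => h; apply: nP; by exists m.
  rewrite (bigD1 m)//= big1 ?addr0; first by rewrite indicE; case: (_ \in _).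
  move=> i im; rewrite indicE memNset// => Pi.
  have /trivIsetP := tP => /(_ i m I I im); rewrite -subset0 => /(_ y); apply; by split.
have fE M y : f M y = (\sum_(m < M) \1_(P m) y) * (chi y * ((1 - e) * cnt E y)).
  by rewrite /f -mulr_suml mulrCA.
have fb M y : `|f M y| <= `|1 - e| * J%:R.
  rewrite fE !normrM.
  have /andP[s0 s1] := S1 M y; have /andP[c0 c1] := chi01 y.
  rewrite (ger0_norm s0) (ger0_norm c0) (ger0_norm (cnt0 y)).
  rewrite mulrA; apply: (@le_trans _ _ (`|1 - e| * cnt E y)); last by rewrite ler_wpM2l.
  by rewrite ler_piMl ?mulr_ge0// -[leRHS](mulr1 1) ler_pM.
have fi M := integrable_bounded measurable_cbox leb_cbox (mf M) (fb M).
have fC M : \int[leb]_(y in cbox) f M y <= C.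
  apply: le_trans (lines_partition M mP tP); apply: le_Rintegral => //.
  - exact: measurable_cbox.
  - apply: (@integrable_bounded R n cbox measurable_cbox leb_cbox _ (\sum_(m < M) \int[lam]_t `|km m t|)).
      apply: measurable_funM => //; apply: measurable_sum => m; apply: measurable_funM => //.
      by apply: measurable_funTS; exact: measurable_hm.
    move=> y; rewrite normrM; have /andP[c0 c1] := chi01 y; rewrite (ger0_norm c0).
    apply: (@le_trans _ _ `|\sum_(m < M) \1_(P m) y * hm E m y|); first by rewrite ler_piMl.
    apply: le_trans (ler_norm_sum _ _ _) _; apply: ler_sum => m _.
    rewrite normrM -[leRHS]mul1r ler_pM//; last exact: hm_bound.
    by rewrite indicE; case: (_ \in _); rewrite ?normr1 ?normr0.
  - move=> y _; rewrite /f ler_wpM2l//; first by have /andP[] := chi01 y.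
    apply: ler_sum => m _; rewrite indicE; have [Pm|_] := boolP (y \in P m); last by rewrite !mul0r.
    by rewrite !mul1r; rewrite inE in Pm; have := subset_seqDU Pm.
have cv : (\int[leb]_(y in cbox) (f M y)%:E @[M --> \oo] --> \int[leb]_(y in cbox) (chi y * ((1 - e) * cnt E y))%:E)%E.
  have [] := @dominated_convergence _ _ _ leb cbox measurable_cbox (fun M y => (f M y)%:E)
    (fun y => (chi y * ((1 - e) * cnt E y))%:E) (fun=> (`|1 - e| * J%:R)%:E).
  - by move=> M; apply/measurable_EFinP; exact: mf.
  - apply/measurable_EFinP; apply: measurable_funM => //.
    by apply: measurable_funM => //; exact: measurable_funTS.
  - apply: aeW => y _.
    have [m _ Pm] : (\bigcup_m P m) y by rewrite UP.
    apply: cvg_near_cst; near=> M; congr EFin; rewrite fE.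
    have mM : (m < M)%N by near: M; exact: nbhs_infty_gt.
    have E1 : 1 <= \sum_(m < M) (\1_(P m) y : R).
      rewrite (bigD1 (Ordinal mM))//= indicE mem_set// lerDl; exact: sumr_ge0.
    have /andP[_ E2] := S1 M y.
    have -> : \sum_(m < M) (\1_(P m) y : R) = 1 by apply/eqP; rewrite eq_le E1 E2.
    by rewrite mul1r.
  - exact: (integrable_cst_fin _ measurable_cbox leb_cbox).
  - by apply: aeW => y M _; rewrite /= lee_fin.
  by [].
rewrite -RintegralZl; [|exact: measurable_cbox|]; last first.
  apply: (@integrable_bounded R n cbox measurable_cbox leb_cbox _ J%:R).
    by apply: measurable_funM => //; exact: measurable_funTS.
  move=> y; have /andP[c0 c1] := chi01 y.
  by rewrite normrM (ger0_norm c0) (ger0_norm (cnt0 y)) -[leRHS]mul1r ler_pM.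
rewrite (_ : (fun x => _) = (fun y => chi y * ((1 - e) * cnt E y))); last first.
  by apply/funext => y; rewrite mulrCA.
rewrite /Rintegral -lee_fin fineK; last first.
  apply: (@integrable_fin_num _ _ _ leb cbox); first exact: measurable_cbox.
  apply: (@integrable_bounded R n cbox measurable_cbox leb_cbox _ (`|1 - e| * J%:R)).
    apply: measurable_funM => //.
    by apply: measurable_funM => //; exact: measurable_funTS.
  move=> y; have /andP[c0 c1] := chi01 y.
  rewrite !normrM (ger0_norm c0) (ger0_norm (cnt0 y)).
  by rewrite -[leRHS]mul1r ler_pM ?mulr_ge0// ler_wpM2l.
rewrite -(cvg_lim (@ereal_hausdorff R) cv); apply: lime_le.
  by apply/cvg_ex; eexists; exact: cv.
apply: nearW => M; have := fC M; rewrite /Rintegral -lee_fin fineK//.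
exact: (integrable_fin_num measurable_cbox (fi M)).
Unshelve. all: by end_near. Qed.

End lines.

(** * Variation in a coordinate direction *)

Section directions.
Variables (R : realType) (n : nat).
Local Notation mR := (measurableTypeR R).
Local Notation lam := (@lebesgue_measure R).
Local Notation X := 'rV[R]_n.
Local Notation V := (Rn1 R n).
Local Notation leb := (leb R n).
Local Notation vol := (vol R n).
Local Notation Om := (@Omega R n).

Lemma lt_limn_einf (u : (\bar R)^nat) (c : \bar R) : (c < limn_einf u)%E -> \forall k \near \oo, (c < u k)%E.
Proof.
rewrite limn_einf_lim => h.
have hc : einfs u @ \oo --> limn (einfs u) by exact: is_cvg_einfs.
have hk : \forall k \near \oo, (c < einfs u k)%E.
  exact: (hc [set x | (c < x)%E] (open_nbhs_nbhs (conj (@open_ereal_gt_ereal _ c) h))).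
near=> k; apply: (@lt_le_trans _ _ (einfs u k)); first by near: k.
by rewrite /einfs; apply: ereal_inf_lbound; exists k => /=.
Unshelve. all: by end_near. Qed.

Lemma limn_einf_le_cst (u : (\bar R)^nat) (c : \bar R) : (forall k, (u k <= c)%E) -> (limn_einf u <= c)%E.
Proof.
move=> uc; rewrite leNgt; apply/negP => /lt_limn_einf [k _ /(_ k (leqnn k))].
by rewrite ltNge uc.
Qed.

Definition Hl (l : R) : set V := [set p : V | l < p.2].

Lemma HlE l : Hl l = (fun p : V => p.2 : R) @^-1` [set t | l < t]. Proof. by []. Qed.

Lemma measurable_Hl l : measurable (Hl l).
Proof.
apply: open_measurable_Rn1; rewrite HlE; apply: open_comp => //= p _; exact: continuous_snd1.
Qed.

Lemma swap_is_linear (i : option 'I_n) : linear (@swap R n i).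
Proof.
case: i => [i|] // a [x s] [y t]; rewrite /swap/=; congr pair; last by rewrite !mxE.
by apply/rowP => j; rewrite !mxE; case: eqP.
Qed.

HB.instance Definition _ (i : option 'I_n) := GRing.isLinear.Build R V V _ (@swap R n i) (swap_is_linear i).

Lemma continuous_swap (i : option 'I_n) : continuous (@swap R n i).
Proof.
rewrite (_ : swap i = mkf (fun j p => comp j (swap i p))); last first.
  apply/funext => p; rewrite /mkf [LHS]surjective_pairing; congr pair => //.
  by apply/rowP => j; rewrite !mxE.
apply: (@C1_continuous R V V); apply: C1_mkf => j.
case: i => [i|]; last exact: C1_coord.
case: j => [j|]; last exact: (@C1_coord R n (Some i)).
have [ji|ji] := eqVneq j i.
  rewrite (_ : (fun p => _) = @comp R n None); first exact: C1_coord.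
  by apply/funext => p; rewrite /comp/= mxE ji eqxx.
rewrite (_ : (fun p => _) = @comp R n (Some j)); first exact: C1_coord.
by apply/funext => p; rewrite /comp/= mxE (negbTE ji).
Qed.

Lemma swap_dirv (i : option 'I_n) : swap i (dirv R i) = dirv R None.
Proof.
case: i => [i|] //; rewrite /swap /dirv/=; congr pair; last by rewrite mxE !eqxx.
by apply/rowP => j; rewrite !mxE; case: eqP => //= _; rewrite andbF.
Qed.

Lemma del_swap (i : option 'I_n) (xi : V -> R) p : C1 xi ->
  del i (xi \o swap i) p = del None xi (swap i p).
Proof.
move=> cxi; rewrite /del.
have -> := @derive_comp_lin R V V R (@swap R n i) xi p (dirv R i) (@continuous_swap i) cxi.
by have -> : (@swap R n i : {linear V -> V}) (dirv R i) = dirv R None := swap_dirv i.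
Qed.

Lemma Int_swap (i : option 'I_n) (E : set V) (g : V -> R) : measurable E -> cc (g \o swap i) ->
  Int (swap i @^-1` E) g = Int E (g \o swap i).
Proof.
move=> mE cg; rewrite /Int /Rintegral; congr fine.
have ms := @measurable_swap R n i.
have mg : measurable_fun setT (EFin \o (g \o swap i)) by apply/measurable_EFinP; exact: cc_measurable.
have mE' := measurable_swap_preimage i mE.
transitivity (\int[pushforward vol (swap i)]_(p in E) ((g \o swap i) p)%:E)%E; last first.
  by apply: eq_measure_integral => A mA _; rewrite /pushforward/=; exact: vol_swap.
have gE : (EFin \o (g \o swap i)) \o swap i = EFin \o g by apply/funext => p /=; rewrite swapK.
have ig : vol.-integrable (swap i @^-1` E) ((EFin \o (g \o swap i)) \o swap i); last first.
  have -> := @integral_pushforward _ _ _ _ _ _ ms vol E (EFin \o (g \o swap i)) mg ig mE.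
  by apply: eq_integral => p _ /=; rewrite swapK.
rewrite gE; apply: cc_integrable => //.
case: cg => cg [K [cK K0]]; split.
  have -> : g = (g \o swap i) \o swap i by apply/funext => p /=; rewrite swapK.
  by move=> p; apply: (@continuous_comp _ _ _ (swap i) (g \o swap i)); [exact: continuous_swap|exact: cg].
exists (swap i @` K); split.
  by apply: continuous_compact => //; apply: continuous_subspaceT; exact: continuous_swap.
move=> p Kp; have := K0 (swap i p); rewrite /= swapK; apply => Ks; apply: Kp.
by exists (swap i p) => //; rewrite swapK.
Qed.

(* The variation of [E] in the direction [i] above height [l] is at most [C]. *)
Definition HV (E : set V) (i : option 'I_n) (l C : R) := forall xi : V -> R, C1 xi ->
  (forall p, `|xi p| <= 1) ->
  (exists K : set V, [/\ compact K, K `<=` Hl l & forall p, ~ K p -> xi p = 0]) ->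
  Int E (del i xi) <= C.

Lemma testf_dir (U : set V) (i : option 'I_n) (xi : V -> R) : C1 xi -> (forall p, `|xi p| <= 1) ->
  (exists K : set V, [/\ compact K, K `<=` U & forall p, ~ K p -> xi p = 0]) ->
  testf U (fun j => if j == i then xi else (fun=> 0)).
Proof.
move=> cxi x1 [K [cK KU K0]]; split.
- by move=> j; case: eqP => _; [exact: cxi|exact: C1_cst].
- move=> p; rewrite (bigD1 i)//= eqxx big1 ?addr0; last by move=> j /negbTE ->; rewrite expr0n.
  by rewrite -real_normK ?num_real// expr_le1// x1.
- by exists K; split => // p Kp j; case: eqP => // _; exact: K0.
Qed.

Lemma dive_dir (i : option 'I_n) (xi : V -> R) :
  dive (fun j => if j == i then xi else (fun=> 0)) = del i xi.
Proof.
apply/funext => p; rewrite /dive (bigD1 i)//= eqxx big1 ?addr0// => j /negbTE ->.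
exact: derive_cst.
Qed.

Lemma Hl0 : Hl 0 = Om. Proof. by []. Qed.

Lemma BV_HV E i : BVset E -> HV E i 0 (Per E).
Proof.
move=> bE xi cxi x1 K; rewrite -dive_dir; apply: Per_lb => //.
by apply: testf_dir => //; rewrite -Hl0.
Qed.

Definition sqn (y : X) : R := \sum_i y ord0 i ^+ 2.

Lemma C1_coordX (i : 'I_n) : C1 (fun x : X => x ord0 i).
Proof.
pose L : X -> R := fun x => x ord0 i.
have lL : linear L by move=> c x y; rewrite /L !mxE.
pose h := GRing.isLinear.Build R X R _ L lL.
pose L' : {linear X -> R} := HB.pack L h.
by apply: (@C1_lin _ _ _ L'); exact: coord_continuous.
Qed.

Lemma C1_sqn : C1 sqn.
Proof.
apply: C1_sum => i _; under eq_fun do rewrite expr2.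
by apply: C1M; exact: C1_coordX.
Qed.

Lemma sqn_ge (y : X) i : y ord0 i ^+ 2 <= sqn y.
Proof. by rewrite /sqn (bigD1 i)//= lerDl; apply: sumr_ge0 => j _; exact: sqr_ge0. Qed.

(** After the exchange of a horizontal coordinate i with the height, the height is the coordinate i
    of the base point y. The second factor keeps it above l, where test functions must live; for i =
    None the height is the variable along the line. *)
Definition cutX (i : option 'I_n) (l : R) (k : nat) (y : X) : R :=
  step (k%:R ^+ 2 - sqn y) * (if i is Some i then step (k.+1%:R * (y ord0 i - l) - 1) else 1).

Lemma C1_cutX i l k : C1 (cutX i l k).
Proof.
apply: C1M.
  apply: (@C1_comp1 R X (fun y => k%:R ^+ 2 - sqn y) (@step R)); first exact: C1_step.
  by apply: C1B; [exact: C1_cst|exact: C1_sqn].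
case: i => [i|]; last exact: C1_cst.
apply: (@C1_comp1 R X (fun y => k.+1%:R * (y ord0 i - l) - 1) (@step R)); first exact: C1_step.
apply: C1B; last exact: C1_cst.
apply: C1M; first exact: C1_cst.
by apply: C1B; [exact: C1_coordX|exact: C1_cst].
Qed.

Lemma cutX01 i l k y : 0 <= cutX i l k y <= 1.
Proof.
rewrite /cutX; have /andP[a0 a1] := step_ge0 (k%:R ^+ 2 - sqn y).
have : 0 <= (if i is Some i then step (k.+1%:R * (y ord0 i - l) - 1) else 1) <= 1.
  by case: i => [i|]; [exact: step_ge0|rewrite ler01 lexx].
move=> /andP[b0 b1]; rewrite mulr_ge0//= -[leRHS](mulr1 1); exact: ler_pM.
Qed.

Definition al (i : option 'I_n) (l : R) (k : nat) (j : 'I_n) : R :=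
  if Some j == i then l + k.+1%:R^-1 else - k%:R.

Definition be (l : R) (k : nat) (j : 'I_n) : R := k%:R + l + 1.

Lemma al_be i l k j : 0 <= l -> al i l k j <= be l k j.
Proof.
move=> l0; rewrite /al /be; case: ifP => _.
  rewrite (addrC k%:R) -addrA lerD2l; apply: le_trans (_ : 1 <= _); last by rewrite lerDr.
  by rewrite invf_le1 ?ler1n.
have k0 : 0 <= k%:R :> R by []. lra.
Qed.

Lemma cutX_out i l k y : 0 <= l -> ~ @cbox R n (al i l k) (be l k) y -> cutX i l k y = 0.
Proof.
move=> l0 /existsNP[j /=]; rewrite /= in_itv/= => /negP; rewrite negb_and -!ltNge => h.
have k0 : 0 <= k%:R :> R by [].
have big : k%:R < `|y ord0 j| -> cutX i l k y = 0.
  move=> ky; rewrite /cutX step_le0 ?mul0r// subr_le0 (le_trans _ (sqn_ge y j))//.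
  by rewrite -[leRHS]real_normK ?num_real// ler_pXn2r ?nnegrE// ltW.
move: h; rewrite /al /be; case: eqP => [ji|_] /orP[h|h].
- rewrite /cutX -ji [X in _ * X]step_le0 ?mulr0// subr_le0.
  rewrite mulrC -ler_pdivlMr// mul1r lerBlDl; exact: ltW.
- by apply: big; rewrite (lt_le_trans _ (ler_norm _))//; lra.
- by apply: big; rewrite -normrN (lt_le_trans _ (ler_norm _))// ltrNr.
- by apply: big; rewrite (lt_le_trans _ (ler_norm _))//; lra.
Qed.

Lemma cutX_cvg i l (y : X) : (if i is Some i then l < y ord0 i else true) ->
  \forall k \near \oo, cutX i l k y = 1.
Proof.
move=> hi.
have [k0 hk0] : exists k0 : R, forall k : nat, k0 <= k%:R -> if i is Some i then step (k.+1%:R * (y ord0 i - l) - 1) = 1 else true.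
  case: i hi => [i|] hi; last by exists 0.
  exists ((1 + 1) / (y ord0 i - l)) => k hk.
  rewrite step_ge1// lerBrDr -ler_pdivrMr ?subr_gt0//.
  by apply: (le_trans hk); rewrite ler_nat.
near=> k; rewrite /cutX step_ge1; last first.
  rewrite lerBrDr; apply: (@le_trans _ _ k%:R).
    near: k; exact: nbhs_infty_ger.
  rewrite expr2 ler_peMr// ler1n; near: k; exact: nbhs_infty_gt.
have : k0 <= k%:R by near: k; exact: nbhs_infty_ger.
by move=> /hk0; case: (i) => [j ->|_]; rewrite mulr1.
Unshelve. all: by end_near. Qed.

Section dir.
Variables (J : nat) (a b : 'I_J -> R).
Hypothesis disj : forall i j u, a i < u < b i -> a j < u < b j -> i = j.

(** [lines_bound], carried to the direction i by [swap] and freed from its cut-off by Fatou. Each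
    line is counted with the number of intervals on which E is not constant. *)
Lemma lines_dir (E : set V) (i : option 'I_n) (l C : R) : 0 <= l -> measurable E -> E `<=` Hl l ->
  (i = None -> forall j, l <= a j) -> HV E i l C ->
  (\sum_j leb (NC (swap i @^-1` E) (a j) (b j)) <= C%:E)%E.
Proof.
move=> l0 mE El hi hE.
pose E' := swap i @^-1` E.
have mE' : measurable E' by exact: measurable_swap_preimage.
have mN j : measurable (NC E' (a j) (b j)) by exact: measurable_NC.
have mcnt := measurable_cnt a b mE'.
have cnt0 y : 0 <= cnt a b E' y by apply: sumr_ge0 => j _.
have H k : (\int[leb]_y (cutX i l k y * cnt a b E' y)%:E <= C%:E)%E.
  have := @lines_bound R n J a b disj (al i l k) (be l k) (fun j => al_be i k j l0) E' (cutX i l k) C mE'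
    (C1_cutX i l k) (cutX01 i l k) (fun y => @cutX_out i l k y l0) _.
  have -> : \int[leb]_(y in cbox (al i l k) (be l k)) (cutX i l k y * cnt a b E' y) =
            \int[leb]_y (cutX i l k y * cnt a b E' y).
    rewrite Rintegral_mkcond; apply: eq_Rintegral => y _; rewrite patchE; case: ifPn => // /negP h.
    by rewrite cutX_out ?mul0r// => h'; apply: h; rewrite inE.
  have fin : (\int[leb]_y (cutX i l k y * cnt a b E' y)%:E \is a fin_num)%E.
    have mc := measurable_cbox (al i l k) (be l k).
    have lc := leb_cbox (fun j => al_be i k j l0).
    have -> : (\int[leb]_y (cutX i l k y * cnt a b E' y)%:E = \int[leb]_(y in cbox (al i l k) (be l k)) (cutX i l k y * cnt a b E' y)%:E)%E.
      rewrite [RHS]integral_mkcond; apply: eq_integral => y _; rewrite patchE; case: ifPn => // /negP h.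
      by rewrite cutX_out ?mul0r// => h'; apply: h; rewrite inE.
    apply: (integrable_fin_num mc); apply: (@integrable_bounded R n _ mc lc _ J%:R) => [|y].
      apply: measurable_funM; last exact: measurable_funTS.
      by apply: measurable_funTS; apply: continuous_measurable_rV; exact: (C1_continuous (C1_cutX i l k)).
    have /andP[c0 c1] := cutX01 i l k y.
    rewrite normrM (ger0_norm c0) (ger0_norm (cnt0 y)) -[leRHS]mul1r ler_pM//.
    rewrite -[leRHS]mulr1 mulr_natl -[X in _ *+ X](card_ord J) -sumr_const; apply: ler_sum => j _.
    by rewrite indicE; case: (_ \in _).
  move=> HH; rewrite -(fineK fin) lee_fin; apply: HH.
  move=> xi cxi x1 [K [cK KD K0]].
  have ccs : cc (del None xi \o swap i).
    rewrite (_ : _ \o _ = del i (xi \o swap i)); last first.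
      by apply/funext => p /=; rewrite del_swap.
    apply: cc_del; first by apply: (@C1_comp_lin R V V R (@swap R n i) xi) => //; exact: continuous_swap.
    exists (swap i @` K); split.
      by apply: continuous_compact => //; apply: continuous_subspaceT; exact: continuous_swap.
    by move=> p Kp; apply: K0 => Ks; apply: Kp; exists (swap i p) => //; rewrite swapK.
  rewrite (Int_swap mE ccs) (_ : _ \o _ = del i (xi \o swap i)); last first.
    by apply/funext => p /=; rewrite del_swap.
  apply: hE.
  - by apply: (@C1_comp_lin R V V R (@swap R n i) xi) => //; exact: continuous_swap.
  - by move=> p; exact: x1.
  exists (swap i @` K); split.
  - by apply: continuous_compact => //; apply: continuous_subspaceT; exact: continuous_swap.
  - move=> _ [p Kp <-]; have [p1 [j pj]] := KD p Kp.
    rewrite /Hl/=; case: i hi {E' mE' mN mcnt cnt0 fin ccs KD} p1 => [i|] hi p1 /=.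
      have := p1 i; rewrite /al eqxx/= in_itv/= => /andP[+ _]; apply: lt_le_trans.
      by rewrite ltrDl invr_gt0.
    by apply: le_lt_trans (hi erefl j) _; case/andP: pj.
  - move=> p Kp; apply: K0 => Ks; apply: Kp; exists (swap i p) => //; by rewrite swapK.
have mf k : measurable_fun setT (fun y => (cutX i l k y * cnt a b E' y)%:E).
  apply/measurable_EFinP; apply: measurable_funM => //.
  by apply: continuous_measurable_rV; exact: (C1_continuous (C1_cutX i l k)).
have f0 k y : (0 <= (cutX i l k y * cnt a b E' y)%:E)%E.
  by rewrite lee_fin mulr_ge0//; have /andP[] := cutX01 i l k y.
have -> : (\sum_j leb (NC E' (a j) (b j)) = \int[leb]_y (cnt a b E' y)%:E)%E.
  rewrite /cnt; under eq_integral do rewrite -sumEFin.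
  rewrite ge0_integral_sum//; last first.
    by move=> j; apply/measurable_EFinP; exact: measurable_indic.
  by apply: eq_bigr => j _; rewrite integral_indic// setIT.
have cv y : (cutX i l k y * cnt a b E' y)%:E @[k --> \oo] --> (cnt a b E' y)%:E.
  (* On a line at height at most l the cut-off does not tend to 1, but such a line does not meet
     E. *)
  case: (boolP (if i is Some i then l < y ord0 i else true)) => hy.
    apply: cvg_near_cst; have hc := @cutX_cvg i l y hy; apply: filterS hc => k hk.
    by rewrite /= hk mul1r.
  have -> : cnt a b E' y = 0; last by under eq_fun do rewrite mulr0; exact: cvg_cst.
  rewrite /cnt big1// => j _; rewrite indicE memNset// => -[h1 _]; move: h1.
  rewrite (_ : line E' y = set0) ?set0I ?measure0 ?ltxx//.
  rewrite -subset0 => t; rewrite /line /E' /= => /El; rewrite /Hl/= /swap.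
  by case: i {hi hE E' mE' mN mcnt cnt0 H mf f0} hy => [i|] // /negP hy /=.
have := @fatou _ _ _ leb setT measurableT _ mf (fun k y _ => f0 k y).
rewrite (eq_integral (fun y => (cnt a b E' y)%:E)); last first.
  by move=> y _; rewrite is_cvg_limn_einfE; [apply: cvg_lim => //; exact: cv|apply/cvg_ex; eexists; exact: cv].
move=> /le_trans; apply.
by apply: limn_einf_le_cst => k; exact: H.
Qed.

End dir.
End directions.

Ltac mset := do ? [assumption|apply: measurableD|apply: measurableI|apply: measurableU|exact: measurable_itv].

Section measure_limits.
Context d (T : measurableType d) (R : realType) (mu : {measure set T -> \bar R}).

Lemma le_meas (A B : set T) : measurable A -> measurable B -> A `<=` B -> (mu A <= mu B)%E.
Proof. by move=> mA mB; apply: le_measure; rewrite inE. Qed.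

Lemma measure_bigcup_le (F : (set T)^nat) (c : \bar R) : (forall k, measurable (F k)) ->
  nondecreasing_seq F -> (forall k, (mu (F k) <= c)%E) -> (mu (\bigcup_k F k) <= c)%E.
Proof.
move=> mF ndF hc.
have h : mu (F k) @[k --> \oo] --> mu (\bigcup_k F k).
  exact: (@nondecreasing_cvg_mu _ _ _ mu F mF (bigcupT_measurable _ mF) ndF).
by apply: (cvge_to_le h); apply: nearW.
Qed.

Lemma measure_bigcup_gt (F : (set T)^nat) (c : \bar R) : (forall k, measurable (F k)) ->
  nondecreasing_seq F -> (c < mu (\bigcup_k F k))%E -> exists k, (c < mu (F k))%E.
Proof.
move=> mF ndF hc; apply: contrapT => /forallNP h.
have := @measure_bigcup_le F c mF ndF; rewrite leNgt hc => /(_ _)/negP; apply => // k.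
by rewrite leNgt; apply/negP.
Qed.

Lemma measure_bigcup0 (F : (set T)^nat) : (forall k, measurable (F k)) ->
  (forall k, mu (F k) = 0%E) -> mu (\bigcup_k F k) = 0%E.
Proof.
move=> mF F0; apply/eqP; rewrite eq_le measure_ge0 andbT.
apply: (le_trans (measure_sigma_subadditive mu mF (bigcupT_measurable _ mF) (@subset_refl _ _))).
by rewrite eseries0//.
Qed.

Lemma measure_fin_lt (A : set T) (c : \bar R) : measurable A -> (mu A <= c)%E -> (c < +oo)%E -> mu A \is a fin_num.
Proof. by move=> mA Ac coo; rewrite ge0_fin_numE// (le_lt_trans Ac coo). Qed.

End measure_limits.

(** * Lines that meet a set of finite perimeter *)

Section consequences.
Variables (R : realType) (n : nat).
Local Notation mR := (measurableTypeR R).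
Local Notation lam := (@lebesgue_measure R).
Local Notation X := 'rV[R]_n.
Local Notation V := (Rn1 R n).
Local Notation leb := (leb R n).
Local Notation vol := (vol R n).
Local Notation Om := (@Omega R n).

Lemma vol_line (E : set V) : vol E = (\int[leb]_y lam (line E y))%E.
Proof. by rewrite /Defs.vol/= /product_measure1; apply: eq_integral => y _; rewrite lineE. Qed.

Lemma vol_line_ae (E : set V) : measurable E -> (vol E < +oo)%E ->
  exists N : set X, [/\ measurable N, leb N = 0%E & forall y, ~ N y -> (lam (line E y) < +oo)%E].
Proof.
move=> mE Eoo.
have ml := measurable_line_meas mE.
have il : leb.-integrable setT (fun y => lam (line E y)).
  apply/integrableP; split => //.
  by under eq_integral do rewrite gee0_abs//; rewrite -vol_line.
have [N [mN N0 sN]] := integrable_ae measurableT il.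
exists N; split => // y Ny; apply: contrapT => h; apply: Ny; apply: sN => /= hy; apply: h.
by have := hy Logic.I; rewrite ge0_fin_numE.
Qed.

Lemma NC_sub (E : set V) (a b c d : R) : a <= c -> d <= b -> measurable E -> NC E c d `<=` NC E a b.
Proof.
move=> ac db mE y; have mL := measurable_line y mE.
have sub : `]c, d[%classic `<=` (`]a, b[%classic : set R) by apply: subset_itv; rewrite bnd_simp.
move=> [h1 h2]; split; [apply: lt_le_trans h1 _|apply: lt_le_trans h2 _]; apply: le_measure;
  rewrite ?inE//; try (by apply: measurableI => //; exact: measurable_itv);
  try (by apply: measurableD => //; exact: measurable_itv).
- by apply: setIS.
- exact: setSD.
Qed.

Lemma NC_le (E : set V) (i : option 'I_n) (l C a b : R) : 0 <= l -> measurable E -> E `<=` Hl l ->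
  (i = None -> l <= a) -> HV E i l C -> (leb (NC (swap i @^-1` E) a b) <= C%:E)%E.
Proof.
move=> l0 mE El la hE.
have := @lines_dir R n 1 (fun=> a) (fun=> b) _ E i l C l0 mE El (fun h _ => la h) hE.
by rewrite big_ord1; apply => i' j' u _ _; rewrite !ord1.
Qed.

Lemma lam_pos_bounded (L : set mR) (lo : nat -> R) : measurable L -> {homo lo : k m / (k <= m)%N >-> m <= k} ->
  (L `<=` \bigcup_k `]lo k, k%:R[%classic) -> (0 < lam L)%E -> exists k, (0 < lam (L `&` `]lo k, k%:R[))%E.
Proof.
move=> mL hlo sL L0.
have [|||k hk] := @measure_bigcup_gt _ _ _ lam (fun k => L `&` `]lo k, k%:R[%classic) 0%E.
- by move=> k; apply: measurableI => //; exact: measurable_itv.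
- by move=> k m km; apply/subsetPset; apply: setIS; apply: subset_itv; rewrite bnd_simp; [exact: hlo|rewrite ler_nat].
- by rewrite -setI_bigcupr (setIidl sL).
by exists k.
Qed.

(** Almost every line meets E in finite length; if this length is positive, E is neither null nor
    full on a long enough interval of the line. *)
Lemma lines_pos (E : set V) i (l C : R) : measurable E -> (vol E < +oo)%E -> 0 <= l -> E `<=` Hl l -> HV E i l C ->
  (leb [set y | 0 < lam (line (swap i @^-1` E) y)]%E <= C%:E)%E.
Proof.
move=> mE Eoo l0 El hE; set E' := swap i @^-1` E.
have mE' : measurable E' := measurable_swap_preimage i mE.
have E'oo : (vol E' < +oo)%E by rewrite vol_swap.
have [N [mN N0 hN]] := vol_line_ae mE' E'oo.
(* Vertical lines are exhausted from the height l upwards, because the test functions vanish below l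
   and E lies above it. *)
pose lo (k : nat) : R := if i is Some _ then - k%:R else l.
have hlo : {homo lo : k m / (k <= m)%N >-> m <= k}.
  by move=> k m km; rewrite /lo; case: i {E' mE' E'oo hN hE lo} => // j; rewrite lerN2 ler_nat.
pose F k := NC E' (lo k) k%:R.
have mF k : measurable (F k) by exact: measurable_NC.
have ndF : nondecreasing_seq F.
  move=> k m km; apply/subsetPset; apply: NC_sub => //; [exact: hlo|by rewrite ler_nat].
have hF k : (leb (F k) <= C%:E)%E.
  apply: (NC_le _ l0 mE El _ hE) => i0; by rewrite /lo i0.
have mP := measurable_pos_line mE'.
apply: (@le_trans _ _ (leb (\bigcup_k F k `|` N))); last first.
  apply: le_trans (measureU2 _ (bigcupT_measurable _ mF) mN) _.
  by rewrite /= N0 adde0; exact: measure_bigcup_le.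
apply: le_measure; rewrite ?inE//; first by apply: measurableU => //; exact: bigcupT_measurable.
move=> y /= y0; case: (pselect (N y)) => Ny; [by right|left].
have mL := measurable_line y mE'.
have [k hk] : exists k, (0 < lam (line E' y `&` `]lo k, k%:R[))%E.
  apply: lam_pos_bounded => // t ht.
  have tk : \forall k \near \oo, `|t| < (k%:R : R) by exact: nbhs_infty_gtr.
  case: tk => k _ hk; exists k => //=; rewrite in_itv/=.
  have tk := hk k (leqnn k); rewrite (le_lt_trans (ler_norm t) tk) andbT.
  move: ht; rewrite /lo /line /E' /=; case: (i) => [j _|/El//].
  by rewrite ltrNl (le_lt_trans _ tk)// -normrN ler_norm.
have Lfin : lam (line E' y) \is a fin_num by rewrite ge0_fin_numE//; exact: hN.
(* An interval longer than the total length of E on the line cannot be filled by E. *)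
have [m hm] : exists m : nat, [/\ (k <= m)%N & fine (lam (line E' y)) < m%:R - lo m].
  have tk : \forall m \near \oo, `|fine (lam (line E' y))| + `|l| < (m%:R : R) by exact: nbhs_infty_gtr.
  case: tk => m _ hm; exists (maxn k m); split; first by rewrite leq_maxl.
  have h := hm (maxn k m) (leq_maxr _ _); rewrite ltrBrDr (le_lt_trans _ h)// lerD ?ler_norm//.
  rewrite /lo; case: (i) => [j|]; last exact: ler_norm.
  by rewrite (@le_trans _ _ 0) ?oppr_le0.
exists m => //; split.
  apply: lt_le_trans hk _; apply: le_measure; rewrite ?inE//; try (by apply: measurableI => //; exact: measurable_itv).
  apply: setIS; apply: subset_itv; rewrite bnd_simp; [by apply: hlo; case: hm|by rewrite ler_nat; case: hm].
case: hm => km hm.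
rewrite lt_neqAle measure_ge0 andbT; apply/negP => /eqP h0.
have : (lam `]lo m, m%:R[ <= lam (line E' y))%E.
  apply: (@le_trans _ _ (lam ((`]lo m, m%:R[ `\` line E' y) `|` line E' y))).
    apply: le_meas; [by mset|by mset|].
    by move=> t ht; case: (pselect (line E' y t)) => ?; [right|left].
  apply: le_trans (measureU2 _ _ mL) _ => //; first by apply: measurableD => //; exact: measurable_itv.
  by rewrite -[X in (_ + X)%E]/(lam _) -[X in (X + _)%E]/(lam _) -h0 add0e.
rewrite lebesgue_measure_itv/= lte_fin -(fineK Lfin).
have L0 : 0 <= fine (lam (line E' y)) by exact: fine_ge0.
have -> : lo m < m%:R by rewrite -subr_gt0; exact: le_lt_trans hm.
by rewrite -EFinB lee_fin leNgt hm.
Qed.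

(** Almost no line in the direction i meets E in positive length. Contraposed, a set of positive
    finite volume varies in every direction; the strict height cut uses this horizontally. *)
Lemma HV0_null (E : set V) i (l : R) : measurable E -> (vol E < +oo)%E -> 0 <= l -> E `<=` Hl l -> HV E i l 0 ->
  vol E = 0%E.
Proof.
move=> mE Eoo l0 El hE; rewrite -(@vol_swap R n i)//.
have mE' : measurable (swap i @^-1` E) := measurable_swap_preimage i mE.
have h := lines_pos mE Eoo l0 El hE.
rewrite vol_line; apply/eqP; rewrite eq_le integral_ge0// andbT.
have [_ /(_ _)] := @ae_eq_integral_abs _ _ _ leb setT measurableT (fun y => lam (line (swap i @^-1` E) y)) (measurable_line_meas mE').
under eq_integral do rewrite gee0_abs//.
move=> ->//; exists [set y | 0 < lam (line (swap i @^-1` E) y)]%E; split.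
- exact: measurable_pos_line.
- by apply/eqP; rewrite eq_le h measure_ge0.
- move=> y /=; apply: contra_notP => /negP; rewrite -leNgt => h0 _.
  by apply/eqP; rewrite eq_le h0 measure_ge0.
Qed.

(** A vertical line meets the strip in length h, and the vertical lines that meet E have total
    measure at most the perimeter. *)
Lemma vol_strip (E : set V) (a h : R) : BVset E -> 0 <= h -> fine (vol (E `&` strip a (a + h))) <= h * Per E.
Proof.
move=> bE h0; have mE := BVset_measurable bE; have Eoo := BVset_vol bE.
have mS := @measurable_strip R n a (a + h).
have mES : measurable (E `&` strip a (a + h)) by exact: measurableI.
have lp := lines_pos mE Eoo (lexx 0) (BVset_sub bE) (BV_HV None bE).
have mP := measurable_pos_line mE.
have le : (vol (E `&` strip a (a + h)) <= (h * Per E)%:E)%E.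
  rewrite vol_line.
  apply: (@le_trans _ _ (\int[leb]_y (h%:E * (\1_([set y | 0 < lam (line E y)]%E) y)%:E))%E).
    apply: ge0_le_integral => //.
    - exact: measurable_line_meas.
    - by apply: emeasurable_funM => //; apply/measurable_EFinP; exact: measurable_indic.
    move=> y _; have mL := measurable_line y mE.
    rewrite (_ : line (E `&` _) y = line E y `&` `]a, a + h[); last by [].
    rewrite indicE; case: (boolP (y \in _)) => hy.
      rewrite mule1; apply: (@le_trans _ _ (lam `]a, a + h[)).
        apply: le_meas; [by mset|by mset|exact: subIsetr].
      rewrite lebesgue_measure_itv/= lte_fin; case: ifP => _; last by rewrite lee_fin.
      by rewrite -EFinB lee_fin addrAC subrr add0r.
    move: hy; rewrite notin_setE/= => /negP; rewrite -leNgt => hy; rewrite mule0.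
    apply: le_trans hy; apply: le_measure; rewrite ?inE//; apply: measurableI => //; exact: measurable_itv.
  rewrite ge0_integralZl//; [|by apply/measurable_EFinP; exact: measurable_indic].
  by rewrite integral_indic// setIT EFinM; apply: lee_pmul.
by rewrite -lee_fin fineK//; apply: (measure_fin_lt mES le); rewrite ltry.
Qed.

(* The trace of [E], by [trace_near0]: the boundary points above which [E] is full near the
   boundary. *)
Definition near0 (E : set V) : set X :=
  \bigcup_k [set y | lam (`]0, k.+1%:R^-1[ `\` line E y) = 0%E].

Lemma measurable_null_line (E : set V) : measurable E -> measurable [set y | lam (line E y) = 0%E].
Proof.
move=> mE; rewrite (_ : mkset _ = ~` [set y | (0 < lam (line E y))%E]).
  by apply: measurableC; exact: measurable_pos_line.
apply/seteqP; split => y /= h; first by rewrite h ltxx.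
by move/negP: h; rewrite -leNgt => h; apply/eqP; rewrite eq_le h measure_ge0.
Qed.

Lemma measurable_near0 (E : set V) : measurable E -> measurable (near0 E).
Proof.
move=> mE; apply: bigcupT_measurable => k.
rewrite (_ : mkset _ = [set y | lam (line (strip 0 k.+1%:R^-1 `\` E) y) = 0%E]) //.
by apply: measurable_null_line; apply: measurableD => //; exact: measurable_strip.
Qed.

(** A line along which E is full near the boundary meets E in positive length. With beta <= 1 - 2
    kappa this is the coercivity of the capillary energy. *)
Lemma near0_le (E : set V) : BVset E -> (leb (near0 E) <= (Per E)%:E)%E.
Proof.
move=> bE; have mE := BVset_measurable bE.
apply: le_trans (lines_pos mE (BVset_vol bE) (lexx 0) (BVset_sub bE) (BV_HV None bE)).
apply: le_measure; rewrite ?inE; [exact: measurable_near0|exact: measurable_pos_line|].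
move=> y [k _ /= hk]; have mL := measurable_line y mE.
rewrite lt_neqAle measure_ge0 andbT; apply/negP => /eqP h0.
have : (lam `]0%R, k.+1%:R^-1%R[ <= 0)%E.
  apply: (@le_trans _ _ (lam ((`]0, k.+1%:R^-1[ `\` line E y) `|` line E y))).
    apply: le_meas; [by mset|by mset|].
    by move=> t ht; case: (pselect (line E y t)) => ?; [right|left].
  apply: le_trans (measureU2 _ _ mL) _ => //; first by apply: measurableD => //; exact: measurable_itv.
  by rewrite -[X in (_ + X)%E]/(lam _) -[X in (X + _)%E]/(lam _) hk add0e -h0.
by rewrite lebesgue_measure_itv/= lte_fin invr_gt0 ltr0n/= sube0 lee_fin leNgt invr_gt0 ltr0n.
Qed.

(** By continuity of the measure along intervals that increase to (0, dl). The degenerate case is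
    part of the conclusion so that a total function of dl can be chosen from it in [NC0_null]. *)
Lemma NC_near (E : set V) (dl : R) : measurable E ->
  \bigcap_k NC E 0 k.+1%:R^-1 `<=` (\bigcup_k NC E k.+1%:R^-1 dl : set X) \/ dl <= 0.
Proof.
move=> mE; case: (leP dl 0) => dl0; [by right|left] => y hy.
have mL := measurable_line y mE.
have [k0 hk0] : exists k : nat, k.+1%:R^-1 <= dl.
  have tk : \forall k \near \oo, dl^-1 < (k%:R : R) by exact: nbhs_infty_gtr.
  case: tk => k _ /(_ k (leqnn k)) h; exists k.
  rewrite invf_ple ?posrE// (le_trans (ltW h))// ler_nat //.
have [h1 h2] : NC E 0 dl y.
  by apply: (@NC_sub E 0 dl 0 k0.+1%:R^-1) => //; exact: hy.
have H (L : set mR) : measurable L -> L `<=` `]0, dl[ -> (0 < lam L)%E ->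
    exists k0, forall k, (k0 <= k)%N -> (0 < lam (L `&` `]k.+1%:R^-1%R, dl[))%E.
  move=> mL' sL L0.
  have nd : nondecreasing_seq (fun k : nat => L `&` `]k.+1%:R^-1, dl[%classic : set mR).
    move=> k m km; apply/subsetPset; apply: setIS; apply: subset_itv; rewrite bnd_simp//.
    by rewrite lef_pV2 ?posrE// ler_nat.
  have mI k : measurable (L `&` `]k.+1%:R^-1, dl[%classic : set mR).
    by apply: measurableI => //; exact: measurable_itv.
  have [|k hk] := @measure_bigcup_gt _ _ _ lam (fun k : nat => L `&` `]k.+1%:R^-1, dl[%classic) 0%E mI nd.
  - rewrite -setI_bigcupr setIidl// => t /sL /=; rewrite !in_itv/= => /andP[t0 td].
    have tk : \forall k \near \oo, t^-1 < (k%:R : R) by exact: nbhs_infty_gtr.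
    case: tk => k _ /(_ k (leqnn k)) h; exists k => //=; rewrite in_itv/= td andbT.
    by rewrite invf_plt ?posrE// (lt_le_trans h)// ler_nat.
  exists k => m km; apply: lt_le_trans hk _; apply: le_measure; rewrite ?inE//.
  by have /subsetPset := nd _ _ km.
have [||k1 hk1] := H (line E y `&` `]0, dl[) _ _ h1.
- by apply: measurableI => //; exact: measurable_itv.
- exact: subIsetr.
have [||k2 hk2] := H (`]0, dl[ `\` line E y) _ _ h2.
- by apply: measurableD => //; exact: measurable_itv.
- exact: subDsetl.
exists (maxn k1 k2) => //; split.
  apply: lt_le_trans (hk1 _ (leq_maxl _ _)) _; apply: le_measure; rewrite ?inE//;
  try (by do ?apply: measurableI => //; exact: measurable_itv).
  by apply: setSI; exact: subIsetl.
apply: lt_le_trans (hk2 _ (leq_maxr k1 _)) _; apply: le_meas; [by mset|by mset|].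
by move=> t [[]].
Qed.

(** These are the lines on which E oscillates at the boundary. If they had measure m > 0, there
    would be successive disjoint intervals tending to 0 on each of which E changes along lines of
    measure more than m / 2; counting J of them gives J m / 2 <= Per E for all J. *)
Lemma NC0_null (E : set V) : BVset E -> leb (\bigcap_k NC E 0 k.+1%:R^-1) = 0%E.
Proof.
move=> bE; have mE := BVset_measurable bE.
set B := \bigcap_k _.
have mB : measurable B by apply: bigcapT_measurable => k; exact: measurable_NC.
have lB : (leb B <= (Per E)%:E)%E.
  apply: (@le_trans _ _ (leb (NC E 0 1))).
    apply: le_measure; rewrite ?inE//; first exact: measurable_NC.
    by move=> y /(_ 0%N Logic.I); rewrite invr1.
  exact: (@NC_le E None 0 (Per E) 0 1 (lexx 0) mE (BVset_sub bE) (fun=> lexx 0) (BV_HV None bE)).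
have fB : leb B \is a fin_num by apply: (measure_fin_lt mB lB); rewrite ltry.
apply/eqP; apply: contrapT => /negP B0.
pose m := fine (leb B).
have m0 : 0 < m by rewrite /m fine_gt0// lt_neqAle eq_sym B0 measure_ge0 -ge0_fin_numE.
have next (dl : R) : exists d', 0 < dl -> [/\ 0 < d', d' <= dl & ((m / 2)%:E < leb (NC E d' dl))%E].
  case: (@NC_near E dl mE) => [s|dlle]; last by exists 0; rewrite ltNge dlle.
  have [|||k hk] := @measure_bigcup_gt _ _ _ leb (fun k => NC E k.+1%:R^-1 dl) (m / 2)%:E.
  - by move=> k; exact: measurable_NC.
  - move=> k k' kk; apply/subsetPset; apply: NC_sub => //.
    by rewrite lef_pV2 ?posrE// ler_nat.
  - apply: (@lt_le_trans _ _ (leb B)).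
      by rewrite -(fineK fB) lte_fin -/m ltr_pdivrMr// mulr_natr mulr2n ltrDl.
    apply: le_measure; rewrite ?inE//; apply: bigcupT_measurable => k; exact: measurable_NC.
  exists (k.+1%:R^-1) => dl0; split => //.
  rewrite leNgt; apply/negP => h.
  suff e0 : `]k.+1%:R^-1, dl[%classic = set0 :> set R.
    move: hk; rewrite (_ : NC _ _ _ = set0) ?measure0 ?lte_fin; first by move/ltW; rewrite leNgt divr_gt0.
    by rewrite -subset0 => y [+ _]; rewrite e0 setI0 measure0 ltxx.
  rewrite -subset0 => t /=; rewrite in_itv/= => /andP[h1 h2].
  by have := lt_trans (lt_trans h h1) h2; rewrite ltxx.
have [f hf] := choice next.
pose dl := fix dl k := if k is k'.+1 then f (dl k') else 1 : R.
have dl0 k : 0 < dl k by elim: k => [|k IH] //=; case: (hf _ IH).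
have dlS k : dl k.+1 <= dl k by case: (hf _ (dl0 k)).
have dl_ni k k' : (k <= k')%N -> dl k' <= dl k.
  by move/subnKC <-; elim: (k' - k)%N => [|j IH]; [rewrite addn0|rewrite addnS (le_trans (dlS _))].
have dlm k : ((m / 2)%:E < leb (NC E (dl k.+1) (dl k)))%E by case: (hf _ (dl0 k)).
have key (J : nat) : J%:R * (m / 2) <= Per E.
  have := @lines_dir R n J (fun j => dl j.+1) (fun j => dl j) _ E None 0 (Per E) (lexx 0) mE
     (BVset_sub bE) (fun _ j => ltW (dl0 _)) (BV_HV None bE).
  have dj : forall (i j : 'I_J) (u : R), dl i.+1 < u < dl i -> dl j.+1 < u < dl j -> i = j.
    move=> i j u /andP[i1 i2] /andP[j1 j2]; apply/val_inj/eqP; rewrite eqn_leq.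
    rewrite leqNgt; apply/andP; split; [|rewrite leqNgt]; apply/negP => ij.
      by have := le_lt_trans (dl_ni _ _ ij) j1; rewrite ltNge (ltW i2).
    by have := le_lt_trans (dl_ni _ _ ij) i1; rewrite ltNge (ltW j2).
  move=> /(_ dj) h; rewrite -lee_fin; apply: le_trans h.
  rewrite (_ : J%:R * (m / 2) = \sum_(j < J) (m / 2)); last by rewrite sumr_const card_ord mulr_natl.
  by rewrite -sumEFin; apply: lee_sum => j _; exact: ltW.
have tk : \forall k \near \oo, Per E / (m / 2) < (k%:R : R) by exact: nbhs_infty_gtr.
case: tk => k _ /(_ k (leqnn k)); rewrite ltr_pdivrMr ?divr_gt0//.
by rewrite ltNge key.
Qed.

End consequences.

(** * Cube averages and the isoperimetric inequality *)

Section averages.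
Variables (R : realType) (n : nat) (s : R).
Hypothesis s0 : 0 < s.
Local Notation mR := (measurableTypeR R).
Local Notation lam := (@lebesgue_measure R).
Local Notation X := 'rV[R]_n.
Local Notation V := (Rn1 R n).
Local Notation leb := (leb R n).
Local Notation vol := (vol R n).
Local Notation Om := (@Omega R n).
Implicit Types (f g : V -> \bar R) (i j : option 'I_n) (p q : V).

Definition fl (t : R) : int := Num.floor (t / s).
Definition cell (k : int) : set mR := [set` `[k%:~R * s, (k + 1)%:~R * s[].

Lemma flE t k : (fl t == k) = (t \in `[k%:~R * s, (k + 1)%:~R * s[).
Proof. by rewrite /fl floor_eq in_itv/= ler_pdivlMr// ltr_pdivrMr. Qed.

Lemma cell_fl k t : cell k t <-> fl t = k.
Proof. by split => [h|<-]; [apply/eqP; rewrite flE|rewrite /cell/= -flE eqxx]. Qed.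

Lemma measurable_cell k : measurable (cell k). Proof. exact: measurable_itv. Qed.

Lemma lam_cell k : lam (cell k) = s%:E.
Proof.
have e : (k + 1)%:~R * s - k%:~R * s = s by rewrite intrD mulrDl mul1r addrAC subrr add0r.
rewrite lebesgue_measure_itv/= lte_fin -subr_gt0 e s0.
by rewrite -EFinB e.
Qed.

(** As a function of u, the uniform density on the grid cell of t. Its symmetry makes the averages
    self-adjoint. *)
Definition ker (t u : R) : \bar R := (s^-1 * (fl t == fl u)%:R)%:E.

Lemma ker_ge0 t u : (0 <= ker t u)%E.
Proof. by rewrite lee_fin mulr_ge0// invr_ge0 ltW. Qed.

Lemma kerC t u : ker t u = ker u t. Proof. by rewrite /ker eq_sym. Qed.

Lemma measurable_ker : measurable_fun setT (fun q : mR * mR => ker q.1 q.2).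
Proof.
apply/measurable_EFinP; apply: measurable_funM => //.
rewrite (_ : (fun q : mR * mR => (fl q.1 == fl q.2)%:R) = \1_(\bigcup_k (cell k `*` cell k))).
  apply: measurable_indic; apply: countable_bigcupT_measurable; first exact: countableP.
  by move=> k; apply: measurableX; exact: measurable_cell.
apply/funext => -[t u]; rewrite indicE; congr ((nat_of_bool _)%:R); apply/idP/idP; last first.
  by rewrite inE => -[k _ [/= /cell_fl -> /cell_fl ->]].
move/eqP => /= e; rewrite inE; exists (fl t) => //; split => /=; apply/cell_fl => //.
Qed.

Lemma measurable_ker1 t : measurable_fun setT (fun u : mR => ker t u).
Proof.
apply: (@measurableT_comp _ _ _ _ _ _ (fun q : mR * mR => ker q.1 q.2) _ (fun u => (t, u))).
  exact: measurable_ker.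
exact: measurable_pair1.
Qed.

Lemma int_ker t (L : set mR) : measurable L ->
  (\int[lam]_u (ker t u * (\1_L u)%:E) = (s^-1)%:E * lam (cell (fl t) `&` L))%E.
Proof.
move=> mL; under eq_integral => u _.
  rewrite (_ : (_ * _)%E = ((s^-1)%:E * (\1_(cell (fl t) `&` L) u)%:E)%E); last first.
    have -> : (\1_(cell (fl t) `&` L) u : R) = (fl t == fl u)%:R * \1_L u.
      rewrite indicI/= [in LHS]indicE; congr ((nat_of_bool _)%:R * _); apply/idP/idP.
        by rewrite inE => /cell_fl ->.
      by move/eqP => e; rewrite inE; apply/cell_fl.
    by rewrite /ker -!EFinM mulrA.
  over.
have mc : measurable (cell (fl t) `&` L) by apply: measurableI => //; exact: measurable_cell.
rewrite ge0_integralZl//; last by rewrite lee_fin invr_ge0 ltW.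
  by rewrite integral_indic// setIT.
by apply/measurable_EFinP; exact: measurable_indic.
Qed.

Definition setc i (u : R) p : V := swap i ((swap i p).1, u).

Lemma comp_setc i j u p : comp j (setc i u p) = if j == i then u else comp j p.
Proof.
rewrite /setc; case: i => [i|]; case: j => [j|] //=; rewrite /comp/= ?mxE ?eqxx//.
by rewrite (inj_eq Some_inj); case: eqP => //; rewrite mxE => /eqP/negbTE ->.
Qed.

Lemma comp_inj p q : (forall i, comp i p = comp i q) -> p = q.
Proof.
move=> h; case: p h => x t; case: q => y u h; congr pair; last exact: (h None).
by apply/rowP => i; exact: (h (Some i)).
Qed.

Lemma comp_swap i p : comp i p = (swap i p).2. Proof. by case: i. Qed.

(** The conditional expectation that averages the coordinate i over its grid cell. *)
Definition Av i f p : \bar R := (\int[lam]_u (ker (comp i p) u * f (setc i u p)))%E.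

Definition nnm f := measurable_fun setT f /\ forall p, (0 <= f p)%E.

Lemma nnm_swap i f : nnm f -> nnm (f \o swap i).
Proof.
by move=> [mf f0]; split; [apply: (measurableT_comp mf); exact: measurable_swap|move=> p; exact: f0].
Qed.

Lemma nnm_kern i f : nnm f ->
  measurable_fun setT (fun q : V * mR => ker q.1.2 q.2 * f (swap i (q.1.1, q.2)))%E.
Proof.
move=> nf; have [mf f0] := nnm_swap i nf.
apply: emeasurable_funM.
  apply: (@measurableT_comp _ _ _ _ _ _ (fun q : mR * mR => ker q.1 q.2) _ (fun q : V * mR => (q.1.2, q.2))).
    exact: measurable_ker.
  apply: measurable_fun_pair => //; apply: measurableT_comp => //.
apply: (@measurableT_comp _ _ _ _ _ _ (f \o swap i) _ (fun q : V * mR => (q.1.1, q.2))) => //.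
by apply: measurable_fun_pair => //; apply: measurableT_comp.
Qed.

Lemma AvE i f : Av i f = (fubini_F lam (fun q : V * mR => ker q.1.2 q.2 * f (swap i (q.1.1, q.2)))%E) \o swap i.
Proof. by apply/funext => p; rewrite /Av /fubini_F/= comp_swap. Qed.

Lemma nnm_Av i f : nnm f -> nnm (Av i f).
Proof.
move=> nf; have [mf f0] := nf; split.
  rewrite AvE; apply: measurableT_comp; last exact: measurable_swap.
  apply: measurable_fun_fubini_tonelli_F; first exact: nnm_kern.
  by move=> q; apply: mule_ge0 => //; exact: ker_ge0.
by move=> p; apply: integral_ge0 => u _; apply: mule_ge0 => //; exact: ker_ge0.
Qed.

Lemma nnm_kern1 i f p : nnm f -> measurable_fun setT (fun u : mR => ker (comp i p) u * f (setc i u p))%E.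
Proof.
move=> [mf f0]; apply: emeasurable_funM; first exact: measurable_ker1.
apply: measurableT_comp => //; apply: measurableT_comp; first exact: measurable_swap.
exact: measurable_pair1.
Qed.

Lemma Av1 i p : Av i (fun=> 1%E) p = 1%E.
Proof.
rewrite /Av (eq_integral (fun u : mR => ker (comp i p) u * (\1_(setT : set mR) u)%:E)%E); last first.
  by move=> u _; rewrite indicT.
by rewrite int_ker// setIT lam_cell -EFinM mulVf// gt_eqF.
Qed.

Lemma Av_le1 i f p : nnm f -> (forall p, f p <= 1)%E -> (Av i f p <= 1)%E.
Proof.
move=> nf f1; rewrite -(Av1 i p); apply: ge0_le_integral => //.
- by move=> u _; apply: mule_ge0; [exact: ker_ge0|case: nf].
- exact: nnm_kern1.
- by apply: (@nnm_kern1 i (fun=> 1%E) p).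
- by move=> u _; apply: lee_pmul => //; [exact: ker_ge0|case: nf].
Qed.

Lemma AvD i f g p : nnm f -> nnm g -> Av i (fun p => f p + g p)%E p = (Av i f p + Av i g p)%E.
Proof.
move=> nf ng; rewrite /Av.
have k0 h u : nnm h -> (0 <= ker (comp i p) u * h (setc i u p))%E.
  by move=> [_ h0]; apply: mule_ge0 => //; exact: ker_ge0.
have m1 := nnm_kern1 i p nf; have m2 := nnm_kern1 i p ng.
have k1 u (_ : setT u) := k0 f u nf; have k2 u (_ : setT u) := k0 g u ng.
rewrite -ge0_integralD//; apply: eq_integral => u _; rewrite ge0_muleDr//; [by case: nf|by case: ng].
Qed.

Lemma int_swap i f : nnm f -> (\int[vol]_p f (swap i p) = \int[vol]_p f p)%E.
Proof.
move=> [mf f0]; have ms := @measurable_swap R n i.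
have h := @ge0_integral_pushforward _ _ _ _ _ _ ms vol setT f measurableT mf (fun y _ => f0 y).
rewrite preimage_setT in h; rewrite -[LHS]h.
by apply: eq_measure_integral => A mA _; rewrite /pushforward/=; exact: vol_swap.
Qed.

Lemma nnmM f g : nnm f -> nnm g -> nnm (fun p => f p * g p)%E.
Proof. by move=> [mf f0] [mg g0]; split => [|p]; [exact: emeasurable_funM|exact: mule_ge0]. Qed.

Lemma Av_adj i f g : nnm f -> nnm g -> (\int[vol]_p (g p * Av i f p) = \int[vol]_p (Av i g p * f p))%E.
Proof.
move=> nf ng.
have H f' g' : nnm f' -> nnm g' -> (\int[vol]_p (g' p * Av i f' p) =
    \int[leb]_y \int[lam]_t \int[lam]_u (g' (swap i (y, t)) * (ker t u * f' (swap i (y, u)))))%E.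
  move=> nf' ng'; rewrite -(int_swap i (nnmM ng' (nnm_Av i nf'))) vol_tonelli.
  - apply: eq_integral => y _; apply: eq_integral => t _.
    rewrite /Av -(@ge0_integralZl _ _ _ lam setT measurableT).
    + apply: eq_integral => u _; rewrite comp_swap swapK/= /setc swapK/=; done.
    + exact: nnm_kern1.
    + by move=> u _; apply: mule_ge0; [exact: ker_ge0|case: nf'].
    + by case: ng'.
  - by case: (nnm_swap i (nnmM ng' (nnm_Av i nf'))).
  - by case: (nnm_swap i (nnmM ng' (nnm_Av i nf'))).
rewrite (H f g nf ng).
have -> : (\int[vol]_p (Av i g p * f p) = \int[vol]_p (f p * Av i g p))%E.
  by apply: eq_integral => p _; rewrite muleC.
rewrite (H g f ng nf); apply: eq_integral => y _.
have [mf' f0'] := nnm_swap i nf; have [mg' g0'] := nnm_swap i ng.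
rewrite (fubini_tonelli (fun q : mR * mR => g (swap i (y, q.1)) * (ker q.1 q.2 * f (swap i (y, q.2)))))%E.
- apply: eq_integral => u _; apply: eq_integral => t _ /=.
  by rewrite kerC muleCA muleA muleC muleA.
- apply: emeasurable_funM.
    apply: (@measurableT_comp _ _ _ _ _ _ (g \o swap i) _ (fun q : mR * mR => (y, q.1))) => //.
    by apply: (@measurableT_comp _ _ _ _ _ _ (fun t : mR => (y, t))); [exact: measurable_pair1|].
  apply: emeasurable_funM; first exact: measurable_ker.
  apply: (@measurableT_comp _ _ _ _ _ _ (f \o swap i) _ (fun q : mR * mR => (y, q.2))) => //.
  by apply: (@measurableT_comp _ _ _ _ _ _ (fun t : mR => (y, t))); [exact: measurable_pair1|].
- by move=> q; apply: mule_ge0; [exact: g0'|apply: mule_ge0; [exact: ker_ge0|exact: f0']].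
Qed.

(** Over all the coordinates this is the average on grid cubes; it is handled through its constancy
    on cubes ([Avs_cell]) and its total integral ([int_Avs]). *)
Definition Avs (r : seq (option 'I_n)) f := foldr Av f r.

Lemma nnm_Avs r f : nnm f -> nnm (Avs r f).
Proof. by move=> nf; elim: r => //= i r IH; exact: nnm_Av. Qed.

Lemma Avs_le1 r f p : nnm f -> (forall p, f p <= 1)%E -> (Avs r f p <= 1)%E.
Proof.
move=> nf f1; elim: r p => [|i r IH] p //=; apply: Av_le1 => //; exact: nnm_Avs.
Qed.

Lemma AvsD r f g p : nnm f -> nnm g -> Avs r (fun p => f p + g p)%E p = (Avs r f p + Avs r g p)%E.
Proof.
move=> nf ng; elim: r p => [|i r IH] p //=.
rewrite (_ : Avs r (f \+ g)%E = (fun p => Avs r f p + Avs r g p)%E); last exact/funext.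
by apply: AvD; exact: nnm_Avs.
Qed.

Lemma Avs1 r p : Avs r (fun=> 1%E) p = 1%E.
Proof.
elim: r p => [//|i r IH] p /=; rewrite (_ : Avs r (fun=> 1%E) = (fun=> 1%E)); last exact/funext.
exact: Av1.
Qed.

Lemma int_Avs r f : nnm f -> (\int[vol]_p Avs r f p = \int[vol]_p f p)%E.
Proof.
move=> nf; elim: r => [|i r IH] //=; rewrite -IH.
have n1 : nnm (fun=> 1%E) by [].
have := Av_adj i (nnm_Avs r nf) n1; under eq_integral do rewrite mul1e.
by move=> ->; apply: eq_integral => p _; rewrite Av1 mul1e.
Qed.

Definition inv i f := forall p u, fl u = fl (comp i p) -> f (setc i u p) = f p.

Lemma setcC i j u v p : i != j -> setc i u (setc j v p) = setc j v (setc i u p).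
Proof.
move=> ij; apply: comp_inj => k; rewrite !comp_setc.
by have [->|//] := eqVneq k i; rewrite (negbTE ij).
Qed.

Lemma setcc i u v p : setc i u (setc i v p) = setc i u p.
Proof. by apply: comp_inj => k; rewrite !comp_setc; case: eqP. Qed.

Lemma inv_Av i f : inv i (Av i f).
Proof.
move=> p u h; rewrite /Av; apply: eq_integral => v _.
by rewrite setcc comp_setc eqxx /ker h.
Qed.

Lemma inv_Av_neq i j f : i != j -> inv j f -> inv j (Av i f).
Proof.
move=> ij hf p u h; rewrite /Av; apply: eq_integral => v _.
rewrite setcC// hf; last by rewrite comp_setc eq_sym (negbTE ij).
by rewrite comp_setc (negbTE ij).
Qed.

Lemma inv_Avs r f i : i \in r -> inv i (Avs r f).
Proof.
elim: r => //= j r IH; rewrite inE; have [<- _|ij /= ir] := eqVneq i j; first exact: inv_Av.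
by apply: inv_Av_neq; [rewrite eq_sym|exact: IH].
Qed.

Definition allc : seq (option 'I_n) := enum {: option 'I_n}.

Lemma Avs_cell f p q : (forall i, fl (comp i p) = fl (comp i q)) -> Avs allc f p = Avs allc f q.
Proof.
(* The points between p and q, with one coordinate after the other taken from q; all of them are in
   the same cube. *)
move=> h; pose hyb r := foldr (fun i p' => setc i (comp i q) p') p r.
have hc r j : comp j (hyb r) = if j \in r then comp j q else comp j p.
  by elim: r => //= i r IH; rewrite comp_setc inE IH; have [->|] := eqVneq j i.
have hv r : Avs allc f (hyb r) = Avs allc f p.
  elim: r => //= i r <-; apply: inv_Avs; first by rewrite mem_enum.
  by rewrite hc -h; case: ifP.
rewrite -(hv allc); congr (Avs allc f _); apply: comp_inj => j.
by rewrite hc mem_enum.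
Qed.

Definition cube q : set V := vbox (fun i : 'I_n => cell (fl (q.1 ord0 i))) (cell (fl q.2)).

Lemma cubeE q p : cube q p <-> forall i, fl (comp i p) = fl (comp i q).
Proof.
split; last by move=> h; split => [i|]; apply/cell_fl; [exact: (h (Some i))|exact: (h None)].
by move=> [h1 h2] [i|]; apply/cell_fl; [exact: h1|exact: h2].
Qed.

Lemma measurable_cube q : measurable (cube q).
Proof. by apply: measurable_vbox => *; exact: measurable_cell. Qed.

Lemma vol_cube q : vol (cube q) = (s ^+ n.+1)%:E.
Proof.
rewrite vol_vbox; try by move=> *; exact: measurable_cell.
rewrite lam_cell (eq_bigr (fun=> s%:E)); last by move=> i _; exact: lam_cell.
by rewrite prode_fin prodr_const card_ord -EFinM exprSr.
Qed.

Lemma nnm_indic (E : set V) : measurable E -> nnm (fun p => (\1_E p)%:E).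
Proof.
move=> mE; split; first by apply/measurable_EFinP; exact: measurable_indic.
by move=> p; rewrite lee_fin indicE.
Qed.

Lemma indic_le1 (E : set V) p : ((\1_E p)%:E <= 1 :> \bar R)%E.
Proof. by rewrite lee_fin indicE; case: (_ \in _). Qed.

(** The average is constant on the cube of q and its integral over the whole space is the volume of
    E. So a set with at most half the volume of a cube has averages at most 1/2. *)
Lemma Avs_cubeE (E : set V) q : measurable E ->
  (Avs allc (fun p => (\1_E p)%:E) q * (s ^+ n.+1)%:E <= vol E)%E.
Proof.
move=> mE; have nE := nnm_indic mE; have [mA A0] := nnm_Avs allc nE.
have -> : vol E = (\int[vol]_p Avs allc (fun p => (\1_E p)%:E) p)%E.
  by rewrite int_Avs// integral_indic// setIT.
rewrite -(vol_cube q) -integral_cst; last exact: measurable_cube.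
rewrite (eq_integral (Avs allc (fun p => (\1_E p)%:E))).
  by apply: ge0_subset_integral => //; exact: measurable_cube.
by move=> p; rewrite inE => /cubeE h; apply/esym; apply: Avs_cell.
Qed.

(** The mass that averaging in the direction i moves across the boundary of E. *)
Definition off i (E : set V) : \bar R :=
  (\int[vol]_p ((\1_E p)%:E * Av i (fun p => (\1_(~` E) p)%:E) p))%E.

Lemma indicC_D (E : set V) p : ((\1_E p)%:E + (\1_(~` E) p)%:E = 1 :> \bar R)%E.
Proof.
rewrite !indicE in_setC; case: (p \in E) => /=; by rewrite ?addr0 ?add0e ?adde0.
Qed.

(** Subadditivity over the directions: the outermost average is moved to the indicator of E by
    [Av_adj]. Of the two averages then multiplied, that of E is at most 1 on E and that of the
    complement at most 1 off E, which leaves one [off] and the same integral with one direction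
    less. *)
Lemma Avs_off (E : set V) r : measurable E ->
  (\int[vol]_p ((\1_E p)%:E * Avs r (fun p => (\1_(~` E) p)%:E) p) <= \sum_(i <- r) off i E)%E.
Proof.
move=> mE; have nE := nnm_indic mE; have nC := nnm_indic (measurableC mE).
elim: r => [|i r IH] /=.
  rewrite big_nil integral0_eq// => p _; rewrite -EFinM !indicE in_setC.
  by case: (_ \in _); rewrite ?mulr0 ?mul0r.
rewrite big_cons; apply: le_trans (leeD (lexx _) IH).
have [mB B0] := nnm_Avs r nC; have [mA A0] := nnm_Av i nE.
rewrite (Av_adj i (nnm_Avs r nC) nE) /off (Av_adj i nC nE).
have n1 := nnmM (nnm_Av i nE) nC; have n2 := nnmM nE (nnm_Avs r nC).
rewrite -ge0_integralD//; try (by case: n1); try (by case: n2).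
apply: ge0_le_integral => //.
- by move=> p _; exact: mule_ge0.
- exact: emeasurable_funM.
- by apply: emeasurable_funD; [case: n1|case: n2].
move=> p _; have := Avs_le1 r p nC (indic_le1 _); have := Av_le1 i p nE (indic_le1 _).
rewrite !indicE in_setC; case: (p \in E) => /= h1 h2.
  rewrite mule0 add0e mul1e -[leRHS]mul1e; exact: lee_pmul.
by rewrite mule1 mul0e adde0 -[leRHS]mule1; exact: lee_pmul.
Qed.

End averages.

(** * From grid averages to perimeter *)

Section averages2.
Variables (R : realType) (n : nat).
Local Notation mR := (measurableTypeR R).
Local Notation lam := (@lebesgue_measure R).
Local Notation X := 'rV[R]_n.
Local Notation V := (Rn1 R n).
Local Notation leb := (leb R n).
Local Notation vol := (vol R n).
Local Notation Om := (@Omega R n).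
Implicit Types (i : option 'I_n) (E F : set V).

Section grid.
Variable s : R.
Hypothesis s0 : 0 < s.

Lemma lam_cell_open (A : set mR) k : measurable A ->
  lam (A `&` cell s k) = lam (A `&` `]k%:~R * s, ((k + 1)%:~R * s)%R[).
Proof.
move=> mA; have mc := measurable_cell s k.
apply/eqP; rewrite eq_le; apply/andP; split; last first.
  by apply: le_meas; [by mset|by mset|apply: setIS; apply: subset_itv; rewrite bnd_simp].
apply: (@le_trans _ _ (lam ([set k%:~R * s : mR] `|` (A `&` `]k%:~R * s, ((k + 1)%:~R * s)%R[)))).
  have m1 : measurable [set k%:~R * s : mR] by exact: measurable_set1.
  apply: le_meas; [by mset|by mset|] => t [At]; rewrite /cell/= !in_itv/= le_eqVlt => /andP[/orP[/eqP <-|h1] h2].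
    by left.
  by right; split => //=; apply/andP.
apply: le_trans (measureU2 _ _ _) _; [exact: measurable_set1|by mset|].
by rewrite -[X in (X + _)%E]/(lam _) lebesgue_measure_set1 add0e.
Qed.

(** The lengths of E and of its complement in a cell have sum s, so their product is at most s^2 /
    4, and it vanishes when E is constant on the cell. *)
Lemma cell_prod E y k : measurable E ->
  ((s^-1)%:E * lam (line E y `&` cell s k) * lam (cell s k `&` ~` line E y) <=
    (s / 4 * \1_(NC E (k%:~R * s) ((k + 1)%:~R * s)) y)%:E)%E.
Proof.
move=> mE; have mL := measurable_line y mE; have mc := measurable_cell s k.
have mLC := measurableC mL.
have ms : (lam (line E y `&` cell s k) + lam (cell s k `&` ~` line E y) = s%:E)%E.
  rewrite -(lam_cell s0 k) (setIC (line _ _)) -measureU//; [|by mset|by mset|].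
    by rewrite -setIUr setUCr setIT.
  by rewrite setIACA setICr setI0.
have f1 : lam (line E y `&` cell s k) \is a fin_num.
  by rewrite ge0_fin_numE// (@le_lt_trans _ _ s%:E) ?ltry// -ms leeDl.
have f2 : lam (cell s k `&` ~` line E y) \is a fin_num.
  by rewrite ge0_fin_numE// (@le_lt_trans _ _ s%:E) ?ltry// -ms leeDr.
have a0 : 0 <= fine (lam (line E y `&` cell s k)) by exact: fine_ge0.
have b0 : 0 <= fine (lam (cell s k `&` ~` line E y)) by exact: fine_ge0.
have ab : fine (lam (line E y `&` cell s k)) + fine (lam (cell s k `&` ~` line E y)) = s.
  by apply: EFin_inj; rewrite EFinD !fineK.
rewrite -(fineK f1) -(fineK f2) -!EFinM lee_fin.
rewrite indicE; case: (boolP (y \in _)) => hy.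
  rewrite mulr1; move: ab a0 b0; move: (fine _) => a; move: (fine _) => b <- a0 b0.
  have [ab0|ab0] := eqVneq (a + b) 0.
    by rewrite ab0 invr0 !mul0r.
  have ab1 : 0 < a + b by rewrite lt_neqAle eq_sym ab0 addr_ge0.
  rewrite -mulrA ler_pdivrMl// -subr_ge0 (_ : _ - _ = (a - b) ^+ 2 / 4); last by field.
  by rewrite divr_ge0// sqr_ge0.
rewrite mulr0; move: hy; rewrite notin_setE => hy.
suff : fine (lam (line E y `&` cell s k)) = 0 \/ fine (lam (cell s k `&` ~` line E y)) = 0.
  by case=> ->; rewrite ?mulr0 ?mul0r.
apply: contrapT => /not_orP[h1 h2]; apply: hy; split.
  rewrite -lam_cell_open// -(fineK f1) lte_fin lt_neqAle eq_sym a0 andbT; exact/eqP.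
rewrite setDE setIC -lam_cell_open// setIC -(fineK f2) lte_fin lt_neqAle eq_sym b0 andbT; exact/eqP.
Qed.

(** On each line a cell contributes at most s / 4, and only if E changes inside it. Counting these
    cells is what the several intervals of [lines_dir] are for. *)
Lemma off_le E i C : measurable E -> E `<=` Om -> HV E i 0 C -> (off s i E <= (s / 4 * C)%:E)%E.
Proof.
move=> mE EO hE.
have nE := nnm_indic mE; have nC := nnm_indic (measurableC mE).
have nh := nnmM nE (nnm_Av s0 i nC).
rewrite /off -(int_swap i nh).
pose E' := swap i @^-1` E.
have mE' : measurable E' := measurable_swap_preimage i mE.
set h := (X in (\int[_]_p X p)%E).
have hE' y t : h (y, t) = ((\1_(line E' y) t)%:E * ((s^-1)%:E * lam (cell s (fl s t) `&` ~` line E' y)))%E.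
  rewrite /h/= /Av comp_swap swapK/=.
  have -> : \1_E (swap i (y, t)) = \1_(line E' y) t :> R by rewrite !indicE; congr ((nat_of_bool _)%:R); apply/idP/idP; rewrite !inE.
  congr (_ * _)%E; rewrite -int_ker//; last by apply: measurableC; exact: measurable_line.
  apply: eq_integral => u _; congr (_ * _%:E)%E; rewrite !indicE /setc swapK/=.
  by congr ((nat_of_bool _)%:R); apply/idP/idP; rewrite !inE.
have [mh h0] : nnm h by exact: (nnm_swap i nh).
(* The 2 M cells start at height 0 in the vertical direction, where E has nothing below and the
   intervals of [lines_dir] must be in Omega. *)
pose lo (M : nat) : int := if i is Some _ then - M%:Z else 0.
pose Dm (M : nat) : set mR := \bigcup_(j < 2 * M) cell s (lo M + j%:Z).
have DmE M t : Dm M t <-> lo M <= fl s t < lo M + (2 * M)%:Z.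
  split.
    move=> [j /= jM /(cell_fl s0) ->]; lia.
  move=> /andP[h1 h2]; exists `|fl s t - lo M|%N; last first.
    by apply/(cell_fl s0); lia.
  rewrite /=; lia.
have mD M : measurable (Dm M) by apply: bigcup_measurable => j _; exact: measurable_cell.
pose FM M : set V := [set p | Dm M p.2].
have mFM M : measurable (FM M).
  rewrite (_ : FM M = setT `*` Dm M); first exact: measurableX.
  by apply/seteqP; split => p //= [].
have ndF : nondecreasing_seq FM.
  move=> M M' MM; apply/subsetPset => p /DmE H; apply/DmE; move: H; rewrite /lo.
  by case: (i) => [j|]; lia.
have -> : (\int[vol]_p h p = \int[vol]_(p in \bigcup_M FM M) h p)%E.
  rewrite [RHS]integral_mkcond; apply: eq_integral => -[y t] _; rewrite patchE.
  case: ifPn => // /negP hn; rewrite hE' indicE memNset ?mul0e// => Lt; apply: hn; rewrite inE.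
  exists (`|fl s t|%N.+1) => //; apply/DmE; rewrite /lo.
  have : i = None -> 0 <= fl s t.
    move=> iN; have := EO _ Lt; rewrite /Om /= iN /= => t0.
    by rewrite /fl floor_ge0 divr_ge0 // ltW.
  move=> /=; move: (fl s t) => k; case: (i) => [j _|/(_ erefl)]; lia.
have key M : (\int[vol]_(p in FM M) h p <= (s / 4 * C)%:E)%E.
  rewrite integral_mkcond vol_tonelli; first last.
  - by move=> p; rewrite patchE; case: ifP.
  - by apply/(measurable_restrictT _ (mFM M)); exact: measurable_funTS.
  pose a (j : 'I_(2 * M)) : R := (lo M + j%:Z)%:~R * s.
  pose b (j : 'I_(2 * M)) : R := (lo M + j%:Z + 1)%:~R * s.
  have dj : forall (k j : 'I_(2 * M)) u, a k < u < b k -> a j < u < b j -> k = j.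
    have H (j : 'I_(2 * M)) u : a j < u < b j -> fl s u = lo M + j%:Z.
      by move=> /andP[h1 h2]; apply/(cell_fl s0); rewrite /cell/= in_itv/= ltW.
    by move=> j j' u /H e1 /H e2; apply: val_inj; move: e1; rewrite e2 => /addrI[].
  have ha : i = None -> forall j, 0 <= a j.
    move=> iN j; rewrite /a /lo iN add0r mulr_ge0 ?(ltW s0)//.
  have := @lines_dir R n _ a b dj E i 0 C (lexx 0) mE EO ha hE.
  rewrite -/E' => hl.
  apply: (@le_trans _ _ (\int[leb]_y \sum_j (s / 4 * \1_(NC E' (a j) (b j)) y)%:E)%E).
    apply: ge0_le_integral => //.
    - by move=> y _; apply: integral_ge0 => t _; rewrite patchE; case: ifP.
    - apply: (@measurable_fun_fubini_tonelli_F _ _ _ _ _ lam (h \_ (FM M))).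
        by apply/(measurable_restrictT _ (mFM M)); exact: measurable_funTS.
      by move=> p; rewrite patchE; case: ifP.
    - apply: emeasurable_sum => j; apply/measurable_EFinP; apply: measurable_funM => //.
      by apply: measurable_indic; exact: measurable_NC.
    move=> y _; have mL := measurable_line y mE'; have mLC := measurableC mL.
    apply: (@le_trans _ _ (\int[lam]_t \sum_(j < 2 * M) ((s^-1)%:E * lam (cell s (lo M + j%:Z) `&` ~` line E' y) * (\1_(line E' y `&` cell s (lo M + j%:Z)) t)%:E))%E).
      have c0 j : (0 <= (s^-1)%:E * lam (cell s (lo M + j%:Z) `&` ~` line E' y))%E.
        by apply: mule_ge0 => //; rewrite lee_fin invr_ge0 ltW.
      apply: ge0_le_integral => //.
      - by move=> t _; rewrite patchE; case: ifP.
      - apply: (@measurableT_comp _ _ _ _ _ _ (h \_ (FM M)) _ (fun t : mR => (y, t))); last exact: measurable_pair1.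
        by apply/(measurable_restrictT _ (mFM M)); exact: measurable_funTS.
      - apply: emeasurable_sum => j; apply: emeasurable_funM => //; apply/measurable_EFinP.
        by apply: measurable_indic; apply: measurableI => //; exact: measurable_cell.
      move=> t _; rewrite patchE; case: ifPn => [|_]; last by apply: sume_ge0 => j _; apply: mule_ge0.
      rewrite inE => -[j /= jM hj].
      rewrite (bigD1 (Ordinal jM))//=; apply: (@le_trans _ _ _ _ _ _ (leeDl _ _)); last first.
        by apply: sume_ge0 => k _; apply: mule_ge0.
      have /(cell_fl s0) e := hj; rewrite hE' e muleC lee_pmul//.
      rewrite lee_fin !indicE; case: (boolP (t \in line E' y)) => // tL.
      by rewrite mem_set//; split => //; rewrite inE in tL.
    have mI j : measurable (line E' y `&` cell s (lo M + j%:Z)) by apply: measurableI => //; exact: measurable_cell.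
    rewrite ge0_integral_sum//; first last.
    - by move=> j t _; apply: mule_ge0 => //; apply: mule_ge0 => //; rewrite lee_fin invr_ge0 ltW.
    - by move=> j; apply: emeasurable_funM => //; apply/measurable_EFinP; apply: measurable_indic.
    apply: lee_sum => j _; rewrite ge0_integralZl//; first last.
    - by apply: mule_ge0 => //; rewrite lee_fin invr_ge0 ltW.
    - by apply/measurable_EFinP; apply: measurable_indic.
    rewrite integral_indic// setIT; apply: le_trans (cell_prod y (lo M + j%:Z) mE').
    by rewrite muleAC.
  rewrite ge0_integral_sum//; first last.
  - by move=> j y _; rewrite lee_fin mulr_ge0// divr_ge0// ltW.
  - by move=> j; apply/measurable_EFinP; apply: measurable_funM => //; apply: measurable_indic; exact: measurable_NC.
  rewrite (eq_bigr (fun j => (s / 4)%:E * leb (NC E' (a j) (b j)))%E); last first.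
    move=> j _; under eq_integral do rewrite EFinM.
    rewrite ge0_integralZl//; first last.
    - by rewrite lee_fin divr_ge0// ltW.
    - by apply/measurable_EFinP; apply: measurable_indic; exact: measurable_NC.
    by rewrite integral_indic ?setIT//; exact: measurable_NC.
  have -> : (\sum_(j < 2 * M) (s / 4)%:E * leb (NC E' (a j) (b j)) = (s / 4)%:E * \sum_(j < 2 * M) leb (NC E' (a j) (b j)))%E.
    by rewrite ge0_sume_distrr.
  rewrite [(s / 4 * C)%:E]EFinM; apply: lee_pmul => //; first by rewrite lee_fin divr_ge0// ltW.
  exact: sume_ge0.
have cv := @ge0_nondecreasing_set_cvg_integral _ _ _ FM h vol ndF mFM (fun M => measurable_funTS mh) (fun M p _ => h0 p).
by apply: (cvge_to_le cv); apply: nearW.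
Qed.

Lemma offC E i : measurable E -> off s i (~` E) = off s i E.
Proof.
move=> mE; have nE := nnm_indic mE; have nC := nnm_indic (measurableC mE).
rewrite /off setCK (Av_adj s0 i nE nC); apply: eq_integral => p _; exact: muleC.
Qed.

Lemma sum_off_le E : BVset E -> (\sum_(i <- allc n) off s i E <= (n.+1%:R * (s / 4) * Per E)%:E)%E.
Proof.
move=> bE; apply: (@le_trans _ _ (\sum_(i <- allc n) (s / 4 * Per E)%:E)%E).
  apply: lee_sum => i _; apply: off_le; [exact: BVset_measurable|exact: BVset_sub|exact: BV_HV].
rewrite sumEFin lee_fin big_const_seq count_predT /allc -cardE card_option card_ord iter_addr_0.
have -> : (s / 4 * Per E) *+ n.+1 = n.+1%:R * (s / 4) * Per E by rewrite -mulr_natl mulrA.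
exact: lexx.
Qed.

(* [E] fills at most half of each grid cube, so on [E] the cube average of the complement is at
   least 1/2, while the averages in each direction move [E] by at most [s / 4] times the
   perimeter. *)
Lemma isoperimetric E : BVset E -> 2 * fine (vol E) <= s ^+ n.+1 ->
  fine (vol E) <= n.+1%:R * (s / 2) * Per E.
Proof.
move=> bE hs; have mE := BVset_measurable bE; have Eoo := BVset_vol bE.
have nE := nnm_indic mE; have nC := nnm_indic (measurableC mE).
have fE : vol E \is a fin_num by rewrite ge0_fin_numE.
have sn0 : 0 < s ^+ n.+1 by exact: exprn_gt0.
have half q : (2^-1%:E <= Avs s (allc n) (fun p => (\1_(~` E) p)%:E) q)%E.
  have [_ A0] := nnm_Avs s0 (allc n) nE; have [_ B0] := nnm_Avs s0 (allc n) nC.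
  have h := Avs_cubeE s0 q mE.
  have e : (Avs s (allc n) (fun p => (\1_E p)%:E) q + Avs s (allc n) (fun p => (\1_(~` E) p)%:E) q = 1)%E.
    rewrite -AvsD// -[RHS](Avs1 s0 (allc n) q); congr (Avs s _ _ q).
    by apply/funext => p; exact: indicC_D.
  have f1 : Avs s (allc n) (fun p => (\1_E p)%:E) q \is a fin_num.
    by rewrite ge0_fin_numE// (@le_lt_trans _ _ 1%E) ?ltry// -e leeDl.
  have f2 : Avs s (allc n) (fun p => (\1_(~` E) p)%:E) q \is a fin_num.
    by rewrite ge0_fin_numE// (@le_lt_trans _ _ 1%E) ?ltry// -e leeDr.
  move: h e; rewrite -(fineK f1) -(fineK f2) -(fineK fE) -EFinM -EFinD !lee_fin => h [e].
  move: h hs e; move: (fine _) => u; move: (fine _) => m; move: (fine _) => v h hs e.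
  have : u * s ^+ n.+1 <= 2^-1 * s ^+ n.+1 by lra.
  rewrite ler_pM2r// => ?; lra.
have h := Avs_off s0 (allc n) mE.
have h2 : (2^-1%:E * vol E <= (n.+1%:R * (s / 4) * Per E)%:E)%E.
  apply: le_trans (le_trans h (sum_off_le bE)).
  have -> : vol E = (\int[vol]_p (\1_E p)%:E)%E by rewrite integral_indic// setIT.
  have [mE1 E10] := nE; have [mB B0] := nnm_Avs s0 (allc n) nC.
  rewrite -ge0_integralZl//.
  apply: ge0_le_integral => //.
  - exact: emeasurable_funM.
  - exact: emeasurable_funM.
  by move=> p _; rewrite muleC; apply: lee_pmul.
rewrite -(fineK fE) -EFinM lee_fin in h2.
by move: h2; move: (fine _) (Per E) n.+1%:R => m P N h2; nra.
Qed.

(** On the part of E outside F, 1 is the average of E plus that of its complement, hence at most the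
    average of F plus [dl] plus the average of the complement of E. The integrals of these averages,
    over the complement of F and over E, are bounded by perimeters through [Avs_off]. *)
Lemma symd_grid E F (dl : R) : BVset E -> BVset F -> 0 <= dl ->
  (forall p, E p -> (Avs s (allc n) (fun p => (\1_E p)%:E) p <= Avs s (allc n) (fun p => (\1_F p)%:E) p + dl%:E)%E) ->
  fine (vol (E `\` F)) <= n.+1%:R * (s / 4) * Per E + n.+1%:R * (s / 4) * Per F + dl * fine (vol E).
Proof.
move=> bE bF dl0 hdl; have mE := BVset_measurable bE; have mF := BVset_measurable bF.
have Eoo := BVset_vol bE.
have nE := nnm_indic mE; have nC := nnm_indic (measurableC mE).
have nF := nnm_indic mF; have nCF := nnm_indic (measurableC mF).
have fE : vol E \is a fin_num by rewrite ge0_fin_numE.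
have fEF : vol (E `\` F) \is a fin_num.
  rewrite ge0_fin_numE// (le_lt_trans _ Eoo)//; apply: le_meas => //; by mset.
rewrite -lee_fin fineK// !EFinD [(dl * _)%:E]EFinM fineK//.
have h1 := le_trans (Avs_off s0 (allc n) mE) (sum_off_le bE).
have h2 := Avs_off s0 (allc n) (measurableC mF).
rewrite setCK in h2; rewrite (eq_bigr (fun i => off s i F)) in h2; last by move=> i _; exact: offC.
have {}h2 := le_trans h2 (sum_off_le bF).
apply: le_trans (leeD (leeD h1 h2) (lexx _)).
have -> : (dl%:E * vol E = \int[vol]_p (dl%:E * (\1_E p)%:E))%E.
  by rewrite ge0_integralZl//; [rewrite integral_indic// setIT|case: nE].
have [mEC EC0] := nnmM nE (nnm_Avs s0 (allc n) nC).
have [mFC FC0] := nnmM nCF (nnm_Avs s0 (allc n) nF).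
have mEd : measurable_fun setT (fun p => dl%:E * (\1_E p)%:E)%E by apply: emeasurable_funM => //; case: nE.
have d0 p : (0 <= dl%:E * (\1_E p)%:E)%E by apply: mule_ge0; rewrite lee_fin.
rewrite -ge0_integralD//.
have mD : measurable_fun setT (fun p => (\1_E p)%:E * Avs s (allc n) (fun p0 => (\1_(~` E) p0)%:E) p +
   (\1_(~` F) p)%:E * Avs s (allc n) (fun p0 => (\1_F p0)%:E) p)%E by exact: emeasurable_funD.
rewrite -ge0_integralD//; last by move=> p _; exact: adde_ge0.
have -> : vol (E `\` F) = (\int[vol]_p (\1_(E `\` F) p)%:E)%E by rewrite integral_indic ?setIT//; by mset.
apply: ge0_le_integral => //.
- by apply/measurable_EFinP; apply: measurable_indic; by mset.
- exact: emeasurable_funD.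
move=> p _; rewrite [in leLHS]indicE; case: (boolP (p \in _)) => [|_]; last first.
  by apply: adde_ge0 => //; exact: adde_ge0.
rewrite inE => -[Ep Fp].
have -> : (\1_E p : R) = 1 by rewrite indicE mem_set.
have -> : (\1_(~` F) p : R) = 1 by rewrite indicE mem_set.
have e : (Avs s (allc n) (fun p => (\1_E p)%:E) p + Avs s (allc n) (fun p => (\1_(~` E) p)%:E) p = 1)%E.
  rewrite -AvsD// -[RHS](Avs1 s0 (allc n) p); congr (Avs s _ _ p).
  by apply/funext => q; exact: indicC_D.
rewrite !mul1e mule1 -[leLHS]/1%E -e addeC -addeA leeD2l//.
exact: hdl.
Qed.

End grid.
End averages2.

(** * Compactness *)

Section ultra.
Variable R : realType.

(** [0, 1] is cut into finitely many slices of height 1 / (m+1), and an ultrafilter contains the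
    preimage of one of them. *)
Lemma ultra_real (U : set_system nat) (u : nat -> R) (dl : R) : UltraFilter U ->
  (forall k, 0 <= u k <= 1) -> 0 < dl -> exists2 A, U A & forall k l, A k -> A l -> u k <= u l + dl.
Proof.
move=> uU u01 dl0.
have [m hm] : exists m : nat, m.+1%:R^-1 <= dl.
  have tk : \forall k \near \oo, dl^-1 < (k%:R : R) by exact: nbhs_infty_gtr.
  case: tk => k _ /(_ k (leqnn k)) h; exists k.
  by rewrite invf_ple ?posrE// (le_trans (ltW h))// ler_nat.
have H (j : nat) : (exists2 A, U A & forall k l, A k -> A l -> u k <= u l + dl) \/ U [set k | j%:R / m.+1%:R <= u k].
  elim: j => [|j [IH|IH]]; [right|by left|].
    by rewrite (_ : mkset _ = setT); [exact: filterT|apply/seteqP; split => k //= _; rewrite mul0r; case/andP: (u01 k)].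
  have [h|h] := in_ultra_setVsetC [set k | j.+1%:R / m.+1%:R <= u k] uU; [by right|left].
  exists ([set k | j%:R / m.+1%:R <= u k] `&` ~` [set k | j.+1%:R / m.+1%:R <= u k]); first exact: filterI.
  move=> k l [_ /negP]; rewrite -ltNge => /ltW h1 [/= h2 _].
  apply: (le_trans h1); rewrite -natr1 mulrDl mul1r; exact: lerD.
(* The level (m+2) / (m+1) exceeds 1, so the second alternative is impossible. *)
have [//|h] := H m.+2.
have [k /= hk] := @filter_ex _ U _ _ h.
have : m.+2%:R / m.+1%:R <= 1 :> R by apply: le_trans hk _; case/andP: (u01 k).
by rewrite ler_pdivrMr// mul1r ler_nat ltnn.
Qed.

Lemma geometric_union d (T : measurableType d) (mu : {measure set T -> \bar R}) (H : nat -> set T) j :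
  (forall i, measurable (H i)) -> (forall i, (mu (H i) <= (2^-1 ^+ (j + i))%:E)%E) ->
  (mu (\bigcup_i H i) <= (2 * 2^-1 ^+ j)%:E)%E.
Proof.
move=> mH hH; pose P m := \big[setU/set0]_(i < m) H i.
have mP m : measurable (P m) by exact: bigsetU_measurable.
have -> : \bigcup_i H i = \bigcup_m P m.
  apply/seteqP; split => x.
    by move=> [i _ Hx]; exists i.+1 => //; rewrite /P -(bigcup_mkord i.+1 H); exists i => /=.
  by move=> [m _]; rewrite /P -(bigcup_mkord m H) => -[i _ Hx]; exists i.
have hP m : (mu (P m) <= (2 * 2^-1 ^+ j - 2 * 2^-1 ^+ (j + m))%:E)%E.
  elim: m => [|m IH]; first by rewrite /P big_ord0 measure0 addn0 subrr.
  rewrite /P big_ord_recr/=; apply: le_trans (measureU2 _ (mP m) (mH m)) _.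
  apply: le_trans (leeD IH (hH m)) _; rewrite -EFinD lee_fin addnS exprS mulrA mulfV// mul1r.
  by move: (2^-1 ^+ (j + m)) (2^-1 ^+ j) => a b; lra.
apply: measure_bigcup_le => //.
  move=> a b ab; apply/subsetPset; rewrite /P -!(bigcup_mkord _ H) => x [i /= ia Hx].
  by exists i => //=; exact: leq_trans ab.
move=> m; apply: le_trans (hP m) _; rewrite lee_fin gerBl.
by rewrite mulr_ge0// exprn_ge0.
Qed.

End ultra.

Section compactness.
Variables (R : realType) (n : nat).
Local Notation mR := (measurableTypeR R).
Local Notation V := (Rn1 R n).
Local Notation vol := (vol R n).
Local Notation Om := (@Omega R n).

Lemma fin_sub (E D : set V) : measurable E -> measurable D -> (vol D < +oo)%E -> E `<=` D -> vol E \is a fin_num.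
Proof. by move=> mE mD Doo ED; rewrite ge0_fin_numE// (le_lt_trans _ Doo)//; apply: le_meas. Qed.

Lemma fine_le_vol (E D : set V) : measurable E -> measurable D -> (vol D < +oo)%E -> E `<=` D ->
  fine (vol E) <= fine (vol D).
Proof.
move=> mE mD Doo ED; apply: fine_le; [exact: (fin_sub mE mD)|by rewrite ge0_fin_numE|exact: le_meas].
Qed.

(* Along an ultrafilter, the volumes in the finitely many cubes of a grid converge; on a fine
   grid these volumes determine a set up to a small error. *)
Lemma ultra_cauchy (U : set_system nat) (F : nat -> set V) (k0 : nat) (P e : R) : UltraFilter U ->
  (forall k, BVset (F k)) -> (forall k, F k `<=` @vcube R n k0) -> (forall k, Per (F k) <= P) -> 0 < e ->
  exists2 A, U A & forall k l, A k -> A l -> symd (F k) (F l) <= e.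
Proof.
move=> uU bF FD FP e0.
have P0 : 0 <= P := le_trans (Per_ge0 _) (FP 0%N).
have mD := @measurable_vcube R n k0; have Doo := @vol_vcube R n k0.
pose v0 := fine (vol (@vcube R n k0)).
have v00 : 0 <= v0 by exact: fine_ge0.
(* With this mesh each perimeter term of [symd_grid] is at most e / 8, and [dl] makes the volume
   term at most e / 4: together e / 2 for each half of the symmetric difference. *)
pose s := e / (n.+1%:R * (P + 1) * 2).
have s0 : 0 < s by rewrite divr_gt0// !mulr_gt0// ltr_wpDl.
pose dl := e / (4 * (v0 + 1)).
have dl0 : 0 < dl by rewrite divr_gt0// mulr_gt0// ltr_wpDl.
have [M hM] : exists M : nat, k0%:R < M%:R * s.
  have tk : \forall k \near \oo, k0%:R / s < (k%:R : R) by exact: nbhs_infty_gtr.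
  by case: tk => k _ /(_ k (leqnn k)) h; exists k; rewrite -ltr_pdivrMr.
(* The lower corner of the cube with integer coordinates c i - M; these cubes cover the bounded
   region that contains all the sets. *)
pose z (c : {ffun option 'I_n -> 'I_(2 * M).+1}) : V := mkf (fun i _ => (c i)%:R * s - M%:R * s) (0 : V).
have nF k := nnm_indic (BVset_measurable (bF k)).
pose u c k := fine (Avs s (allc n) (fun p => (\1_(F k) p)%:E) (z c)).
have A1 k p : (Avs s (allc n) (fun p => (\1_(F k) p)%:E) p <= 1)%E by apply: Avs_le1 => // q; exact: indic_le1.
have A0 k p : (0 <= Avs s (allc n) (fun p => (\1_(F k) p)%:E) p)%E by case: (nnm_Avs s0 (allc n) (nF k)).
have fA k p : Avs s (allc n) (fun p => (\1_(F k) p)%:E) p \is a fin_num.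
  by rewrite ge0_fin_numE// (le_lt_trans (A1 k p))// ltry.
have u01 c k : 0 <= u c k <= 1.
  by apply/andP; split; [exact: fine_ge0|rewrite -lee_fin fineK].
have hc c := ultra_real uU (u01 c) dl0.
have [A hA] : exists A, forall c, U (A c) /\ forall k l, A c k -> A c l -> u c k <= u c l + dl.
  have /choice[A hA] : forall c, exists A, U A /\ forall k l, A k -> A l -> u c k <= u c l + dl.
    by move=> c; have [A UA h] := hc c; exists A.
  by exists A.
exists [set k | forall c, A c k].
  by apply: filter_forall => c; case: (hA c).
have one k l : (forall c, A c k) -> (forall c, A c l) -> fine (vol (F k `\` F l)) <= e / 2.
  move=> Ak Al.
  have H := @symd_grid R n s s0 (F k) (F l) dl (bF k) (bF l) (ltW dl0) _.
  apply: (le_trans (H _)).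
    move=> p Fp; pose c : {ffun option 'I_n -> 'I_(2 * M).+1} := [ffun i => inord (absz (fl s (comp i p) + M%:Z))].
    have hb i : - M%:Z <= fl s (comp i p) < M%:Z.
      have : - k0%:R < comp i p < k0%:R.
        have [h1 h2] := FD k p Fp; case: i => [i|].
          by have := h1 i; rewrite /= in_itv/=.
        by move: h2; rewrite /= in_itv/=.
      move=> /andP[h1 h2]; rewrite /fl floor_ge_int floor_lt_int; apply/andP; split.
        rewrite ler_pdivlMr// mulrNz mulNr; apply: ltW; apply: lt_trans h1.
        by rewrite ltrN2.
      by rewrite ltr_pdivrMr//; exact: lt_trans hM.
    have same i : fl s (comp i p) = fl s (comp i (z c)).
      have /andP[h1 h2] := hb i.
      rewrite comp_mkf ffunE inordK; last by lia.
      apply/esym/(cell_fl s0); rewrite /cell/= in_itv/= natr_absz ger0_norm; last by lia.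
      rewrite intrD mulrDl addrK lexx/= intrD mulrDl mul1r ltrDl s0//.
    rewrite (Avs_cell _ same) (Avs_cell (fun p => (\1_(F l) p)%:E) same).
    have := (hA c).2 k l (Ak c) (Al c); rewrite -lee_fin EFinD /u !fineK//.
  have h1 : n.+1%:R * (s / 4) * Per (F k) <= e / 8 /\ n.+1%:R * (s / 4) * Per (F l) <= e / 8.
    have g Q : 0 <= Q <= P -> n.+1%:R * (s / 4) * Q <= e / 8.
      move=> /andP[Q0 QP]; have -> : n.+1%:R * (s / 4) * Q = e / 8 * (Q / (P + 1)).
        have P1 : P + 1 != 0 by apply: lt0r_neq0; exact: ltr_wpDl.
        have N1 : (n.+1%:R : R) != 0 by rewrite pnatr_eq0.
        by rewrite /s; move: N1; move: (n.+1%:R) => N N1; field; rewrite P1 N1.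
      rewrite -[leRHS]mulr1 ler_pM2l ?divr_gt0// ler_pdivrMr ?ltr_wpDl// mul1r.
      by apply: (le_trans QP); rewrite lerDl.
    by split; apply: g; rewrite Per_ge0 FP.
  have h2 : dl * fine (vol (F k)) <= e / 4.
    have vk : fine (vol (F k)) <= v0 by apply: fine_le_vol => //; exact: BVset_measurable.
    have -> : e / 4 = dl * (v0 + 1) by rewrite /dl; field; apply: lt0r_neq0; exact: ltr_wpDl.
    by apply: ler_wpM2l; [exact: ltW|rewrite (le_trans vk)// lerDl].
  case: h1 => h1 h1'; have := lerD (lerD h1 h1') h2; move: (_ + _ + _) => x h.
  by apply: (le_trans h); lra.
move=> k l Ak Al; rewrite /symd; have := lerD (one k l Ak Al) (one l k Al Ak).
by move: (_ + _) => x; lra.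
Qed.

(** A diagonal choice in the sets of [ultra_cauchy] makes consecutive distances summable, and then
    the sets converge to their upper limit (Borel-Cantelli). The indices are not claimed to
    increase; k <= sg k is what the minimizing sequences ask for. *)
Lemma precompact (F : nat -> set V) (k0 : nat) (P : R) :
  (forall k, BVset (F k)) -> (forall k, F k `<=` @vcube R n k0) -> (forall k, Per (F k) <= P) ->
  exists (sg : nat -> nat) (E : set V), [/\ forall k, (k <= sg k)%N, measurable E, E `<=` \bigcup_k F k &
    (fun k => symd (F (sg k)) E) @ \oo --> (0 : R)].
Proof.
move=> bF FD FP.
have [U [uU sU]] := @ultraFilterLemma nat \oo _.
have mF k := BVset_measurable (bF k).
have mD := @measurable_vcube R n k0; have Doo := @vol_vcube R n k0.
have e0 j : 0 < 2^-1 ^+ j :> R by rewrite exprn_gt0.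
have /choice[A hA] : forall j, exists A, U A /\ forall k l, A k -> A l -> symd (F k) (F l) <= 2^-1 ^+ j.
  by move=> j; have [A UA h] := ultra_cauchy uU bF FD FP (e0 j); exists A.
have /choice[sg hsg] : forall j, exists k, (j <= k)%N /\ forall i, (i <= j)%N -> A i k.
  move=> j; have UB : U ([set k | (j <= k)%N] `&` [set k | forall i : 'I_j.+1, A i k]).
    apply: filterI; first by apply: sU; exists j.
    by apply: filter_forall => i; case: (hA i).
  have [k [/= jk hk]] := @filter_ex _ U _ _ UB.
  by exists k; split => // i ij; exact: (hk (Ordinal (ij : (i < j.+1)%N))).
pose G k := F (sg k).
have mG k : measurable (G k) by exact: mF.
have cG k : symd (G k) (G k.+1) <= 2^-1 ^+ k.
  by apply: (hA k).2; [apply: (hsg k).2|apply: (hsg k.+1).2].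
have fv k l : vol (G k `\` G l) \is a fin_num.
  by apply: (fin_sub _ mD Doo); [by mset|move=> p [/FD]].
have c1 k : (vol (G k `\` G k.+1) <= (2^-1 ^+ k)%:E)%E.
  rewrite -(fineK (fv _ _)) lee_fin; apply: le_trans (cG k); by rewrite lerDl.
have c2 k : (vol (G k.+1 `\` G k) <= (2^-1 ^+ k)%:E)%E.
  rewrite -(fineK (fv _ _)) lee_fin; apply: le_trans (cG k); by rewrite lerDr.
(* A point where E and G j differ lies in one of the later differences between consecutive sets,
   whose volumes add up to at most 2 / 2^j. *)
pose E := \bigcap_m \bigcup_i G (m + i)%N.
have mE : measurable E by apply: bigcapT_measurable => m; exact: bigcupT_measurable.
exists sg, E; split => //.
- by move=> k; case: (hsg k).
- by move=> p /(_ 0%N Logic.I)[i _ h]; exists (sg (0 + i)%N).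
have ED : E `<=` @vcube R n k0 by move=> p /(_ 0%N Logic.I)[i _ /FD].
have b1 j : fine (vol (E `\` G j)) <= 2 * 2^-1 ^+ j.
  rewrite -lee_fin fineK; last by apply: (fin_sub _ mD Doo); [by mset|move=> p [/ED]].
  apply: (@le_trans _ _ (vol (\bigcup_i (G (j + i).+1 `\` G (j + i)%N)))); last first.
    by apply: geometric_union => i; [by mset|exact: c2].
  apply: le_meas; [by mset|by apply: bigcupT_measurable => i; mset|].
  move=> p [/(_ j Logic.I)[i _ Gi] Gj]; apply: contrapT => h.
  suff : ~ G (j + i)%N p by [].
  elim: i {Gi} => [|i IH]; first by rewrite addn0.
  by rewrite addnS => Gs; apply: h; exists i.
have b2 j : fine (vol (G j `\` E)) <= 2 * 2^-1 ^+ j.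
  rewrite -lee_fin fineK; last by apply: (fin_sub _ mD Doo); [by mset|move=> p [/FD]].
  apply: (@le_trans _ _ (vol (\bigcup_i (G (j + i)%N `\` G (j + i).+1)))); last first.
    by apply: geometric_union => i; [by mset|exact: c1].
  apply: le_meas; [by mset|by apply: bigcupT_measurable => i; mset|].
  move=> p [Gj Ep]; apply: contrapT => h; apply: Ep.
  have H i : G (j + i)%N p.
    elim: i => [|i IH]; first by rewrite addn0.
    by rewrite addnS; apply: contrapT => Gs; apply: h; exists i.
  move=> m _; case: (leqP m j) => mj.
    by exists (j - m)%N => //; rewrite subnKC//; have := H 0%N; rewrite addn0.
  by exists 0%N => //; rewrite addn0 -(subnKC (ltnW mj)); exact: H.
apply: (@squeeze_cvgr _ _ _ _ (fun=> 0) (fun k => 4 * 2^-1 ^+ k)).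
- apply: nearW => k; rewrite symd_ge0/= /symd -/(G k).
  by have := lerD (b2 k) (b1 k); move: (_ + fine _) (2^-1 ^+ k) => x y; lra.
- exact: cvg_cst.
- by rewrite -[X in _ --> X](mulr0 4); apply: cvgMl_tmp; apply: cvg_expr; rewrite ger0_norm// invf_lt1// ltr1n.
Qed.

End compactness.

(** * Density points and traces *)

Section density.
Variables (R : realType) (n : nat).
Local Notation mR := (measurableTypeR R).
Local Notation X := 'rV[R]_n.
Local Notation leb := (leb R n).

Definition kub (x : X) (h : R) : set X := box (fun i => [set` `]x ord0 i - h, x ord0 i + h[]).

Lemma measurable_kub x h : measurable (kub x h).
Proof. by apply: measurable_box => i; exact: measurable_itv. Qed.

Lemma kubP x h y : kub x h y <-> forall i, `|y ord0 i - x ord0 i| < h.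
Proof.
by split => H i; have := H i; rewrite /= in_itv/= ltr_distl.
Qed.

Lemma leb_kub x h : 0 <= h -> leb (kub x h) = ((2 * h) ^+ n)%:E.
Proof.
move=> h0; rewrite /kub leb_itv; last by move=> i; lra.
rewrite (eq_bigr (fun=> 2 * h)); last by move=> i _; ring.
by rewrite prodr_const card_ord.
Qed.

Definition good (s D : seq (X * R)) :=
  [/\ {subset D <= s}, pairwise (fun a b => `[< kub a.1 a.2 `&` kub b.1 b.2 = set0 >]) D &
   forall a, a \in s -> exists2 b, b \in D & kub a.1 a.2 `<=` kub b.1 (3 * b.2)].

(** The greedy choice from the largest cube down: as the list increases, its head is the smallest
    and is examined last. Either it is disjoint from the chosen cubes, or it meets a larger one and
    is contained in its triple. *)
Lemma vitali_kub (s : seq (X * R)) : sorted (fun a b => a.2 <= b.2) s -> all (fun a => 0 < a.2) s ->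
  exists D, good s D.
Proof.
elim: s => [|a s IH] /=; first by exists [::]; split.
move=> sas /andP[a0 s0].
have tr : transitive (fun a b : X * R => a.2 <= b.2) by move=> ? ? ?; exact: le_trans.
have amin := order_path_min tr sas.
have [D [Ds Dd Dc]] := IH (path_sorted sas) s0.
have [h|h] := pselect (exists2 b, b \in D & kub a.1 a.2 `&` kub b.1 b.2 !=set0).
  exists D; split => //; first by move=> b /Ds; rewrite inE => ->; rewrite orbT.
  move=> c; rewrite inE => /orP[/eqP ->|]; last exact: Dc.
  have [b bD [y [/kubP y1 /kubP y2]]] := h; exists b => // z /kubP y3; apply/kubP => i.
  have ab : a.2 <= b.2 by move/allP: amin; apply; exact: Ds.
  move: (y1 i) (y2 i) (y3 i); rewrite !ltr_norml => /andP[? ?] /andP[? ?] /andP[? ?].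
  by apply/andP; split; lra.
exists (a :: D); split.
- by move=> b; rewrite !inE => /orP[->//|/Ds ->]; rewrite orbT.
- rewrite /= Dd andbT; apply/allP => b bD; apply/asboolP.
  apply: contrapT => ne; apply: h; exists b => //; exact/set0P/eqP.
- move=> c; rewrite inE => /orP[/eqP ->|cs].
    exists a; first by rewrite inE eqxx.
    by move=> z /kubP hz; apply/kubP => i; apply: lt_le_trans (hz i) _; lra.
  by have [b bD hb] := Dc c cs; exists b => //; rewrite inE bD orbT.
Qed.

(** The weak type inequality of the maximal function, for finitely many cubes; 3^n is the cost of
    tripling the disjoint ones. *)
Lemma maximal_fin (g : X -> \bar R) (c : R) (s : seq (X * R)) : measurable_fun setT g -> (forall x, (0 <= g x)%E) ->
  0 < c -> (forall a, a \in s -> 0 < a.2 /\ ((c * (2 * a.2) ^+ n)%:E <= \int[leb]_(x in kub a.1 a.2) g x)%E) ->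
  (leb (\big[setU/set0]_(a <- s) kub a.1 a.2) <= (3 ^+ n / c)%:E * \int[leb]_x g x)%E.
Proof.
move=> mg g0 c0 hs.
pose s' := sort (fun a b : X * R => a.2 <= b.2) s.
have ss' : s' =i s by exact: mem_sort.
have [||D [Ds Dd Dc]] := @vitali_kub s'.
- by apply: sort_sorted => a b; exact: le_total.
- by apply/allP => a; rewrite ss' => /hs[].
have c1 : (leb (\big[setU/set0]_(a <- s) kub a.1 a.2) <= \sum_(b <- D) ((3 * (2 * b.2)) ^+ n)%:E)%E.
  apply: (@le_trans _ _ (leb (\big[setU/set0]_(b <- D) kub b.1 (3 * b.2)))).
    apply: le_meas.
    - by apply: bigsetU_measurable => a _; exact: measurable_kub.
    - by apply: bigsetU_measurable => a _; exact: measurable_kub.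
    move=> x; rewrite -!bigcup_seq => -[a /= ain ax].
    have [|b bD hb] := Dc a; first by rewrite ss'.
    by exists b => //; exact: hb.
  elim: D {Dd Dc} Ds => [_|b D IH Ds]; first by rewrite !big_nil measure0.
  rewrite !big_cons; apply: le_trans (measureU2 _ _ _) _; first exact: measurable_kub.
    by apply: bigsetU_measurable => a _; exact: measurable_kub.
  apply: leeD; last by apply: IH => a aD; apply: Ds; rewrite inE aD orbT.
  have b0 : 0 < b.2 by case: (hs b) => //; rewrite -ss'; apply: Ds; rewrite inE eqxx.
  have h3 : 0 <= 3 * b.2 by rewrite mulr_ge0// ltW.
  by rewrite mulrCA -(leb_kub b.1 h3).
apply: (le_trans c1).
have c2 : (\sum_(b <- D) \int[leb]_(x in kub b.1 b.2) g x <= \int[leb]_x g x)%E.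
  rewrite (eq_bigr (fun b => \int[leb]_x (g x * (\1_(kub b.1 b.2) x)%:E))%E); last first.
    by move=> b _; rewrite integral_mkcond; apply: eq_integral => x _; rewrite patchE indicE; case: ifP; rewrite ?mule1 ?mule0.
  have mgi (b : X * R) : measurable_fun setT (fun x => g x * (\1_(kub b.1 b.2) x)%:E)%E.
    apply: emeasurable_funM => //; apply/measurable_EFinP; apply: measurable_indic; exact: measurable_kub.
  have g0i (b : X * R) x : setT x -> (0 <= g x * (\1_(kub b.1 b.2) x)%:E)%E by move=> _; apply: mule_ge0; rewrite ?lee_fin.
  rewrite -ge0_integral_sum//; apply: ge0_le_integral => //.
  - by move=> x _; apply: sume_ge0 => b _; exact: g0i.
  - exact: emeasurable_sum.
  move=> x _; rewrite -ge0_sume_distrr//.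
  rewrite -[leRHS]mule1; apply: lee_pmul => //; first by apply: sume_ge0 => b _; rewrite lee_fin.
  rewrite sumEFin lee_fin.
  elim: D Dd {Ds Dc c1} => [_|b D IH /= /andP[ball Dd]]; first by rewrite big_nil.
  rewrite big_cons; rewrite indicE; case: (boolP (x \in _)) => xb; last by rewrite add0r; exact: IH.
  rewrite big_seq big1 ?addr0// => b' bD; rewrite indicE memNset// => xb'.
  move/allP: ball => /(_ _ bD)/asboolP e; rewrite inE in xb.
  by suff : set0 x by []; rewrite -e.
have c3 : (\sum_(b <- D) ((3 * (2 * b.2)) ^+ n)%:E <= (3 ^+ n / c)%:E * \sum_(b <- D) \int[leb]_(x in kub b.1 b.2) g x)%E.
  rewrite ge0_sume_distrr; last by move=> b _; apply: integral_ge0.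
  rewrite big_seq [leRHS]big_seq; apply: lee_sum => b bD.
  have bs : b \in s by rewrite -ss'; exact: Ds.
  have [b0 hb] := hs b bs.
  apply: (@le_trans _ _ ((3 ^+ n / c)%:E * (c * (2 * b.2) ^+ n)%:E)%E).
    by rewrite -EFinM lee_fin exprMn mulrA divfK ?gt_eqF.
  by apply: lee_pmul => //; rewrite lee_fin ?divr_ge0 ?mulr_ge0 ?exprn_ge0 ?mulr_ge0 ?ltW.
apply: (le_trans c3); apply: lee_pmul => //; first by rewrite lee_fin divr_ge0 ?exprn_ge0 ?ltW.
by apply: sume_ge0 => b _; exact: integral_ge0.
Qed.

Definition dens_at (A : set X) (e : R) (y : X) := exists2 d, 0 < d & forall h, 0 < h < d ->
  (leb (kub y h `\` A) <= (e * h ^+ n)%:E)%E.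

(** Any cube is contained in a rational one of at most twice its size, so that the maximal
    inequality is applied to a countable family. *)
Lemma kub_rat (y : X) (h : R) : 0 < h -> exists (q : 'rV[rat]_n) (r : rat),
  [/\ 0 < ratr r :> R, ratr r <= 2 * h, kub (\row_i ratr (q ord0 i)) (ratr r) y & kub y h `<=` kub (\row_i ratr (q ord0 i)) (ratr r)].
Proof.
move=> h0.
have [r] := @rat_in_itvoo R (3 / 2 * h) (2 * h) (ltac:(lra)); rewrite in_itv/= => /andP[r1 r2].
have /choice[q hq] : forall i : 'I_n, exists q : rat, `|ratr q - y ord0 i| < h / 2.
  move=> i; have [q] := @rat_in_itvoo R (y ord0 i - h / 2) (y ord0 i + h / 2) (ltac:(lra)).
  by rewrite in_itv/= => ?; exists q; rewrite ltr_distl.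
exists (\row_i q i), r; split; [lra|exact: ltW| |].
  apply/kubP => i; rewrite !mxE; move: (hq i); rewrite distrC => /lt_trans; apply; lra.
move=> z /kubP hz; apply/kubP => i; rewrite !mxE; move: (hz i) (hq i); rewrite !ltr_norml => /andP[? ?] /andP[? ?].
by apply/andP; split; lra.
Qed.

(** The indicator of A is approximated in L^1 by a continuous f. Two small sets are removed: the
    points of A where f <= 1/2 (Chebyshev) and the cubes on which the mean error is large (maximal
    inequality). At any other point f > 1/2 nearby, so a sizeable part of the complement of A in a
    small cube would make the mean error large. *)
Lemma bad_small (A : set X) (e eta : R) (k : nat) : measurable A -> 0 < e -> 0 < eta ->
  exists N : set X, [/\ measurable N, (leb N <= eta%:E)%E &
   forall y, A y -> kub 0 k%:R y -> ~ N y -> dens_at A e y].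
Proof.
move=> mA e0 eta0; pose D := kub 0 k%:R.
have mD : measurable D := measurable_kub 0 k%:R.
have Doo : (leb D < +oo)%E by rewrite leb_kub// ltry.
(* A rational cube around a cube of half-side h has half-side at most 2 h, and c (4 h)^n = e h^n /
   2, the error forced by a part of the complement of measure e h^n. *)
pose c := e / (2 * 4 ^+ n).
have c0 : 0 < c by rewrite divr_gt0// mulr_gt0// exprn_gt0.
(* The two exceptional sets have measures at most 2 e1 and (3^n / c) e1. *)
pose e1 := eta / (2 + 3 ^+ n / c).
have d0 : 0 < 2 + 3 ^+ n / c by rewrite ltr_wpDr// divr_ge0 ?exprn_ge0 ?ltW.
have e10 : 0 < e1 by rewrite divr_gt0.
have [_ /(_ e1 e10)[f [Cf f01 hf]]] := approximable_measurable mD Doo mA.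
have mf : measurable_fun setT f by apply: continuous_measurable_rV; exact: C1_continuous.
pose g := ((fun x => `|f x - \1_A x|%:E) \_ D).
have mg : measurable_fun setT g by apply/(measurable_restrictT _ mD); exact: measurable_L1d.
have g0 x : (0 <= g x)%E by rewrite /g patchE; case: ifP => // _; rewrite lee_fin.
have hg : (\int[leb]_x g x <= e1%:E)%E by rewrite -integral_mkcond.
pose W := A `&` D `&` [set y | f y <= 2^-1].
have mW : measurable W.
  apply: measurableI; first exact: measurableI.
  by have := mf measurableT _ (measurable_itv `]-oo, 2^-1]); rewrite setTI; congr measurable; apply/seteqP; split => y /=; rewrite in_itv.
have lW : (leb W <= (2 * e1)%:E)%E.
  have -> : leb W = (\int[leb]_x (\1_W x)%:E)%E by rewrite integral_indic// setIT.
  apply: (@le_trans _ _ (2%:E * \int[leb]_x g x)%E); last by rewrite EFinM; apply: lee_pmul => //; exact: integral_ge0.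
  rewrite -ge0_integralZl//; apply: ge0_le_integral => //.
  - by apply/measurable_EFinP; exact: measurable_indic.
  - exact: emeasurable_funM.
  move=> x _; rewrite indicE; case: (boolP (x \in W)) => [|_]; last by apply: mule_ge0.
  rewrite inE => -[[Ax Dx] /= fx]; rewrite /g patchE mem_set// -EFinM lee_fin indicE mem_set//=.
  by rewrite distrC ger0_norm; [lra|move: fx; lra].
pose cand (o : option ('rV[rat]_n * rat)) : X * R :=
  if o is Some (q, r) then (\row_i ratr (q ord0 i), ratr r) else (0, 0).
pose gd (a : X * R) := 0 < a.2 /\ ((c * (2 * a.2) ^+ n)%:E <= \int[leb]_(x in kub a.1 a.2) g x)%E.
pose cd m := cand (unpickle m).
pose Pm m := \big[setU/set0]_(a <- [seq cd i | i <- iota 0 m & `[< gd (cd i) >]]) kub a.1 a.2.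
pose M := \bigcup_m Pm m.
have mP m : measurable (Pm m) by apply: bigsetU_measurable => a _; exact: measurable_kub.
have PmE m x : Pm m x <-> exists i, [/\ (i < m)%N, gd (cd i) & kub (cd i).1 (cd i).2 x].
  rewrite /Pm -bigcup_seq; split.
    move=> [a /= /mapP[i]]; rewrite mem_filter mem_iota/= add0n => /andP[/asboolP gi im] -> hx.
    by exists i.
  move=> [i [im gi hx]]; exists (cd i) => //=; apply/mapP; exists i => //.
  by rewrite mem_filter mem_iota/= add0n im andbT; apply/asboolP.
have lM : (leb M <= (3 ^+ n / c * e1)%:E)%E.
  apply: measure_bigcup_le => //.
    move=> a b ab; apply/subsetPset => x /PmE[i [ia gi hx]]; apply/PmE; exists i; split => //.
    exact: leq_trans ab.
  move=> m; apply: le_trans (maximal_fin (g := g) mg g0 c0 _) _.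
    by move=> a /mapP[i]; rewrite mem_filter => /andP[/asboolP gi _] ->.
  rewrite [(3 ^+ n / c * e1)%:E]EFinM; apply: lee_pmul => //; first by rewrite lee_fin divr_ge0 ?exprn_ge0 ?ltW.
  exact: integral_ge0.
have mM : measurable M by exact: bigcupT_measurable.
exists (W `|` M); split; first exact: measurableU.
  apply: le_trans (measureU2 _ mW mM) _; apply: le_trans (leeD lW lM) _.
  by rewrite -EFinD lee_fin -mulrDl /e1 mulrC divfK// gt_eqF.
move=> y Ay Dy /not_orP[Wy My].
have fy : 2^-1 < f y by rewrite ltNge; apply/negP => h; apply: Wy.
have : \forall z \near y, 2^-1 < f z.
  have := (C1_continuous Cf) y; move/cvgrPdist_lt => /(_ (f y - 2^-1)); rewrite subr_gt0 => /(_ fy).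
  by apply: filterS => z; rewrite ltr_norml => /andP[_]; lra.
move=> /nbhs_ballP[d1 /= d10 hd1].
have [d2 d20 hd2] : exists2 d2, 0 < d2 & forall h, h < d2 -> kub y h `<=` D.
  have /kubP hy := Dy.
  pose d2 := \big[Num.min/1]_i (k%:R - `|y ord0 i - (0 : X) ord0 i|).
  exists d2.
    by rewrite /d2; elim/big_ind: _ => // [a b a0 b0|i _]; [rewrite lt_min a0 b0|rewrite subr_gt0].
  move=> h hd z /kubP hz; apply/kubP => i.
  have : d2 <= k%:R - `|y ord0 i - (0 : X) ord0 i| by rewrite /d2 (bigD1 i)//= ge_min lexx.
  have := ler_normD (z ord0 i - y ord0 i) (y ord0 i - (0 : X) ord0 i); rewrite addrA subrK.
  have := hz i; move: hd; move: (`|_|) (`|_|) (`|_|) (k%:R) => a b c' K'; lra.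
exists (Num.min d1 d2); first by rewrite lt_min d10.
move=> h /andP[h0]; rewrite lt_min => /andP[hd1' hd2'].
rewrite leNgt; apply/negP => hbig; apply: My.
have [q [r [r0 rh yq sub]]] := kub_rat y h0.
have mk := measurable_kub y h; have mkA : measurable (kub y h `\` A) by exact: measurableD.
have big : ((c * (2 * ratr r) ^+ n)%:E <= \int[leb]_(x in kub (\row_i ratr (q ord0 i)) (ratr r)) g x)%E.
  apply: (@le_trans _ _ (\int[leb]_(x in kub y h `\` A) g x)%E); last first.
    apply: ge0_subset_integral => //; [exact: measurable_kub|exact: measurable_funTS|].
    by move=> x [/sub].
  apply: (@le_trans _ _ (2^-1%:E * leb (kub y h `\` A))%E).
    apply: (@le_trans _ _ (2^-1%:E * (e * h ^+ n)%:E)%E); last first.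
      apply: lee_pmul => //; last exact: ltW.
      by rewrite lee_fin mulr_ge0 ?exprn_ge0 ?(ltW e0) ?(ltW h0).
    rewrite -EFinM lee_fin /c.
    have -> : 2^-1 * (e * h ^+ n) = e / (2 * 4 ^+ n) * (4 * h) ^+ n.
      by rewrite exprMn; field; rewrite expf_neq0.
    rewrite ler_pM2l//; apply: lerXn2r; rewrite ?nnegrE; move: rh r0 h0; move: (ratr r) => r'; lra.
  rewrite -integral_cst//; apply: ge0_le_integral => //; [by move=> x _; rewrite lee_fin invr_ge0|exact: measurable_funTS|].
  move=> x [xk Ax]; rewrite /g patchE mem_set; last exact: hd2 xk.
  rewrite lee_fin indicE memNset// subr0 ger0_norm; last by case/andP: (f01 x).
  apply/ltW/hd1; rewrite /ball/= /mx_ball; split => // i j; rewrite ord1 /ball/= distrC.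
  by apply: lt_trans hd1'; have /kubP := xk; apply.
exists (pickle (q, r)).+1 => //; apply/PmE; exists (pickle (q, r)).
by split => //; rewrite /cd pickleK/=.
Qed.

(** The exceptional sets of [bad_small] are intersected over the bound on their measure, and the
    null sets obtained are united over the size of the region and the precision. *)
Lemma lebesgue_density (A : set X) : measurable A -> exists N : set X, [/\ measurable N, leb N = 0%E &
  forall y, A y -> ~ N y -> forall e, 0 < e -> dens_at A e y].
Proof.
move=> mA.
have i0 m : 0 < m.+1%:R^-1 :> R by rewrite invr_gt0.
have /choice[N hN] : forall q : nat * nat * nat, exists N : set X, [/\ measurable N, (leb N <= (q.2.+1%:R^-1)%:E)%E &
   forall y, A y -> kub 0 q.1.1%:R y -> ~ N y -> dens_at A q.1.2.+1%:R^-1 y].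
  by move=> q; exact: (bad_small q.1.1 mA (i0 q.1.2) (i0 q.2)).
pose N1 q := \bigcap_j N (q, j).
have mN1 q : measurable (N1 q) by apply: bigcapT_measurable => j; case: (hN (q, j)).
have N10 q : leb (N1 q) = 0%E.
  apply/eqP; rewrite eq_le measure_ge0 andbT; apply/lee_addgt0Pr => e e0; rewrite add0e.
  have tk : \forall k \near \oo, e^-1 < (k%:R : R) by exact: nbhs_infty_gtr.
  case: tk => j _ /(_ j (leqnn j)) h.
  have [m1 m2 _] := hN (q, j).
  apply: (@le_trans _ _ (leb (N (q, j)))); first by apply: le_meas => // x; exact.
  apply: (le_trans m2); rewrite lee_fin invf_ple ?posrE// (le_trans (ltW h))// ler_nat //.
pose N2 m := N1 (odflt (0%N, 0%N) (unpickle m)).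
exists (\bigcup_m N2 m); split; first by apply: bigcupT_measurable => m; exact: mN1.
  by apply: measure_bigcup0 => m; [exact: mN1|exact: N10].
move=> y Ay Ny e e0.
have tk : \forall k \near \oo, e^-1 < (k%:R : R) by exact: nbhs_infty_gtr.
case: tk => j _ /(_ j (leqnn j)) hj.
have [k hk] : exists k : nat, kub 0 k%:R y.
  pose m := \big[Num.max/0]_i `|y ord0 i|.
  have tk : \forall k \near \oo, m < (k%:R : R) by exact: nbhs_infty_gtr.
  case: tk => k _ /(_ k (leqnn k)) hk; exists k; apply/kubP => i; rewrite mxE subr0.
  by apply: le_lt_trans hk; rewrite /m (bigD1 i)//= le_max lexx.
have : ~ N1 (k, j) y by move=> h; apply: Ny; exists (pickle (k, j)) => //; rewrite /N2 pickleK.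
move=> /existsNP[m /not_implyP[_ hm]].
have [_ _ /(_ y Ay hk hm)[d d0 hd]] := hN (k, j, m).
exists d => // h hh; apply: le_trans (hd h hh) _; rewrite lee_fin ler_wpM2r//.
  by rewrite exprn_ge0// ltW//; case/andP: hh.
by rewrite /= invf_ple ?posrE// (le_trans (ltW hj))// ler_nat.
Qed.

End density.

Section null_integral.
Context d (T : measurableType d) (R : realType) (mu : {measure set T -> \bar R}).
Import HBNNSimple.

Lemma measure_nullU (A B : set T) : measurable A -> measurable B -> mu A = 0%E -> mu B = 0%E ->
  mu (A `|` B) = 0%E.
Proof.
move=> mA mB A0 B0; apply/eqP; rewrite eq_le measure_ge0 andbT.
by have := measureU2 mu mA mB; rewrite -[X in (_ <= X + _)%E]/(mu A) A0 add0e -[X in (_ <= X)%E]/(mu B) B0.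
Qed.

(* No measurability is assumed of [f] and [g]: the integral of a nonnegative function is
   a supremum over simple functions, which may be set to zero on [N]. *)
Lemma integral_null_eq (N : set T) (f g : T -> \bar R) : measurable N -> mu N = 0%E ->
  (forall x, ~ N x -> f x = g x) -> (\int[mu]_x f x = \int[mu]_x g x)%E.
Proof.
move=> mN N0.
have H (u v : T -> \bar R) : (forall x, 0 <= u x)%E -> (forall x, 0 <= v x)%E ->
    (forall x, ~ N x -> u x = v x) -> (\int[mu]_x u x <= \int[mu]_x v x)%E.
  move=> u0 v0 uv; rewrite (ge0_integralTE _ u0) (ge0_integralTE _ v0).
  apply: ge_ereal_sup => _ [h /= hu <-].
  have mC := measurableC mN.
  have pE x : proj_nnsfun h mC x = h x * \1_(~` N) x by [].
  apply: ereal_sup_ubound; exists (proj_nnsfun h mC).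
    move=> x; rewrite pE indicE; case: (boolP (x \in ~` N)) => hx.
      by rewrite mulr1 -uv//; rewrite inE in hx.
    by rewrite mulr0.
  rewrite -!integralT_nnsfun; apply: ae_eq_integral => //.
  - by apply/measurable_EFinP; exact: measurable_funP.
  - by apply/measurable_EFinP; exact: measurable_funP.
  exists N; split => // x; apply: contra_notP => Nx _ /=.
  by have := pE x; rewrite indicE mem_set// mulr1 => /= ->.
move=> fg; rewrite integralE [RHS]integralE; congr (_ - _)%E.
  apply/eqP; rewrite eq_le; apply/andP; split; apply: H => // x Nx; by rewrite !funeposE fg.
apply/eqP; rewrite eq_le; apply/andP; split; apply: H => // x Nx; by rewrite !funenegE fg.
Qed.

End null_integral.

(** * The trace and the boundary points above which the set is full *)

Section traces.
Variables (R : realType) (n : nat).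
Local Notation mR := (measurableTypeR R).
Local Notation lam := (@lebesgue_measure R).
Local Notation X := 'rV[R]_n.
Local Notation V := (Rn1 R n).
Local Notation leb := (leb R n).
Local Notation vol := (vol R n).
Local Notation Om := (@Omega R n).
Implicit Types (E Z : set V) (y : X).

Definition esq (p q : V) : R := \sum_i (comp i q - comp i p) ^+ 2.

Lemma C1_esq p : C1 (esq p).
Proof.
apply: C1_sum => i _; under eq_fun do rewrite expr2.
by apply: C1M; apply: C1B; [exact: C1_coord|exact: C1_cst|exact: C1_coord|exact: C1_cst].
Qed.

Lemma eballE p (h : R) q : 0 < h -> eball p h q <-> esq p q < h ^+ 2.
Proof.
move=> h0; rewrite /eball/= enormE.
have -> : \sum_i comp i (q - p) ^+ 2 = esq p q by apply: eq_bigr => i _; rewrite linearB.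
have e0 : 0 <= esq p q by apply: sumr_ge0 => i _; exact: sqr_ge0.
rewrite -{1}(gtr0_norm h0) -sqrtr_sqr ltr_sqrt ?exprn_gt0//.
Qed.

Lemma measurable_eball (p : V) (h : R) : measurable (eball p h).
Proof.
case: (ltP 0 h) => h0; last first.
  rewrite (_ : eball p h = set0)// -subset0 => q; rewrite /eball/= => hq.
  have := lt_le_trans hq h0; rewrite /enorm ltNge sqrtr_ge0//.
apply: open_measurable_Rn1.
rewrite (_ : eball p h = esq p @^-1` [set t | t < h ^+ 2]).
  by apply: open_comp => // q _; exact: (C1_continuous (C1_esq p)).
by apply/seteqP; split => q /eballE; apply.
Qed.

Lemma esq_coord p q i : (comp i q - comp i p) ^+ 2 <= esq p q.
Proof. by rewrite /esq (bigD1 i)//= lerDl; apply: sumr_ge0 => j _; exact: sqr_ge0. Qed.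

Definition hball y (h : R) : set V := eball (y, 0) h `&` Om.

Lemma measurable_hball y h : measurable (hball y h).
Proof. by apply: measurableI; [exact: measurable_eball|exact: measurable_Omega]. Qed.

Definition cube0 y (h : R) : set V := kub y h `*` [set` `]0, h[].

Lemma measurable_cube0 y h : measurable (cube0 y h).
Proof. by apply: measurableX; [exact: measurable_kub|exact: measurable_itv]. Qed.

Lemma vol_cube0 y h : 0 <= h -> vol (cube0 y h) = ((2 * h) ^+ n * h)%:E.
Proof.
move=> h0; rewrite volX; [|exact: measurable_kub|exact: measurable_itv].
rewrite leb_kub// EFinM; congr (_ * _)%E; rewrite lebesgue_measure_itv/= lte_fin sube0.
by case: ltP => // h1; congr EFin; apply: le_anti; rewrite h0 h1.
Qed.

Lemma hball_sub y h : 0 < h -> hball y h `<=` cube0 y h.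
Proof.
move=> h0 q [/(eballE _ _ h0) hq q0].
have H i : `|comp i q - comp i (y, 0 : mR)| < h.
  by rewrite -(gtr0_norm h0) -ltr_sqr ?nnegrE// !real_normK ?num_real// (le_lt_trans (esq_coord _ _ i)).
split; first by apply/kubP => i; exact: (H (Some i)).
rewrite /= in_itv/= q0/=; have := H None; rewrite /= subr0; exact: le_lt_trans (ler_norm _).
Qed.

Lemma sub_hball y h : 0 < h -> cube0 y (h / n.+2%:R) `<=` hball y h.
Proof.
move=> h0 q [/kubP h1]; rewrite /= in_itv/= => /andP[q0 h2]; split => //; apply/eballE => //.
have c0 : 0 <= h / n.+2%:R by rewrite divr_ge0 ?ltW.
apply: (@le_lt_trans _ _ (\sum_(i : option 'I_n) (h / n.+2%:R) ^+ 2)).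
  apply: ler_sum => -[i|] _.
    by rewrite -real_normK ?num_real// ler_pXn2r ?nnegrE//; apply/ltW/h1.
  by rewrite /= subr0 ler_pXn2r ?nnegrE// ltW.
rewrite sumr_const card_option card_ord exprMn -mulrnAr -[ltRHS]mulr1 ltr_pM2l ?exprn_gt0//.
rewrite exprVn -[_ *+ _]mulr_natl ltr_pdivrMr ?exprn_gt0// mul1r -natrX ltr_nat; nia.
Qed.

Lemma hball_ge y h : 0 < h -> (((2 / n.+2%:R) ^+ n / n.+2%:R * h ^+ n.+1)%:E <= vol (hball y h))%E.
Proof.
move=> h0; apply: (@le_trans _ _ (vol (cube0 y (h / n.+2%:R)))); last first.
  by apply: le_meas; [exact: measurable_cube0|exact: measurable_hball|exact: sub_hball].
have c0 : 0 <= h / n.+2%:R by rewrite divr_ge0 ?ltW.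
rewrite vol_cube0// lee_fin exprSr !exprMn le_eqVlt.
apply/orP; left; apply/eqP; have : n.+2%:R != 0 :> R by rewrite pnatr_eq0.
by move: (n.+2%:R) => N _; rewrite exprVn; ring.
Qed.

Definition nullnear Z (k : nat) : set X := [set y | lam (`]0, k.+1%:R^-1[ `&` line Z y) = 0%E].

Lemma measurable_nullnear Z k : measurable Z -> measurable (nullnear Z k).
Proof.
move=> mZ; rewrite (_ : nullnear Z k = [set y | lam (line (strip 0 k.+1%:R^-1 `&` Z) y) = 0%E])//.
by apply: measurable_null_line; apply: measurableI => //; exact: measurable_strip.
Qed.

(** For small h only the lines outside [nullnear] contribute; their base points in the cube have
    measure at most e h^n, and each carries a length of at most h. *)
Lemma small_hball Z k y : measurable Z -> (forall e, 0 < e -> dens_at (nullnear Z k) e y) ->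
  forall e, 0 < e -> exists2 d, 0 < d & forall h, 0 < h < d -> (vol (hball y h `&` Z) <= (e * h ^+ n.+1)%:E)%E.
Proof.
move=> mZ hd e e0; have [d d0 H] := hd e e0.
have mk0 := measurable_nullnear k mZ.
exists (Num.min d k.+1%:R^-1); first by rewrite lt_min d0 invr_gt0 ltr0n.
move=> h /andP[h0]; rewrite lt_min => /andP[hd' hk].
have mc := measurable_cube0 y h; have mb := measurable_hball y h; have mk := measurable_kub y h.
apply: (@le_trans _ _ (vol (cube0 y h `&` Z))).
  by apply: le_meas; [by mset|by mset|apply: setSI; exact: hball_sub].
rewrite vol_line.
apply: (@le_trans _ _ (\int[leb]_x (h%:E * (\1_(kub y h `\` nullnear Z k) x)%:E))%E).
  apply: ge0_le_integral => //.
  - by apply: measurable_line_meas; mset.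
  - by apply: emeasurable_funM => //; apply/measurable_EFinP; apply: measurable_indic; mset.
  move=> x _; have mL := measurable_line x mZ.
  have mI : measurable (`]0, h[%classic : set mR) by exact: measurable_itv.
  have sub1 : line (cube0 y h `&` Z) x `<=` `]0, h[%classic by move=> t [[_]].
  have mLc : measurable (line (cube0 y h `&` Z) x) by apply: measurable_line; mset.
  rewrite indicE; case: (boolP (x \in _)) => hx.
    rewrite mule1; apply: (@le_trans _ _ (lam (`]0, h[%classic : set mR))); first exact: le_meas.
    by rewrite lebesgue_measure_itv/= lte_fin h0 sube0.
  rewrite mule0; have [xk|xk] := pselect (kub y h x); last first.
    rewrite (_ : line _ x = set0) ?measure0// -subset0 => t [[/=]]//.
  have : nullnear Z k x by apply: contrapT => hn; move/negP: hx; apply; rewrite inE.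
  rewrite /nullnear/= => <-; apply: le_meas => //; first by mset.
  move=> t ht; have := sub1 t ht; rewrite /= !in_itv/= => /andP[t0 th]; split; last by case: ht.
  by rewrite /= t0 (lt_trans th).
rewrite ge0_integralZl//; [|by apply/measurable_EFinP; apply: measurable_indic; mset|by rewrite lee_fin ltW].
rewrite integral_indic ?setIT//; last by mset.
have hh : 0 < h < d by rewrite h0.
rewrite exprS mulrCA EFinM; apply: lee_pmul => //; [by rewrite lee_fin ltW|exact: H].
Qed.

Lemma cvge0_right (F : R -> \bar R) : (forall h, 0 < h -> (0 <= F h)%E) ->
  (forall e, 0 < e -> exists2 d, 0 < d & forall h, 0 < h < d -> (F h <= e%:E)%E) ->
  F h @[h --> 0^'+] --> 0%E.
Proof.
move=> F0 H; apply/fine_cvgP.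
have nr d : 0 < d -> \forall h \near (0 : R)^'+, 0 < h < d.
  by move=> d0; near=> h; apply/andP; split; near: h; [exact: nbhs_right_gt|exact: nbhs_right_lt].
split.
  have [d d0 hd] := H 1 ltr01; have := nr d d0; apply: filterS => h hh.
  have h0 : 0 < h by case/andP: hh.
  by rewrite ge0_fin_numE ?F0// (le_lt_trans (hd h hh))// ltry.
apply/cvgrPdist_le => e e0; have [d d0 hd] := H e e0; have := nr d d0; apply: filterS => h hh.
have h0 : 0 < h by case/andP: hh.
have f := F0 h h0.
have ff : F h \is a fin_num by rewrite ge0_fin_numE// (le_lt_trans (hd h hh))// ltry.
by rewrite sub0r normrN /= ger0_norm ?fine_ge0// -lee_fin fineK// hd.
Unshelve. all: by end_near. Qed.

(** The property of a through which [bd_trace] is selected. *)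
Definition tracep (f : V -> R) y (a : R) :=
  ((h ^- n.+1)%:E * \int[vol]_(p in hball y h) `|f p - a|%:E)%E @[h --> 0^'+] --> 0%E.

(** A half-ball of radius h has volume at least a constant times h^(n+1), so two distinct values
    cannot both have vanishing mean distance to f. *)
Lemma tracep_uniq f y a b : measurable_fun setT f -> tracep f y a -> tracep f y b -> a = b.
Proof.
move=> mf ha hb; apply/eqP/negP => /negP ab.
have ab0 : 0 < `|a - b| by rewrite normr_gt0 subr_eq0.
pose c := (2 / n.+2%:R) ^+ n / n.+2%:R : R.
have c0 : 0 < c by rewrite divr_gt0// exprn_gt0// divr_gt0.
have e0 : 0 < `|a - b| * c / 4 by rewrite divr_gt0// mulr_gt0.
have lt0 (u : R) : tracep f y u -> \forall h \near (0 : R)^'+,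
    ((h ^- n.+1)%:E * \int[vol]_(p in hball y h) `|f p - u|%:E < (`|a - b| * c / 4)%:E)%E.
  move=> hu; apply: (hu [set x | (x < (`|a - b| * c / 4)%:E)%E]).
  by apply: open_nbhs_nbhs; split; [exact: open_ereal_lt_ereal|rewrite /= lte_fin].
have : \forall h \near (0 : R)^'+, False; last by move/filter_ex => [].
near=> h.
have h0 : 0 < h by near: h; exact: nbhs_right_gt.
have ka : ((h ^- n.+1)%:E * \int[vol]_(p in hball y h) `|f p - a|%:E < (`|a - b| * c / 4)%:E)%E by near: h; exact: lt0.
have kb : ((h ^- n.+1)%:E * \int[vol]_(p in hball y h) `|f p - b|%:E < (`|a - b| * c / 4)%:E)%E by near: h; exact: lt0.
have mb := measurable_hball y h.
have mfa u : measurable_fun (hball y h) (fun p => `|f p - u|%:E).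
  apply/measurable_EFinP; apply: measurableT_comp => //; apply: measurable_funTS.
  by apply: measurable_funB.
have hn0 : 0 < h ^- n.+1 by rewrite invr_gt0 exprn_gt0.
have : ((`|a - b| * c)%:E <= (h ^- n.+1)%:E * (\int[vol]_(p in hball y h) `|f p - a|%:E + \int[vol]_(p in hball y h) `|f p - b|%:E))%E.
  rewrite -ge0_integralD//; try (by move=> p _; rewrite lee_fin).
  apply: (@le_trans _ _ ((h ^- n.+1)%:E * (`|a - b|%:E * vol (hball y h)))%E).
    apply: (@le_trans _ _ ((h ^- n.+1)%:E * (`|a - b|%:E * (c * h ^+ n.+1)%:E))%E).
      rewrite -!EFinM lee_fin.
      have -> : h ^- n.+1 * (`|a - b| * (c * h ^+ n.+1)) = `|a - b| * c * (h ^- n.+1 * h ^+ n.+1) by ring.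
      by rewrite mulVf ?mulr1// expf_neq0// gt_eqF.
    apply: lee_pmul => //; [by rewrite lee_fin ltW|by rewrite -EFinM lee_fin !mulr_ge0// ?exprn_ge0// ltW|].
    by apply: lee_pmul => //; [rewrite lee_fin mulr_ge0 ?exprn_ge0// ltW|exact: hball_ge].
  apply: lee_pmul => //; [by rewrite lee_fin ltW|].
  rewrite -integral_cst//; apply: ge0_le_integral => //.
  - by move=> p _; rewrite lee_fin.
  - by apply: emeasurable_funD; exact: mfa.
  move=> p _; rewrite -EFinD lee_fin; have := ler_normB (f p - b) (f p - a).
  have -> : f p - b - (f p - a) = a - b by ring.
  by move/le_trans; apply; rewrite addrC.
rewrite muleDr//; last first.
  by rewrite ge0_adde_def// inE; apply: integral_ge0 => p _; rewrite lee_fin.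
move=> H; have := le_lt_trans H (lteD ka kb); rewrite -EFinD lte_fin.
have : 0 < `|a - b| * c by rewrite mulr_gt0.
by move: (`|a - b| * c) => x; lra.
Unshelve. all: by end_near. Qed.

Lemma bd_trace_eq f y a : measurable_fun setT f -> tracep f y a -> bd_trace f y = a.
Proof.
move=> mf ha.
have ex : exists b : R, tracep f y b by exists a.
have h : tracep f y (bd_trace f y) by exact: (@getPex _ [set b : R | tracep f y b] ex).
exact: tracep_uniq mf h ha.
Qed.

Lemma tracep_indic E y (b : bool) : measurable E ->
  (forall e, 0 < e -> exists2 d, 0 < d & forall h, 0 < h < d ->
     (vol (hball y h `&` (if b then ~` E else E)) <= (e * h ^+ n.+1)%:E)%E) ->
  tracep \1_E y b%:R.
Proof.
move=> mE H; apply: cvge0_right.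
  move=> h h0; apply: mule_ge0; first by rewrite lee_fin invr_ge0 exprn_ge0// ltW.
  by apply: integral_ge0 => p _; rewrite lee_fin.
move=> e e0; have [d d0 hd] := H e e0; exists d => // h hh; have h0 : 0 < h by case/andP: hh.
have mZ : measurable (if b then ~` E else E) by case: (b) => //; exact: measurableC.
have -> : (\int[vol]_(p in hball y h) `|\1_E p - b%:R|%:E = vol (hball y h `&` (if b then ~` E else E)))%E.
  rewrite setIC -integral_indic//; last exact: measurable_hball.
  apply: eq_integral => p _; congr EFin; rewrite !indicE.
  case: (b) => /=; last by rewrite subr0 ger0_norm.
  by rewrite in_setC; case: (p \in E); rewrite /= ?subrr ?normr0// sub0r normrN normr1.
apply: (@le_trans _ _ ((h ^- n.+1)%:E * (e * h ^+ n.+1)%:E)%E).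
  by apply: lee_pmul => //; [rewrite lee_fin invr_ge0 exprn_ge0// ltW|exact: hd].
by rewrite -EFinM lee_fin mulrCA mulVf ?mulr1// expf_neq0// gt_eqF.
Qed.

(** Off the null set of lines that oscillate at the boundary, E is either full or null near the
    boundary on the line above y. Almost every y is a density point of the points with the same
    behaviour on a common height, and there the half-balls see E as full or empty. *)
Lemma trace_near0 E : BVset E -> exists N : set X, [/\ measurable N, leb N = 0%E &
  forall y, ~ N y -> bd_trace \1_E y = \1_(near0 E) y].
Proof.
move=> bE; have mE := BVset_measurable bE; have mC := measurableC mE.
have /choice[N1 hN1] : forall k, exists N : set X, [/\ measurable N, leb N = 0%E &
    forall y, nullnear (~` E) k y -> ~ N y -> forall e, 0 < e -> dens_at (nullnear (~` E) k) e y].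
  by move=> k; apply: lebesgue_density; exact: measurable_nullnear.
have /choice[N2 hN2] : forall k, exists N : set X, [/\ measurable N, leb N = 0%E &
    forall y, nullnear E k y -> ~ N y -> forall e, 0 < e -> dens_at (nullnear E k) e y].
  by move=> k; apply: lebesgue_density; exact: measurable_nullnear.
pose B := \bigcap_k (NC E 0 k.+1%:R^-1 : set X).
have mB : measurable B by apply: bigcapT_measurable => k; exact: measurable_NC.
have m1 : measurable (\bigcup_k N1 k) by apply: bigcupT_measurable => k; case: (hN1 k).
have m2 : measurable (\bigcup_k N2 k) by apply: bigcupT_measurable => k; case: (hN2 k).
have z1 : leb (\bigcup_k N1 k) = 0%E by apply: measure_bigcup0 => k; case: (hN1 k).
have z2 : leb (\bigcup_k N2 k) = 0%E by apply: measure_bigcup0 => k; case: (hN2 k).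
exists (B `|` (\bigcup_k N1 k `|` \bigcup_k N2 k)); split.
- by mset.
- by apply: measure_nullU; [by mset|by mset|exact: NC0_null|exact: measure_nullU].
move=> y /not_orP[yB /not_orP[y1 y2]].
have mind : measurable_fun setT (\1_E : V -> R) by exact: measurable_indic.
have [yn|yn] := pselect (near0 E y).
  have -> : \1_(near0 E) y = true%:R :> R by rewrite indicE mem_set.
  apply: bd_trace_eq => //; apply: tracep_indic => //; have [k _ hk] := yn.
  apply: (@small_hball _ k) => //; have [_ _ h] := hN1 k; apply: h => // Ny; apply: y1; exists k => //.
have -> : \1_(near0 E) y = false%:R :> R by rewrite indicE memNset.
apply: bd_trace_eq => //; apply: tracep_indic => //.
have /existsNP[k /not_implyP[_ hk]] := yB.
apply: (@small_hball _ k) => //; have [_ _ h] := hN2 k; apply: h; last by move=> Ny; apply: y2; exists k.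
rewrite /nullnear/=; apply/eqP; rewrite eq_le measure_ge0 andbT leNgt; apply/negP => h1.
apply: hk; split; first by rewrite setIC.
rewrite lt_neqAle measure_ge0 andbT; apply/negP => /eqP h2; apply: yn; exists k => //=.
Qed.

Definition Tr (beta : X -> R) E : R := \int[leb]_(y in near0 E) beta y.

Lemma capillaryE (beta : X -> R) E : BVset E -> measurable_fun setT beta ->
  (exists M : R, \forall x \ae leb, `|beta x| <= M) ->
  capillary beta E = (Per E - Tr beta E)%:E /\ leb.-integrable (near0 E) (EFin \o beta).
Proof.
move=> bE mb [M hM]; have mE := BVset_measurable bE.
have mA := measurable_near0 mE.
have lA : (leb (near0 E) < +oo)%E by apply: le_lt_trans (near0_le bE) _; rewrite ltry.
have ib : leb.-integrable (near0 E) (EFin \o beta).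
  apply/integrableP; split; first by apply/measurable_EFinP; exact: measurable_funTS.
  apply: (@le_lt_trans _ _ (\int[leb]_(y in near0 E) (cst `|M|%:E) y)%E); last first.
    by rewrite integral_cst// lte_mul_pinfty.
  apply: ae_ge0_le_integral => //.
  - by apply: measurableT_comp => //; apply/measurable_EFinP; exact: measurable_funTS.
  - by move=> x _; rewrite lee_fin.
  by apply: filterS hM => x hx _; rewrite /= lee_fin (le_trans hx)// ler_norm.
split => //; rewrite /capillary (BVset_per bE) EFinB; congr (_ - _)%E.
have [N [mN N0 hN]] := trace_near0 bE.
rewrite (integral_null_eq (g := (fun x => (beta x * \1_(near0 E) x)%:E)) mN N0); last by move=> x Nx; rewrite hN.
rewrite /Tr /Rintegral fineK; last exact: integrable_fin_num.
rewrite [RHS]integral_mkcond; apply: eq_integral => x _; rewrite patchE indicE.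
by case: (x \in _); rewrite ?mulr1 ?mulr0.
Qed.

End traces.

(** * Cutting at a given height *)

Section height.
Variables (R : realType) (n : nat).
Local Notation mR := (measurableTypeR R).
Local Notation lam := (@lebesgue_measure R).
Local Notation X := 'rV[R]_n.
Local Notation V := (Rn1 R n).
Local Notation leb := (leb R n).
Local Notation vol := (vol R n).
Local Notation Om := (@Omega R n).

Definition below (l : R) : set V := [set p | p.2 < l].

Lemma measurable_below l : measurable (below l).
Proof.
rewrite (_ : below l = setT `*` [set` `]-oo, l[]); first by apply: measurableX => //; exact: measurable_itv.
by apply/seteqP; split => p /=; rewrite in_itv//= => -[].
Qed.

Lemma vol_level (l : R) : vol [set p | p.2 = l] = 0%E.
Proof.
rewrite (_ : mkset _ = setT `*` [set l]); last by apply/seteqP; split => p //= [].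
by rewrite volX// -[X in (_ * X)%E]/(lam _) lebesgue_measure_set1 mule0.
Qed.

Lemma measurable_level (l : R) : measurable ([set p | p.2 = l] : set V).
Proof.
rewrite (_ : mkset _ = setT `*` [set l]); last by apply/seteqP; split => p //= [].
by apply: measurableX => //; exact: measurable_set1.
Qed.

Lemma C1_step_comp (u : V -> R) : C1 u -> C1 (fun p => step (u p)).
Proof. by move=> cu; apply: (@C1_comp1 R V u (@step R)) => //; exact: C1_step. Qed.

Lemma del_step_comp j (u : V -> R) p : C1 u -> del j (fun p => step (u p)) p = tent (u p) * del j u p.
Proof.
move=> cu; rewrite /del; have := @derive_comp1 R V u (@step R) p (dirv R j) (@C1_step R) cu.
by rewrite derive1_step; apply.
Qed.

Lemma C1_affine1 (i : option 'I_n) (a b : R) : C1 (fun p : V => a * comp i p + b).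
Proof. by apply: C1D; [apply: C1M; [exact: C1_cst|exact: C1_coord]|exact: C1_cst]. Qed.

Lemma del_affine1 (i j : option 'I_n) (a b : R) (p : V) : del j (fun p : V => a * comp i p + b) p = a * (j == i)%:R.
Proof.
rewrite /del deriveD'; [|by apply: C1M; [exact: C1_cst|exact: C1_coord]|exact: C1_cst].
rewrite derive_cst addr0 deriveM'; [|exact: C1_cst|exact: C1_coord].
by rewrite derive_cst mulr0 addr0 -/(del j _ _) del_coord.
Qed.

Lemma del_scale j (c : R) (g : V -> R) p : C1 g -> del j (fun p => c * g p) p = c * del j g p.
Proof.
move=> cg; rewrite /del deriveM'; [|exact: C1_cst|exact: cg].
by rewrite derive_cst mulr0 addr0.
Qed.

Definition nsq (p : V) : R := \sum_i comp i p ^+ 2.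

Lemma C1_nsq : C1 nsq.
Proof.
apply: C1_sum => i _; under eq_fun do rewrite expr2.
by apply: C1M; exact: C1_coord.
Qed.

Lemma del_nsq j p : del j nsq p = 2 * comp j p.
Proof.
have c2 i : C1 (fun p : V => comp i p ^+ 2).
  by under eq_fun do rewrite expr2; apply: C1M; exact: C1_coord.
rewrite /del derive_sum'; last by move=> i _; exact: c2.
rewrite (bigD1 j)//= big1 ?addr0.
  rewrite (_ : (fun p : V => _) = (fun p => comp j p * comp j p)); last by apply/funext => q; rewrite expr2.
  rewrite deriveM'; try exact: C1_coord.
  by rewrite -/(del j _ _) del_coord eqxx mulr1 mulr2n mulrDl mul1r.
move=> i ij; rewrite (_ : (fun p : V => _) = (fun p => comp i p * comp i p)); last by apply/funext => q; rewrite expr2.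
rewrite deriveM'; try exact: C1_coord.
by rewrite -/(del j _ _) del_coord eq_sym (negbTE ij) mulr0 addr0.
Qed.

Lemma nsq_coord p i : comp i p ^+ 2 <= nsq p.
Proof. by rewrite /nsq (bigD1 i)//= lerDl; apply: sumr_ge0 => j _; exact: sqr_ge0. Qed.

Lemma nsq_bounded (K : set V) : compact K -> exists M : R, forall p, K p -> nsq p <= M.
Proof.
move=> cK; have [k Kk] := compact_vcube cK; exists (\sum_(i : option 'I_n) k%:R ^+ 2) => p /Kk [h1 h2].
apply: ler_sum => -[i|] _; rewrite -real_normK ?num_real// ler_pXn2r ?nnegrE//; apply: ltW; rewrite ltr_norml.
  by have := h1 i; rewrite /= in_itv.
by move: h2; rewrite /= in_itv.
Qed.

Lemma compact_nsq (M a : R) : compact [set p : V | nsq p <= M /\ a <= p.2].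
Proof.
have [k hk] : exists k : nat, `|M| < k%:R.
  have tk : \forall k \near \oo, `|M| < (k%:R : R) by exact: nbhs_infty_gtr.
  by case: tk => k _ /(_ k (leqnn k)); exists k.
have cB : compact (cbox (fun _ : 'I_n => - (k%:R + 1) : R) (fun=> k%:R + 1) `*` (`[- (k%:R + 1), k%:R + 1]%classic : set mR) : set V).
  by apply: compact_setX; [exact: compact_cbox|exact: segment_compact].
apply: (subclosed_compact _ cB).
  rewrite (_ : mkset _ = [set p | nsq p <= M] `&` [set p : V | a <= p.2])//; apply: closedI.
    apply: (@preimage_closed _ _ nsq [set t | t <= M]); last exact: closed_le.
    by move=> p _; exact: (C1_continuous C1_nsq).
  apply: (@preimage_closed _ _ (fun p : V => p.2 : R) [set t | a <= t]); last exact: closed_ge.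
  by move=> p _; exact: continuous_snd1.
have H (t : R) : t ^+ 2 <= M -> - (k%:R + 1) <= t <= k%:R + 1.
  move=> tM; have k0 : 0 <= k%:R :> R by [].
  rewrite -ler_norml; have [//|h] := leP `|t| (k%:R + 1).
  have : (k%:R + 1) ^+ 2 <= t ^+ 2 by rewrite -[leRHS]real_normK ?num_real// ler_pXn2r ?nnegrE ?addr_ge0// ltW.
  by have := ler_norm M; move: `|M| hk => m; move: (k%:R) k0 => K; rewrite sqrrD1; nra.
move=> p [/= pM _]; split.
  by move=> i /=; rewrite in_itv/= H//; exact: le_trans (nsq_coord p (Some i)) pM.
by rewrite /= in_itv/= H//; exact: le_trans (nsq_coord p None) pM.
Qed.

Lemma Int_upper (E S : set V) (g : V -> R) (c : R) : measurable E -> measurable S -> (vol E < +oo)%E -> cc g ->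
  0 <= c -> (forall p, E p -> g p <= c * \1_S p) -> Int E g <= c * fine (vol (E `&` S)).
Proof.
move=> mE mS Eoo cg c0 h.
have mI : measurable (E `&` S) by mset.
have mD : measurable (E `\` S) by mset.
have Ioo : (vol (E `&` S) < +oo)%E by apply: le_lt_trans Eoo; apply: le_meas => //; exact: subIsetl.
have -> : Int E g = Int (E `&` S) g + Int (E `\` S) g.
  rewrite -Int_setU//; first by rewrite setUIDK.
  by rewrite -subset0 => p [[_ ?] [_ ?]].
rewrite -[leRHS]addr0; apply: lerD.
  apply: (@le_trans _ _ (\int[vol]_(p in E `&` S) c)).
    rewrite /Int; apply: le_Rintegral => //.
    - exact: cc_integrable.
    - exact: integrable_cst_fin.
    - by move=> p [Ep Sp]; apply: (le_trans (h p Ep)); rewrite indicE mem_set// mulr1.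
  by rewrite Rintegral_cst.
rewrite -(Int0 mD); apply: le_Int => //; first exact: cc0.
by move=> p [Ep Sp]; apply: (le_trans (h p Ep)); rewrite indicE memNset// mulr0.
Qed.

Section field.
Variables (i : 'I_n) (E : set V) (l : R).
Hypotheses (bE : BVset E) (l0 : 0 < l).
Variables (th : R) (xi : V -> R) (f : option 'I_n -> V -> R).
Hypotheses (th01 : 0 <= th <= 1) (cxi : C1 xi) (xi1 : forall p, `|xi p| <= 1).
Hypothesis (xiK : exists K : set V, [/\ compact K, K `<=` Hl l & forall p, ~ K p -> xi p = 0]).
Hypothesis (tf : testf Om f).

(** Equal to 1 where |p| <= m+1 and the height is at least l / 2; zero where |p|^2 >= 2 (m+1)^2 or
    the height is at most l / 4. As m grows it tends to 1 above l / 2. *)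
Definition zeta (m : nat) (p : V) : R := step (- (m.+1%:R ^- 2) * nsq p + 2) * step (4 / l * comp None p - 1).
(* The field used above the height [l]: vertical, except for a tilt by [th] in the direction [i].
   The tilt gains a multiple of [th] and costs only [th ^+ 2] at the height [l], hence the strict
   inequality in [cut_height_strict]. *)
Definition gfield m (j : option 'I_n) : V -> R :=
  if j == Some i then (fun p => th * xi p) else if j == None then (fun p => (1 - th ^+ 2) * zeta m p) else (fun=> 0).
(** One up to the height l - 1 / (k+1) and zero from the height l on. *)
Definition eta (k : nat) (p : V) : R := step (- k.+1%:R * comp None p + k.+1%:R * l).

Lemma C1_zeta m : C1 (zeta m).
Proof.
apply: C1M; apply: C1_step_comp; last exact: C1_affine1.
by apply: C1D; [apply: C1M; [exact: C1_cst|exact: C1_nsq]|exact: C1_cst].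
Qed.

Lemma zeta01 m p : 0 <= zeta m p <= 1.
Proof.
rewrite /zeta; have /andP[a0 a1] := step_ge0 (- (m.+1%:R ^- 2) * nsq p + 2).
have /andP[b0 b1] := step_ge0 (4 / l * comp None p - 1).
by rewrite mulr_ge0//= -[leRHS]mulr1 ler_pM.
Qed.

Lemma gfield_None m : gfield m None = (fun p => (1 - th ^+ 2) * zeta m p). Proof. by []. Qed.

(** The two components are at most th and 1 - th^2 in absolute value, and th^2 + (1 - th^2)^2 <= 1
    since th <= 1. *)
Lemma gfield_test m : testf Om (gfield m).
Proof.
have [K [cK KH K0]] := xiK.
split.
- move=> j; rewrite /gfield; case: eqP => _; first by apply: C1M; [exact: C1_cst|exact: cxi].
  by case: eqP => _; [apply: C1M; [exact: C1_cst|exact: C1_zeta]|exact: C1_cst].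
- move=> p; rewrite (bigD1 None)//= (bigD1 (Some i))//= big1 ?addr0; last first.
    by move=> j /andP[j1 j2]; rewrite /gfield (negbTE j2) (negbTE j1) expr0n.
  rewrite /gfield/= eqxx.
  have := zeta01 m p; move: (zeta m p) => ze /andP[z0 z1].
  rewrite !exprMn.
  have h1 : ze ^+ 2 <= 1 by rewrite expr_le1.
  have h2 : xi p ^+ 2 <= 1 by rewrite -real_normK ?num_real// expr_le1.
  have /andP[t0 t1] := th01.
  have h3 : 0 <= th ^+ 2 <= 1 by rewrite sqr_ge0 expr_le1.
  move: (ze ^+ 2) (xi p ^+ 2) (th ^+ 2) (sqr_ge0 ze) h1 h2 h3 => z x t z2 h1 h2 /andP[h3 h4].
  have e1 := ler_wpM2l (sqr_ge0 (1 - t)) h1; have e2 := ler_wpM2l h3 h2.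
  have e3 : 0 <= t * (1 - t) by rewrite mulr_ge0// subr_ge0.
  by move: e1 e2 e3; rewrite !mulr1 [(1 - t) ^+ 2]expr2; move: ((1 - t) * (1 - t) * z) (t * x) => ? ?; nra.
- exists (K `|` [set p | nsq p <= 2 * m.+1%:R ^+ 2 /\ l / 4 <= p.2]); split.
  + by apply: compactU => //; exact: compact_nsq.
  + move=> p [/KH|[_ /= h]]; first by rewrite /Hl/= => h; exact: lt_trans h.
    by apply: lt_le_trans h; rewrite divr_gt0.
  + move=> p /not_orP[Kp hp] j; rewrite /gfield; case: eqP => _; first by rewrite K0 ?mulr0.
    case: eqP => // _; rewrite /zeta.
    have m0 : 0 < m.+1%:R ^+ 2 :> R by rewrite exprn_gt0.
    have [h|h] := leP (nsq p) (2 * m.+1%:R ^+ 2).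
      rewrite [X in _ * (_ * X)]step_le0 ?mulr0//= subr_le0.
      have [h2|h2] := leP (l / 4) p.2; first by exfalso; apply: hp.
      by move: h2; rewrite ltr_pdivlMr// => h2; rewrite mulrAC ler_pdivrMr// mul1r mulrC ltW.
    rewrite step_le0 ?mul0r ?mulr0// mulNr addrC subr_le0 mulrC ler_pdivlMr//; exact: ltW.
Qed.

Lemma C1_eta k : C1 (eta k). Proof. by apply: C1_step_comp; exact: C1_affine1. Qed.

Lemma eta01 k p : 0 <= eta k p <= 1. Proof. exact: step_ge0. Qed.

Lemma del_eta k j p : del j (eta k) p = - (k.+1%:R * tent (- k.+1%:R * comp None p + k.+1%:R * l)) * (j == None)%:R.
Proof. by rewrite /eta del_step_comp ?del_affine1; [ring|exact: C1_affine1]. Qed.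

Lemma eta_cvg p : eta ^~ p @ \oo --> (\1_(below l) p : R).
Proof.
apply: cvg_near_cst; rewrite indicE; case: (boolP (p \in _)) => hp.
  rewrite inE /below/= -subr_gt0 in hp.
  have tk : \forall k \near \oo, (l - p.2)^-1 < (k%:R : R) by exact: nbhs_infty_gtr.
  apply: filterS tk => k hk; rewrite /eta step_ge1// mulNr addrC -mulrBr -ler_pdivrMr// div1r.
  by rewrite (le_trans (ltW hk))// ler_nat.
rewrite notin_setE /below/= in hp; move/negP: hp; rewrite -leNgt => hp.
apply: nearW => k; rewrite /eta step_le0// mulNr addrC -mulrBr mulr_ge0_le0// subr_le0//.
Qed.

(** The field f below l is glued to [gfield] above. As [eta] decreases with the height, the gluing
    term has the favourable sign whenever the vertical component of [gfield] exceeds that of f; in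
    the layer it falls short by at most th^2, because [zeta] is 1 wherever f does not vanish. *)
Lemma height_step m : exists k0, forall k, (k0 <= k)%N -> (forall p, (exists j, f j p != 0) -> nsq p <= m.+1%:R ^+ 2) ->
  Int E (fun p => eta k p * dive f p) + Int E (fun p => (1 - eta k p) * dive (gfield m) p) <=
   Per E * (1 + 2 * th ^+ 2).
Proof.
have [k0 hk0] : exists k0 : nat, 2 / l < k0%:R.
  have tk : \forall k \near \oo, 2 / l < (k%:R : R) by exact: nbhs_infty_gtr.
  by case: tk => k _ /(_ k (leqnn k)); exists k.
exists k0 => k kk hm.
have mE := BVset_measurable bE.
have tg := gfield_test m.
have tc := testf_convex (C1_eta k) (eta01 k) tf tg.
have := Per_lb bE tc.
have [Cf f1 _] := tf; have [Cg g1 _] := tg.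
have Ceta := C1_continuous (C1_eta k).
pose w (p : V) := k.+1%:R * tent (- k.+1%:R * comp None p + k.+1%:R * l) * (gfield m None p - f None p).
have e : dive (fun j p => eta k p * f j p + (1 - eta k p) * gfield m j p) =
    (fun p => (eta k p * dive f p + (1 - eta k p) * dive (gfield m) p) + w p).
  apply/funext => p; rewrite (dive_convex p (C1_eta k) Cf Cg); congr (_ + _).
  rewrite (bigD1 None)//= big1 ?addr0.
    by rewrite del_eta eqxx mulr1 /w; move: (gfield m None p) (f None p) => a b; ring.
  by move=> j /negbTE h; rewrite del_eta h mulr0 mul0r.
have ccf : cc (fun p => eta k p * dive f p) by apply: ccM; [exact: Ceta|exact: (cc_dive tf)].
have ccg : cc (fun p => (1 - eta k p) * dive (gfield m) p).
  by apply: ccM; [move=> p; apply: cvgB; [exact: cvg_cst|exact: Ceta]|exact: (cc_dive tg)].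
have ccw : cc w.
  have h : cc (fun p => (eta k p * dive f p + (1 - eta k p) * dive (gfield m) p) + w p) by rewrite -e; exact: (cc_dive tc).
  rewrite (_ : w = (fun p => ((eta k p * dive f p + (1 - eta k p) * dive (gfield m) p) + w p) -
      (eta k p * dive f p + (1 - eta k p) * dive (gfield m) p))); last by apply/funext => p; ring.
  by apply: ccB => //; exact: ccD.
rewrite e (IntD mE (ccD ccf ccg) ccw) (IntD mE ccf ccg).
have /andP[t0 t1] := th01.
pose S := strip (l - k.+1%:R^-1) l : set V.
have kl : k.+1%:R^-1 < l / 2.
  have lk : 2 / l < k.+1%:R by apply: lt_le_trans hk0 _; rewrite ler_nat; exact: leq_trans kk _.
  rewrite -[ltRHS]invrK invf_div ltf_pV2 ?posrE// divr_gt0//.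
(* The slope of the cut-off is at most (3/2)(k+1), rounded to 2 (k+1); it is paid only in a strip of
   height 1 / (k+1), in which E has volume at most Per E / (k+1). *)
have wlow p : E p -> - w p <= 2 * th ^+ 2 * k.+1%:R * \1_S p.
  move=> Ep; rewrite /w indicE.
  have /andP[te0 te1] := tent_ge0 (- k.+1%:R * comp None p + k.+1%:R * l).
  case: (boolP (p \in S)) => hS; last first.
    suff -> : tent (- k.+1%:R * comp None p + k.+1%:R * l) = 0 by rewrite !(mulr0, mul0r) oppr0.
    move: hS; rewrite notin_setE /S /strip/= in_itv/= => /negP; rewrite negb_and -!leNgt => /orP[h|h].
      have hh : k.+1%:R^-1 <= l - p.2 by rewrite lerBrDr addrC -lerBrDr.
      by rewrite tent_ge1// mulNr addrC -mulrBr -ler_pdivrMl// mulr1.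
    by rewrite tent_le0// mulNr addrC -mulrBr mulr_ge0_le0// subr_le0.
  rewrite mulr1; have : - (gfield m None p - f None p) <= th ^+ 2.
    rewrite gfield_None.
    have /andP[z0 z1] := zeta01 m p.
    have t2 : 0 <= th ^+ 2 <= 1 by rewrite sqr_ge0 expr_le1.
    have [fp|fp] := pselect (exists j, f j p != 0); last first.
      have -> : f None p = 0 by apply: contrapT => h; apply: fp; exists None; apply/eqP.
      move: t2 z0; move: (th ^+ 2) (zeta m p) => t z; nra.
    have -> : zeta m p = 1.
      rewrite inE /S /strip/= in_itv/= in hS.
      rewrite /zeta !step_ge1 ?mulr1//.
        move: hS => /andP[h1 h2].
        have hl : l / 2 <= comp None p by apply: le_trans (ltW h1); rewrite lerBrDl -lerBrDr (le_trans (ltW kl))// -{2}(mulr1 l) -mulrBr ler_pM2l//; lra.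
        have l4 : 0 <= 4 / l by rewrite divr_ge0// ltW.
        rewrite lerBrDr; have := ler_wpM2l l4 hl.
        have -> : 4 / l * (l / 2) = 1 + 1 by field; rewrite gt_eqF.
        by [].
      have := hm p fp; have m0 : 0 < m.+1%:R ^+ 2 :> R by rewrite exprn_gt0.
      move=> h; have : m.+1%:R ^- 2 * nsq p <= 1 by rewrite mulrC ler_pdivrMr// mul1r.
      by rewrite mulNr; move: (_ * _) => x; lra.
    have fN : f None p <= 1.
      have := f1 p; rewrite (bigD1 None)//= => h.
      have : f None p ^+ 2 <= 1 by apply: le_trans h; rewrite lerDl; apply: sumr_ge0 => j _; exact: sqr_ge0.
      by rewrite -real_normK ?num_real// expr_le1// => /(le_trans (ler_norm _)).
    by move: fN; move: (th ^+ 2) (f None p) => a b; lra.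
  rewrite -mulrN; move: (_ - _) => d hd.
  have hn : 0 <= - d \/ - d <= 0 by case: (leP 0 (- d)) => ?; [left|right; apply: ltW].
  have k1 : 0 <= k.+1%:R :> R by [].
  move: k1 te0 te1 hd hn (sqr_ge0 th); move: (k.+1%:R) (tent _) (th ^+ 2) (- d) => K te t' d' k1 te0 te1 hd hn t'0.
  case: hn => hn.
    have a1 : te * d' <= 3 / 2 * t' by nra.
    have a2 : K * (te * d') <= K * (3 / 2 * t') by nra.
    have a3 : 0 <= K * t' by nra.
    rewrite -mulrA; lra.
  have a3 : 0 <= K * t' by nra.
  have a2 : 0 <= K * te by nra.
  nra.
have mS : measurable S by exact: measurable_strip.
have Sv : k.+1%:R * fine (vol (E `&` S)) <= Per E.
  have := @vol_strip R n E (l - k.+1%:R^-1) k.+1%:R^-1 bE.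
  rewrite subrK invr_ge0 => /(_ (ler0n _ _)) h.
  by rewrite -ler_pdivlMl//; rewrite mulrC in h *; rewrite mulrC.
have Iw : - Int E w <= 2 * th ^+ 2 * Per E.
  rewrite -IntN//.
  apply: (@le_trans _ _ (2 * th ^+ 2 * k.+1%:R * fine (vol (E `&` S)))).
    apply: Int_upper => //; [exact: BVset_vol|exact: ccN|by rewrite !mulr_ge0// exprn_ge0].
  by rewrite -mulrA ler_wpM2l// mulr_ge0// exprn_ge0.
by move: Iw; move: (Int E w) (Int E _) (Int E _) (Per E) (th ^+ 2) => a b c d t; lra.
Qed.

(** The limits are taken first in the layer, then in the radius m of the vertical field. In the
    latter only the horizontal tilt is left above l: there the vertical component is almost constant
    and its divergence tends to zero uniformly. *)
Lemma height_field : Int (E `&` below l) (dive f) + th * Int (E `\` below l) (del (Some i) xi) <=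
  Per E * (1 + 2 * th ^+ 2).
Proof.
have mE := BVset_measurable bE; have mA := measurable_below l.
have Eoo := BVset_vol bE.
have [Cf f1 [Kf [cKf KfO Kf0]]] := tf.
have [M hM] := nsq_bounded cKf.
have [m0 hm0] : exists m0 : nat, forall m, (m0 <= m)%N -> (forall p, (exists j, f j p != 0) -> nsq p <= m.+1%:R ^+ 2).
  have tk : \forall k \near \oo, M < (k%:R : R) by exact: nbhs_infty_gtr.
  case: tk => k _ hk; exists k => m km p [j fj].
  have Kp : Kf p by apply: contrapT => Kp; move: fj; rewrite Kf0 ?eqxx.
  apply: (le_trans (hM p Kp)); apply: (le_trans (ltW (hk m km))).
  apply: (@le_trans _ _ m.+1%:R); first by rewrite ler_nat.
  by rewrite expr2 ler_peMr// ler1n.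
have mD : measurable (E `\` below l) by mset.
have Doo : (vol (E `\` below l) < +oo)%E by apply: le_lt_trans Eoo; apply: le_meas => //; mset.
have ccx : cc (del (Some i) xi).
  by apply: cc_del => //; have [K [cK _ K0]] := xiK; exists K.
have H1 m : (m0 <= m)%N -> Int (E `&` below l) (dive f) + Int (E `\` below l) (dive (gfield m)) <= Per E * (1 + 2 * th ^+ 2).
  move=> mm; have [k0 hk0] := height_step m.
  have c1 : (fun k => Int E (fun p => eta (k + k0)%N p * dive f p)) @ \oo --> Int (E `&` below l) (dive f).
    apply: (@Int_weight_cvg R n E (below l) (fun k => eta (k + k0)%N)).
    - exact: mE.
    - exact: mA.
    - exact: cc_dive tf.
    - by move=> k; exact: C1_eta.
    - by move=> k p; exact: eta01.
    - by move=> p _; rewrite (cvg_shiftn k0 (eta ^~ p)); exact: eta_cvg.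
  have c2 : (fun k => Int E (fun p => (1 - eta (k + k0)%N p) * dive (gfield m) p)) @ \oo --> Int (E `&` ~` below l) (dive (gfield m)).
    apply: (@Int_weight_cvg R n E (~` below l) (fun k p => 1 - eta (k + k0)%N p)).
    - exact: mE.
    - exact: measurableC.
    - exact: cc_dive (gfield_test m).
    - by move=> k; apply: C1B; [exact: C1_cst|exact: C1_eta].
    - by move=> k p; have /andP[a b] := eta01 (k + k0)%N p; apply/andP; split; lra.
    - move=> p _; have -> : \1_(~` below l) p = 1 - \1_(below l) p :> R.
        by rewrite !indicE in_setC; case: (_ \in _); rewrite /= ?subrr ?subr0.
      by apply: cvgB; [exact: cvg_cst|rewrite (cvg_shiftn k0 (eta ^~ p)); exact: eta_cvg].
  apply: (le_limD c1 c2) => k; apply: hk0; [exact: leq_addl|exact: hm0].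
have cczeta m : cc (del None (zeta m)).
  apply: cc_del; first exact: C1_zeta.
  exists [set p | nsq p <= 2 * m.+1%:R ^+ 2 /\ l / 4 <= p.2]; split; first exact: compact_nsq.
  move=> p hp; have m1 : 0 < m.+1%:R ^+ 2 :> R by rewrite exprn_gt0.
  rewrite /zeta; have [h|h] := leP (nsq p) (2 * m.+1%:R ^+ 2).
    rewrite [X in _ * X]step_le0 ?mulr0//= subr_le0.
    have [h2|h2] := leP (l / 4) p.2; first by exfalso; apply: hp.
    by move: h2; rewrite ltr_pdivlMr// => h2; rewrite mulrAC ler_pdivrMr// mul1r mulrC ltW.
  rewrite step_le0 ?mul0r// mulNr addrC subr_le0 mulrC ler_pdivlMr//; exact: ltW.
have H2 m : Int (E `\` below l) (dive (gfield m)) = (1 - th ^+ 2) * Int (E `\` below l) (del None (zeta m)) + th * Int (E `\` below l) (del (Some i) xi).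
  have -> : dive (gfield m) = (fun p => (1 - th ^+ 2) * del None (zeta m) p + th * del (Some i) xi p).
    apply/funext => p; rewrite /dive (bigD1 None)//= (bigD1 (Some i))//= big1 ?addr0.
      by rewrite /gfield/= eqxx (del_scale _ _ _ (C1_zeta m)) (del_scale _ _ _ cxi).
    move=> j /andP[j1 j2]; rewrite /gfield (negbTE j2) (negbTE j1); exact: derive_cst.
  rewrite IntD ?IntZ//; exact: ccZ.
(* Above l only the cut-off at infinity varies: the slope 3/2, times (m+1)^-2, times 2 |t| with |t|
   <= 2 (m+1). *)
have H3 m : `|Int (E `\` below l) (del None (zeta m))| <= 6 / m.+1%:R * fine (vol (E `\` below l)).
  apply: Int_bound => // p [_ pl].
  have {}pl : l <= p.2 by rewrite leNgt; apply/negP.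
  have m1 : 0 < m.+1%:R :> R by [].
  have cu : C1 (fun p : V => - (m.+1%:R ^- 2) * nsq p + 2 : R).
    by apply: C1D; [apply: C1M; [exact: C1_cst|exact: C1_nsq]|exact: C1_cst].
  rewrite /zeta /del deriveM'; [|exact: C1_step_comp|by apply: C1_step_comp; exact: C1_affine1].
  rewrite -/(del None _ p) -/(del None _ p) (del_step_comp _ _ (C1_affine1 _ _ _)) (del_step_comp _ _ cu).
  have big : 1 <= 4 / l * comp None p - 1.
    have hl : l / 2 <= comp None p by rewrite /=; apply: le_trans pl; rewrite ler_pdivrMr// ler_peMr ?ler1n// ltW.
    have l4 : 0 <= 4 / l by rewrite divr_ge0// ltW.
    rewrite lerBrDr; have := ler_wpM2l l4 hl.
    have -> : 4 / l * (l / 2) = 1 + 1 by field; rewrite gt_eqF.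
    by [].
  rewrite tent_ge1// mul0r mulr0 add0r step_ge1// mul1r.
  rewrite /del deriveD'; [|by apply: C1M; [exact: C1_cst|exact: C1_nsq]|exact: C1_cst].
  rewrite derive_cst addr0 deriveM'; [|exact: C1_cst|exact: C1_nsq].
  rewrite derive_cst mulr0 addr0 -/(del None _ p) del_nsq.
  have [ht|ht] := leP (nsq p) (2 * m.+1%:R ^+ 2); last first.
    rewrite tent_le0 ?mul0r ?normr0 ?divr_ge0//.
    rewrite mulNr addrC subr_le0 mulrC ler_pdivlMr ?exprn_gt0//; exact: ltW.
  have /andP[te0 te1] := tent_ge0 (- m.+1%:R ^- 2 * nsq p + 2).
  have ct : `|comp None p| <= 2 * m.+1%:R.
    rewrite -ler_sqr ?nnegrE ?mulr_ge0// real_normK ?num_real//; apply: (le_trans (nsq_coord p None)).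
    by apply: (le_trans ht); rewrite exprMn ler_pM2r ?exprn_gt0//; lra.
  move: (tent _) te0 te1 => te te0 te1.
  have i0 : 0 <= m.+1%:R ^- 2 :> R by rewrite invr_ge0 exprn_ge0.
  have n2 : `|2 : R| = 2 by rewrite ger0_norm.
  rewrite normrM (ger0_norm te0) normrM normrN (ger0_norm i0) normrM n2.
  have -> : 6 / m.+1%:R = 3 / 2 * (m.+1%:R ^- 2 * (2 * (2 * m.+1%:R))) :> R.
    by move: (m.+1%:R) m1 => M1 M10; field; rewrite gt_eqF.
  have b0 : 0 <= m.+1%:R ^- 2 * (2 * `|comp None p|) by rewrite mulr_ge0 ?mulr_ge0.
  have b1 : m.+1%:R ^- 2 * (2 * `|comp None p|) <= m.+1%:R ^- 2 * (2 * (2 * m.+1%:R)).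
    by apply: ler_wpM2l => //; apply: ler_wpM2l.
  exact: (ler_pM te0 b0 te1 b1).
have c3 : (fun m => (1 - th ^+ 2) * Int (E `\` below l) (del None (zeta (m + m0)))) @ \oo --> (1 - th ^+ 2) * 0.
  apply: cvgMl_tmp; rewrite (cvg_shiftn m0 (fun m => Int (E `\` below l) (del None (zeta m)))).
  apply/cvgr0Pnorm_le => e e0.
  pose v := fine (vol (E `\` below l)); have v0 : 0 <= v by exact: fine_ge0.
  have tk : \forall k \near \oo, 6 * v / e < (k%:R : R) by exact: nbhs_infty_gtr.
  apply: filterS tk => m hm; apply: le_trans (H3 m) _; rewrite -/v mulrAC ler_pdivrMr//.
  have hm' : 6 * v < e * m%:R by rewrite (mulrC e) -ltr_pdivrMr.
  by apply: le_trans (ltW hm') _; rewrite ler_pM2l// ler_nat.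
rewrite -[leLHS]add0r -(mulr0 (1 - th ^+ 2)).
apply: (le_limD c3 (cvg_cst _)) => m.
have := H1 (m + m0)%N (leq_addl _ _); rewrite H2.
by move: (_ * Int _ _) (_ * Int _ _) (Int _ _) (_ * (1 + _)) => a b c d; lra.
Qed.

End field.

(** The case th = 0: the vertical unit field calibrates the horizontal plane. *)
Lemma cut_height (i : 'I_n) (E : set V) (l : R) : BVset E -> 0 < l ->
  BVset (E `&` below l) /\ Per (E `&` below l) <= Per E.
Proof.
move=> bE l0; have mE := BVset_measurable bE; have mA := measurable_below l.
apply: BVset_intro.
- by mset.
- by move=> p [/(BVset_sub bE)].
- by apply: le_lt_trans (BVset_vol bE); apply: le_meas => //; mset.
move=> f tf.
pose z (p : V) : R := 0.
have K0 : exists K : set V, [/\ compact K, K `<=` Hl l & forall p, ~ K p -> z p = 0].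
  by exists set0; split => //; exact: compact0.
have h01 : (0 : R) <= 0 <= (1 : R) by rewrite lexx ler01.
have cz : C1 z by exact: C1_cst.
have z1 p : `|z p| <= 1 by rewrite normr0.
have := height_field i bE l0 h01 cz z1 K0 tf.
by rewrite expr0n/= mulr0 mul0r !addr0 mulr1.
Qed.

(** By [HV0_null] the part of E above l varies in the horizontal direction i, so some xi gives a
    positive integral c there. The tilt by th gains th c and costs 2 th^2 Per E. *)
Lemma cut_height_strict (i : 'I_n) (E : set V) (l : R) : BVset E -> 0 < l ->
  (0 < vol (E `\` below l))%E -> Per (E `&` below l) < Per E.
Proof.
move=> bE l0 vpos; have mE := BVset_measurable bE; have mA := measurable_below l.
have [bF FE] := cut_height i bE l0.
have mH := @measurable_Hl R n l.
have mEH : measurable (E `&` Hl l) by mset.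
have EHoo : (vol (E `&` Hl l) < +oo)%E by apply: le_lt_trans (BVset_vol bE); apply: le_meas => //; mset.
pose L := E `&` [set p : V | p.2 = l].
have mL : measurable L by apply: measurableI => //; exact: measurable_level.
have L0 : vol L = 0%E.
  apply/eqP; rewrite eq_le measure_ge0 andbT -(vol_level l); apply: le_meas => //; first exact: measurable_level.
  exact: subIsetr.
have dec : E `\` below l = (E `&` Hl l) `|` L.
  apply/seteqP; split => p.
    move=> [Ep /negP]; rewrite -leNgt le_eqVlt => /orP[/eqP h|h]; [by right; split|by left; split].
  by case=> -[Ep h]; split => //; rewrite /below/=; [rewrite ltNge (ltW h)|rewrite h ltxx].
have disj : (E `&` Hl l) `&` L = set0.
  by rewrite -subset0 => p [[_ h1] [_ h2]]; move: h1; rewrite /Hl/= h2 ltxx.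
have vH : (0 < vol (E `&` Hl l))%E.
  rewrite lt_neqAle measure_ge0 andbT; apply/negP => /eqP h0; move: vpos; rewrite dec.
  by rewrite measure_nullU// ltxx.
have nH : ~ HV (E `&` Hl l) (Some i) l 0.
  move=> h; move: vH; rewrite (HV0_null mEH EHoo (ltW l0) _ h) ?ltxx//; exact: subIsetr.
have [xi [cxi x1 K0 hI]] : exists xi : V -> R, [/\ C1 xi, (forall p, `|xi p| <= 1),
    (exists K : set V, [/\ compact K, K `<=` Hl l & forall p, ~ K p -> xi p = 0]) &
    0 < Int (E `&` Hl l) (del (Some i) xi)].
  apply: contrapT => h; apply: nH => xi cxi x1 K0; rewrite leNgt; apply/negP => hI; apply: h.
  by exists xi.
have ccx : cc (del (Some i) xi) by apply: cc_del => //; have [K [cK _ K1]] := K0; exists K.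
set c := Int _ _ in hI.
have Ic : Int (E `\` below l) (del (Some i) xi) = c.
  by rewrite dec Int_setU// (Int_null mL ccx L0) addr0.
have P0 := Per_ge0 E.
(* Small enough for 2 th^2 Per E < th c, and at most 1 as [height_field] asks; Per E + 1 avoids a
   division by zero. *)
pose th := Num.min 1 (c / (2 * (Per E + 1) * 2)).
have den : 0 < 2 * (Per E + 1) * 2 by rewrite !mulr_gt0// ltr_wpDl.
have th0 : 0 < th by rewrite lt_min ltr01 divr_gt0.
have th1 : th <= 1 by rewrite ge_min lexx.
have thc : th * (2 * (Per E + 1) * 2) <= c by rewrite -ler_pdivlMr// ge_min lexx orbT.
have sup : Per (E `&` below l) <= Per E * (1 + 2 * th ^+ 2) - th * c.
  have [] // := BVset_intro (BVset_measurable bF) (BVset_sub bF) (BVset_vol bF) (c := Per E * (1 + 2 * th ^+ 2) - th * c).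
  move=> f tf; have := @height_field i E l bE l0 th xi f _ cxi x1 K0 tf.
  rewrite Ic (ltW th0) th1 => /(_ isT).
  by move: (Int _ _) (th * c) (_ * (1 + _)) => a b d; lra.
apply: (le_lt_trans sup).
have hc : 0 < th * c by rewrite mulr_gt0.
have : Per E * (2 * th ^+ 2) < th * c.
  have e : Per E * (2 * th ^+ 2) = th * (th * (2 * Per E)) by ring.
  rewrite e ltr_pM2l//; apply: lt_le_trans thc; rewrite ltr_pM2l//; move: P0; move: (Per E) => P; lra.
by move: (Per E) (th ^+ 2) (th * c) => P t d; lra.
Qed.

Lemma near0_local (E F : set V) (d : R) : measurable E -> measurable F -> 0 < d ->
  (forall p, 0 < p.2 < d -> E p <-> F p) -> near0 E = near0 F.
Proof.
move=> mE mF d0.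
have H (A B : set V) : measurable A -> measurable B -> (forall p, 0 < p.2 < d -> A p <-> B p) -> near0 A `<=` near0 B.
  move=> mA mB AB y [k _ /= hk].
  have tk : \forall m \near \oo, d^-1 < (m%:R : R) by exact: nbhs_infty_gtr.
  case: tk => m _ /(_ (maxn k m) (leq_maxr _ _)) hm.
  have dm : (maxn k m).+1%:R^-1 <= d.
    by rewrite invf_ple ?posrE// (le_trans (ltW hm))// ler_nat.
  have km : (maxn k m).+1%:R^-1 <= k.+1%:R^-1 :> R by rewrite lef_pV2 ?posrE// ler_nat ltnS leq_maxl.
  exists (maxn k m) => //=; apply/eqP; rewrite eq_le measure_ge0 andbT -hk.
  have mlA := measurable_line y mA; have mlB := measurable_line y mB.
  apply: le_meas; [by mset|by mset|] => t [] /=; rewrite !in_itv/= => /andP[t0 t1] nB; split.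
    by rewrite /= t0 (lt_le_trans t1).
  by move=> At; apply: nB; apply/(AB (y, t)) => //=; rewrite t0 (lt_le_trans t1).
move=> EF; apply/seteqP; split; apply: H => // p hp; have := EF p hp; tauto.
Qed.

Lemma near0_cut_height (E : set V) (l : R) : measurable E -> 0 < l -> near0 (E `&` below l) = near0 E.
Proof.
move=> mE l0; apply: (near0_local _ _ l0) => //; first by apply: measurableI => //; exact: measurable_below.
by move=> p /andP[_ pl]; split => [[]|Ep].
Qed.

End height.

(** * Lower semicontinuity of the capillary energy *)

Section traceflux.
Variables (R : realType) (n : nat).
Local Notation mR := (measurableTypeR R).
Local Notation lam := (@lebesgue_measure R).
Local Notation X := 'rV[R]_n.
Local Notation V := (Rn1 R n).
Local Notation leb := (leb R n).
Local Notation vol := (vol R n).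
Local Notation Om := (@Omega R n).

Lemma compact_lower (K : set V) : compact K -> K `<=` Om -> exists2 d : R, 0 < d & forall p, K p -> d <= p.2.
Proof.
move=> cK KO.
pose I := (fun p : V => p.2 : R) @` K.
have cI : compact I.
  by apply: continuous_compact => //; apply: continuous_subspaceT; exact: continuous_snd1.
have I0 : (~` I) (0 : R) by move=> [p Kp p0]; have := KO p Kp; rewrite /Om /= p0 ltxx.
have oI : open (~` I) by apply: closed_openC; apply: compact_closed => //; exact: Rhausdorff.
have /nbhs_ballP[e /= e0 he] := open_nbhs_nbhs (conj oI I0).
exists e => // p Kp; rewrite leNgt; apply/negP => pe; apply: (he p.2); last by exists p.
by rewrite /ball/= sub0r normrN gtr0_norm //; exact: KO.
Qed.

Definition ccX (b : X -> R) := exists K : set X, compact K /\ forall y, ~ K y -> b y = 0.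

(** A plateau that rises on [sg, 2 sg] and falls on [d, 2 d]; its derivative is the difference of
    the kernels at the two ends. *)
Definition gst (sg d u : R) : R := step (sg^-1 * (u - sg)) - step (d^-1 * (u - d)).

Lemma C1_gst sg d : C1 (gst sg d). Proof. by apply: C1B; exact: C1_stepd. Qed.

Lemma derive_gst sg d u : 'D_1 (gst sg d) u = kern sg sg u - kern d d u.
Proof. by rewrite /gst deriveB'; [rewrite !derive_stepd|exact: C1_stepd|exact: C1_stepd]. Qed.

Lemma gst_le sg d u : 0 < sg -> u <= sg -> sg <= d -> gst sg d u = 0.
Proof.
move=> s0 us sd; have d0 := lt_le_trans s0 sd.
rewrite /gst !step_le0 ?subrr// mulr_ge0_le0 ?invr_ge0 ?(ltW s0) ?(ltW d0)// subr_le0//.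
exact: le_trans sd.
Qed.

Lemma gst_ge sg d u : 0 < sg -> 2 * sg <= d -> 2 * d <= u -> gst sg d u = 0.
Proof.
move=> s0 sd du; have d0 : 0 < d by apply: lt_le_trans sd; rewrite mulr_gt0.
rewrite /gst !step_ge1 ?subrr// mulrC ler_pdivlMr// mul1r; lra.
Qed.

Lemma gst_le1 sg d u : `|gst sg d u| <= 1.
Proof.
have /andP[a0 a1] := step_ge0 (sg^-1 * (u - sg)); have /andP[b0 b1] := step_ge0 (d^-1 * (u - d)).
by rewrite /gst ler_norml; move: (step _) (step _) a0 a1 b0 b1 => a b *; apply/andP; split; lra.
Qed.

Section flux.
Variables (E : set V) (b : X -> R).
Hypotheses (bE : BVset E) (Cb : C1 b) (b1 : forall y, `|b y| <= 1) (cb : ccX b).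

Lemma cc_bkern d : 0 < d -> cc (fun p : V => b p.1 * kern d d p.2).
Proof.
move=> d0; have [K [cK K0]] := cb; split.
  move=> p; apply: cvgM.
    apply: (@continuous_comp _ _ _ (fst : V -> X) b); [exact: cvg_fst|exact: (C1_continuous Cb)].
  by apply: (@continuous_comp _ _ _ (fun p : V => p.2 : R) (kern d d)); [exact: continuous_snd1|exact: continuous_kern].
exists (K `*` (`[d, d + d]%classic : set mR)); split; first by apply: compact_setX => //; exact: segment_compact.
move=> p hp; have [Kp|Kp] := pselect (K p.1); last by rewrite K0// mul0r.
rewrite kern_out ?mulr0// => /andP[h1 h2]; apply: hp; split => //=.
by rewrite in_itv/= !ltW.
Qed.

(** The vertical field b(y) g(t), with g the profile [gst], fits under f, which vanishes up to the
    height 2 d, so the sum is admissible. Its divergence is the flux of b near the height sg minus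
    the flux near d. *)
Lemma flux_ineq f sg d : testf Om f -> 0 < sg -> 2 * sg <= d -> (forall p i, p.2 <= 2 * d -> f i p = 0) ->
  Int E (dive f) + Int E (fun p => b p.1 * kern sg sg p.2) - Int E (fun p => b p.1 * kern d d p.2) <= Per E.
Proof.
move=> tf s0 sd f0; have d0 : 0 < d by apply: lt_le_trans sd; rewrite mulr_gt0.
have mE := BVset_measurable bE.
have [Cf f1 [K [cK KO K0]]] := tf.
have [Kb [cKb Kb0]] := cb.
pose h (p : V) := b p.1 * gst sg d p.2.
have Ch : C1 h := C1_prodfun Cb (C1_gst sg d).
pose g i : V -> R := if i == None then (fun p => f i p + h p) else f i.
have sle : sg <= d by apply: le_trans sd; lra.
have tg : testf Om g.
  split.
  - by move=> i; rewrite /g; case: eqP => _; [apply: C1D; [exact: Cf|exact: Ch]|exact: Cf].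
  - move=> p; have [pd|pd] := leP p.2 (2 * d).
      rewrite (bigD1 None)//= big1 ?addr0; last first.
        by move=> i /negbTE ni; rewrite /g ni f0// expr0n.
      rewrite /g/= f0// add0r -real_normK ?num_real// expr_le1//.
      by rewrite /h normrM -[leRHS]mulr1 ler_pM// gst_le1.
    rewrite (eq_bigr (fun i => f i p ^+ 2)); first exact: f1.
    move=> i _; rewrite /g; case: eqP => // _.
    by rewrite /h (gst_ge s0 sd (ltW pd)) mulr0 addr0.
  - exists (K `|` Kb `*` (`[sg, 2 * d]%classic : set mR)); split.
    + by apply: compactU => //; apply: compact_setX => //; exact: segment_compact.
    + move=> p [/KO//|[_ /=]]; rewrite in_itv/= => /andP[+ _]; exact: lt_le_trans.
    + move=> p /not_orP[Kp hp] i; have h0 : h p = 0.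
        rewrite /h; have [Kbp|Kbp] := pselect (Kb p.1); last by rewrite Kb0// mul0r.
        have [ps|ps] := leP p.2 sg; first by rewrite gst_le// mulr0.
        have [pd|pd] := leP (2 * d) p.2; first by rewrite gst_ge// mulr0.
        by exfalso; apply: hp; split => //=; rewrite in_itv/= !ltW.
      by rewrite /g; case: eqP => _; rewrite ?h0 ?addr0 K0.
have := Per_lb bE tg.
have cs := cc_bkern s0; have cd := cc_bkern d0.
have -> : dive g = (fun p => dive f p + (b p.1 * kern sg sg p.2 - b p.1 * kern d d p.2)).
  apply/funext => p; rewrite /dive (bigD1 None)//= [in RHS](bigD1 None)//=.
  have a1 : \sum_(i | i != None) del i (g i) p = \sum_(i | i != None) del i (f i) p.
    by apply: eq_bigr => i /negbTE ni; rewrite /g ni.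
  have a2 : del None (g None) p = del None (f None) p + (b p.1 * kern sg sg p.2 - b p.1 * kern d d p.2).
    rewrite /g/= /del deriveD'; [|exact: Cf|exact: Ch]; congr (_ + _).
    have := @del_prodfun R n b (gst sg d) p Cb (C1_gst sg d); rewrite /del => ->.
    by rewrite derive_gst mulrBr.
  by rewrite a1 a2 addrAC.
rewrite (IntD mE (cc_dive tf) (ccB cs cd)) (IntB mE cs cd).
by move: (Int _ _) (Int _ _) (Int _ _) => a c e; lra.
Qed.

(** On almost every line E is full or null near the boundary, so the mass of the kernel in E is
    eventually 1 or 0, according to [near0]; the limit is then by domination. *)
Lemma kern_limit : (fun k => Int E (fun p => b p.1 * kern k.+1%:R^-1 k.+1%:R^-1 p.2)) @ \oo -->
  \int[leb]_(y in near0 E) b y.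
Proof.
have mE := BVset_measurable bE; have mn := measurable_near0 mE.
have i0 k : 0 < k.+1%:R^-1 :> R by rewrite invr_gt0.
have mb : measurable_fun setT b by apply: continuous_measurable_rV; exact: C1_continuous.
pose Fk k y := \int[lam]_(t in line E y) kern k.+1%:R^-1 k.+1%:R^-1 t.
have F01 k y : 0 <= Fk k y <= 1.
  have mL := measurable_line y mE; apply/andP; split.
    by apply: Rintegral_ge0 => t _; have /andP[] := kern_ge0 k.+1%:R^-1 t (i0 k).
  rewrite -(kern_total k.+1%:R^-1 (i0 k)) /Fk Rintegral_mkcond; apply: le_Rintegral => //.
  - by have := kern_integrable k.+1%:R^-1 (i0 k) mL; rewrite (integrable_mkcond _ mL) -restrict_EFin.
  - exact: kern_integrable.
  - move=> t _; rewrite patchE; case: ifP => // _; by have /andP[] := kern_ge0 k.+1%:R^-1 t (i0 k).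
have IE k : Int E (fun p => b p.1 * kern k.+1%:R^-1 k.+1%:R^-1 p.2) = \int[leb]_y (b y * Fk k y).
  by apply: Int_prod => //; [exact: cc_bkern|exact: kern_integrable].
have mF k : measurable_fun setT (Fk k).
  have -> : Fk k = fine \o (fun y => \int[lam]_t ((EFin \o (fun p : V => kern k.+1%:R^-1 k.+1%:R^-1 p.2)) \_ E) (y, t))%E.
    apply/funext => y.
    have e : (\int[lam]_(t in line E y) (kern k.+1%:R^-1 k.+1%:R^-1 t)%:E =
        \int[lam]_t ((EFin \o (fun p : V => kern k.+1%:R^-1 k.+1%:R^-1 p.2)) \_ E) (y, t))%E.
      rewrite integral_mkcond; apply: eq_integral => t _; rewrite /patch /=.
      by have -> : (t \in line E y) = ((y, t) \in E) by apply/idP/idP; rewrite !inE.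
    by rewrite /Fk /Rintegral e.
  apply: (measurableT_comp (@fine_measurable R setT measurableT)).
  apply: (@measurable_fun_fubini_tonelli_F _ _ _ _ _ lam).
    apply/(measurable_restrictT _ mE); apply/measurable_EFinP; apply: measurable_funTS.
    apply: continuous_measurable_Rn1 => p.
    by apply: (@continuous_comp _ _ _ (fun p : V => p.2 : R) (kern _ _)); [exact: continuous_snd1|exact: continuous_kern].
  by move=> p; rewrite patchE; case: ifP => // _; rewrite lee_fin; have /andP[] := kern_ge0 k.+1%:R^-1 p.2 (i0 k).
have ib : leb.-integrable setT (EFin \o (fun y => `|b y|)).
  have [K [cK K0]] := cb.
  have [m Km] : exists m : nat, K `<=` kub 0 m%:R.
    have /compact_bounded[M [Mr hM]] := cK.
    have tk : \forall k \near \oo, `|M| + 1 < (k%:R : R) by exact: nbhs_infty_gtr.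
    case: tk => m _ /(_ m (leqnn m)) hm; exists m => y Ky; apply/kubP => i; rewrite mxE subr0.
    apply: le_lt_trans hm; apply: (le_trans _ (hM (`|M| + 1) _ y Ky)).
      by rewrite [leRHS]/Num.norm/= mx_normrE (bigD1 (ord0, i))//= le_max lexx.
    by rewrite (le_lt_trans (ler_norm M))// ltrDl.
  have mk := measurable_kub (0 : X) m%:R.
  have -> : EFin \o (fun y => `|b y|) = (EFin \o (fun y => `|b y|)) \_ (kub 0 m%:R).
    apply/funext => y; rewrite patchE; case: ifPn => // /negP hy /=; rewrite K0 ?normr0// => Ky.
    by apply: hy; rewrite inE; exact: Km.
  apply/(integrable_mkcond _ mk); apply: (@integrable_bounded R n _ mk _ _ 1).
  - by rewrite leb_kub// ltry.
  - by apply: measurableT_comp => //; exact: measurable_funTS.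
  - by move=> y; rewrite normr_id.
have m1 k : measurable_fun setT (fun y => (b y * Fk k y)%:E) by apply/measurable_EFinP; exact: measurable_funM.
have m2 : measurable_fun setT (fun y => (b y * \1_(near0 E) y)%:E).
  by apply/measurable_EFinP; apply: measurable_funM => //; exact: measurable_indic.
have cv := @dominated_convergence _ _ _ leb setT measurableT
  (fun k y => (b y * Fk k y)%:E) (fun y => (b y * \1_(near0 E) y)%:E) (EFin \o (fun y => `|b y|))
  m1 m2 _ ib _.
have lim : (\int[leb]_y (b y * Fk k y)%:E)%E @[k --> \oo] --> (\int[leb]_y (b y * \1_(near0 E) y)%:E)%E.
  have [] // := cv.
    pose B := \bigcap_k (NC E 0 k.+1%:R^-1 : set X).
    have mB : measurable B by apply: bigcapT_measurable => k; exact: measurable_NC.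
    exists B; split => //; first exact: NC0_null.
    move=> y; apply: contra_notP => yB _; apply/fine_cvgP; split; first by apply: nearW.
    rewrite /=; apply: cvgMl_tmp.
    have mL := measurable_line y mE; have mC := measurableC mL.
    have small (S : set mR) (k0 : nat) : measurable S -> lam (`]0%R, k0.+1%:R^-1%R[ `&` S) = 0%E ->
        (* The kernel is carried by heights between 1 / (k+1) and 2 / (k+1), which are below 1 /
           (k0+1) from the index 2 (k0+1) on. *)
        \forall k \near \oo, \int[lam]_(t in S) kern k.+1%:R^-1 k.+1%:R^-1 t = 0.
      move=> mS S0; exists (2 * k0.+1)%N => // k /= kk.
      have sub : `]k.+1%:R^-1, (k.+1%:R^-1 + k.+1%:R^-1)%R[%classic `<=` (`]0, k0.+1%:R^-1[%classic : set R).
        apply: subset_itv; rewrite bnd_simp ?(ltW (i0 k))//.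
        have h : k.+1%:R^-1 <= (2 * k0.+1%:R)^-1 :> R.
          by rewrite lef_pV2 ?posrE ?mulr_gt0// -natrM ler_nat; lia.
        by rewrite invfM in h; move: h; move: (k.+1%:R^-1) (k0.+1%:R^-1) => a c; lra.
      have h0 : lam (S `&` `]k.+1%:R^-1%R, (k.+1%:R^-1 + k.+1%:R^-1)%R[) = 0%E.
        apply/eqP; rewrite eq_le measure_ge0 andbT -S0; apply: le_meas; [by mset|by mset|].
        by move=> t [St /sub].
      have := @kern_small R k.+1%:R^-1 k.+1%:R^-1 S 0 (i0 k) mS (lexx 0).
      by rewrite h0 mul0r mulr0 => /(_ (lexx _)) h; apply: le_anti; rewrite andbC.
    have [yn|yn] := pselect (near0 E y).
      rewrite indicE mem_set//; apply: cvg_near_cst; have [k0 _ hk0] := yn.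
      have := small (~` line E y) k0 mC hk0; apply: filterS => k hk.
      have := kern_total k.+1%:R^-1 (i0 k); rewrite -(setUv (line E y)) Rintegral_setU//.
      - by rewrite hk addr0 => e; rewrite /Fk e.
      - by rewrite setUv; exact: kern_integrable.
      - by rewrite disj_set2E; apply/eqP; exact: setICr.
    rewrite indicE memNset//; apply: cvg_near_cst.
    have /existsNP[k0 /not_implyP[_ hk]] := yB.
    have z : lam (`]0%R, k0.+1%:R^-1%R[ `&` line E y) = 0%E.
      apply/eqP; rewrite eq_le measure_ge0 andbT leNgt; apply/negP => h1.
      apply: hk; split; first by rewrite setIC.
      by rewrite lt_neqAle measure_ge0 andbT; apply/negP => /eqP h2; apply: yn; exists k0.
    exact: small mL z.
  apply: aeW => y k _; rewrite /= lee_fin normrM -[leRHS]mulr1 ler_pM//.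
  by have /andP[a c] := F01 k y; rewrite ger0_norm.
have fin : (\int[leb]_y (b y * \1_(near0 E) y)%:E)%E \is a fin_num.
  apply: integrable_fin_num => //.
  apply: (le_integrable measurableT _ _ ib); first by apply/measurable_EFinP; apply: measurable_funM => //; exact: measurable_indic.
  move=> y _ /=; rewrite lee_fin normrM normr_id -[leRHS]mulr1 ler_pM// indicE.
  by case: (_ \in _); rewrite ?normr1 ?normr0.
have -> : \int[leb]_(y in near0 E) b y = fine (\int[leb]_y (b y * \1_(near0 E) y)%:E)%E.
  rewrite /Rintegral integral_mkcond; congr fine; apply: eq_integral => y _.
  by rewrite patchE indicE; case: ifP; rewrite ?mulr1 ?mulr0.
under eq_fun do rewrite IE /Rintegral.
by apply: fine_cvg; rewrite fineK//; exact: lim.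
Qed.

Lemma flux_trace f d : testf Om f -> 0 < d -> (forall p i, p.2 <= 2 * d -> f i p = 0) ->
  Int E (dive f) + \int[leb]_(y in near0 E) b y - Int E (fun p => b p.1 * kern d d p.2) <= Per E.
Proof.
move=> tf d0 f0.
have tk : \forall k \near \oo, 2 / d < (k%:R : R) by exact: nbhs_infty_gtr.
case: tk => k0 _ hk0.
have c1 : (fun k => Int E (fun p => b p.1 * kern (k + k0).+1%:R^-1 (k + k0).+1%:R^-1 p.2)) @ \oo --> \int[leb]_(y in near0 E) b y.
  by rewrite (cvg_shiftn k0 (fun k => Int E (fun p => b p.1 * kern k.+1%:R^-1 k.+1%:R^-1 p.2))); exact: kern_limit.
have := le_limD c1 (cvg_cst (Int E (dive f) - Int E (fun p => b p.1 * kern d d p.2))) (c := Per E).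
have -> : \int[leb]_(y in near0 E) b y + (Int E (dive f) - Int E (fun p => b p.1 * kern d d p.2)) =
  Int E (dive f) + \int[leb]_(y in near0 E) b y - Int E (fun p => b p.1 * kern d d p.2) by ring.
apply => k.
have h := @flux_ineq f (k + k0).+1%:R^-1 d tf _ _ f0.
rewrite addrA [X in X - _]addrC; apply: h; first by rewrite invr_gt0.
rewrite ler_pdivrMr// mulrC -ler_pdivrMr//; apply: (le_trans (ltW (hk0 (k + k0)%N (leq_addl _ _)))).
by rewrite ler_nat.
Qed.

End flux.

(** A discrete layer-cake formula: for u in [0, 1] the number of the m levels reached, divided by m,
    is u up to 1 / m. *)
Definition level (m : nat) (u : R) (j : nat) : bool := j.+1%:R / m%:R <= u.

Lemma sum_levels (m : nat) (u : R) : 0 <= u <= 1 -> (0 < m)%N ->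
  `|m%:R^-1 * \sum_(j < m) (level m u j)%:R - u| <= m%:R^-1.
Proof.
move=> /andP[u0 u1] m0; have mR0 : 0 < m%:R :> R by rewrite ltr0n.
have mu0 : 0 <= m%:R * u by rewrite mulr_ge0.
pose k := Num.truncn (m%:R * u).
have /andP[h1 h2] : k%:R <= m%:R * u < k.+1%:R by exact: truncn_itv.
have km : (k <= m)%N by rewrite -(ler_nat R) (le_trans h1)// ler_piMr// ltW.
have lev j : level m u j = (j < k)%N.
  by rewrite /level ler_pdivrMr// (mulrC u) /k truncn_ge_nat.
have cnt M : (\sum_(j < M) (j < k)%N)%N = minn M k.
  elim: M => [|M IH]; first by rewrite big_ord0 min0n.
  by rewrite big_ord_recr/= IH; case: (ltnP M k) => h /=; lia.
have -> : \sum_(j < m) (level m u j)%:R = k%:R :> R.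
  rewrite (eq_bigr (fun j : 'I_m => ((j < k)%N : nat)%:R)); last by move=> j _; rewrite lev.
  by rewrite -natr_sum cnt; congr (_%:R); lia.
have -> : m%:R^-1 * k%:R - u = - (m%:R^-1 * (m%:R * u - k%:R)) by rewrite mulrBr mulKf ?gt_eqF//; ring.
rewrite normrN ger0_norm; last by rewrite mulr_ge0 ?invr_ge0 ?subr_ge0// ltW.
rewrite -[leRHS]mulr1 ler_wpM2l// ?invr_ge0 ?(ltW mR0)//.
by move: h2; rewrite -natr1; move: (_ * u) => w; lra.
Qed.

(** beta, mapped affinely to [0, 1], is written by its superlevel sets, each of which is
    approximated with values in [0, 1]; this keeps |b| <= 1, as needed for b to be a component of an
    admissible field. *)
Lemma approx_beta (beta : X -> R) (D : set X) (e : R) : measurable_fun setT beta -> measurable D -> (leb D < +oo)%E ->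
  (forall y, -1 <= beta y <= 1) -> 0 < e ->
  exists b : X -> R, [/\ C1 b, forall y, `|b y| <= 1 & (\int[leb]_(y in D) `|b y - beta y|%:E <= e%:E)%E].
Proof.
move=> mbeta mD Doo b1 e0.
have fD : leb D \is a fin_num by rewrite ge0_fin_numE.
pose d := fine (leb D); have d0 : 0 <= d by exact: fine_ge0.
pose u y := (beta y + 1) / 2.
have u01 y : 0 <= u y <= 1 by rewrite /u; have /andP[h1 h2] := b1 y; apply/andP; split; lra.
(* Half of e pays for the discretization, (2 / m) d, and half for the smoothing of the m levels,
   each within e / 4. *)
have tk : \forall k \near \oo, 4 * d / e < (k%:R : R) by exact: nbhs_infty_gtr.
case: tk => m0 _ /(_ m0.+1 (leqnSn _)) hm; set m := m0.+1 in hm.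
have mR0 : 0 < m%:R :> R by rewrite ltr0n.
pose P j := [set y | j.+1%:R / m%:R <= u y].
have mu : measurable_fun setT u by apply: measurable_funM => //; exact: measurable_funD.
have mP j : measurable (P j).
  have := mu measurableT _ (measurable_itv `[j.+1%:R / m%:R, +oo[); rewrite setTI.
  by congr measurable; apply/seteqP; split => y; rewrite /P /= in_itv/= andbT.
have e4 : 0 < e / 4 by rewrite divr_gt0.
have /choice[f hf] : forall j, exists f : X -> R, [/\ C1 f, forall x, 0 <= f x <= 1 & (L1d D f (P j) <= (e / 4)%:E)%E].
  by move=> j; have [_ /(_ _ e4)] := approximable_measurable mD Doo (mP j).
have Cf j : C1 (f j) by case: (hf j).
have f01 j y : 0 <= f j y <= 1 by case: (hf j).
pose s y := \sum_(j < m) f j y.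
pose b y := 2 / m%:R * s y - 1.
exists b; split.
- by apply: C1B; [apply: C1M; [exact: C1_cst|apply: C1_sum => j _; exact: Cf]|exact: C1_cst].
- move=> y; rewrite /b; have s0 : 0 <= s y by apply: sumr_ge0 => j _; case/andP: (f01 j y).
  have s1 : s y <= m%:R.
    rewrite -[leRHS]mulr1 mulr_natl -[X in _ *+ X](card_ord m) -sumr_const; apply: ler_sum => j _.
    by case/andP: (f01 j y).
  have q0 : 0 <= s y / m%:R by rewrite divr_ge0// ltW.
  have q1 : s y / m%:R <= 1 by rewrite ler_pdivrMr// mul1r.
  rewrite ler_norml (_ : 2 / m%:R * s y = 2 * (s y / m%:R)); last by ring.
  by move: (s y / _) q0 q1 => q *; apply/andP; split; lra.
have pt y : `|b y - beta y| <= 2 / m%:R * (\sum_(j < m) `|f j y - \1_(P j) y|) + 2 / m%:R.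
  have -> : b y - beta y = 2 / m%:R * (\sum_(j < m) (f j y - \1_(P j) y)) +
      2 * (m%:R^-1 * \sum_(j < m) (level m (u y) j)%:R - u y).
    have -> : \sum_(j < m) (level m (u y) j)%:R = \sum_(j < m) \1_(P j) y :> R.
      by apply: eq_bigr => j _; rewrite indicE; congr ((nat_of_bool _)%:R); apply/idP/idP; rewrite inE.
    by rewrite /b /s /u sumrB; move: (\sum_(j < m) _) (\sum_(j < m) _) => A B'; field; rewrite gt_eqF.
  apply: (le_trans (ler_normD _ _)); apply: lerD; rewrite normrM ger0_norm ?divr_ge0 ?(ltW mR0)//.
    by apply: ler_wpM2l; rewrite ?divr_ge0 ?(ltW mR0)//; exact: ler_norm_sum.
  by apply: ler_wpM2l => //; exact: sum_levels.
have mLd j : measurable_fun D (fun y => `|f j y - \1_(P j) y|%:E) by exact: measurable_L1d.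
have m2 : 0 <= 2 / m%:R :> R by rewrite divr_ge0// ltW.
have mb : measurable_fun D (fun y => `|b y - beta y|%:E).
  apply/measurable_EFinP; apply: measurableT_comp => //; apply: measurable_funB; last exact: measurable_funTS.
  apply: measurable_funTS; apply: continuous_measurable_rV; apply: (@C1_continuous R X R).
  by apply: C1B; [apply: C1M; [exact: C1_cst|apply: C1_sum => j _; exact: Cf]|exact: C1_cst].
apply: (@le_trans _ _ (\int[leb]_(y in D) ((2 / m%:R)%:E * (\sum_(j < m) `|f j y - \1_(P j) y|%:E) + (2 / m%:R)%:E))%E).
  apply: ge0_le_integral => //.
  - apply: emeasurable_funD => //; apply: emeasurable_funM => //; exact: emeasurable_sum.
  by move=> y _; rewrite sumEFin -EFinM -EFinD lee_fin; exact: pt.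
rewrite ge0_integralD//; first last.
- by apply: emeasurable_funM => //; exact: emeasurable_sum.
- by move=> y _; apply: mule_ge0; [rewrite lee_fin|apply: sume_ge0 => j _; rewrite lee_fin].
rewrite ge0_integralZl//; first last.
- by move=> y _; apply: sume_ge0 => j _; rewrite lee_fin.
- exact: emeasurable_sum.
rewrite ge0_integral_sum//.
rewrite integral_cst// -(fineK fD) -EFinM.
apply: (@le_trans _ _ ((2 / m%:R)%:E * (\sum_(j < m) (e / 4)%:E) + (2 / m%:R * d)%:E)%E).
  apply: leeD => //; apply: lee_pmul => //.
    by apply: sume_ge0 => j _; apply: integral_ge0 => y _; rewrite lee_fin.
  by apply: lee_sum => j _; case: (hf j).
rewrite sumEFin -EFinM -EFinD lee_fin sumr_const card_ord -(mulr_natl (e / 4)).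
have -> : 2 / m%:R * (m%:R * (e / 4)) = e / 2 by field; rewrite gt_eqF.
have : 2 / m%:R * d <= e / 2.
  rewrite mulrAC ler_pdivrMr//; move: hm; rewrite ltr_pdivrMr// => hm.
  by rewrite mulrAC ler_pdivlMr// mulrC; move: (d) (m%:R) hm => ? ?; lra.
by move: (_ * d) => x; lra.
Qed.

End traceflux.

(** * Coercivity and lower semicontinuity *)

Section wetting.
Variables (R : realType) (n : nat).
Local Notation mR := (measurableTypeR R).
Local Notation lam := (@lebesgue_measure R).
Local Notation X := 'rV[R]_n.
Local Notation V := (Rn1 R n).
Local Notation leb := (leb R n).
Local Notation vol := (vol R n).
Local Notation Om := (@Omega R n).

Definition over (Q : set X) : set V := [set p | Q p.1].

Lemma measurable_over Q : measurable Q -> measurable (over Q).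
Proof.
move=> mQ; rewrite (_ : over Q = Q `*` setT); first exact: measurableX.
by apply/seteqP; split => p //= [].
Qed.

Lemma near0_sub (E : set V) y : measurable E -> near0 E y -> exists t, E (y, t).
Proof.
move=> mE [k _ /= hk]; apply: contrapT => /forallNP h.
move: hk; rewrite (_ : line E y = set0); last by rewrite -subset0 => t; exact: h.
rewrite setD0 lebesgue_measure_itv/= lte_fin invr_gt0 ltr0n/= sube0 => -[/eqP].
by rewrite invr_eq0 pnatr_eq0.
Qed.

Lemma near0_over (E : set V) (Q : set X) : measurable E -> near0 (E `&` over Q) = near0 E `&` Q.
Proof.
move=> mE; apply/seteqP; split => y.
  move=> h; have [k _ hk] := h.
  have Qy : Q y.
    apply: contrapT => nQ; move: hk; rewrite /= (_ : line (E `&` over Q) y = set0); last first.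
      by rewrite -subset0 => t [_ /nQ].
    rewrite setD0 lebesgue_measure_itv/= lte_fin invr_gt0 ltr0n/= sube0 => -[/eqP].
    by rewrite invr_eq0 pnatr_eq0.
  split => //; exists k => //; move: hk; rewrite /= (_ : line (E `&` over Q) y = line E y)//.
  by apply/seteqP; split => t => [[]|Et]//; split.
move=> [[k _ hk] Qy]; exists k => //=; rewrite (_ : line (E `&` over Q) y = line E y)//.
by apply/seteqP; split => t => [[]|Et]//; split.
Qed.

Section weight.
Variables (beta : X -> R) (kappa : R).
Hypothesis mbeta : measurable_fun setT beta.
Hypothesis kp : 0 < kappa <= 2^-1.
Hypothesis hb : forall y, -1 <= beta y <= 1 - 2 * kappa.

Definition cap (E : set V) : R := Per E - Tr beta E.

Lemma beta1 y : `|beta y| <= 1.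
Proof. by have /andP[h1 h2] := hb y; have /andP[k0 k1] := kp; rewrite ler_norml h1/=; lra. Qed.

Lemma near0_fin (E : set V) : BVset E -> (leb (near0 E) < +oo)%E.
Proof. by move=> bE; apply: le_lt_trans (near0_le bE) _; rewrite ltry. Qed.

Lemma integrable_beta (A : set X) : measurable A -> (leb A < +oo)%E -> leb.-integrable A (EFin \o beta).
Proof.
move=> mA Aoo; apply: (@integrable_bounded R n _ mA Aoo _ 1); first exact: measurable_funTS.
exact: beta1.
Qed.

Lemma Tr_le E : BVset E -> Tr beta E <= (1 - 2 * kappa) * Per E.
Proof.
move=> bE; have mE := BVset_measurable bE; have mA := measurable_near0 mE; have Aoo := near0_fin bE.
have /andP[k0 k1] := kp.
apply: (@le_trans _ _ (\int[leb]_(y in near0 E) (1 - 2 * kappa))).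
  rewrite /Tr; apply: le_Rintegral => //; [exact: integrable_beta|exact: integrable_cst_fin|].
  by move=> y _; have /andP[] := hb y.
rewrite Rintegral_cst//; apply: ler_wpM2l; first lra.
rewrite -lee_fin fineK; [exact: near0_le|by rewrite ge0_fin_numE].
Qed.

Lemma cap_ge E : BVset E -> 2 * kappa * Per E <= cap E.
Proof. by move=> bE; have := Tr_le bE; rewrite /cap; move: (Per E) (Tr _ _) => P T; lra. Qed.

Lemma Tr_split E (Q : set X) : BVset E -> measurable Q ->
  Tr beta E = Tr beta (E `&` over Q) + Tr beta (E `\` over Q).
Proof.
move=> bE mQ; have mE := BVset_measurable bE; have mA := measurable_near0 mE; have Aoo := near0_fin bE.
have e : E `\` over Q = E `&` over (~` Q) by [].
rewrite /Tr e !near0_over// -{1}(setUIDK (near0 E) Q) setDE Rintegral_setU//.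
- by mset.
- by apply: measurableI => //; exact: measurableC.
- by rewrite -setDE setUIDK; exact: integrable_beta.
- by rewrite disj_set2E; apply/eqP; rewrite -subset0 => p [[_ ?] []].
Qed.

(* The trace term is not continuous in L^1: it is first replaced by the flux of a vertical field
   across a thin layer, at the expense of the perimeter in that layer. *)
Lemma lsc (F : nat -> set V) (E : set V) (M : nat) (P c : R) :
  (forall k, BVset (F k)) -> (forall k, F k `<=` over (kub 0 M%:R)) -> E `<=` over (kub 0 M%:R) ->
  measurable E -> E `<=` Om -> (vol E < +oo)%E ->
  (fun k => symd (F k) E) @ \oo --> (0 : R) -> (forall k, Per (F k) <= P) -> (forall k, cap (F k) <= c) ->
  BVset E /\ cap E <= c.
Proof.
move=> bF FM EM mE EO Eoo FE FP Fc.
have mF k := BVset_measurable (bF k); have Foo k := BVset_vol (bF k).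
have lim g : cc g -> (fun k => Int (F k) g) @ \oo --> Int E g by move=> cg; exact: Int_symd_cvg.
have [bE _] : BVset E /\ Per E <= P.
  apply: BVset_intro => // f tf; apply: (cvgr_to_le (lim _ (cc_dive tf))).
  by apply: nearW => k; apply: le_trans (FP k); exact: Per_lb.
split => //; pose D := kub (0 : X) M%:R.
have mD : measurable D := measurable_kub 0 M%:R.
have Doo : (leb D < +oo)%E by rewrite leb_kub// ltry.
have nD (A : set V) : measurable A -> A `<=` over D -> near0 A `<=` D.
  by move=> mA AD y /(near0_sub mA)[t /AD].
apply/ler_addgt0Pr => e0 e0pos; pose e := e0 / 4.
(* Four errors: the test field for Per E, the replacement of beta by b in the trace of F k and in
   that of E, and the flux in the layer against the trace of E. *)
have epos : 0 < e by rewrite divr_gt0.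
have [f tf fE] := Per_approx bE epos.
have [Cf f1 [K [cK KO K0]]] := tf.
have [d0 d00 hd0] := compact_lower cK KO.
have b1' y : -1 <= beta y <= 1.
  by have := beta1 y; rewrite ler_norml.
have [b0 [Cb0 b01 hb0]] := approx_beta mbeta mD Doo b1' epos.
(* A cut-off that gives b compact support; it is 1 on the cube D, where |y|^2 <= n M^2. *)
pose chi (y : X) := step (n%:R * M%:R ^+ 2 + 1 - sqn y).
have Cchi : C1 chi.
  apply: (@C1_comp1 R X (fun y => n%:R * M%:R ^+ 2 + 1 - sqn y) (@step R)); first exact: C1_step.
  by apply: C1B; [exact: C1_cst|exact: C1_sqn].
have chi1 y : D y -> chi y = 1.
  move=> /kubP Dy; rewrite /chi step_ge1//.
  suff : sqn y <= n%:R * M%:R ^+ 2 by move: (sqn y) (_ * _) => u v; lra.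
  apply: (@le_trans _ _ (\sum_(i < n) M%:R ^+ 2)); last by rewrite sumr_const card_ord mulr_natl.
  apply: ler_sum => i _; have := Dy i; rewrite mxE subr0 => h.
  by rewrite -real_normK ?num_real// ler_pXn2r ?nnegrE// ltW.
pose b y := b0 y * chi y.
have Cb : C1 b := C1M Cb0 Cchi.
have b1 y : `|b y| <= 1.
  have /andP[c0 c1] := step_ge0 (n%:R * M%:R ^+ 2 + 1 - sqn y).
  by rewrite /b normrM -[leRHS]mulr1 ler_pM// ger0_norm.
have cb : ccX b.
  pose m := (n * M ^ 2).+1.
  exists (cbox (fun _ : 'I_n => - m%:R : R) (fun=> m%:R)); split.
    by apply: compact_cbox.
  move=> y /existsNP[i]; rewrite /= in_itv/= => /negP hy.
  rewrite /b /chi [X in _ * X]step_le0 ?mulr0// subr_le0; apply: le_trans (sqn_ge y i).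
  have hm : m%:R < `|y ord0 i|.
    by rewrite ltNge; apply/negP => h; move/negP: hy; apply; rewrite -ler_norml.
  have -> : n%:R * M%:R ^+ 2 + 1 = m%:R :> R by rewrite /m -natr1 natrM natrX.
  rewrite -[leRHS]real_normK ?num_real//; apply: (@le_trans _ _ (m%:R ^+ 2)); first by rewrite expr2 ler_peMr// ler1n.
  by rewrite ler_pXn2r ?nnegrE// ltW.
have close (A : set V) : BVset A -> A `<=` over D -> `|\int[leb]_(y in near0 A) b y - Tr beta A| <= e.
  move=> bA AD; have mA := BVset_measurable bA; have mN := measurable_near0 mA; have Noo := near0_fin bA.
  have mb : measurable_fun setT b by apply: continuous_measurable_rV; exact: C1_continuous.
  have ib : leb.-integrable (near0 A) (EFin \o b).
    by apply: (@integrable_bounded R n _ mN Noo _ 1) => //; exact: measurable_funTS.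
  have ibeta := integrable_beta mN Noo.
  rewrite /Tr -RintegralB//.
  have i2 : leb.-integrable (near0 A) (EFin \o (fun y => b y - beta y)).
    apply: (@integrable_bounded R n _ mN Noo _ 2); first by apply: measurable_funB; exact: measurable_funTS.
    by move=> y; apply: (le_trans (ler_normB _ _)); have := lerD (b1 y) (beta1 y); rewrite -mulr2n.
  apply: (le_trans (le_normr_Rintegral mN i2)).
  rewrite -lee_fin /Rintegral fineK; last by apply: integrable_fin_num => //; exact: (integrable_norm i2).
  apply: le_trans hb0.
  rewrite (eq_integral (fun y => `|b0 y - beta y|%:E)); last first.
    by move=> y; rewrite inE => /(nD _ mA AD) Dy; rewrite /b chi1 ?mulr1.
  apply: ge0_subset_integral => //; last exact: nD.
  apply/measurable_EFinP; apply: measurableT_comp => //; apply: measurable_funB; apply: measurable_funTS => //.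
  by apply: continuous_measurable_rV; exact: C1_continuous.
have kl := kern_limit bE Cb b1 cb.
(* The layer is chosen for the limit set E only; for the sets F k the inequality [flux_trace] holds
   at any height d under the support of f. *)
have [d [dpos dd0 hd]] : exists d, [/\ 0 < d, 2 * d < d0 & Int E (fun p => b p.1 * kern d d p.2) - \int[leb]_(y in near0 E) b y <= e].
  have /cvgrPdist_le/(_ e epos) n1 := kl.
  have tk : \forall k \near \oo, 2 / d0 < (k%:R : R) by exact: nbhs_infty_gtr.
  have [k [hk1 hk2]] := filter_ex (filterI n1 tk).
  exists k.+1%:R^-1; split => //.
    rewrite ltr_pdivrMr// mulrC -ltr_pdivrMr//; apply: lt_le_trans hk2 _; by rewrite ler_nat.
  by move: hk1; rewrite distrC => /(le_trans (ler_norm _)).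
have f0 p i : p.2 <= 2 * d -> f i p = 0.
  by move=> pd; apply: K0 => Kp; have := hd0 p Kp; rewrite leNgt (le_lt_trans pd dd0).
have cd := cc_bkern Cb cb dpos.
(* The left side no longer contains a trace: it is an integral of continuous functions with compact
   support, hence continuous in L^1. *)
have Fk k : Int (F k) (dive f) - Int (F k) (fun p => b p.1 * kern d d p.2) <= c + e.
  have h1 := flux_trace (bF k) Cb b1 cb tf dpos f0.
  have h2 := close (F k) (bF k) (FM k).
  have h3 := Fc k; rewrite /cap in h3.
  move: h1 h2 h3; rewrite ler_norml => h1 /andP[h2 _] h3.
  by move: (Int _ _) (Int _ _) (\int[_]_(_ in _) _) (Per _) (Tr _ _) h1 h2 h3 => x1 x2 x3 x4 x5; lra.
have lE : Int E (dive f) - Int E (fun p => b p.1 * kern d d p.2) <= c + e.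
  by apply: (cvgr_to_le (cvgB (lim _ (cc_dive tf)) (lim _ cd))); exact: nearW.
have hE := close E bE EM.
move: fE hd lE hE; rewrite /cap ler_norml => h1 h2 h3 /andP[h4 h5].
have -> : e0 = 4 * e by rewrite /e; field.
by move: (Int _ _) (Int _ _) (\int[_]_(_ in _) _) (Per _) (Tr _ _) h1 h2 h3 h4 h5 => x1 x2 x3 x4 x5; lra.
Qed.

End weight.
End wetting.

(** * Cylinders and radial cuts *)

Section radial.
Variables (R : realType) (n : nat).
Local Notation mR := (measurableTypeR R).
Local Notation lam := (@lebesgue_measure R).
Local Notation X := 'rV[R]_n.
Local Notation V := (Rn1 R n).
Local Notation leb := (leb R n).
Local Notation vol := (vol R n).
Local Notation Om := (@Omega R n).

(** The integral is the difference of the values of f at the two ends, whichever of them belong to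
    L. *)
Lemma Rintegral_interval (f : R -> R) (L : set mR) (k : R) : C1 f -> (forall t, `|f t| <= 1) ->
  is_interval L -> (forall t, L t -> `|t| <= k) -> \int[lam]_(t in L) 'D_1 f t <= 2.
Proof.
move=> Cf f1 iL Lk.
have hl : has_lbound L by exists (- k) => t /Lk; rewrite ler_norml => /andP[].
have hu : has_ubound L by exists k => t /Lk; rewrite ler_norml => /andP[].
have [b1 [b2 Le]] : exists b1 b2, L = [set` Interval (BSide b1 (inf L)) (BSide b2 (sup L))].
  move/is_intervalP : (iL) => e; exists `[< L (inf L) >], (~~ `[< L (sup L) >]).
  by rewrite {1}e /Rhull (asboolT hl) (asboolT hu).
move: (inf L) (sup L) Le => a c Le.
have cD : continuous ('D_1 f) by case: Cf => _; exact.
have mf : measurable_fun setT ('D_1 f : mR -> R) by exact: continuous_measurable_fun.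
have [ac|ca] := ltP a c; last first.
  have L0 : lam L = 0%E.
    have sub : L `<=` [set a].
      move=> t; rewrite Le {Le}; case: b1; case: b2; rewrite /= in_itv/= => /andP[h1 h2].
      - by move: (le_lt_trans h1 h2); rewrite ltNge ca.
      - by apply: le_anti; rewrite h1 (le_trans h2 ca).
      - by move: (lt_trans h1 h2); rewrite ltNge ca.
      - by move: (lt_le_trans h1 h2); rewrite ltNge ca.
    apply/eqP; rewrite eq_le measure_ge0 andbT -(@lebesgue_measure_set1 R a); apply: le_meas => //.
    by rewrite Le; exact: measurable_itv.
  rewrite /Rintegral null_set_integral//; first by rewrite Le; exact: measurable_itv.
  by apply/measurable_EFinP; exact: measurable_funTS.
have -> : \int[lam]_(t in L) 'D_1 f t = f c - f a.
  transitivity (\int[lam]_(t in `[a, c]) 'D_1 f t).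
    have ii (u v : bool) : lam.-integrable [set` Interval (BSide u a) (BSide v c)] (EFin \o 'D_1 f).
      have i0 : lam.-integrable `[a, c] (EFin \o 'D_1 f).
        by apply: continuous_compact_integrable; [exact: segment_compact|exact: continuous_subspaceT].
      apply: integrableS i0 => //.
      by apply: subset_itv; [case: u|case: v]; rewrite bnd_simp.
    rewrite Le; case: b1 {Le}; case: b2.
    - by rewrite Rintegral_itv_bndo_bndc.
    - by [].
    - by rewrite Rintegral_itv_bndo_bndc// Rintegral_itv_obnd_cbnd.
    - by rewrite Rintegral_itv_obnd_cbnd.
  rewrite /Rintegral (@continuous_FTC2 _ _ f)//.
  - by apply: continuous_subspaceT.
  - split.
    + by move=> u _; exact: C1_derivable.
    + by apply: cvg_at_right_filter; exact: (C1_continuous Cf).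
    + by apply: cvg_at_left_filter; exact: (C1_continuous Cf).
  - by move=> u _; rewrite derive1E.
have := f1 c; have := f1 a; rewrite !ler_norml => /andP[h1 h2] /andP[h3 h4].
by move: (f a) (f c) h1 h2 h3 h4 => u v; lra.
Qed.

Lemma is_derive_line (xi : V -> R) (y : X) (t : R) : C1 xi ->
  is_derive t 1 (fun t => xi (y, t)) (del None xi (y, t)).
Proof.
move=> Cxi; have D := @C1_derivable R _ _ xi (y, t) (dirv R None) Cxi.
have e : (fun h : R => h^-1 *: (((fun t => xi (y, t)) \o shift t) (h *: 1) - xi (y, t))) =
         (fun h : R => h^-1 *: ((xi \o shift (y, t)) (h *: dirv R (None : option 'I_n)) - xi (y, t))).
  apply/funext => h; congr (_ *: (xi _ - _)); rewrite /= /shift/=.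
  have -> : h *: (0, 1) + (y, t) = (h *: 0 + y, h *: 1 + t) :> V by [].
  by rewrite scaler0 add0r.
by apply: DeriveDef; rewrite /derivable /derive /del e.
Qed.

Lemma continuous_pairr (y : X) : continuous (fun t : R => (y, t) : V).
Proof. by move=> t; apply: (@cvg_pair _ _ _ (nbhs t) (nbhs y) (nbhs t)); [exact: cvg_cst|exact: cvg_id]. Qed.

Lemma C1_line (xi : V -> R) (y : X) : C1 xi -> C1 (fun t : R => xi (y, t)).
Proof.
move=> Cxi; apply: (@C1_from_derive _ _ (fun t => del None xi (y, t))).
  by move=> t; exact: is_derive_line.
move=> t; apply: (@continuous_comp _ _ _ (fun t : R => (y, t) : V) (del None xi)); last by case: Cxi => _; exact.
exact: continuous_pairr.
Qed.

Lemma Int_lines (E : set V) (g : V -> R) : measurable E -> cc g ->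
  Int E g = \int[leb]_y \int[lam]_(t in line E y) g (y, t) /\
  leb.-integrable setT (EFin \o (fun y => \int[lam]_(t in line E y) g (y, t))).
Proof.
move=> mE cg.
pose F (p : V) := ((EFin \o g) \_ E) p.
have iF : (vol.-integrable setT F) by apply/(integrable_mkcond _ mE); exact: cc_integrable.
have e y : fubini_F lam F y = (\int[lam]_(t in line E y) g (y, t))%:E.
  rewrite /fubini_F /Rintegral fineK.
    rewrite [RHS]integral_mkcond; apply: eq_integral => t _; rewrite /F !patchE.
    by have -> : (t \in line E y) = ((y, t) \in E) by apply/idP/idP; rewrite !inE.
  apply: integrable_fin_num; first exact: measurable_line.
  have [M M0 hM] := cc_bounded cg.
  have [k hk] : exists k, forall p, g p != 0 -> @vcube R n k p.
    have [K [cK K0]] := cg.2; have [k Kk] := compact_vcube cK; exists k => p gp.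
    by apply: Kk; apply: contrapT => /K0/eqP; apply/negP.
  have mI : measurable (`]- k%:R, k%:R[%classic : set mR) := measurable_itv _.
  have Ioo : (lam (`](- k%:R)%R, k%:R%R[%classic : set R) < +oo)%E.
    by rewrite lebesgue_measure_itv/=; case: ifP => _; rewrite ltry.
  have mg : measurable_fun setT (fun t : mR => g (y, t)).
    apply: continuous_measurable_fun => t.
    apply: (@continuous_comp _ _ _ (fun t : R => (y, t) : V) g); last exact: cg.1.
    exact: continuous_pairr.
  apply: (@integrableS _ _ _ lam setT) => //; first exact: measurable_line.
  have eg : (fun t : mR => (g (y, t))%:E) = (EFin \o (fun t => g (y, t))) \_ (`]- k%:R, k%:R[%classic : set mR).
    apply/funext => t; rewrite patchE; case: ifPn => // /negP ht /=; congr EFin.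
    apply: contrapT => /eqP g0; apply: ht; rewrite inE; exact: (hk _ g0).2.
  rewrite eg; apply/(integrable_mkcond _ mI); apply: (@le_integrable _ _ _ _ _ mI _ (EFin \o (fun=> M))).
  - by apply/measurable_EFinP; exact: measurable_funTS.
  - by move=> t _ /=; rewrite lee_fin (le_trans (hM _))// ler_norm.
  - exact: integrable_cst_fin.
split.
  rewrite /Int {1}/Rintegral integral_mkcond.
  have := @integral12_prod_meas1 _ _ _ _ _ (@lebm R n) lam F iF.
  by move=> <-; congr fine; apply: eq_integral => y _; rewrite e.
have := @integrable_fubini_F _ _ _ _ _ (@lebm R n) lam F iF.
by apply: eq_integrable => // y _; rewrite e.
Qed.

Lemma Int_interval_lines (E : set V) (i : option 'I_n) (k : nat) (xi : V -> R) : measurable E ->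
  E `<=` @vcube R n k -> (forall y, is_interval (line (swap i @^-1` E) y)) ->
  C1 xi -> (forall p, `|xi p| <= 1) -> (exists K : set V, compact K /\ forall p, ~ K p -> xi p = 0) ->
  Int E (del i xi) <= 2 * (2 * k%:R) ^+ n.
Proof.
move=> mE Ek iE Cxi xi1 Kxi.
have Cz : C1 (xi \o swap i) := C1_comp_lin (@continuous_swap R n i) Cxi.
have e0 : del i xi = del None (xi \o swap i) \o swap i.
  apply/funext => p; rewrite /= -del_swap//; congr (del _ _ _).
  by apply/funext => q /=; rewrite swapK.
have cd := cc_del i Cxi Kxi.
rewrite e0 -Int_swap//; last by rewrite -e0.
have mE' := measurable_swap_preimage i mE.
have Ek' : swap i @^-1` E `<=` @vcube R n k.
  move=> p /Ek [h1 h2].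
  have h j : comp j (swap i p) \in `]- k%:R, k%:R[ by case: j => [j|]; [exact: h1|exact: h2].
  have g j : comp j p \in `]- k%:R, k%:R[.
    have [->|ij] := eqVneq j i; first by rewrite comp_swap; exact: (h None).
    case: i j ij h {e0 iE cd mE' h1 h2 Cz} => [i|] [j|] // ij h.
    - have := h (Some j); rewrite /= mxE; case: eqP => // e; by rewrite e eqxx in ij.
    - by have := h (Some i); rewrite /= mxE eqxx.
  by split => [j|]; [exact: (g (Some j))|exact: (g None)].
have Kz : exists K : set V, compact K /\ forall p, ~ K p -> (xi \o swap i) p = 0.
  have [K [cK K0]] := Kxi; exists (swap i @` K); split.
    by apply: continuous_compact => //; apply: continuous_subspaceT; exact: continuous_swap.
  by move=> p hp; apply: K0 => Kp; apply: hp; exists (swap i p) => //; rewrite swapK.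
have cz := cc_del None Cz Kz.
have [-> iI] := Int_lines mE' cz.
have mk := measurable_kub (0 : X) k%:R.
have koo : (leb (kub 0 k%:R) < +oo)%E by rewrite leb_kub// ltry.
have hk : \int[leb]_(y in kub 0 k%:R) (2 : R) = 2 * (2 * k%:R) ^+ n.
  by rewrite Rintegral_cst// leb_kub.
rewrite -hk [leRHS]Rintegral_mkcond; apply: le_Rintegral => //.
  by have := @integrable_cst_fin _ _ R leb _ 2 mk koo; rewrite (integrable_mkcond _ mk) -restrict_EFin.
move=> y _; rewrite patchE; case: ifPn => [_|/negP ny].
  have := @Rintegral_interval (fun t => (xi \o swap i) (y, t)) (line (swap i @^-1` E) y) k%:R (C1_line y Cz).
  have -> : 'D_1 (fun t : R => (xi \o swap i) (y, t)) = (fun t => del None (xi \o swap i) (y, t)).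
    by apply/funext => t; have [] := is_derive_line y t Cz.
  move=> H; apply: H; [by move=> t; exact: xi1|exact: iE|].
  by move=> t /Ek' [_]; rewrite /= in_itv/= => /andP[h1 h2]; rewrite ler_norml !ltW.
rewrite (_ : line _ y = set0) ?Rintegral_set0//.
rewrite -subset0 => t /Ek' [h _]; apply: ny; rewrite inE => j; move: (h j).
by rewrite /= !in_itv/= mxE sub0r add0r.
Qed.

(** Along each coordinate line that meets E in an interval the derivative of a test function
    integrates to at most 2; summing over the directions bounds the perimeter. Cylinders are of this
    kind, by convexity. *)
Lemma BVset_interval_lines (E : set V) (k : nat) : measurable E -> E `<=` Om ->
  E `<=` @vcube R n k -> (forall i y, is_interval (line (swap i @^-1` E) y)) -> BVset E.
Proof.
move=> mE EO Ek iE.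
have [] // := @BVset_intro R n E (\sum_(i : option 'I_n) 2 * (2 * k%:R) ^+ n) mE EO.
  by apply: le_lt_trans (vol_vcube R n k); apply: le_meas => //; exact: measurable_vcube.
move=> f [Cf f1 [K [cK KO K0]]].
have Kf i : exists K : set V, compact K /\ forall p, ~ K p -> f i p = 0.
  by exists K; split => // p Kp; exact: K0.
rewrite /dive Int_sum//; last by move=> i; exact: cc_del.
apply: ler_sum => i _; apply: Int_interval_lines => // p.
rewrite -(@expr_le1 _ 2)// real_normK ?num_real//; apply: le_trans (f1 p).
by rewrite (bigD1 i)//= lerDl sumr_ge0// => j _; exact: sqr_ge0.
Qed.

Lemma cylE (r K : R) (p : V) : 0 < r -> cyl r%:E K p <-> [/\ sqn p.1 < r ^+ 2, 0 < p.2 & p.2 < K].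
Proof.
move=> r0; have s0 : 0 <= sqn p.1 by apply: sumr_ge0 => i _; exact: sqr_ge0.
rewrite /cyl/= lte_fin /enorm_rV -/(sqn p.1).
have -> : (Num.sqrt (sqn p.1) < r) = (sqn p.1 < r ^+ 2).
  by rewrite -{1}(gtr0_norm r0) -sqrtr_sqr ltr_sqrt// exprn_gt0.
split; first by move=> [h /andP[]].
by move=> [h -> ->].
Qed.

Lemma measurable_sqn : measurable_fun setT (@sqn R n).
Proof. by apply: continuous_measurable_rV; apply: C1_continuous; exact: C1_sqn. Qed.

Lemma measurable_sqn_pre (A : set mR) : measurable A -> measurable (@sqn R n @^-1` A).
Proof. by move=> mA; rewrite -[X in measurable X]setTI; exact: measurable_sqn. Qed.

Lemma BVset_cyl (r K : R) : 0 < r -> 0 < K -> BVset (cyl r%:E K : set V).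
Proof.
move=> r0 K0.
have eq : cyl r%:E K = over (@sqn R n @^-1` `]-oo, (r ^+ 2)[) `&` (Om `&` below K).
  apply/seteqP; split => p.
    by move=> /(cylE _ _ r0)[h1 h2 h3]; split => //; rewrite /over/= in_itv.
  by move=> [h1 [h2 h3]]; apply/(cylE _ _ r0); split => //; move: h1; rewrite /over/= in_itv.
have tk : \forall k \near \oo, r + K < (k%:R : R) by exact: nbhs_infty_gtr.
have [k hk] := filter_ex tk.
have kr : r < k%:R by apply: lt_trans hk; rewrite ltrDl.
have kK : K < k%:R by apply: lt_trans hk; rewrite ltrDr.
apply: (@BVset_interval_lines _ k).
- rewrite eq; apply: measurableI; first by apply: measurable_over; apply: measurable_sqn_pre; exact: measurable_itv.
  by apply: measurableI; [exact: measurable_Omega|exact: measurable_below].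
- by move=> p [_ /andP[]].
- move=> p /(cylE _ _ r0)[h1 h2 h3]; split => [j|] /=; rewrite in_itv/=.
    rewrite -ltr_norml -ltr_sqr ?nnegrE// real_normK ?num_real//.
    apply: (le_lt_trans (sqn_ge _ _)); apply: (lt_trans h1).
    by rewrite ltr_sqr ?nnegrE// ltW.
  by rewrite (lt_trans h3)// (lt_trans _ h2)// oppr_lt0 (lt_trans r0).
move=> i y u v; rewrite /line/= => /(cylE _ _ r0)[a1 a2 a3] /(cylE _ _ r0)[b1 b2 b3] w /andP[uw wv].
apply/(cylE _ _ r0).
case: i a1 a2 a3 b1 b2 b3 => [i|] /= a1 a2 a3 b1 b2 b3; last first.
  by split => //; [exact: lt_le_trans uw|exact: le_lt_trans b3].
split => //.
have sq t : sqn (\row_j (if j == i then t else y ord0 j)) = t ^+ 2 + \sum_(j | j != i) y ord0 j ^+ 2.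
  rewrite /sqn (bigD1 i)//= mxE eqxx; congr (_ + _).
  by apply: eq_bigr => j /negbTE ji; rewrite mxE ji.
move: a1 b1; rewrite !sq; move: (\sum_(_ | _) _) => S h1 h2.
have : w ^+ 2 <= u ^+ 2 \/ w ^+ 2 <= v ^+ 2.
  have [w0|w0] := leP 0 w; [right|left]; nra.
by case=> h; lra.
Qed.

End radial.

(** * Cut-offs that depend on the distance to the axis *)

Section radialcut.
Variables (R : realType) (n : nat).
Local Notation mR := (measurableTypeR R).
Local Notation X := 'rV[R]_n.
Local Notation V := (Rn1 R n).
Local Notation leb := (leb R n).
Local Notation vol := (vol R n).
Local Notation Om := (@Omega R n).

Lemma sqn_ge0 (y : X) : 0 <= sqn y.
Proof. by apply: sumr_ge0 => i _; exact: sqr_ge0. Qed.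

Lemma sqn1E : (fun p : V => sqn p.1) = (fun p => nsq p - comp None p * comp None p).
Proof.
apply/funext => p; rewrite /nsq big_option/= -expr2 addrK.
by [].
Qed.

Lemma C1_sqn1 : C1 (fun p : V => sqn p.1).
Proof.
rewrite sqn1E; apply: C1B; first exact: C1_nsq.
by apply: C1M; exact: C1_coord.
Qed.

Lemma del_sqn1 j (p : V) : del j (fun p : V => sqn p.1) p = if j is Some i then 2 * comp j p else 0.
Proof.
rewrite sqn1E /del deriveB'; [|exact: C1_nsq|by apply: C1M; exact: C1_coord].
rewrite -/(del j _ p) del_nsq deriveM'; [|exact: C1_coord|exact: C1_coord].
rewrite !derive_coord !comp_dirv; case: j => [j|] /=; first by rewrite mulr0 addr0 subr0.
by rewrite mulr1 mulr2n mulrDl mul1r subrr.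
Qed.

(** The cut-off is a function g of the squared distance t to the axis, which is smooth on the axis
    too; its squared gradient is 4 t g'(t)^2. *)
Lemma radial_cut (E : set V) (Q : set X) (g : nat -> R -> R) (T : nat -> set mR) (b : nat -> R) (c : R) :
  BVset E -> measurable Q -> (forall k, C1 (g k)) -> (forall k t, 0 <= g k t <= 1) ->
  (forall y, (fun k => g k (sqn y)) @ \oo --> (\1_Q y : R)) ->
  (forall k, measurable (T k)) -> (forall k, 0 <= b k) ->
  (forall k t, 0 <= t -> 4 * t * 'D_1 (g k) t ^+ 2 <= (b k * \1_(T k) t) ^+ 2) ->
  (forall k, b k * fine (vol (E `&` [set p | T k (sqn p.1)])) <= c) ->
  [/\ BVset (E `&` over Q), BVset (E `\` over Q) &
    Per (E `&` over Q) + Per (E `\` over Q) <= Per E + 2 * c].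
Proof.
move=> bE mQ Cg g01 gQ mT b0 gT hc.
apply: (@cut_BV R n E (over Q) (fun k p => g k (sqn p.1)) b (fun k => [set p | T k (sqn p.1)]) c bE).
- exact: measurable_over.
- by move=> k; exact: (C1_comp1 (Cg k) C1_sqn1).
- by move=> k p; exact: g01.
- by move=> p _; rewrite (_ : \1_(over Q) p = \1_Q p.1 :> R)// !indicE /over/=; congr (_ %:R); apply/idP/idP; rewrite !inE.
- by move=> k; have -> : [set p : V | T k (sqn p.1)] = over (@sqn R n @^-1` T k) by []; apply: measurable_over; exact: measurable_sqn_pre.
- exact: b0.
- move=> k p Ep.
  have d j : del j (fun p : V => g k (sqn p.1)) p = 'D_1 (g k) (sqn p.1) * (if j is Some i then 2 * comp j p else 0).
    by rewrite -del_sqn1 -derive1E; exact: (derive_comp1 _ _ (Cg k) C1_sqn1).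
  rewrite (eq_bigr (fun j => ('D_1 (g k) (sqn p.1) * (if j is Some i then 2 * comp j p else 0)) ^+ 2)); last first.
    by move=> j _; rewrite d.
  rewrite big_option/= mulr0 expr0n addr0.
  rewrite (eq_bigr (fun i => ('D_1 (g k) (sqn p.1) ^+ 2 * 4) * p.1 ord0 i ^+ 2)); last first.
    by move=> i _; move: ('D_1 (g k) (sqn p.1)) (p.1 ord0 i) => u v /=; ring.
  rewrite -mulr_sumr -/(sqn p.1).
  rewrite (_ : \1_[set p | T k (sqn p.1)] p = \1_(T k) (sqn p.1) :> R); last first.
    by rewrite !indicE; congr (_ %:R); apply/idP/idP; rewrite !inE.
  apply: le_trans (gT k _ (sqn_ge0 p.1)).
  by rewrite -mulrA [leLHS]mulrC.
- exact: hc.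
Qed.

Definition ramp (a b t : R) : R := step ((b ^+ 2 - a ^+ 2)^-1 * (t - a ^+ 2)).

(** The gradient is at most 2 b (3/2) / (b^2 - a^2), which is 2 / (b - a) times 3 b / (2 (b + a)),
    and the last factor is at most 1 for b <= 2 a. *)
Lemma ramp_slope (a b t : R) : 0 < a -> a < b -> b <= 2 * a -> 0 <= t ->
  4 * t * kern (a ^+ 2) (b ^+ 2 - a ^+ 2) t ^+ 2 <= (2 / (b - a) * \1_(`]a ^+ 2, b ^+ 2[%classic : set mR) t) ^+ 2.
Proof.
move=> a0 ab b2 t0; have d0 : 0 < b ^+ 2 - a ^+ 2 by rewrite subr_gt0 ltr_sqr ?nnegrE// ltW// (lt_trans a0).
rewrite indicE; case: (boolP (t \in _)) => ht; last first.
  rewrite kern_out//; first by rewrite expr0n/= !mulr0 expr0n.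
  by move: ht; rewrite notin_setE/= in_itv/= addrC subrK.
have tb : t <= b ^+ 2 by move: ht; rewrite inE/= in_itv/= => /andP[_ /ltW].
have /andP[k0 k1] := kern_ge0 (a ^+ 2) t d0; move: (kern _ _ _) k0 k1 => k k0 k1.
rewrite mulr1; apply: (@le_trans _ _ (4 * b ^+ 2 * (3 / 2 / (b ^+ 2 - a ^+ 2)) ^+ 2)).
  apply: ler_pM; rewrite ?mulr_ge0 ?sqr_ge0//; first by rewrite ler_pM2l.
  by rewrite ler_sqr ?nnegrE// (le_trans k0).
have ba : b - a != 0 by rewrite subr_eq0 gt_eqF.
have bpa : 0 < b + a by rewrite addr_gt0// (lt_trans a0).
have -> : 4 * b ^+ 2 * (3 / 2 / (b ^+ 2 - a ^+ 2)) ^+ 2 = (2 / (b - a)) ^+ 2 * ((3 * b) / (2 * (b + a))) ^+ 2.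
  have e : b ^+ 2 - a ^+ 2 = (b - a) * (b + a) by ring.
  by rewrite e; field; rewrite ba gt_eqF.
rewrite -[leRHS]mulr1 ler_wpM2l ?sqr_ge0// expr_le1//.
  by rewrite ler_pdivrMr ?mulr_gt0// mul1r; lra.
by rewrite divr_ge0 ?mulr_ge0// ltW// (lt_trans a0).
Qed.

Lemma ramp_le (a b t : R) : 0 < a -> a < b -> t <= a ^+ 2 -> ramp a b t = 0.
Proof.
move=> a0 ab ta; apply: step_le0; rewrite mulr_ge0_le0 ?subr_le0// invr_ge0 subr_ge0.
by rewrite ler_sqr ?nnegrE ?ltW// (lt_trans a0).
Qed.

Lemma ramp_ge (a b t : R) : 0 < a -> a < b -> b ^+ 2 <= t -> ramp a b t = 1.
Proof.
move=> a0 ab tb; have d0 : 0 < b ^+ 2 - a ^+ 2 by rewrite subr_gt0 ltr_sqr ?nnegrE// ltW// (lt_trans a0).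
by apply: step_ge1; rewrite mulrC ler_pdivlMr// mul1r lerB.
Qed.

Lemma C1_ramp (a b : R) : C1 (ramp a b). Proof. exact: C1_stepd. Qed.

Lemma ramp_cvg_right (a : R) (h : nat -> R) (t : R) : 0 < a -> (forall k, 0 < h k) -> h @ \oo --> (0 : R) ->
  0 <= t -> (fun k => ramp a (a + h k) t) @ \oo --> ((a ^+ 2 < t)%R%:R : R).
Proof.
move=> a0 h0 hl t0; apply: cvg_near_cst.
have [ta|ta] := ltP (a ^+ 2) t; last by apply: nearW => k; rewrite ramp_le// ltrDl.
have sa : a < Num.sqrt t by rewrite -(gtr0_norm a0) -sqrtr_sqr ltr_sqrt// (le_lt_trans _ ta)// sqr_ge0.
have := @cvgr_lt R _ _ _ h 0 hl (Num.sqrt t - a); rewrite subr_gt0 => /(_ _ sa); apply: filterS => k hk.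
rewrite ramp_ge// ?ltrDl//; rewrite -(sqr_sqrtr t0) ler_sqr ?nnegrE ?sqrtr_ge0//.
  by rewrite -lerBrDl ltW.
by rewrite addr_ge0// ltW.
Qed.

Lemma ramp_cvg_left (b : R) (h : nat -> R) (t : R) : (forall k, 0 < h k < b) -> h @ \oo --> (0 : R) ->
  0 <= t -> (fun k => ramp (b - h k) b t) @ \oo --> ((b ^+ 2 <= t)%R%:R : R).
Proof.
move=> h0 hl t0; apply: cvg_near_cst.
have bh k : 0 < b - h k /\ b - h k < b.
  by have /andP[h1 h2] := h0 k; rewrite subr_gt0; split => //; rewrite gtrDl oppr_lt0.
have b0 : 0 < b by have /andP[h1 h2] := h0 0%N; exact: lt_trans h2.
have [tb|tb] := leP (b ^+ 2) t; first by apply: nearW => k; have [h1 h2] := bh k; rewrite ramp_ge.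
have sb : Num.sqrt t < b by rewrite -(gtr0_norm b0) -sqrtr_sqr ltr_sqrt// exprn_gt0.
have := @cvgr_lt R _ _ _ h 0 hl (b - Num.sqrt t); rewrite subr_gt0 => /(_ _ sb); apply: filterS => k hk.
have [h1 h2] := bh k; rewrite ramp_le//; rewrite -(sqr_sqrtr t0) ler_sqr ?nnegrE ?sqrtr_ge0//.
  by rewrite lerBrDr addrC -lerBrDr ltW.
exact: ltW.
Qed.

Definition shell (a b : R) : set V := [set p | a ^+ 2 < sqn p.1 < b ^+ 2].

Lemma shellE a b : shell a b = [set p : V | (`]a ^+ 2, b ^+ 2[%classic : set mR) (sqn p.1)].
Proof. by apply/seteqP; split => p; rewrite /shell/= in_itv. Qed.

Lemma shell_over a b : shell a b = over (@sqn R n @^-1` (`]a ^+ 2, b ^+ 2[%classic : set mR)).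
Proof. exact: shellE. Qed.

Lemma measurable_shell a b : measurable (shell a b).
Proof. by rewrite shell_over; apply: measurable_over; apply: measurable_sqn_pre; exact: measurable_itv. Qed.

(** The ramp is placed just inside the radius b; 2 h <= b is the condition b <= 2 (b - h) of
    [ramp_slope]. *)
Lemma outer_cut (E : set V) (b c : R) (h : nat -> R) : BVset E ->
  (forall k, 0 < h k /\ 2 * h k <= b) ->
  h @ \oo --> (0 : R) -> (forall k, 2 / h k * fine (vol (E `&` shell (b - h k) b)) <= c) ->
  let Q := [set y : X | b ^+ 2 <= sqn y] in
  [/\ BVset (E `&` over Q), BVset (E `\` over Q) &
    Per (E `&` over Q) + Per (E `\` over Q) <= Per E + 2 * c].
Proof.
move=> bE hb hl hc Q.
have h0 k : 0 < h k by have [] := hb k.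
have h1 k : 0 < h k < b by have [] := hb k; move: (h k) => u; lra.
apply: (@radial_cut E Q (fun k => ramp (b - h k) b) (fun k => `](b - h k) ^+ 2, b ^+ 2[%classic) (fun k => 2 / h k) c bE).
- rewrite (_ : Q = @sqn R n @^-1` (`[b ^+ 2, +oo[%classic : set mR)); first exact: measurable_sqn_pre (measurable_itv _).
  by apply/seteqP; split => y; rewrite /Q/= in_itv/= andbT.
- by move=> k; exact: C1_ramp.
- by move=> k t; exact: step_ge0.
- move=> y; have := ramp_cvg_left h1 hl (sqn_ge0 y).
  have -> // : (\1_Q y : R) = (b ^+ 2 <= sqn y)%R%:R.
  by rewrite indicE (_ : (y \in Q) = (b ^+ 2 <= sqn y)%R)//; apply/idP/idP; rewrite inE.
- by move=> k; exact: measurable_itv.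
- by move=> k; rewrite divr_ge0// ltW.
- move=> k t t0; rewrite /ramp derive_stepd.
  have := @ramp_slope (b - h k) b t _ _ _ t0; rewrite gtrDl oppr_lt0 h0 (_ : b - (b - h k) = h k); last by ring.
  apply => //.
    by have /andP[_] := h1 k; rewrite subr_gt0.
  by have [] := hb k; move: (h k) => u; lra.
by move=> k; rewrite -shellE; exact: hc.
Qed.

(** At t = 0 a bound on 4 t w^2 says nothing about the derivative w, hence the product with t. *)
Lemma mul0_of_sq (t w : R) : 0 <= t -> 4 * t * w ^+ 2 <= 0 -> t * w = 0.
Proof.
move=> t0 hw; have h4 := ler_wpM2l t0 hw.
have e : t * (4 * t * w ^+ 2) = 4 * (t * w) ^+ 2 by ring.
move: h4; rewrite mulr0 e pmulr_rle0// => h4.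
by apply/eqP; rewrite -sqrf_eq0; apply/eqP/le_anti; rewrite h4 sqr_ge0.
Qed.

(** Both ramps are placed inside the ring, so that the cost is measured by the volume lost when the
    ring shrinks. The bounds on h give the ratio 2 of [ramp_slope] and keep the two shells
    disjoint. *)
Lemma ring_cut (E : set V) (a b c : R) (h : nat -> R) : BVset E -> 0 < a ->
  (forall k, [/\ 0 < h k, h k <= a & 2 * h k <= b - a]) ->
  h @ \oo --> (0 : R) ->
  (forall k, 2 / h k * fine (vol (E `&` (shell a (a + h k) `|` shell (b - h k) b))) <= c) ->
  let Q := [set y : X | a ^+ 2 < sqn y < b ^+ 2] in
  [/\ BVset (E `&` over Q), BVset (E `\` over Q) &
    Per (E `&` over Q) + Per (E `\` over Q) <= Per E + 2 * c].
Proof.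
move=> bE a0 ha hl hc Q.
have h0 k : 0 < h k by have [] := ha k.
have hb k : 0 < h k < b by have [] := ha k; move: (h k) => u; lra.
pose I1 k : set mR := `]a ^+ 2, (a + h k) ^+ 2[%classic.
pose I2 k : set mR := `](b - h k) ^+ 2, b ^+ 2[%classic.
have Cr k : C1 (fun t => 1 - ramp (b - h k) b t) by apply: C1B; [exact: C1_cst|exact: C1_ramp].
apply: (@radial_cut E Q (fun k t => ramp a (a + h k) t * (1 - ramp (b - h k) b t)) (fun k => I1 k `|` I2 k) (fun k => 2 / h k) c bE).
- rewrite (_ : Q = @sqn R n @^-1` (`]a ^+ 2, b ^+ 2[%classic : set mR)); first exact: measurable_sqn_pre (measurable_itv _).
  by apply/seteqP; split => y; rewrite /Q/= in_itv/=.
- by move=> k; apply: C1M; [exact: C1_ramp|exact: Cr].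
- move=> k t; have /andP[x0 x1] := step_ge0 (((a + h k) ^+ 2 - a ^+ 2)^-1 * (t - a ^+ 2)).
  have /andP[y0 y1] := step_ge0 ((b ^+ 2 - (b - h k) ^+ 2)^-1 * (t - (b - h k) ^+ 2)).
  rewrite /ramp; move: (step _) (step _) x0 x1 y0 y1 => x y x0 x1 y0 y1.
  by rewrite mulr_ge0 ?subr_ge0// mulr_ile1 ?subr_ge0// gerBl.
- move=> y; have c1 := ramp_cvg_right a0 h0 hl (sqn_ge0 y).
  have c2 := ramp_cvg_left hb hl (sqn_ge0 y).
  have -> : \1_Q y = (a ^+ 2 < sqn y)%R%:R * (1 - (b ^+ 2 <= sqn y)%R%:R) :> R.
    rewrite indicE leNgt (_ : (y \in Q) = (a ^+ 2 < sqn y) && (sqn y < b ^+ 2)); last by apply/idP/idP; rewrite inE.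
    by case: (a ^+ 2 < _); case: (_ < _); rewrite /= ?(subrr, subr0, mulr0, mulr1, mul0r).
  by apply: cvgM => //; apply: cvgB => //; exact: cvg_cst.
- by move=> k; apply: measurableU; exact: measurable_itv.
- by move=> k; rewrite divr_ge0// ltW.
- move=> k t t0; have [h1 h2 h3] := ha k.
  rewrite (deriveM' _ _ (C1_ramp _ _) (Cr k)) (deriveB' _ _ (C1_cst _ _) (C1_ramp _ _)) derive_cst sub0r.
  rewrite !derive_stepd.
  have s1 : 4 * t * kern (a ^+ 2) ((a + h k) ^+ 2 - a ^+ 2) t ^+ 2 <= (2 / h k * \1_(I1 k) t) ^+ 2.
    have := @ramp_slope a (a + h k) t a0 _ _ t0; rewrite ltrDl h0 [a + h k - a]addrAC subrr add0r; apply => //.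
    by move: (h k) h2 => u; lra.
  have s2 : 4 * t * kern ((b - h k) ^+ 2) (b ^+ 2 - (b - h k) ^+ 2) t ^+ 2 <= (2 / h k * \1_(I2 k) t) ^+ 2.
    have := @ramp_slope (b - h k) b t _ _ _ t0; rewrite gtrDl oppr_lt0 h0 (_ : b - (b - h k) = h k); last by ring.
    apply => //.
      by have /andP[_] := hb k; rewrite subr_gt0.
    by move: (h k) h2 h3 => u; lra.
  have /andP[x0 x1] := step_ge0 (((a + h k) ^+ 2 - a ^+ 2)^-1 * (t - a ^+ 2)).
  have /andP[y0 y1] := step_ge0 ((b ^+ 2 - (b - h k) ^+ 2)^-1 * (t - (b - h k) ^+ 2)).
  rewrite -/(ramp _ _ _) in x0 x1; rewrite -/(ramp _ _ _) in y0 y1.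
  move: (ramp _ _ _) (ramp _ _ _) x0 x1 y0 y1 => y x x0 x1 y0 y1.
  (* At each t at most one of the two ramps varies, so the cross terms of the squared derivative
     disappear. *)
  have disj : \1_(I1 k) t = 0 :> R \/ \1_(I2 k) t = 0 :> R.
    rewrite !indicE; case: (boolP (t \in I1 k)) => i1; last by left.
    case: (boolP (t \in I2 k)) => i2; last by right.
    exfalso; move: i1 i2; rewrite !inE /I1 /I2 /= !in_itv/= => /andP[_ t1] /andP[t2 _].
    have := lt_trans t2 t1; rewrite ltr_sqr ?nnegrE; [|by move: (h k) h1 h2 h3 => u; lra|by move: (h k) h1 h2 h3 => u; lra].
    by move: (h k) h3 => u; lra.
  have -> : \1_(I1 k `|` I2 k) t = \1_(I1 k) t + \1_(I2 k) t :> R.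
    move: disj; rewrite !indicE in_setU; case: (t \in I1 k); case: (t \in I2 k); rewrite /= ?addr0 ?add0r// => -[/eqP|/eqP]; by rewrite oner_eq0.
  move: (kern _ _ _) (kern _ _ _) s1 s2 => v u s1 s2.
  case: disj => z; rewrite z ?add0r ?addr0; rewrite z mulr0 expr0n/= in s1 s2.
    have tu := mul0_of_sq t0 s1.
    apply: le_trans s2.
    have -> : 4 * t * (x * - v + (1 - y) * u) ^+ 2 = 4 * t * v ^+ 2 * x ^+ 2 + (t * u) * (4 * (1 - y) * ((1 - y) * u - 2 * x * v)) by ring.
    rewrite tu mul0r addr0; apply: ler_piMr; last by rewrite expr_le1.
    apply: mulr_ge0; [exact: mulr_ge0|exact: sqr_ge0].
  have tv := mul0_of_sq t0 s2.
  apply: le_trans s1.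
  have -> : 4 * t * (x * - v + (1 - y) * u) ^+ 2 = 4 * t * u ^+ 2 * (1 - y) ^+ 2 + (t * v) * (4 * x * (x * v - 2 * (1 - y) * u)) by ring.
  rewrite tv mul0r addr0; apply: ler_piMr; last by rewrite expr_le1 ?subr_ge0// gerBl.
  apply: mulr_ge0; [exact: mulr_ge0|exact: sqr_ge0].
move=> k; have := hc k; rewrite !shellE.
by [].
Qed.

End radialcut.

(** * Confinement *)

(** The points up to t where the linear bound holds have a supremum m; the bound holds at m because
    phi is nonincreasing, no continuity being assumed, and if m < t a further small drop contradicts
    the choice of m. *)
Lemma dini_decrease (R : realType) (phi : R -> R) (T q : R) :
  (forall s t : R, 0 <= s -> s <= t -> t < T -> phi t <= phi s) ->
  (forall s : R, 0 <= s < T -> forall d : R, 0 < d -> exists2 h : R, 0 < h < d & phi (s + h) <= phi s - q * h) ->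
  forall t : R, 0 <= t < T -> phi t <= phi 0 - q * t.
Proof.
move=> mono dec t /andP[t0 tT].
pose A := [set s : R | [/\ 0 <= s, s <= t & phi s <= phi 0 - q * s]].
have A0 : A 0 by split => //; rewrite mulr0 subr0.
have uA : has_ubound A by exists t => s [].
have hA : has_sup A by split => //; exists 0.
pose m := sup A.
have m0 : 0 <= m by exact: ub_le_sup.
have mt : m <= t by apply: ge_sup; [exists 0|move=> s []].
have Am : phi m <= phi 0 - q * m.
  apply/ler_addgt0Pr => e e0.
  pose d := e / (`|q| + 1).
  have q1 : 0 < `|q| + 1 by rewrite ltr_wpDl.
  have d0 : 0 < d by rewrite divr_gt0.
  have [s [s0 st hs] ms] := sup_adherent d0 hA.
  have sm : s <= m by apply: ub_le_sup.
  apply: (le_trans (mono s m s0 sm (le_lt_trans mt tT))); apply: (le_trans hs).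
  have hd : (m - s) * (`|q| + 1) <= e.
    by rewrite -ler_pdivlMr// lerBlDr -lerBlDl; apply: ltW.
  have qq : q * (m - s) <= `|q| * (m - s) by apply: ler_wpM2r; rewrite ?subr_ge0// ler_norm.
  have ms0 : 0 <= m - s by rewrite subr_ge0.
  by move: hd qq ms0; rewrite !mulrBr !mulrBl !mulrDr !mulr1; move: (`|q|) => u; lra.
have [mt'|tm] := ltP m t; last first.
  by have <- : m = t by apply/le_anti; rewrite mt tm.
have tm0 : 0 < t - m by rewrite subr_gt0.
have mT : 0 <= m < T by rewrite m0 (le_lt_trans mt tT).
have [h /andP[h0 hd] hh] := dec m mT _ tm0.
have : A (m + h).
  split; [by rewrite addr_ge0// ltW|by rewrite -lerBrDl ltW|].
  by apply: (le_trans hh); rewrite mulrDr; move: Am; move: (q * m) (q * h) (phi m) (phi 0) => a b c e; lra.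
by move=> /(ub_le_sup uA); rewrite -/m gerDl leNgt h0.
Qed.

Lemma subX_le (R : realType) (n : nat) (x y : R) : 0 <= y -> y <= x ->
  x ^+ n.+1 - y ^+ n.+1 <= n.+1%:R * x ^+ n * (x - y).
Proof.
move=> y0 yx; have x0 : 0 <= x by apply: le_trans yx.
rewrite subrXX mulrC ler_wpM2r ?subr_ge0//.
apply: (@le_trans _ _ (\sum_(i < n.+1) x ^+ n)); last by rewrite sumr_const card_ord mulr_natl.
apply: ler_sum => i _; have ile : (i <= n)%N by rewrite -ltnS.
rewrite [leRHS](_ : _ = x ^+ (n - i) * x ^+ i); last by rewrite -exprD subnK.
by apply: ler_wpM2l; [exact: exprn_ge0|apply: lerXn2r => //; rewrite nnegrE].
Qed.

(** Exponents of 2 in [width_arith]: on the left those of the bounds 8 (n+1)^2 <= 2^(2n+3) and n+1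
    <= 2^n, raised to n (n+1) and n+1; on the right those of 2^(n+1), 8^((n^2+n+1) n) and 4^(n
    n). *)
Lemma width_exponents (n : nat) : (1 <= n)%N ->
  ((2 * n + 3) * (n * n.+1) + n * n.+1 < n.+1 + 3 * ((n ^ 2 + n + 1) * n) + 2 * (n * n))%N.
Proof.
move=> n1; have nn : (n * n <= n * (n * n))%N by rewrite leq_pmull.
rewrite expnS expn1; lia.
Qed.

(* With [W] the width of the ring and [Phi] the initial value of [phi], the conclusion says that
   [phi], of slope at most [- kappa / (4 * n.+1%:R ^+ 2)], vanishes before [W / 2]. The
   constants of R_0 come in through [n.+1 <= 2 ^ n], see [width_exponents]. *)
Lemma width_arith (R : realType) (n : nat) (a kappa W Phi A M : R) : (1 <= n)%N ->
  0 <= a -> 0 < kappa -> 0 <= Phi -> 0 <= A -> 0 <= M ->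
  A ^+ n = a ^+ n.+1 -> M ^+ n * kappa ^+ n.+1 = 1 ->
  2 * Phi ^+ n <= n.+1%:R * a ->
  8 ^+ (n ^ 2 + n + 1) * A <= W -> 4 * M <= W -> 0 < W ->
  8 * n.+1%:R ^+ 2 * Phi < kappa * W.
Proof.
move=> n1 a0 k0 P0 A0 M0 hA hM hP hWA hWM W0; rewrite ltNge; apply/negP => H.
have N0 : 0 <= n.+1%:R :> R by [].
pose N : R := n.+1%:R.
have h1 : 2 * (kappa * W) ^+ n <= (8 * N ^+ 2) ^+ n * (N * a).
  apply: (@le_trans _ _ ((8 * N ^+ 2) ^+ n * (2 * Phi ^+ n))).
    rewrite mulrCA ler_pM2l// -exprMn; apply: lerXn2r; rewrite ?nnegrE//.
      by rewrite mulr_ge0// ltW.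
    by rewrite !mulr_ge0// sqr_ge0.
  by apply: ler_wpM2l => //; rewrite exprn_ge0// mulr_ge0// sqr_ge0.
(* The power n+1 produces a^(n+1), which equals A^n, and W^(n (n+1)). The latter splits as W^n W^(n
   n): the first factor is bounded below by A, the second by M, and then a and kappa cancel. *)
have h2 : 2 ^+ n.+1 * (kappa * W) ^+ (n * n.+1) <= (8 * N ^+ 2) ^+ (n * n.+1) * (N ^+ n.+1 * a ^+ n.+1).
  rewrite [X in _ * X <= _]exprM [X in _ <= X * _]exprM -!exprMn; apply: lerXn2r; rewrite ?nnegrE//.
    by rewrite mulr_ge0// exprn_ge0// mulr_ge0// ltW.
  by rewrite !mulr_ge0// exprn_ge0// mulr_ge0// sqr_ge0.
have h3 : (8 ^+ (n ^ 2 + n + 1)) ^+ n * a ^+ n.+1 <= W ^+ n.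
  by rewrite -hA -exprMn; apply: lerXn2r; rewrite ?nnegrE ?(ltW W0)// mulr_ge0// exprn_ge0.
have h4 : (4 ^+ n * M ^+ n) ^+ n <= W ^+ (n * n).
  by rewrite exprM; apply: lerXn2r; rewrite ?nnegrE ?exprn_ge0 ?mulr_ge0 ?exprn_ge0 ?(ltW W0)// -exprMn; apply: lerXn2r; rewrite ?nnegrE ?(ltW W0)// mulr_ge0.
have Nn : N <= 2 ^+ n.
  by rewrite -natrX ler_nat; exact: ltn_expl.
pose D : R := 8 * N ^+ 2.
have D0 : 0 <= D by rewrite mulr_ge0// sqr_ge0.
have DN : D <= 2 ^+ (2 * n + 3).
  rewrite exprD mulrC; apply: ler_pM => //; first exact: sqr_ge0.
    by rewrite -natrX ler_nat.
  by rewrite mulnC exprM; apply: lerXn2r; rewrite ?nnegrE// exprn_ge0.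
have key : 2 ^+ n.+1 * (8 ^+ (n ^ 2 + n + 1)) ^+ n * (4 ^+ n) ^+ n <= D ^+ (n * n.+1) * N ^+ n.+1.
  have Wn : 0 < W ^+ (n * n.+1) by rewrite exprn_gt0.
  rewrite -(ler_pM2r Wn).
  have b0 : 0 <= (8 ^+ (n ^ 2 + n + 1)) ^+ n :> R by rewrite !exprn_ge0.
  have d0 : 0 <= (4 ^+ n) ^+ n :> R by rewrite !exprn_ge0.
  have kk : kappa ^+ (n * n.+1) * (M ^+ n) ^+ n = 1.
    by rewrite mulnC exprM -exprMn mulrC hM expr1n.
  have e1 : 2 ^+ n.+1 * (8 ^+ (n ^ 2 + n + 1)) ^+ n * (4 ^+ n) ^+ n * W ^+ (n * n.+1) =
     (8 ^+ (n ^ 2 + n + 1)) ^+ n * (4 ^+ n * M ^+ n) ^+ n * (2 ^+ n.+1 * (kappa * W) ^+ (n * n.+1)).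
    rewrite [(kappa * W) ^+ _]exprMn [(4 ^+ n * M ^+ n) ^+ n]exprMn -[LHS]mulr1 -[X in _ * X = _]kk.
    move: (kappa ^+ _) ((M ^+ n) ^+ n) ((4 ^+ n) ^+ n) (W ^+ _) (2 ^+ n.+1) ((8 ^+ _) ^+ n) => u1 u2 u3 u4 u5 u6; ring.
  rewrite e1.
  have m0 : 0 <= (4 ^+ n * M ^+ n) ^+ n by rewrite exprn_ge0// mulr_ge0// exprn_ge0.
  apply: (le_trans (ler_wpM2l (mulr_ge0 b0 m0) h2)).
  have e2 : W ^+ (n * n.+1) = W ^+ n * W ^+ (n * n) by rewrite -exprD mulnS.
  rewrite e2 -/D.
  have c0 : 0 <= D ^+ (n * n.+1) * N ^+ n.+1 by rewrite mulr_ge0// exprn_ge0.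
  have an : 0 <= a ^+ n.+1 by rewrite exprn_ge0.
  have := ler_pM (mulr_ge0 b0 an) m0 h3 h4.
  move=> /(ler_wpM2l c0); apply: le_trans; rewrite le_eqVlt; apply/orP; left; apply/eqP.
  move: (D ^+ _) (N ^+ _) (a ^+ _) ((4 ^+ n * _) ^+ n) ((8 ^+ _) ^+ n) => u1 u2 u3 u4 u5; ring.
have up : D ^+ (n * n.+1) * N ^+ n.+1 <= 2 ^+ ((2 * n + 3) * (n * n.+1) + n * n.+1).
  rewrite exprD; apply: ler_pM; rewrite ?exprn_ge0//.
    by rewrite [leRHS]exprM; apply: lerXn2r; rewrite ?nnegrE// exprn_ge0.
  by rewrite [leRHS]exprM; apply: lerXn2r; rewrite ?nnegrE// exprn_ge0.
have := le_trans key up.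
have -> : 8 = 2 ^+ 3 :> R by rewrite -natrX.
have -> : 4 = 2 ^+ 2 :> R by rewrite -natrX.
rewrite -!exprM -!exprD ler_eXn2l ?ltr1n//.
by rewrite leqNgt width_exponents.
Qed.

Section nroot.
Variables (R : realType) (n : nat).

Definition nroot (w : R) : R := w `^ (n.+1%:R)^-1.

Lemma nroot_ge0 w : 0 <= nroot w. Proof. exact: powR_ge0. Qed.

Lemma nrootK w : 0 <= w -> nroot w ^+ n.+1 = w.
Proof. by move=> w0; rewrite -powR_mulrn ?powR_ge0// -powRrM mulVf ?pnatr_eq0// powRr1. Qed.

Lemma nroot_le u v : 0 <= u -> u <= v -> nroot u <= nroot v.
Proof. by move=> u0 uv; apply: ge0_ler_powR; rewrite ?nnegrE// (le_trans u0). Qed.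

(** It removes the rational exponents of R_0, so that [width_arith] involves integer powers only. *)
Lemma powR_ratK (x : R) : (1 <= n)%N -> 0 <= x -> (x `^ (n.+1%:R / n%:R)) ^+ n = x ^+ n.+1.
Proof.
move=> n1 x0; rewrite -powR_mulrn ?powR_ge0// -powRrM -mulrA mulVf ?mulr1 ?powR_mulrn//.
by rewrite pnatr_eq0 -lt0n.
Qed.

End nroot.

Section confinement.
Variables (R : realType) (n : nat).
Local Notation mR := (measurableTypeR R).
Local Notation X := 'rV[R]_n.
Local Notation V := (Rn1 R n).
Local Notation leb := (leb R n).
Local Notation vol := (vol R n).
Local Notation Om := (@Omega R n).

(** [isoperimetric] with cubes of side twice the root of the volume v: their volume 2^(n+1) v is at
    least 2 v. *)
Lemma iso_root (E : set V) : (1 <= n)%N -> BVset E ->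
  nroot n (fine (vol E)) ^+ n <= n.+1%:R * Per E.
Proof.
move=> n1 bE; have v0 : 0 <= fine (vol E) by exact: fine_ge0.
have := @isoperimetric R n (2 * nroot n (fine (vol E))) ^~ E.
move: (fine (vol E)) v0 => v v0 iso.
have [p0|h] := ltP 0 (nroot n v); last first.
  have -> : nroot n v = 0 by apply/le_anti; rewrite h nroot_ge0.
  by rewrite expr0n gtn_eqF// mulr_ge0// Per_ge0.
have s0 : 0 < 2 * nroot n v by rewrite mulr_gt0.
have h : 2 * v <= (2 * nroot n v) ^+ n.+1.
  by rewrite exprMn nrootK// ler_wpM2r// -natrX ler_nat expnS leq_pmulr// expn_gt0.
have := iso s0 bE h; rewrite [2 * _]mulrC mulfK// -{1}(nrootK n v0) exprSr mulrAC.
by rewrite ler_pM2r.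
Qed.

Lemma Per0_null (E : set V) : BVset E -> Per E = 0 -> vol E = 0%E.
Proof.
move=> bE P0; have v0 : 0 <= fine (vol E) by exact: fine_ge0.
have fv : vol E \is a fin_num by rewrite ge0_fin_numE// BVset_vol.
have s0 : 0 < 2 * fine (vol E) + 1 by rewrite ltr_wpDl// mulr_ge0.
have h : 2 * fine (vol E) <= (2 * fine (vol E) + 1) ^+ n.+1.
  have s1 : 1 <= 2 * fine (vol E) + 1 by rewrite lerDr mulr_ge0.
  apply: le_trans (ler_eXnr _ s1); first by rewrite lerDl.
  by [].
have := isoperimetric s0 bE h; rewrite P0 mulr0 => h1.
by rewrite -(fineK fv); congr EFin; apply/le_anti; rewrite h1 v0.
Qed.

End confinement.

(** * The empty ring *)

Section confinement.
Variables (R : realType) (n : nat).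
Hypothesis n1 : (1 <= n)%N.
Local Notation mR := (measurableTypeR R).
Local Notation X := 'rV[R]_n.
Local Notation V := (Rn1 R n).
Local Notation leb := (leb R n).
Local Notation vol := (vol R n).
Local Notation Om := (@Omega R n).

Definition rring (a b : R) : set X := [set y | a ^+ 2 < sqn y < b ^+ 2].
Definition far (b : R) : set X := [set y | b ^+ 2 <= sqn y].

Lemma measurable_rring a b : measurable (rring a b).
Proof.
rewrite (_ : rring a b = @sqn R n @^-1` (`]a ^+ 2, b ^+ 2[%classic : set mR)); first exact: measurable_sqn_pre (measurable_itv _).
by apply/seteqP; split => y; rewrite /rring/= in_itv.
Qed.

Lemma measurable_far b : measurable (far b).
Proof.
rewrite (_ : far b = @sqn R n @^-1` (`[b ^+ 2, +oo[%classic : set mR)); first exact: measurable_sqn_pre (measurable_itv _).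
by apply/seteqP; split => y; rewrite /far/= in_itv/= andbT.
Qed.

Lemma inset_order (a b h : R) : 0 < h -> 2 * h <= b - a -> 0 < a -> a < b ->
  [/\ 0 <= b - h, 0 <= a + h, a + h <= b & a <= b - h].
Proof. by move=> *; split; lra. Qed.

Lemma middle_order (r T s h : R) : 0 < h -> h <= T - s -> 0 < r -> 0 < T -> 0 <= s -> s < T ->
  [/\ 0 <= r + s, r + s <= r + T - h, 0 <= r + T & r + T <= r + 2 * T - s].
Proof. by move=> *; split; lra. Qed.

(** A small drop of the root is turned into a small drop of the volume, by the mean value inequality
    for the power n+1. *)
Lemma nroot_step (w0 w1 u q : R) : 0 <= w1 -> 0 <= u -> w1 + u <= w0 ->
  nroot n w0 - nroot n w1 <= q -> u <= n.+1%:R * nroot n w0 ^+ n * q.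
Proof.
move=> w10 u0 wu hq; have w00 : 0 <= w0 by apply: le_trans wu; rewrite addr_ge0.
have ph : nroot n w1 <= nroot n w0 by apply: nroot_le => //; apply: le_trans wu; rewrite lerDl.
have := subX_le n (nroot_ge0 n w1) ph; rewrite !nrootK// => hX.
apply: (@le_trans _ _ (n.+1%:R * nroot n w0 ^+ n * (nroot n w0 - nroot n w1))).
  by apply: le_trans hX; rewrite lerBrDl.
by apply: ler_wpM2l => //; rewrite mulr_ge0// exprn_ge0// nroot_ge0.
Qed.

Lemma shell_sub (a b c d : R) : 0 <= c -> c <= a -> 0 <= b -> b <= d -> shell a b `<=` @shell R n c d.
Proof.
move=> c0 ca b0 bd p /andP[h1 h2]; apply/andP; split.
  by apply: le_lt_trans h1; rewrite ler_sqr ?nnegrE// (le_trans c0).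
by apply: (lt_le_trans h2); rewrite ler_sqr ?nnegrE// (le_trans b0).
Qed.

Lemma fine_vol_sub (E : set V) (S S' : set V) : BVset E -> measurable S -> measurable S' -> S `<=` S' ->
  fine (vol (E `&` S)) <= fine (vol (E `&` S')).
Proof.
move=> bE mS mS' SS; have mE := BVset_measurable bE.
have fin (A : set V) : measurable A -> vol (E `&` A) \is a fin_num.
  move=> mA; rewrite ge0_fin_numE//; apply: le_lt_trans (BVset_vol bE).
  by apply: le_meas; [exact: measurableI|exact: mE|move=> p []].
rewrite fine_le ?fin//; apply: le_meas; [exact: measurableI|exact: measurableI|].
by move=> p [Ep /SS].
Qed.

Lemma fine_vol_split (E : set V) (S S' D : set V) : BVset E -> measurable S -> measurable S' -> measurable D ->
  S `&` S' = set0 -> S `<=` D -> S' `<=` D ->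
  fine (vol (E `&` S)) + fine (vol (E `&` S')) <= fine (vol (E `&` D)).
Proof.
move=> bE mS mS' mD SS SD SD'; have mE := BVset_measurable bE.
have fin (A : set V) : measurable A -> vol (E `&` A) \is a fin_num.
  move=> mA; rewrite ge0_fin_numE//; apply: le_lt_trans (BVset_vol bE).
  by apply: le_meas; [exact: measurableI|exact: mE|move=> p []].
have i1 : measurable (E `&` S) by exact: measurableI.
have i2 : measurable (E `&` S') by exact: measurableI.
have f1 := fin S mS; have f2 := fin S' mS'; have f3 := fin D mD.
rewrite -fineD// -lee_fin (fineK f3) fineK; last by rewrite fin_numD f1 f2.
rewrite -(measureU vol i1 i2); last by rewrite setIACA SS setI0.
apply: le_meas; [exact: measurableU|exact: measurableI|].
by move=> p [[Ep /SD]|[Ep /SD']].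
Qed.

Section slab.
Variables (beta : X -> R) (kappa : R).
Hypothesis mbeta : measurable_fun setT beta.
Hypothesis kp : 0 < kappa <= 2^-1.
Hypothesis hb : forall y, -1 <= beta y <= 1 - 2 * kappa.

Lemma inv_seq_cvg (d : R) : (fun k : nat => d / k.+1%:R) @ \oo --> (0 : R).
Proof. by rewrite -(mulr0 d); apply: cvgMl_tmp; exact: cvg_harmonic. Qed.

Lemma inv_seq_bound (d : R) (k : nat) : 0 < d -> 0 < d / k.+1%:R <= d.
Proof. move=> d0; rewrite divr_gt0//= ler_pdivrMr//; apply: ler_peMr; first exact: ltW.
by rewrite ler1n. Qed.

Variables (E : set V) (r T : R).
Hypotheses (bE : BVset E) (r0 : 0 < r) (T0 : 0 < T).
Hypothesis Hring : forall a b : R, r <= a -> a < b -> BVset (E `\` over (rring a b)) ->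
  cap beta E <= cap beta (E `\` over (rring a b)).

(** The ring shrinks at the same rate from both sides towards the radius r + T, which it reaches at
    s = T. *)
Let w (s : R) : R := fine (vol (E `&` shell (r + s) (r + 2 * T - s))).
Let phi (s : R) : R := nroot n (w s).
Let q : R := kappa / (4 * n.+1%:R ^+ 2).

Let w_ge0 s : 0 <= w s. Proof. exact: fine_ge0. Qed.

(** By contradiction: if every small drop is below q h, the two shells have volume at most (n+1)
    phi^n q h, and removing the ring costs at most 2 c with c = 2 (n+1) q phi^n. Comparison with E
    and the bound on the trace then give kappa times the perimeter of the removed part <= c, against
    the isoperimetric inequality in the ring. *)
Lemma ring_decrease (s : R) : 0 <= s < T -> 0 < w s ->
  forall d : R, 0 < d -> exists2 h : R, 0 < h < d & phi (s + h) <= phi s - q * h.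
Proof.
move=> /andP[s0 sT] ws d d0; apply: contrapT => /forall2NP H.
have /andP[k0 k1] := kp.
have N0 : 0 < n.+1%:R :> R by [].
set a := r + s; set b := r + 2 * T - s.
have a0 : 0 < a by rewrite /a ltr_wpDr.
have ab : a < b by rewrite /a /b; lra.
pose d1 := Num.min (d / 2) (Num.min a ((b - a) / 2)).
have d10 : 0 < d1 by rewrite !lt_min !divr_gt0 ?a0// subr_gt0.
pose h (k : nat) : R := d1 / k.+1%:R.
have hk k : [/\ 0 < h k, h k < d, h k <= a & 2 * h k <= b - a].
  have /andP[x1 x2] := inv_seq_bound k d10.
  have m1 : d1 <= d / 2 by rewrite /d1 ge_min lexx.
  have m2 : d1 <= a by rewrite /d1 !ge_min lexx orbT.
  have m3 : d1 <= (b - a) / 2 by rewrite /d1 !ge_min lexx !orbT.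
  by rewrite -/(h k) in x1 x2; move: (h k) x1 x2 => u x1 x2; split; lra.
have phi0 x : 0 <= phi x by exact: nroot_ge0.
pose c := 2 * n.+1%:R * q * phi s ^+ n.
have hc k : 2 / h k * fine (vol (E `&` (shell a (a + h k) `|` shell (b - h k) b))) <= c.
  have [x1 x2 x3 x4] := hk k.
  have -> : 2 / h k * fine (vol (E `&` (shell a (a + h k) `|` shell (b - h k) b))) =
     2 * fine (vol (E `&` (shell a (a + h k) `|` shell (b - h k) b))) / h k by rewrite mulrAC.
  rewrite ler_pdivrMr//.
  have -> : c * h k = 2 * (n.+1%:R * phi s ^+ n * (q * h k)) by rewrite /c; ring.
  rewrite ler_pM2l//.
  have q1 : phi s - phi (s + h k) <= q * h k.
    have [|/negP] := H (h k); first by rewrite x1 x2.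
    by rewrite -ltNge => /ltW; move: (phi s) (phi _) (q * _) => u v z; lra.
  have sp : w (s + h k) + fine (vol (E `&` (shell a (a + h k) `|` shell (b - h k) b))) <= w s.
    apply: fine_vol_split => //; [exact: measurable_shell|by apply: measurableU; exact: measurable_shell|exact: measurable_shell| | |].
    - rewrite -subset0 => p [/andP[p1 p2]] [] /andP[p3 p4].
        by move: (lt_trans p1 p4); rewrite addrA ltxx.
      by move: (lt_trans p3 p2); rewrite opprD addrA ltxx.
    - rewrite !(addrA r) !(opprD, addrA) -/a -/b; apply: shell_sub => //; [exact: ltW|by rewrite lerDl ltW| |by rewrite gerBl ltW].
      by have [] := inset_order x1 x4 a0 ab.
    - have [y1 y2 y3 y4] := inset_order x1 x4 a0 ab; have a0' := ltW a0; have b0' := le_trans a0' (ltW ab).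
      move=> p [] hp; [apply: (shell_sub _ _ _ _ hp)|apply: (shell_sub _ _ _ _ hp)]; by rewrite -/a -/b.
  exact: nroot_step (w_ge0 _) _ sp q1.
have hl : h @ \oo --> (0 : R) := inv_seq_cvg d1.
have h3 k : [/\ 0 < h k, h k <= a & 2 * h k <= b - a] by have [] := hk k.
have [b1 b2 P12] := ring_cut bE a0 h3 hl hc.
have := @Hring a b _ ab b2; rewrite lerDl s0 => /(_ isT).
rewrite /cap (Tr_split mbeta kp hb bE (measurable_rring a b)) => hr.
have hT := Tr_le mbeta kp hb b1.
have wE : w s = fine (vol (E `&` over (rring a b))) by [].
have iso := iso_root n1 b1.
rewrite -wE -/(phi s) in iso.
have php : 0 < phi s by exact: powR_gt0.
have pn : 0 < phi s ^+ n by rewrite exprn_gt0.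
have kP : kappa * Per (E `&` over (rring a b)) <= c.
  rewrite -/(rring a b) in P12 hr hT *.
  move: P12 hr hT; rewrite -/(rring a b).
  move: (Per (E `&` _)) (Per (E `\` _)) (Per E) (Tr _ (E `&` _)) (Tr _ (E `\` _)) => u1 u2 u3 u4 u5; lra.
have : kappa * phi s ^+ n <= kappa / 2 * phi s ^+ n.
  apply: (@le_trans _ _ (n.+1%:R * (kappa * Per (E `&` over (rring a b))))).
    by rewrite mulrCA ler_pM2l.
  apply: (@le_trans _ _ (n.+1%:R * c)); first by rewrite ler_pM2l.
  have -> // : n.+1%:R * c = kappa / 2 * phi s ^+ n.
  rewrite /c /q; move: (n.+1%:R) N0 => N N0; field; exact: lt0r_neq0.
rewrite ler_pM2r//; move: (kappa) k0 => k k0; lra.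
Qed.

Hypothesis small : 4 * n.+1%:R ^+ 2 * nroot n (fine (vol E)) < kappa * T.

Lemma empty_ring : exists2 s : R, 0 <= s < T & w s = 0.
Proof.
have /andP[k0 k1] := kp.
have N0 : 0 < 4 * n.+1%:R ^+ 2 :> R by rewrite mulr_gt0// exprn_gt0.
have q0 : 0 < q by rewrite divr_gt0.
apply: contrapT => /forall2NP H.
have wp (s : R) : 0 <= s < T -> 0 < w s.
  move=> hs; rewrite lt_neqAle w_ge0 andbT; apply/negP => /eqP e.
  by case: (H s) => //; rewrite -e.
have mono (s t : R) : 0 <= s -> s <= t -> t < T -> phi t <= phi s.
  move=> s0 st tT; apply: nroot_le; [exact: w_ge0|]; apply: fine_vol_sub => //; try exact: measurable_shell.
  by apply: shell_sub; move: r0 T0 s0 st tT; move: r T s t => r' T' s t; lra.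
have D := dini_decrease mono (fun s hs => ring_decrease hs (wp s hs)).
have p0 : phi 0 < q * T.
  apply: (@le_lt_trans _ _ (nroot n (fine (vol E)))).
    apply: nroot_le; [exact: w_ge0|]; rewrite -[in leRHS](setIT E); apply: fine_vol_sub => //; exact: measurable_shell.
  by rewrite /q mulrAC ltr_pdivlMr// mulrC.
(* At the midpoint of phi 0 / q and T the linear bound on phi is negative. *)
pose t := (phi 0 / q + T) / 2.
have pq : phi 0 / q < T by rewrite ltr_pdivrMr// mulrC.
have pq0 : 0 <= phi 0 / q by rewrite divr_ge0 ?nroot_ge0// ltW.
have tT : 0 <= t < T by rewrite /t; move: (phi 0 / q) pq pq0 => u; lra.
have := D t tT; apply/negP; rewrite -ltNge; apply: (@lt_le_trans _ _ 0); last exact: nroot_ge0.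
rewrite subr_lt0 mulrC -ltr_pdivrMr// /t; move: (phi 0 / q) pq => u; lra.
Qed.

Hypothesis Hcut : forall b : R, r <= b -> BVset (E `\` over (far b)) ->
  cap beta E <= cap beta (E `\` over (far b)).

Lemma confined : vol (E `&` over (far (r + T))) = 0%E.
Proof.
have /andP[k0 k1] := kp.
have [s /andP[s0 sT] ws] := empty_ring.
(* Shells of width at most T - s just inside the middle radius lie in the empty ring, so the cut
   there is free. *)
pose b := r + T; pose d := Num.min (T - s) (b / 2).
have b0 : 0 < b by rewrite addr_gt0.
have d0 : 0 < d by rewrite lt_min subr_gt0 sT divr_gt0.
pose h (k : nat) : R := d / k.+1%:R.
have hk k : [/\ 0 < h k, h k <= T - s & 2 * h k <= b].
  have /andP[x1 x2] := inv_seq_bound k d0.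
  have m1 : d <= T - s by rewrite /d ge_min lexx.
  have m2 : d <= b / 2 by rewrite /d ge_min lexx orbT.
  by rewrite -/(h k) in x1 x2; move: (h k) x1 x2 => u x1 x2; split; lra.
have hl : h @ \oo --> (0 : R) := inv_seq_cvg d.
have hc k : 2 / h k * fine (vol (E `&` shell (b - h k) b)) <= 0.
  have [x1 x2 x3] := hk k.
  have : fine (vol (E `&` shell (b - h k) b)) <= w s.
    apply: fine_vol_sub => //; try exact: measurable_shell.
    by have [*] := middle_order x1 x2 r0 T0 s0 sT; apply: shell_sub.
  rewrite ws => hw; have : fine (vol (E `&` shell (b - h k) b)) = 0 by apply/le_anti; rewrite hw fine_ge0.
  by move=> ->; rewrite mulr0.
have h2 k : 0 < h k /\ 2 * h k <= b by have [] := hk k.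
have [b1 b2] := outer_cut bE h2 hl hc.
rewrite mulr0 addr0 -/(far b) in b1 b2 * => P12.
have := @Hcut b _ b2; rewrite lerDl (ltW T0) => /(_ isT).
rewrite /cap (Tr_split mbeta kp hb bE (measurable_far b)) => hr.
have hT := Tr_le mbeta kp hb b1.
apply: Per0_null b1 _.
have := Per_ge0 (E `&` over (far b)).
move: P12 hr hT; move: (Per (E `&` _)) (Per (E `\` _)) (Per E) (Tr _ (E `&` _)) (Tr _ (E `\` _)) => u1 u2 u3 u4 u5 p1 p2 p3 p4.
have : kappa * u1 <= 0 by lra.
by rewrite pmulr_rle0// => h5; apply/le_anti; rewrite h5.
Qed.

End slab.
End confinement.

(** * Existence of minimizers *)

Section cylinders.
Variables (R : realType) (n : nat).
Hypothesis n1 : (1 <= n)%N.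
Local Notation mR := (measurableTypeR R).
Local Notation X := 'rV[R]_n.
Local Notation V := (Rn1 R n).
Local Notation leb := (leb R n).
Local Notation vol := (vol R n).
Local Notation Om := (@Omega R n).

Lemma cut_cyl (E : set V) (K b : R) : 0 < b -> E `<=` Om -> E `<=` below K ->
  E `&` cyl b%:E K = E `\` over (far b).
Proof.
move=> b0 EO EK; apply/seteqP; split => p.
  by move=> [Ep /(cylE _ _ b0)[h _ _]]; split => //; rewrite /over/= /far/= leNgt h.
move=> [Ep /negP]; rewrite -ltNge => h; split => //; apply/(cylE _ _ b0).
by split => //; [exact: EO|exact: EK].
Qed.

Lemma cut_cyl_oo (E : set V) (K : R) : E `<=` Om -> E `&` cyl +oo K = E `&` below K.
Proof.
move=> EO; apply/seteqP; split => p; first by move=> [Ep [_ /andP[]]].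
by move=> [Ep h]; split => //; split; [exact: ltry|rewrite (EO p Ep)].
Qed.

Lemma sqnZ (c : R) (y : X) : sqn (c *: y) = c ^+ 2 * sqn y.
Proof. by rewrite /sqn mulr_sumr; apply: eq_bigr => i _; rewrite mxE exprMn. Qed.

(** Points at distance a from the axis are reached by shrinking horizontally by 1 - 1 / (k+2). It
    identifies the rings removed in the hypothesis on V with open rings. *)
Lemma closure_cyl (K a : R) (p : V) : 0 < a -> 0 < p.2 < K ->
  closure (cyl a%:E K : set V) p <-> sqn p.1 <= a ^+ 2.
Proof.
move=> a0 /andP[p0 pK]; split => [cp|h].
  have cl : closed [set q : V | sqn q.1 <= a ^+ 2].
    rewrite (_ : [set q : V | _] = (fun q : V => sqn q.1) @^-1` [set x | x <= a ^+ 2])//.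
    by apply: closed_comp; [move=> q _; apply: C1_continuous; exact: C1_sqn1|exact: closed_le].
  rewrite closureE in cp; apply: (cp [set q : V | sqn q.1 <= a ^+ 2]); split => // q.
  by move=> /(cylE _ _ a0)[/ltW].
pose u (k : nat) : V := ((1 - k.+2%:R^-1) *: p.1, p.2).
have uc : u @ \oo --> p.
  have c1 : (fun k : nat => 1 - k.+2%:R^-1) @ \oo --> (1 : R).
    rewrite -[X in _ --> X]subr0; apply: cvgB; first exact: cvg_cst.
    by rewrite (cvg_shiftS (fun k : nat => k.+1%:R^-1 : R)); exact: cvg_harmonic.
  rewrite [X in _ --> X](_ : p = (1 *: p.1, p.2)); last by rewrite scale1r -surjective_pairing.
  apply: (@cvg_pair _ _ _ (nbhs \oo) (nbhs (1 *: p.1)) (nbhs (p.2))); last exact: cvg_cst.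
  by apply: cvgZr_tmp.
apply: (@closed_cvg _ _ \oo _ u (closure (cyl a%:E K))) uc.
- exact: closed_closure.
- apply: nearW => k; apply: subset_closure; apply/(cylE _ _ a0); split => //=.
  have k0 : 0 < k.+2%:R^-1 :> R by rewrite invr_gt0.
  have k1 : k.+2%:R^-1 < 1 :> R by rewrite invf_lt1// ltr1n.
  rewrite sqnZ; move: (k.+2%:R^-1) k0 k1 (sqn_ge0 p.1) => e e0 e1 s0.
  apply: (@le_lt_trans _ _ ((1 - e) ^+ 2 * a ^+ 2)); first by rewrite ler_wpM2l ?sqr_ge0.
  by rewrite gtr_pMl ?exprn_gt0// expr_lt1 ?subr_ge0 ?ltW// gtrBl.
Qed.

Lemma cut_ring (E : set V) (K a b : R) : 0 < a -> 0 < b -> E `<=` Om -> E `<=` below K ->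
  E `\` (cyl b%:E K `\` closure (cyl a%:E K)) = E `\` over (rring a b).
Proof.
move=> a0 b0 EO EK; apply/seteqP; split => p [Ep np]; split => // hp; apply: np.
  have pO := EO p Ep; have pK := EK p Ep; rewrite /below/= in pK.
  have /andP[h1 h2] : a ^+ 2 < sqn p.1 < b ^+ 2 := hp.
  split; first by apply/(cylE _ _ b0).
  by move/(closure_cyl a0); rewrite pO pK => /(_ isT); rewrite leNgt h1.
have pO := EO p Ep; have pK := EK p Ep; rewrite /below/= in pK.
move: hp => [/(cylE _ _ b0)[h1 _ _] h2]; rewrite /over/= /rring/= h1 andbT ltNge; apply/negP => h3.
by apply: h2; apply/(closure_cyl a0) => //; rewrite pO.
Qed.

Lemma reflect_cyl (K b : R) (p q : V) : 0 < b -> cyl b%:E K q -> cyl b%:E K (reflect p q) -> cyl b%:E K p.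
Proof.
move=> b0 /(cylE _ _ b0)[q1 q2 q3] /(cylE _ _ b0)[]; rewrite /reflect/= => r1 r2 r3; apply/(cylE _ _ b0).
have e i : p.1 ord0 i ^+ 2 <= 2^-1 * (q.1 ord0 i ^+ 2) + 2^-1 * ((p.1 *+ 2 - q.1) ord0 i ^+ 2).
  rewrite !mxE mulr2n; move: (p.1 ord0 i) (q.1 ord0 i) => u v.
  have : 0 <= (u - v) ^+ 2 by exact: sqr_ge0.
  rewrite (_ : 2^-1 * v ^+ 2 + 2^-1 * (u + u - v) ^+ 2 = u ^+ 2 + (u - v) ^+ 2); last by field.
  by rewrite lerDl.
have : sqn p.1 <= 2^-1 * sqn q.1 + 2^-1 * sqn (p.1 *+ 2 - q.1).
  by rewrite /sqn !mulr_sumr -big_split/=; apply: ler_sum => i _; exact: e.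
move: q1 r1; move: (sqn q.1) (sqn (_ - _)) (sqn p.1) => u v w h1 h2 h3.
move: q2 q3 r2 r3; rewrite mulr2n; move: (p.2 : R) (q.2 : R) => x y h4 h5 h6 h7.
by split; lra.
Qed.

Lemma eball_reflect (p q : V) (h : R) : eball p h (reflect p q) <-> eball p h q.
Proof.
have e : enorm (reflect p q - p) = enorm (q - p).
  rewrite !enormE; congr Num.sqrt; apply: eq_bigr => i _.
  have -> : reflect p q - p = - (q - p).
    by apply: comp_inj => -[j|]; rewrite /reflect/= ?mxE ?mulr2n; [move: (p.1 ord0 j) (q.1 ord0 j)|move: (p.2 : R) (q.2 : R)] => u v; ring.
  by rewrite linearN sqrrN.
by rewrite /eball/= e.
Qed.

Lemma half_ratio (x y z : R) : 0 <= x -> y + y <= x -> z <= y -> z / x <= 2^-1.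
Proof.
move=> x0 h1 h2; have [->|xn] := eqVneq x 0; first by rewrite invr0 mulr0 invr_ge0.
have xp : 0 < x by rewrite lt_neqAle eq_sym xn.
by rewrite ler_pdivrMr//; lra.
Qed.

(** If p is not in the cylinder C, no point and its mirror image in p are both in C, by convexity.
    The reflection preserves the balls about p, so C fills at most half of each. *)
Lemma dens1_cyl (E : set V) (K b : R) : 0 < b -> measurable E ->
  vol (E `\` cyl b%:E K) = 0%E -> measurable (cyl b%:E K : set V) -> dens1 E `<=` cyl b%:E K.
Proof.
move=> b0 mE E0 mC p dp; apply: contrapT => Cp.
have half (h : R) : fine (vol (E `&` eball p h)) / fine (vol (eball p h)) <= 2^-1.
  have mB := measurable_eball p h.
  (* [fine] sends an infinite volume to 0 and the inverse of 0 is 0, so the ratio is 0 in that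
     case. *)
  have [Boo|] := boolP (vol (eball p h) \is a fin_num); last first.
    by rewrite ge0_fin_numE// ltey negbK => /eqP ->; rewrite /= invr0 mulr0 invr_ge0.
  pose D := cyl b%:E K `&` eball p h.
  have mD : measurable D by exact: measurableI.
  have mD' : measurable (reflect p @^-1` D).
    by rewrite -[X in measurable X]setTI; exact: measurable_reflect.
  have two : (vol D + vol D <= vol (eball p h))%E.
    rewrite -{2}(vol_reflect p mD) -measureU//.
    - apply: le_meas; [by apply: measurableU|by []|].
      by move=> q [[_ //]|[_ /eball_reflect]].
    - by rewrite -subset0 => q [[Cq _] [Cq' _]]; apply: Cp; exact: reflect_cyl Cq Cq'.
  have leD : (vol (E `&` eball p h) <= vol D)%E.
    have sub : E `&` eball p h `<=` D `|` (E `\` cyl b%:E K).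
      by move=> q [Eq Bq]; have [Cq|Cq] := pselect (cyl b%:E K q); [left|right].
    have mEC : measurable (E `\` cyl b%:E K) by exact: measurableD.
    apply: (@le_trans _ _ (vol (D `|` (E `\` cyl b%:E K)))).
      by apply: le_meas => //; [exact: measurableI|exact: measurableU].
    have := measureU2 vol mD mEC.
    by rewrite [X in (_ <= _ + X)%E -> _](_ : _ = 0%E) ?adde0//; exact: E0.
  have Doo : vol D \is a fin_num.
    by rewrite ge0_fin_numE//; apply: (@le_lt_trans _ _ (vol (eball p h))); [apply: le_meas => // q []|rewrite -ge0_fin_numE].
  have Eoo : vol (E `&` eball p h) \is a fin_num.
    by rewrite ge0_fin_numE//; apply: (le_lt_trans leD); rewrite -ge0_fin_numE.
  apply: (@half_ratio _ (fine (vol D))); first exact: fine_ge0.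
    by move: two; rewrite -{1 2}(fineK Doo) -{1}(fineK Boo) -EFinD lee_fin.
  by move: leD; rewrite -{1}(fineK Doo) -{1}(fineK Eoo) lee_fin.
have : (1 : R) <= 2^-1 by apply: (cvgr_to_le dp); apply: nearW => h; exact: half.
by lra.
Qed.

End cylinders.

(** * Minimizers in cylinders and on the half-space *)

Section minimization.
Variables (R : realType) (n : nat).
Hypothesis n1 : (1 <= n)%N.
Local Notation mR := (measurableTypeR R).
Local Notation X := 'rV[R]_n.
Local Notation V := (Rn1 R n).
Local Notation leb := (leb R n).
Local Notation vol := (vol R n).
Local Notation Om := (@Omega R n).

Lemma top_order (c s h : R) : 0 < c -> 0 <= s -> 0 <= h -> s + h <= 1 ->
  [/\ 0 <= c + 1 - (s + h), c + 1 - (s + h) <= c + 1 - s, 0 <= c + 1 - s & c <= c + 1 - s - h].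
Proof. by move=> *; split; lra. Qed.

Lemma L1_symd (F E : set V) : BVset F -> measurable E -> E `<=` Om -> (vol E < +oo)%E ->
  (\int[vol]_(p in Om) `|\1_F p - \1_E p|%:E)%E = (symd F E)%:E.
Proof.
move=> bF mE EO Eoo; have mF := BVset_measurable bF; have FO := BVset_sub bF; have Foo := BVset_vol bF.
have m1 : measurable (F `\` E) by exact: measurableD.
have m2 : measurable (E `\` F) by exact: measurableD.
have f1 : vol (F `\` E) \is a fin_num.
  by rewrite ge0_fin_numE//; apply: le_lt_trans Foo; apply: le_meas => // p [].
have f2 : vol (E `\` F) \is a fin_num.
  by rewrite ge0_fin_numE//; apply: le_lt_trans Eoo; apply: le_meas => // p [].
have disj : (F `\` E) `&` (E `\` F) = set0 by rewrite -subset0 => p [[Fp nE] [Ep _]].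
transitivity (\int[vol]_(p in Om) (\1_((F `\` E) `|` (E `\` F)) p)%:E)%E.
  apply: eq_integral => p _; congr EFin; rewrite !indicE.
  rewrite in_setU !in_setD; case: (p \in F); case: (p \in E); rewrite /= ?(subrr, subr0, sub0r, normrN, normr0, normr1)//.
rewrite integral_indic; [|exact: measurable_Omega|exact: measurableU].
have -> : ((F `\` E) `|` (E `\` F)) `&` Om = (F `\` E) `|` (E `\` F).
  by apply/setIidPl => p [[/FO]|[/EO]].
by rewrite measureU// /symd EFinD !fineK.
Qed.

Variables (beta : X -> R) (kappa : R).
Hypothesis mbeta : measurable_fun setT beta.
Hypothesis kp : 0 < kappa <= 2^-1.
Hypothesis hb : forall y, -1 <= beta y <= 1 - 2 * kappa.

Lemma cap_ge0 (E : set V) : BVset E -> 0 <= cap beta E.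
Proof.
move=> bE; apply: le_trans (cap_ge mbeta kp hb bE).
by have /andP[/ltW k0 _] := kp; rewrite !mulr_ge0// Per_ge0.
Qed.

(** The removed part has nonnegative capillary energy, so its removal costs at most the cut
    itself. *)
Lemma cap_cut (E : set V) (Q : set X) (c : R) : BVset E -> measurable Q -> BVset (E `&` over Q) ->
  Per (E `&` over Q) + Per (E `\` over Q) <= Per E + 2 * c ->
  cap beta (E `\` over Q) <= cap beta E + 2 * c.
Proof.
move=> bE mQ b1; have := cap_ge0 b1; rewrite /cap (Tr_split mbeta kp hb bE mQ).
move: (Per (E `&` _)) (Per (E `\` _)) (Per E) (Tr _ (E `&` _)) (Tr _ (E `\` _)) => u1 u2 u3 u4 u5; lra.
Qed.

Lemma cap_cut_height (E : set V) (l : R) : BVset E -> 0 < l ->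
  [/\ BVset (E `&` below l), cap beta (E `&` below l) <= cap beta E &
  (0 < vol (E `\` below l))%E -> cap beta (E `&` below l) < cap beta E].
Proof.
move=> bE l0; have mE := BVset_measurable bE; pose i := Ordinal n1.
have [b1 P1] := cut_height i bE l0.
have tr : Tr beta (E `&` below l) = Tr beta E by rewrite /Tr near0_cut_height.
split; [exact: b1|by rewrite /cap tr lerD2r|].
move=> v0; have := cut_height_strict i bE l0 v0; rewrite /cap tr => P2.
by rewrite ltrD2r.
Qed.

Variables (Vf : set V -> \bar R) (r K m : R).
Hypotheses (hr : 0 < r) (hK : 1 < K).
Hypothesis hVm : forall E, BVset E -> (m%:E <= Vf E)%E.
Hypothesis hVfin : (Vf (cyl r%:E K) < +oo)%E.
Hypothesis hVcut : forall E (rho : \bar R) (l : R), BVset E ->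
     (r%:E < rho)%E -> K - 1 < l < K + 1 -> (Vf (E `&` cyl rho l) <= Vf E)%E.
Hypothesis hVring : forall E (rho1 rho2 : R), BVset E -> r < rho2 -> rho2 < rho1 ->
     (Vf (E `\` (cyl rho1%:E K `\` closure (cyl rho2%:E K))) <= Vf E)%E.
Hypothesis hVlsc : L1_lsc Vf.

Let K0 : 0 < K. Proof. exact: lt_trans hK. Qed.
Let KK : K - 1 < K < K + 1. Proof. by rewrite gtrDl oppr_lt0 ltrDl ltr01. Qed.

Definition energy (E : set V) : \bar R := ((cap beta E)%:E + Vf E)%E.

Lemma energy_le (E : set V) (S : R) : BVset E -> (energy E <= S%:E)%E -> cap beta E <= S - m.
Proof.
move=> bE; have := hVm bE; rewrite /energy; move: (cap beta E) (Vf E) => c [v| |]//=.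
by rewrite -EFinD !lee_fin => h1 h2; lra.
Qed.

(** [Vf E] lies between m and a finite bound, so it is finite and can be cancelled. *)
Lemma energy_cap (E F : set V) (S : R) : BVset E -> (energy E <= S%:E)%E -> (Vf F <= Vf E)%E ->
  (energy E <= energy F)%E -> cap beta E <= cap beta F.
Proof.
move=> bE ES FE EF; have : (energy E <= (cap beta F)%:E + Vf E)%E by apply: (le_trans EF); exact: leeD2l.
have := hVm bE; move: ES; rewrite /energy; move: (cap beta E) (cap beta F) (Vf E) => c d [v| |]//= _ _.
by rewrite -!EFinD lee_fin; lra.
Qed.

Lemma Vf_far (E : set V) (b : R) : BVset E -> E `<=` below K -> r < b -> (Vf (E `\` over (far b)) <= Vf E)%E.
Proof.
move=> bE EK rb; rewrite -(cut_cyl (lt_trans hr rb) (BVset_sub bE) EK); apply: hVcut => //.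
Qed.

Lemma Vf_ring (E : set V) (a b : R) : BVset E -> E `<=` below K -> r < a -> a < b ->
  (Vf (E `\` over (rring a b)) <= Vf E)%E.
Proof.
move=> bE EK ra ab; have a0 := lt_trans hr ra.
rewrite -(cut_ring a0 (lt_trans a0 ab) (BVset_sub bE) EK); exact: hVring.
Qed.

Lemma Vf_below (E : set V) : BVset E -> (Vf (E `&` below K) <= Vf E)%E.
Proof.
move=> bE; rewrite -(cut_cyl_oo K (BVset_sub bE)); apply: hVcut => //.
by rewrite ltry.
Qed.

Section confined_minimizers.
Variables (S a : R).
Hypothesis hS : kappa * a = S - m.

Definition radius0 : R :=
  r + 1 + Num.max (8 ^+ (n ^ 2 + n + 1) * a `^ (n.+1%:R / n%:R)) (4 * mu_const n kappa).

(** The width of the ring between the radii r + 1/2 and R_0; it exceeds the maximum in R_0 by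
    1/2. *)
Let W : R := radius0 - r - 2^-1.

(** [confined] in the ring from r + 1/2 to R_0, so that all the radii used are larger than r, as the
    hypotheses on V ask. Minimality is required among subsets of E only: this covers both the
    minimizers in a cylinder and the global minimizers cut at height K. *)
Lemma minimal_confined (E : set V) : BVset E -> E `<=` below K ->
  (forall F, BVset F -> F `<=` E -> (energy E <= energy F)%E) -> (energy E <= S%:E)%E ->
  exists b, [/\ r < b, b < radius0 & vol (E `&` over (far b)) = 0%E].
Proof.
move=> bE EK minE ES; have /andP[k0 k1] := kp.
have capE := energy_le bE ES.
have a0 : 0 <= a by rewrite -(pmulr_rge0 _ k0) hS; apply: le_trans capE; exact: cap_ge0.
(* [M] is a lower bound of [mu_const] that satisfies M^n kappa^(n+1) = 1. *)
pose A : R := a `^ (n.+1%:R / n%:R); pose M : R := (kappa^-1) `^ (n.+1%:R / n%:R).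
have ki0 : 0 <= kappa^-1 by rewrite invr_ge0 ltW.
have M0 : 0 < M by rewrite powR_gt0// invr_gt0.
pose mx : R := Num.max (8 ^+ (n ^ 2 + n + 1) * A) (4 * mu_const n kappa).
have hW : W = 2^-1 + mx.
  by rewrite /W /radius0 -/A -/mx; move: (mx) => u; field.
have WA : 8 ^+ (n ^ 2 + n + 1) * A <= W.
  by rewrite hW; apply: (@le_trans _ _ mx); [rewrite /mx le_max lexx|rewrite lerDr].
have WM : 4 * M <= W.
  have h1 : 4 * mu_const n kappa <= mx by rewrite /mx le_max lexx orbT.
  have h2 : 4 * M <= 4 * mu_const n kappa.
    rewrite ler_pM2l//; apply: ge0_ler_powR; rewrite ?nnegrE ?addr_ge0//; by rewrite lerDl.
  by rewrite hW; apply: (le_trans h2); apply: (le_trans h1); rewrite lerDr.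
have W0 : 0 < W by apply: lt_le_trans WM; rewrite mulr_gt0.
have PE : 2 * nroot n (fine (vol E)) ^+ n <= n.+1%:R * a.
  have iso := iso_root n1 bE.
  have cg := cap_ge mbeta kp hb bE.
  have Pa : 2 * Per E <= a.
    rewrite -(ler_pM2l k0) hS; apply: le_trans capE; apply: le_trans cg.
    by rewrite mulrA (mulrC kappa).
  apply: (@le_trans _ _ (2 * (n.+1%:R * Per E))); first by rewrite ler_pM2l.
  by rewrite mulrCA ler_pM2l.
have hA : A ^+ n = a ^+ n.+1 by exact: powR_ratK.
have hM : M ^+ n * kappa ^+ n.+1 = 1.
  by rewrite /M powR_ratK// -exprMn mulVf ?expr1n// gt_eqF.
have ar := width_arith n1 a0 k0 (nroot_ge0 n (fine (vol E))) (powR_ge0 _ _) (ltW M0) hA hM PE WA WM W0.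
have T0 : 0 < W / 2 by rewrite divr_gt0.
have r20 : 0 < r + 2^-1 by rewrite addr_gt0.
have sm : 4 * n.+1%:R ^+ 2 * nroot n (fine (vol E)) < kappa * (W / 2).
  move: ar; move: (n.+1%:R) (nroot _ _) (kappa) (W) => N x k w h.
  have : 4 * N ^+ 2 * x * 2 < kappa * 0 + k * w by rewrite mulr0 add0r; apply: le_lt_trans h; rewrite le_eqVlt; apply/orP; left; apply/eqP; ring.
  by rewrite mulr0 add0r mulrA ltr_pdivlMr.
exists (r + 2^-1 + W / 2); split.
- by rewrite -addrA ltrDl addr_gt0.
- by rewrite /W in W0 *; move: (radius0) W0 => x h; lra.
apply: (@confined R n n1 beta kappa mbeta kp hb E (r + 2^-1) (W / 2) bE r20 T0 _ sm).
  move=> x y rx xy bF; apply: (energy_cap bE ES).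
    by apply: Vf_ring => //; apply: lt_le_trans rx; rewrite ltrDl.
  by apply: minE => // p [].
move=> x rx bF; apply: (energy_cap bE ES).
  by apply: Vf_far => //; apply: lt_le_trans rx; rewrite ltrDl.
by apply: minE => // p [].
Qed.

End confined_minimizers.

(** It distributes a strict inequality between the two terms of the energy, whose lower
    semicontinuity is known separately; v may be infinite. *)
Lemma adde_split (c i : R) (v : \bar R) : (m%:E <= v)%E -> (i%:E < c%:E + v)%E ->
  exists c1 v1 : R, [/\ c1 < c, (v1%:E < v)%E & i < c1 + v1].
Proof.
case: v => [v| |] // mv.
  rewrite -EFinD lte_fin => h; exists (c - (c + v - i) / 3), (v - (c + v - i) / 3).
  by rewrite lte_fin; split; lra.
move=> _; exists (c - 1), (i - c + 2); split; [lra|exact: ltry|lra].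
Qed.

Lemma energy_split (E : set V) (x v1 : R) : (energy E <= x%:E)%E -> (v1%:E < Vf E)%E -> cap beta E <= x - v1.
Proof.
rewrite /energy; move: (cap beta E) (Vf E) => c [v| |]//=.
by rewrite -EFinD lee_fin lte_fin; lra.
Qed.

Lemma cyl_vcube (rho : R) : 0 < rho -> exists k : nat, (cyl rho%:E K : set V) `<=` @vcube R n k /\ (cyl rho%:E K : set V) `<=` over (kub 0 k%:R).
Proof.
move=> r0.
have tk : \forall k \near \oo, rho + K < (k%:R : R) by exact: nbhs_infty_gtr.
have [k hk] := filter_ex tk; exists k.
have kr : rho < k%:R by apply: lt_trans hk; rewrite ltrDl.
have kK : K < k%:R by apply: lt_trans hk; rewrite ltrDr.
have coord (p : V) j : cyl rho%:E K p -> `|p.1 ord0 j| < k%:R.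
  move=> /(cylE _ _ r0)[h1 h2 h3].
  rewrite -ltr_sqr ?nnegrE// real_normK ?num_real//.
  apply: (le_lt_trans (sqn_ge _ _)); apply: (lt_trans h1).
  by rewrite ltr_sqr ?nnegrE// ltW.
split => p hp; last by apply/kubP => j; rewrite mxE subr0; exact: coord.
split => [j|] /=; rewrite in_itv/=; first by rewrite -ltr_norml; exact: coord.
move: hp => /(cylE _ _ r0)[h1 h2 h3].
by rewrite (lt_trans h3)// (lt_trans _ h2)// oppr_lt0 (lt_trans r0).
Qed.

Definition admissible (rho : R) (E : set V) : Prop := BVset E /\ E `<=` cyl rho%:E K.

Lemma cyl_le (b c : R) : b <= c -> cyl b%:E K `<=` (cyl c%:E K : set V).
Proof. by move=> bc p [h1 h2]; split => //; apply: (lt_le_trans h1); rewrite lee_fin. Qed.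

Lemma admissible_cyl (rho : R) : r <= rho -> admissible rho (cyl r%:E K).
Proof. by move=> rr; split; [exact: BVset_cyl|exact: cyl_le]. Qed.

Lemma energy_cyl : (energy (cyl r%:E K) < +oo)%E.
Proof. by rewrite /energy lte_add_pinfty// ltry. Qed.

Lemma energy_ge (E : set V) : BVset E -> (m%:E <= energy E)%E.
Proof.
move=> bE; rewrite -[leLHS]add0e; apply: leeD; last exact: hVm.
by rewrite lee_fin cap_ge0.
Qed.

Lemma inf_energy_fin (rho : R) : r <= rho -> ereal_inf [set energy E | E in admissible rho] \is a fin_num.
Proof.
move=> rr; rewrite fin_numElt; apply/andP; split.
  apply: (@lt_le_trans _ _ m%:E); first exact: ltNyr.
  by apply: le_ereal_inf_tmp => _ [E [bE _] <-]; exact: energy_ge.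
apply: le_lt_trans energy_cyl; apply: ereal_inf_lbound.
by exists (cyl r%:E K) => //; exact: admissible_cyl.
Qed.

(** The direct method. If the limit set had energy above the infimum i, then by [adde_split] V would
    eventually exceed v1 along the sequence, so the capillary energies would be at most c1, hence
    also that of the limit. *)
Lemma exists_min_cyl (rho : R) : r <= rho ->
  exists E, admissible rho E /\ forall F, admissible rho F -> (energy E <= energy F)%E.
Proof.
move=> rr; have rho0 : 0 < rho by apply: lt_le_trans rr.
have Ifin := inf_energy_fin rr.
set I := ereal_inf _ in Ifin; pose i := fine I; have iI : I = i%:E by rewrite fineK.
have hF k : exists F, admissible rho F /\ (energy F <= (i + k.+1%:R^-1)%:E)%E.
  have k0 : (0 : R) < k.+1%:R^-1 by rewrite invr_gt0.
  have [_ [F aF <-] hF] := lb_ereal_inf_adherent k0 Ifin.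
  by exists F; split => //; apply: ltW; rewrite EFinD -iI.
have [F aF] := choice hF.
have bF k : BVset (F k) by have [[]] := aF k.
have Fc k : F k `<=` cyl rho%:E K by have [[]] := aF k.
have Fi k : (energy (F k) <= (i + k.+1%:R^-1)%:E)%E by have [] := aF k.
have /andP[k0 k1] := kp.
have ki k : k.+1%:R^-1 <= (1 : R) by rewrite invf_le1// ler1n.
have capF k : cap beta (F k) <= i + 1 - m.
  by apply: energy_le => //; apply: (le_trans (Fi k)); rewrite lee_fin lerD2l.
have PF k : Per (F k) <= (i + 1 - m) / (2 * kappa).
  rewrite ler_pdivlMr ?mulr_gt0// mulrC; apply: le_trans (capF k); exact: cap_ge.
have [k2 [cv ck]] := cyl_vcube rho0.
have [sg [E [sgk mE EF symE]]] := precompact bF (fun k => subset_trans (Fc k) cv) PF.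
have Ec : E `<=` cyl rho%:E K by move=> p /EF[k _ /Fc].
have EO : E `<=` Om by move=> p /Ec[_ /andP[]].
have Eoo : (vol E < +oo)%E.
  apply: le_lt_trans (vol_vcube R n k2); apply: le_meas => //; [exact: measurable_vcube|exact: subset_trans cv].
have Ek := subset_trans Ec ck.
have Fk k : F k `<=` over (kub 0 k2%:R) := subset_trans (Fc k) ck.
(* A first use with a crude bound, to know that E has finite perimeter: the semicontinuity of V
   speaks of such sets only. *)
have [bE _] := lsc mbeta kp hb (fun k => bF (sg k)) (fun k => Fk (sg k)) Ek mE EO Eoo symE (fun k => PF (sg k)) (fun k => capF (sg k)).
exists E; split; [by split|move=> G aG]; apply: (@le_trans _ _ I); last by apply: ereal_inf_lbound; exists G.
rewrite iI leNgt; apply/negP => hi.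
have [c1 [v1 [hc hv hcv]]] := adde_split (hVm bE) hi.
have L1 : (\int[vol]_(p in Om) `|\1_(F (sg k)) p - \1_E p|%:E)%E @[k --> \oo] --> 0%E.
  under eq_fun do rewrite (L1_symd (bF _) mE EO Eoo).
  by apply: cvg_EFin; [exact: nearW|exact: symE].
have := hVlsc (fun k => bF (sg k)) bE L1.
move=> /(lt_le_trans hv)/lt_limn_einf ev1.
have ev2 : \forall k \near \oo, (c1 + v1 - i)^-1 < (k%:R : R) by exact: nbhs_infty_gtr.
have [k3 _ hk3] := filterI ev1 ev2.
have c1F k : cap beta (F (sg (k + k3)%N)) <= c1.
  have [h1 h2] := hk3 (k + k3)%N (leq_addl _ _).
  have h3 := energy_split (Fi (sg (k + k3)%N)) h1.
  apply: (le_trans h3).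
  have pos : 0 < c1 + v1 - i by rewrite subr_gt0.
  have h4 : (sg (k + k3)%N).+1%:R^-1 <= c1 + v1 - i.
    rewrite invf_ple ?posrE//; apply: (le_trans (ltW h2)); rewrite ler_nat.
    by apply: (leq_trans (sgk (k + k3)%N)).
  by move: h4; move: ((sg _).+1%:R^-1) => u; lra.
have symE' : (fun k => symd (F (sg (k + k3)%N)) E) @ \oo --> (0 : R).
  by rewrite (cvg_shiftn k3 (fun k => symd (F (sg k)) E)).
have [_ ] := lsc mbeta kp hb (fun k => bF (sg (k + k3)%N)) (fun k => Fk (sg (k + k3)%N)) Ek mE EO Eoo symE' (fun k => PF (sg (k + k3)%N)) c1F.
by rewrite leNgt hc.
Qed.

Lemma far_small (F : set V) (e : R) : BVset F -> 0 < e ->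
  exists k : nat, fine (vol (F `&` over (far k.+1%:R))) < e.
Proof.
move=> bF e0; have mF := BVset_measurable bF.
have Ffin : vol F \is a fin_num by rewrite ge0_fin_numE// BVset_vol.
pose N (k : nat) : set V := F `\` over (far k.+1%:R).
have mO k : measurable (over (far k.+1%:R) : set V) by apply: measurable_over; exact: measurable_far.
have mN k : measurable (N k) by exact: measurableD.
have ndN : nondecreasing_seq N.
  move=> k l kl; apply/subsetPset => p [Fp np]; split => // hp; apply: np.
  apply: le_trans hp; rewrite ler_sqr ?nnegrE// ler_nat ltnS//.
have UN : \bigcup_k N k = F.
  apply/seteqP; split => [p [k _ []]//|p Fp].
  have tk : \forall k \near \oo, sqn p.1 < (k%:R : R) by exact: nbhs_infty_gtr.
  have [k hk] := filter_ex tk; exists k => //; split => // hp.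
  have : k%:R < k.+1%:R ^+ 2 :> R.
    apply: (@lt_le_trans _ _ k.+1%:R); first by rewrite ltr_nat.
    by rewrite expr2 ler_peMr// ler1n.
  by move=> h; move: (lt_trans hk h); rewrite ltNge hp.
have [k hk] : exists k, ((fine (vol F) - e)%:E < vol (N k))%E.
  apply: measure_bigcup_gt => //.
  have -> : vol (\bigcup_k N k) = (fine (vol F))%:E by rewrite fineK// UN.
  by rewrite lte_fin gtrDl oppr_lt0.
exists k.
move: hk; rewrite -(@fineK _ (vol (N k))); last first.
  by rewrite ge0_fin_numE//; apply: (@le_lt_trans _ _ (vol F)); [apply: le_meas => // p []|rewrite -ge0_fin_numE].
rewrite lte_fin => hk.
have := @fine_vol_split R n F (over (far k.+1%:R)) (~` over (far k.+1%:R)) setT bF (mO k) (measurableC (mO k)) measurableT.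
rewrite setICr => /(_ erefl (subsetT _) (subsetT _)); rewrite setIT -setDE -/(N k).
by move: (fine _) (fine _) (fine _) hk => x y z; lra.
Qed.

(** Far out, a ring of width one contains volume at most q / 2. If cutting were expensive at all its
    radii, [dini_decrease] would make this volume fall at the rate q and become negative. *)
Lemma far_cut (F : set V) (e b0 : R) : BVset F -> 0 < e -> 0 < b0 ->
  exists b, [/\ b0 < b, BVset (F `\` over (far b)) & cap beta (F `\` over (far b)) <= cap beta F + e].
Proof.
move=> bF e0 b00.
pose q := e / 4; have q0 : 0 < q by rewrite divr_gt0.
have [k hk] := far_small bF (divr_gt0 q0 (ltr0n R 2)).
pose c := Num.max b0 k.+1%:R; have c0 : 0 < c by rewrite lt_max b00.
have cb : b0 <= c by rewrite le_max lexx.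
have ck : k.+1%:R <= c by rewrite le_max lexx orbT.
pose ph (s : R) := fine (vol (F `&` shell c (c + 1 - s))).
have ph_split (s h : R) : 0 <= s -> 0 < h -> s + h <= 1 ->
    ph (s + h) + fine (vol (F `&` shell (c + 1 - s - h) (c + 1 - s))) <= ph s.
  move=> s0 h0 sh; have [y1 y2 y3 y4] := top_order c0 s0 (ltW h0) sh.
  apply: fine_vol_split => //; try exact: measurable_shell.
  - rewrite -subset0 => p [/andP[p1 p2] /andP[p3 p4]].
    by move: (lt_trans p3 p2); rewrite opprD addrA ltxx.
  - by apply: shell_sub => //; exact: ltW.
  - by apply: shell_sub => //; exact: ltW.
have mono (s t : R) : 0 <= s -> s <= t -> t < 1 -> ph t <= ph s.
  move=> s0 st t1; apply: fine_vol_sub => //; try exact: measurable_shell.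
  have st0 : 0 <= t - s by rewrite subr_ge0.
  have := top_order c0 s0 st0; rewrite (addrC s) subrK => /(_ (ltW t1))[y1 y2 y3 y4].
  by apply: shell_sub => //; exact: ltW.
have [s [d [/andP[s0 s1] d0 hd]]] : exists s d : R, [/\ 0 <= s < 1, 0 < d & forall h : R, 0 < h < d -> ph s - q * h < ph (s + h)].
  apply: contrapT => H.
  have D : forall s : R, 0 <= s < 1 -> forall d : R, 0 < d -> exists2 h : R, 0 < h < d & ph (s + h) <= ph s - q * h.
    move=> s s01 d d0; apply: contrapT => /forall2NP H2; apply: H; exists s, d; split => // h hh.
    by have [//|/negP] := H2 h; rewrite -ltNge.
  (* [dini_decrease] reaches only points before 1; 3/4 is enough, since 3 q / 4 exceeds q / 2. *)
  have h34 : 0 <= (3 / 4 : R) < 1 by apply/andP; split; lra.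
  have := dini_decrease mono D h34.
  have p0 : ph 0 <= q / 2.
    apply: le_trans (ltW hk); apply: fine_vol_sub => //; [exact: measurable_shell|apply: measurable_over; exact: measurable_far|].
    move=> p /andP[h _]; apply: (le_trans _ (ltW h)).
    by rewrite ler_sqr ?nnegrE// ltW.
  have : 0 <= ph (3 / 4) by exact: fine_ge0.
  by move: (ph _) (ph 0) p0 q0 => x y p0 q0; lra.
pose b := c + 1 - s; have bc : c < b by rewrite /b; lra.
pose dd := Num.min (d / 2) (Num.min ((1 - s) / 2) (b / 2)).
have b0' : 0 < b by exact: lt_trans bc.
have s10 : 0 < 1 - s by rewrite subr_gt0.
have dd0 : 0 < dd by rewrite !lt_min; apply/and3P; split; exact: divr_gt0.
pose h (j : nat) : R := dd / j.+1%:R.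
have hj j : [/\ 0 < h j, h j < d, s + h j <= 1 & 2 * h j <= b].
  have /andP[x1 x2] := inv_seq_bound j dd0.
  have m1 : dd <= d / 2 by rewrite /dd ge_min lexx.
  have m2 : dd <= (1 - s) / 2 by rewrite /dd !ge_min lexx orbT.
  have m3 : dd <= b / 2 by rewrite /dd !ge_min lexx !orbT.
  by rewrite -/(h j) in x1 x2; move: (h j) x1 x2 => u x1 x2; split; lra.
have hl : h @ \oo --> (0 : R) := inv_seq_cvg dd.
have h2 j : 0 < h j /\ 2 * h j <= b by have [] := hj j.
have hc j : 2 / h j * fine (vol (F `&` shell (b - h j) b)) <= 2 * q.
  have [x1 x2 x3 x4] := hj j.
  have sp := ph_split s (h j) s0 x1 x3.
  have := hd (h j); rewrite x1 x2 => /(_ isT) h5.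
  rewrite mulrAC ler_pdivrMr// -mulrA ler_pM2l//.
  by rewrite -/b in sp; move: (fine _) (ph s) (ph _) (q * h j) sp h5 => x y z w; lra.
have [b1 b2] := outer_cut bF h2 hl hc.
rewrite -/(far b) in b1 b2 * => P12.
exists b; split; [exact: le_lt_trans cb bc|exact: b2|].
have := cap_cut bF (measurable_far b) b1 P12.
by rewrite (_ : 2 * (2 * q) = e)//; rewrite /q; field.
Qed.

Section global.
Variables (S a : R).
Hypothesis hS : kappa * a = S - m.
Hypothesis hSup : forall rho, r < rho -> (ereal_inf [set energy E | E in admissible rho] <= S%:E)%E.

Lemma radius0_gt : r < radius0 a.
Proof.
rewrite /radius0 -addrA ltrDl; apply: ltr_pwDl => //; rewrite le_max; apply/orP; right.
by rewrite mulr_ge0// powR_ge0.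
Qed.

Lemma admissible_below (rho : R) (E : set V) : admissible rho E -> E `<=` below K.
Proof. by move=> [_ EC] p /EC[_ /andP[]]. Qed.

Lemma admissible_far (E : set V) (b : R) : 0 < b -> E `<=` Om -> E `<=` below K ->
  BVset (E `\` over (far b)) -> admissible b (E `\` over (far b)).
Proof. by move=> b0 EO EK bD; split => //; rewrite -(cut_cyl b0 EO EK); exact: subIsetr. Qed.

(** A minimizer in the larger cylinder has no volume beyond some b < R_0, so it can be cut at R_0 at
    no cost and compared with E. *)
Lemma min_cyl_le (E : set V) : (forall F, admissible (radius0 a) F -> (energy E <= energy F)%E) ->
  forall rho, radius0 a <= rho -> forall G, admissible rho G -> (energy E <= energy G)%E.
Proof.
move=> minE rho rr G aG; have rrho := lt_le_trans radius0_gt rr.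
have [Er [aEr minEr]] := exists_min_cyl (ltW rrho).
apply: le_trans (minEr G aG); have [bEr _] := aEr; have EO := BVset_sub bEr.
have EK := admissible_below aEr.
have ES : (energy Er <= S%:E)%E.
  by apply: le_trans (hSup rrho); apply: le_ereal_inf_tmp => _ [F aF <-]; exact: minEr.
have [b [rb bR null]] := minimal_confined hS bEr EK
  (fun F bF FE => minEr F (conj bF (subset_trans FE aEr.2))) ES.
have b0 := lt_trans hr rb; set R0 := radius0 a in bR *.
have R00 : 0 < R0 by exact: lt_trans bR.
pose d := Num.min (R0 - b) (R0 / 2).
have d0 : 0 < d by rewrite lt_min subr_gt0 bR divr_gt0.
pose h (j : nat) : R := d / j.+1%:R.
have hj j : [/\ 0 < h j, h j <= R0 - b & 2 * h j <= R0].
  have /andP[x1 x2] := inv_seq_bound j d0.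
  have m1 : d <= R0 - b by rewrite /d ge_min lexx.
  have m2 : d <= R0 / 2 by rewrite /d !ge_min lexx orbT.
  by rewrite -/(h j) in x1 x2; move: (h j) x1 x2 => u x1 x2; split; lra.
have hl : h @ \oo --> (0 : R) := inv_seq_cvg d.
have h2 j : 0 < h j /\ 2 * h j <= R0 by have [] := hj j.
have hc j : 2 / h j * fine (vol (Er `&` shell (R0 - h j) R0)) <= 0.
  have [x1 x2 x3] := hj j.
  have v0 : fine (vol (Er `&` shell (R0 - h j) R0)) <= 0.
    have -> : 0 = fine (vol (Er `&` over (far b))) by rewrite null.
    apply: fine_vol_sub => //; [exact: measurable_shell|by apply: measurable_over; exact: measurable_far|].
    move=> p /andP[hp _]; apply: (le_trans _ (ltW hp)).
    have bh : b <= R0 - h j by rewrite lerBrDr addrC -lerBrDr.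
    have b0' := ltW b0; have Rh0 := le_trans b0' bh.
    by rewrite ler_sqr ?nnegrE.
  have -> : fine (vol (Er `&` shell (R0 - h j) R0)) = 0 by apply/le_anti; rewrite v0 fine_ge0.
  by rewrite mulr0.
have [b1 b2] := outer_cut bEr h2 hl hc.
rewrite -/(far R0) in b1 b2 * => P12.
have cD := cap_cut bEr (measurable_far R0) b1 P12.
rewrite mulr0 addr0 in cD.
apply: (@le_trans _ _ (energy (Er `\` over (far R0)))).
  by apply: minE; exact: admissible_far.
by apply: leeD; [rewrite lee_fin|exact: (Vf_far bEr EK radius0_gt)].
Qed.

Lemma energy_below (E : set V) : BVset E -> BVset (E `&` below K) /\ (energy (E `&` below K) <= energy E)%E.
Proof.
move=> bE; have [b1 c1 _] := cap_cut_height bE K0; split => //.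
by apply: leeD; [rewrite lee_fin|exact: Vf_below].
Qed.

Lemma exists_minimizer : exists E, BVset E /\ forall F, BVset F -> (energy E <= energy F)%E.
Proof.
have [E [[bE Ec] minE]] := exists_min_cyl (ltW radius0_gt).
exists E; split; [exact: bE|move=> F bF].
have [bF1 eF1] := energy_below bF.
apply: le_trans eF1; set F1 := F `&` below K in bF1 *.
have F1K : F1 `<=` below K by exact: subIsetr.
apply/lee_addgt0Pr => e e0.
have R00 := lt_trans hr radius0_gt.
(* The competitor becomes bounded at the price of an arbitrary e, and E is minimal in every larger
   cylinder. *)
have [b [Rb bD cD]] := far_cut bF1 e0 R00.
have b0 := lt_trans R00 Rb.
apply: (@le_trans _ _ (energy (F1 `\` over (far b)))).
  apply: (min_cyl_le minE (ltW Rb)); apply: admissible_far => //; exact: BVset_sub.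
rewrite /energy addeAC -EFinD; apply: leeD; first by rewrite lee_fin.
by apply: Vf_far => //; exact: lt_trans radius0_gt Rb.
Qed.

(** A minimizer with volume above K would be strictly improved by the cut at height K. The set cut
    at K is again a minimizer, and [minimal_confined] applies to it. *)
Lemma minimizer_confined (E : set V) : BVset E -> (forall F, BVset F -> (energy E <= energy F)%E) ->
  vol (E `\` cyl (radius0 a)%:E K) = 0%E.
Proof.
move=> bE minE; have mE := BVset_measurable bE.
have R00 := lt_trans hr radius0_gt.
have r1 : r < r + 1 by rewrite ltrDl.
have ES : (energy E <= S%:E)%E.
  by apply: le_trans (hSup r1); apply: le_ereal_inf_tmp => _ [F [bF _] <-]; exact: minE.
have [b1 c1 c2] := cap_cut_height bE K0.
have [_ eF] := energy_below bE.
have n0 : vol (E `\` below K) = 0%E.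
  apply/eqP; rewrite eq_le measure_ge0 andbT leNgt; apply/negP => /c2.
  by rewrite ltNge (energy_cap bE ES (Vf_below bE) (minE _ b1)).
set F := E `&` below K in b1 eF.
have [b [rb bR null]] := minimal_confined hS b1 (@subIsetr _ _ _)
  (fun G bG _ => le_trans eF (minE G bG)) (le_trans eF ES).
have mb : measurable (E `\` below K) by apply: measurableD => //; exact: measurable_below.
have mf : measurable (F `&` over (far b)).
  by apply: measurableI; [exact: BVset_measurable|apply: measurable_over; exact: measurable_far].
have mC : measurable (cyl (radius0 a)%:E K : set V) by apply: BVset_measurable; exact: BVset_cyl.
apply/eqP; rewrite eq_le measure_ge0 andbT -(measure_nullU mb mf n0 null); apply: le_meas.
- exact: measurableD.
- exact: measurableU.
move=> p [Ep Cp]; have [pK|pK] := pselect (below K p); last by left.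
right; split => //; rewrite /over/= /far/= leNgt; apply/negP => h; apply: Cp.
apply/(cylE _ _ R00); split => //; last exact: (BVset_sub bE).
have b0 := ltW (lt_trans hr rb); have R00' := ltW R00.
by apply: (lt_trans h); rewrite ltr_sqr ?nnegrE.
Qed.

End global.

End minimization.

Theorem theoremA3 (R : realType) (n : nat) (hn : (1 <= n)%N)
  (V : set (Rn1 R n) -> \bar R) (r K : R) (hr : 0 < r) (hK : 1 < K)
  (hVNy : forall E, BVset E -> (-oo < V E)%E)
  (hVbelow : exists m : R, forall E, BVset E -> (m%:E <= V E)%E)
  (hVfin : (V (cyl r%:E K) < +oo)%E)
  (hVcut : forall E (rho : \bar R) (l : R), BVset E ->
     (r%:E < rho)%E -> K - 1 < l < K + 1 ->
     (V (E `&` cyl rho l) <= V E)%E)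
  (hVring : forall E (rho1 rho2 : R), BVset E -> r < rho2 -> rho2 < rho1 ->
     (V (E `\` (cyl rho1%:E K `\` closure (cyl rho2%:E K))) <= V E)%E)
  (hVlsc : L1_lsc V)
  (beta : 'rV[R]_n -> R) (hbeta : beta \in Lfun (leb R n) +oo%E)
  (kappa : R) (hkappa : 0 < kappa <= 2^-1)
  (hbetab : \forall x \ae leb R n, -1 <= beta x <= 1 - 2 * kappa) :
  let G := fun E => (capillary beta E + V E)%E in
  (exists E, minimizer G E) /\
  (forall E, minimizer G E ->
     dens1 E `<=` cyl (calR0 n r kappa (frak_a r K kappa V G)) K).
Proof.
move=> G; have /andP[k0 k1] := hkappa; have K0 : 0 < K := lt_trans ltr01 hK.
have mb : measurable_fun setT beta.
  by have := sub_Lfun_mfun hbeta; rewrite inE.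
(* The bounds on beta hold almost everywhere; truncation makes them hold everywhere, and the
   capillary energy does not change. *)
pose b x := Num.max (-1) (Num.min (beta x) (1 - 2 * kappa)).
have mb' : measurable_fun setT b.
  apply: measurable_maxr; first exact: measurable_cst.
  by apply: measurable_minr => //; exact: measurable_cst.
have hb x : -1 <= b x <= 1 - 2 * kappa.
  by rewrite /b le_max lexx/= ge_max ge_min lexx orbT andbT; lra.
have bE x : -1 <= beta x <= 1 - 2 * kappa -> b x = beta x.
  by move=> /andP[h1 h2]; rewrite /b (min_idPl h2) (max_idPr h1).
have b1 : exists M : R, \forall x \ae leb R n, `|b x| <= M.
  by exists 1; apply: aeW => x; apply: (beta1 hkappa hb).
have cE E : BVset E -> capillary beta E = (cap b E)%:E.
  move=> bvE; rewrite -(capillaryE bvE mb' b1).1 /capillary; congr (_ - _)%E.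
  have [N [mN N0 hN]] := hbetab.
  apply: (integral_null_eq mN N0) => x Nx; congr (_ * _)%:E.
  by rewrite bE//; apply: contrapT => h; apply: Nx; exact: hN.
have [m0 hm0] := hVbelow.
pose I := ereal_inf [set V E | E in @BVset R n].
have bC : BVset (cyl r%:E K : set (Rn1 R n)) by exact: BVset_cyl.
have Ifin : I \is a fin_num.
  rewrite fin_numElt; apply/andP; split.
    apply: (@lt_le_trans _ _ m0%:E); first exact: ltNyr.
    by apply: le_ereal_inf_tmp => _ [E bvE <-]; exact: hm0.
  by apply: le_lt_trans hVfin; apply: ereal_inf_lbound; exists (cyl r%:E K).
(* The lower bound passed on is the infimum of V itself, the one that enters [frak_a]. *)
pose m := fine I; have Im : I = m%:E by rewrite fineK.
have hm E : BVset E -> (m%:E <= V E)%E.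
  by move=> bvE; rewrite -Im; apply: ereal_inf_lbound; exists E.
have GE E : BVset E -> G E = energy b V E by move=> bvE; rewrite /G cE.
pose J rho := ereal_inf [set energy b V E | E in admissible K rho].
have GJ rho : ereal_inf [set G E | E in [set E | BVset E /\ E `<=` cyl rho%:E K]] = J rho.
  rewrite /J; congr ereal_inf; apply/seteqP; split => _ [E aE <-]; exists E => //.
    by rewrite (GE E aE.1).
  by rewrite (GE E aE.1).
pose Sup := ereal_sup [set J rho | rho in [set rho : R | r < rho]].
have Sfin : Sup \is a fin_num.
  rewrite fin_numElt; apply/andP; split.
    have r1 : r < r + 1 by rewrite ltrDl.
    apply: (@lt_le_trans _ _ (J (r + 1))).
      by have := inf_energy_fin mb' hkappa hb hr hK hm hVfin (ltW r1); rewrite fin_numElt => /andP[].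
    by apply: ereal_sup_ubound; exists (r + 1).
  apply: (@le_lt_trans _ _ (energy b V (cyl r%:E K))); last exact: energy_cyl.
  apply: ge_ereal_sup => _ [rho rr <-]; apply: ereal_inf_lbound; exists (cyl r%:E K) => //.
  by apply: admissible_cyl => //; exact: ltW.
pose S := fine Sup; have SS : Sup = S%:E by rewrite fineK.
have hSup rho : r < rho -> (J rho <= S%:E)%E.
  by move=> rr; rewrite -SS; apply: ereal_sup_ubound; exists rho.
pose a := kappa^-1 * (S - m).
have ha : kappa * a = S - m by rewrite /a mulrA divff ?mul1r// gt_eqF.
have aE : frak_a r K kappa V G = a%:E.
  rewrite /frak_a -/I Im.
  have -> : [set ereal_inf [set G E | E in [set E | BVset E /\ E `<=` cyl rho%:E K]] | rho in [set rho : R | r < rho]] =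
      [set J rho | rho in [set rho : R | r < rho]].
    by apply/seteqP; split => _ [rho rr <-]; exists rho => //; rewrite GJ.
  by rewrite -/Sup SS -EFinB -EFinM.
have RE : calR0 n r kappa (frak_a r K kappa V G) = (radius0 n kappa r a)%:E.
  by rewrite aE /calR0 /radius0 poweR_EFin -EFinM -EFin_max -EFinD.

rewrite RE; split.
  have [E [bvE minE]] := exists_minimizer hn mb' hkappa hb hr hK hm hVfin hVcut hVring hVlsc ha hSup.
  by exists E; split; [exact: bvE|move=> F bF; rewrite (GE E bvE) (GE F bF); exact: minE].
move=> E [bvE minE].
have minE' F : BVset F -> (energy b V E <= energy b V F)%E by move=> bF; rewrite -(GE E bvE) -(GE F bF); exact: minE.
have n0 := minimizer_confined hn mb' hkappa hb hr hK hm hVcut hVring ha hSup bvE minE'.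
have r0 : 0 < radius0 n kappa r a.
  exact: lt_trans hr (radius0_gt n kappa r a).
apply: (dens1_cyl r0 (BVset_measurable bvE) n0).
by apply: BVset_measurable; exact: BVset_cyl.
Qed.
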